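(* Let $(W,S)$ be a Coxeter system with $S=\{s,t\}$, $s\neq t$, such that $st$ has infinite order in $W$. Then $\bar S$ is identified with $\{s,t\}$ and $\mathbb{Z}[\bar S]=\mathbb{Z}s\oplus\mathbb{Z}t$. With the definitions given in the context: (i) Conjecture A holds for $(W,S)$; (ii) the essential hyperplanes of $(W,S)$ are exactly $\mathcal{H}_s$, $\mathcal{H}_t$, $\mathcal{H}_{s-t}$ and $\mathcal{H}_{s+t}$; (iii) Conjecture B holds for $(W,S)$.
   Context: **Positive subsets.** Let $\Lambda$ be a free abelian group of finite rank and $V=\mathbb{R}\otimes_{\mathbb Z}\Lambda$. A subset $X\subseteq\Lambda$ is *positive* if $\Lambda=X\cup(-X)$, $X+X\subseteq X$ and $X\cap(-X)$ is a subgroup of $\Lambda$. $\mathcal{P}os(\Lambda)$ is the set of positive subsets. For $E\subseteq\Lambda$ put $\mathcal{U}(E)=\{X\in\mathcal{P}os(\Lambda): X\cap E=\varnothing\}$ and $\mathcal{U}(\lambda)=\mathcal{U}(\{\lambda\})$. $\mathcal{P}os(\Lambda)$ has the topology whose base of open sets is the family $\mathcal{U}(E)$, $E$ finite. **Arrangements.** For $\lambda\in\Lambda\setminus\{0\}$ the *rational hyperplane* $\mathcal{H}_\lambda$ is $\{X\in\mathcal{P}os(\Lambda):\lambda\in X\cap(-X)\}$; one has $\mathcal{P}os(\Lambda)=\mathcal{U}(\lambda)\sqcup\mathcal{H}_\lambda\sqcup\mathcal{U}(-\lambda)$, and this partition depends only on $\mathcal{H}_\lambda$. Let $\mathfrak{A}$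 be a finite set of rational hyperplanes. $X,Y$ are $\mathfrak{A}$-equivalent if, for each $\mathcal{H}_\lambda\in\mathfrak{A}$, they lie in the same one of the three pieces $\mathcal{U}(\lambda),\mathcal{H}_\lambda,\mathcal{U}(-\lambda)$. The equivalence classes are the *$\mathfrak{A}$-facets*; an *$\mathfrak{A}$-chamber* is a facet meeting no hyperplane of $\mathfrak{A}$. For facets, $\mathcal{F}\preccurlyeq\mathcal{F}'$ means $\overline{\mathcal{F}}\subseteq\overline{\mathcal{F}'}$ (closures). **Cells.** Let $(W,S)$ be a Coxeter system with length function $\ell$. $\bar S$ is the set of classes of $S$ under conjugacy in $W$ and $\mathbb{Z}[\bar S]$ the free $\mathbb{Z}$-module on $\bar S$. Let $\Gamma$ be a totally ordered abelian group and $\varphi:\bar S\to\Gamma$ a map; write $\varphi(s)$ for the value at the class of $s\in S$. $\mathbb{Z}[\Gamma]=\bigoplus_\gamma\mathbb{Z}e^\gamma$ is the group ring. The Hecke algebra $\mathcal{H}(W,S,\varphi)$ is the free $\mathbb{Z}[\Gamma]$-module with basis $(T_w)_{w\in W}$ and $\mathbb{Z}[\Gamma]$-bilinear multiplication determined by $T_wT_{w'}=T_{ww'}$ if $\ell(ww')=\ell(w)+\ell(w')$ and $(T_s-e^{\varphi(s)})(T_s+e^{-\varphi(s)})=0$ for $s\in S$. The bar involution is the ring automorphism with $\overline{e^\gamma}=e^{-\gamma}$, $\overline{T_w}=T_{w^{-1}}^{-1}$. For $w\in W$, $C_w$ is the unique bar-invariant element of $T_w+\bigoplus_{x\in W}\mathbb{Z}[\Gamma_{<0}]T_x$,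 where $\mathbb{Z}[\Gamma_{<0}]=\bigoplus_{\gamma<0}\mathbb{Z}e^\gamma$; $(C_w)_{w\in W}$ is a $\mathbb{Z}[\Gamma]$-basis. The preorder $\leqslant_L^\varphi$ (resp. $\leqslant_R^\varphi$, resp. $\leqslant_{LR}^\varphi$) is the transitive closure of the relation ''$C_x$ has nonzero coefficient in $hC_y$ (resp. $C_yh$, resp. $hC_yh'$) for some $h,h'\in\mathcal{H}(W,S,\varphi)$'' between $x$ and $y$; $\sim_?^\varphi$ is the associated equivalence relation, whose classes are the left ($?=L$), right ($?=R$), two-sided ($?=LR$) cells for $(W,S,\varphi)$. For a left cell $C$ and $w\in C$, $M_C^\varphi$ is the left $\mathcal{H}(W,S,\varphi)$-module $\bigoplus_{x\leqslant_L w}\mathbb{Z}[\Gamma]C_x\big/\bigoplus_{x\leqslant_L w,\,x\notin C}\mathbb{Z}[\Gamma]C_x$; viewing $\mathbb{Z}$ as a $\mathbb{Z}[\Gamma]$-algebra via $e^\gamma\mapsto 1$, $\mathbb{Z}M_C^\varphi:=\mathbb{Z}\otimes_{\mathbb{Z}[\Gamma]}M_C^\varphi$ is a $\mathbb{Z}W$-module ($T_w$ acting as $w$). For $X\in\mathcal{P}os(\mathbb{Z}[\bar S])$ let $\Gamma_X=\mathbb{Z}[\bar S]/(X\cap(-X))$, totally ordered by $\gamma\le_X\gamma'$ iff $\gamma'-\gamma$ has a representative in $X$, and let $\varphi_X:\bar S\to\Gamma_X$ be the canonical map. Write $\sim_?^X$, $\mathbb{Z}M_C^X$ for $\sim_?^{\varphi_X}$,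 $\mathbb{Z}M_C^{\varphi_X}$. **Conjecture A for $(W,S)$.** Call a finite set $\mathfrak{A}$ of rational hyperplanes of $\mathcal{P}os(\mathbb{Z}[\bar S])$ *complete* if $\mathcal{H}_\omega\in\mathfrak{A}$ for all $\omega\in\bar S$; for a facet $\mathcal{F}$ of a complete $\mathfrak{A}$, let $W_{\mathcal{F}}$ be the subgroup of $W$ generated by the union of the $\omega\in\bar S$ with $\mathcal{F}\subseteq\mathcal{H}_\omega$. Conjecture A: there is a complete finite $\mathfrak{A}$ such that for every $?\in\{L,R,LR\}$: (a) if $X,Y$ lie in the same $\mathfrak{A}$-facet $\mathcal{F}$, then $\sim_?^X$ and $\sim_?^Y$ coincide (denote this relation $\sim_?^{\mathcal{F}}$); (b) for every $\mathfrak{A}$-facet $\mathcal{F}$, the equivalence classes of $\sim_?^{\mathcal{F}}$ are the minimal nonempty subsets $C\subseteq W$ such that (b1) for every chamber $\mathcal{C}$ with $\mathcal{F}\preccurlyeq\mathcal{C}$, $C$ is a union of $\sim_?^{\mathcal{C}}$-classes, and (b2) $C$ is stable under translation by $W_{\mathcal{F}}$ (on the left if $?=L$, on the right if $?=R$, on both sides if $?=LR$). **Essential hyperplanes.** If Conjecture A holds, the essential hyperplanes are the members of the smallest complete finite arrangement for which (a) and (b) hold. **Conjecture B for $(W,S)$** (Conjecture A holding, $\mathfrak{A}$ the set of essential hyperplanes). For every $X\in\mathcal{P}os(\mathbb{Z}[\bar S])$, every left cell $C$ for $(W,S,\varphi_X)$, every $\mathfrak{A}$-chamber $\mathcal{C}$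 with $X\in\overline{\mathcal{C}}$ and every $Y\in\mathcal{C}$, writing $C=C_1\sqcup\cdots\sqcup C_d$ with $C_i$ left cells for $(W,S,\varphi_Y)$, there exist a filtration $0=M_0\subseteq M_1\subseteq\cdots\subseteq M_d=\mathbb{Z}M_C^X$ by $\mathbb{Z}W$-submodules and a permutation $\sigma$ of $\{1,\dots,d\}$ such that $M_i/M_{i-1}\simeq\mathbb{Z}M_{C_{\sigma(i)}}^Y$ for $1\le i\le d$. *)

(* Defs.v *)
From HB Require Import structures.
From mathcomp Require Import all_boot all_order all_algebra.
From mathcomp Require Import generic_quotient ring_quotient perm.
From mathcomp Require Import boolp classical_sets cardinality topology.
From mathcomp Require Import finmap monalg.
From Stdlib Require Import Relation_Operators.

Set Implicit Arguments.
Unset Strict Implicit.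
Unset Printing Implicit Defensive.

Import Order.TTheory GRing.Theory Num.Theory.
Local Open Scope classical_set_scope.
Local Open Scope quotient_scope.
Local Open Scope ring_scope.

Definition add_subgroup (V : zmodType) (G : set V) : Prop :=
  G 0 /\ forall x y, G x -> G y -> G (x - y).

Section GeneratedSubgroup.
Variables (V : zmodType) (E : set V).

Definition gen_add : {pred V} :=
  [pred x : V | `[< smallest (@add_subgroup V) E x >]].

Lemma gen_add_closed : zmod_closed gen_add.
Proof.
split; first by rewrite inE; apply/asboolP => G [[]].
move=> x y; rewrite !inE => /asboolP Ex /asboolP Ey.
by apply/asboolP => G sG; apply: sG.1.2; [apply: Ex|apply: Ey].
Qed.

HB.instance Definition _ := GRing.isZmodClosed.Build V gen_add gen_add_closed.

End GeneratedSubgroup.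

Definition subgrp (V : zmodType) (A : zmodClosed V) : Type := {x : V | x \in A}.

HB.instance Definition _ (V : zmodType) (A : zmodClosed V) :=
  SubType.on (subgrp A).
HB.instance Definition _ (V : zmodType) (A : zmodClosed V) :=
  Choice.on (subgrp A).
HB.instance Definition _ (V : zmodType) (A : zmodClosed V) :=
  [SubChoice_isSubZmodule of subgrp A by <:].

Section SubTrace.
Variables (V : zmodType) (A B : zmodClosed V).

Definition sub_trace : {pred subgrp A} := [pred x : subgrp A | val x \in B].

Lemma sub_trace_closed : zmod_closed sub_trace.
Proof.
split=> [|x y]; rewrite !inE ?rpred0 // raddfB => xB yB.
exact: rpredB.
Qed.

HB.instance Definition _ := GRing.isZmodClosed.Build (subgrp A) sub_trace sub_trace_closed.

End SubTrace.

Definition subquot (V : zmodType) (A B : zmodClosed V) : zmodType :=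
  Quotient.quot (@sub_trace V A B).

Definition group_ring (G : zmodType) : Type := {malg int[G]}.

HB.instance Definition _ (G : zmodType) := GRing.Zmodule.on (group_ring G).

Section GroupRing.
Variable G : zmodType.
Implicit Types f g h : group_ring G.

Definition gr_mul f g : group_ring G :=
  \sum_(a <- msupp f) \sum_(b <- msupp g) << f@_a * g@_b *g (a + b) >>.

Lemma gr_mulEw (d1 d2 : {fset G}) f g :
  (msupp f `<=` d1)%fset -> (msupp g `<=` d2)%fset ->
  gr_mul f g =
    \sum_(a <- d1) \sum_(b <- d2) << f@_a * g@_b *g (a + b) >> :> {malg int[G]}.
Proof.
move=> le1 le2; rewrite /gr_mul (big_fset_incl _ le1) /=.
  apply: eq_bigr => a _; rewrite (big_fset_incl _ le2) //= => b _ bg.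
  by rewrite (mcoeff_outdom bg) mulr0 monalgU0.
move=> a _ af; rewrite big1 // => b _.
by rewrite (mcoeff_outdom af) mul0r monalgU0.
Qed.

Lemma gr_mulDl : left_distributive gr_mul +%R.
Proof.
move=> f g h.
pose d := (msupp f `|` msupp g `|` msupp (f + g))%fset.
have sf : (msupp f `<=` d)%fset by rewrite /d -fsetUA fsubsetUl.
have sg : (msupp g `<=` d)%fset.
  by rewrite /d -fsetUA; apply: fsubsetU; rewrite fsubsetUl orbT.
have sfg : (msupp (f + g) `<=` d)%fset by rewrite /d fsubsetUr.
have sh := fsubset_refl (msupp h).
rewrite (gr_mulEw sf sh) (gr_mulEw sg sh) (gr_mulEw sfg sh) -big_split /=.
apply: eq_bigr => a _; rewrite -big_split /=; apply: eq_bigr => b _.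
by rewrite mcoeffD mulrDl monalgUD.
Qed.

Lemma gr_mulC : commutative gr_mul.
Proof.
move=> f g; rewrite /gr_mul exchange_big /=.
apply: eq_bigr => a _; apply: eq_bigr => b _.
by rewrite mulrC addrC.
Qed.

Lemma gr_mulDr : right_distributive gr_mul +%R.
Proof. by move=> f g h; rewrite gr_mulC gr_mulDl !(gr_mulC f). Qed.

Lemma gr_mul0l f : gr_mul 0 f = 0.
Proof. by apply: (addIr (gr_mul 0 f)); rewrite -gr_mulDl !add0r. Qed.

Lemma gr_mul_suml I (r : seq I) (F : I -> group_ring G) g :
  gr_mul (\sum_(i <- r) F i) g = \sum_(i <- r) gr_mul (F i) g.
Proof.
elim: r => [|i r IH]; first by rewrite !big_nil gr_mul0l.
by rewrite !big_cons gr_mulDl IH.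
Qed.

Lemma gr_mul_sumr I (r : seq I) (F : I -> group_ring G) g :
  gr_mul g (\sum_(i <- r) F i) = \sum_(i <- r) gr_mul g (F i).
Proof. by rewrite gr_mulC gr_mul_suml; apply: eq_bigr => i _; rewrite gr_mulC. Qed.

Lemma gr_mulUU (x y : int) (a b : G) :
  gr_mul << x *g a >> << y *g b >> = << x * y *g (a + b) >>.
Proof.
rewrite (gr_mulEw (@msuppU_le _ _ _ _) (@msuppU_le _ _ _ _)).
by rewrite !big_seq_fset1 !mcoeffUU.
Qed.

Lemma gr_E f : f = \sum_(a <- msupp f) (<< f@_a *g a >> : group_ring G).
Proof. exact: monalgE. Qed.

Lemma gr_mulA : associative gr_mul.
Proof.
move=> f g h; rewrite (gr_E f) !gr_mul_suml; apply: eq_bigr => a _.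
rewrite (gr_E g) gr_mul_suml !gr_mul_sumr gr_mul_suml.
apply: eq_bigr => b _; rewrite (gr_E h) !gr_mul_sumr.
by apply: eq_bigr => c _; rewrite !gr_mulUU mulrA addrA.
Qed.

Lemma gr_mul1 : left_id (<< 1 *g 0 >> : group_ring G) gr_mul.
Proof.
move=> f; rewrite {1}(gr_E f) gr_mul_sumr [RHS]gr_E.
by apply: eq_bigr => a _; rewrite gr_mulUU mul1r add0r.
Qed.

Lemma gr_1_neq0 : (<< 1 *g 0 >> : group_ring G) != 0.
Proof. by rewrite monalgU_eq0 oner_eq0. Qed.

HB.instance Definition _ := GRing.Zmodule_isComNzRing.Build (group_ring G)
  gr_mulA gr_mulC gr_mul1 gr_mulDl gr_1_neq0.

Definition gexp (a : G) : group_ring G := << a >>.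

Definition gr_bar (f : group_ring G) : group_ring G :=
  \sum_(a <- msupp f) << f@_a *g (- a) >>.

Definition augmentation (f : group_ring G) : int := \sum_(a <- msupp f) f@_a.

End GroupRing.

HB.mixin Record isTotallyOrderedZmodule V & Num.POrderedZmodule V := {
  tozmod_total : total (<=%O : rel V);
  tozmod_leD2r : forall x y z : V, x <= y -> x + z <= y + z
}.

#[short(type="tozmodType")]
HB.structure Definition TotallyOrderedZmodule :=
  { V of isTotallyOrderedZmodule V & Num.POrderedZmodule V }.

Section Positive.
Variable L : zmodType.

Definition positive_subset (X : set L) : Prop :=
  [/\ X `|` (-%R @` X) = setT,
      forall a b, X a -> X b -> X (a + b)
    & add_subgroup (X `&` (-%R @` X))].

Record pos := Pos { pos_set :> set L; pos_positive : positive_subset pos_set }.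

HB.instance Definition _ := gen_eqMixin pos.
HB.instance Definition _ := gen_choiceMixin pos.

Definition posU (E : set L) : set pos := [set X | pos_set X `&` E = set0].

Definition posH (a : L) : set pos :=
  [set X | (pos_set X `&` (-%R @` pos_set X)) a].

Lemma posU_cover : \bigcup_(E in finite_set) posU E = setT.
Proof.
by apply/seteqP; split=> // X _; exists set0 => //; rewrite /posU /= setI0.
Qed.

Lemma posU_join (E F : set L) (X : pos) :
  finite_set E -> finite_set F -> posU E X -> posU F X ->
  exists G, [/\ finite_set G, posU G X & posU G `<=` posU E `&` posU F].
Proof.
move=> fE fF XE XF; exists (E `|` F); split; first by rewrite finite_setU.
  by rewrite /posU /= setIUr XE XF setU0.
by move=> Y; rewrite /posU /= setIUr setU_eq0.
Qed.

HB.instance Definition _ :=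
  isBaseTopological.Build pos posU_cover posU_join.

End Positive.

Section PositiveQuotient.
Variables (L : zmodType) (X : pos L).

Definition pos_units : {pred L} :=
  [pred a : L | `[< (pos_set X `&` (-%R @` pos_set X)) a >]].

Lemma pos_units_closed : zmod_closed pos_units.
Proof.
have [_ _ [X0 XB]] := pos_positive X.
split=> [|a b]; rewrite !inE; first exact/asboolP.
by move=> /asboolP Xa /asboolP Xb; apply/asboolP; apply: XB.
Qed.

HB.instance Definition _ := GRing.isZmodClosed.Build L pos_units pos_units_closed.

Definition pos_quot : Type := Quotient.quot pos_units.

HB.instance Definition _ := GRing.Zmodule.on pos_quot.

Definition pos_pi (a : L) : pos_quot := \pi_(Quotient.quot pos_units) a.

Definition pos_le (p q : pos_quot) : bool :=
  `[< exists2 a, pos_set X a & pos_pi a = q - p >].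

Lemma pos_pi_surj (p : pos_quot) : exists a, p = pos_pi a.
Proof. by exists (repr (p : Quotient.quot pos_units)); rewrite /pos_pi reprK. Qed.

Lemma pos_piB a b : pos_pi (a - b) = pos_pi a - pos_pi b.
Proof. exact: raddfB. Qed.

Lemma pos_piN a : pos_pi (- a) = - pos_pi a.
Proof. exact: raddfN. Qed.

Lemma pos_piD a b : pos_pi (a + b) = pos_pi a + pos_pi b.
Proof. exact: raddfD. Qed.

Lemma pos_pi_eq a b : pos_pi a = pos_pi b -> pos_units (a - b).
Proof.
move=> ab; have /eqP := ab.
by rewrite /pos_pi -Quotient.idealrBE.
Qed.

Lemma pos_pi_eq0 a : pos_set X a -> pos_set X (- a) -> pos_pi a = 0.
Proof.
move=> Xa XNa; have : pos_units (a - 0).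
  by rewrite subr0; apply/asboolP; split=> //; exists (- a) => //; rewrite opprK.
rewrite -[pos_units _]/(a - 0 \in pos_units) Quotient.idealrBE => /eqP.
by rewrite -[LHS]/(pos_pi a) => ->; exact: raddf0.
Qed.

Lemma pos_le_refl : reflexive pos_le.
Proof.
move=> p; apply/asboolP; exists 0; last by rewrite subrr; exact: raddf0.
by have [_ _ [[]]] := pos_positive X.
Qed.

Lemma pos_le_anti : antisymmetric pos_le.
Proof.
move=> p q /andP[/asboolP[a Xa ea] /asboolP[b Xb eb]].
have /pos_pi_eq/asboolP[XNab _] : pos_pi (- a) = pos_pi b.
  by rewrite pos_piN ea eb opprB.
have XNa : pos_set X (- a).
  have [_ XD _] := pos_positive X.
  by rewrite -[- a](subrK b); exact: XD.
by apply/eqP; rewrite eq_sym -subr_eq0 -ea; apply/eqP; exact: pos_pi_eq0.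
Qed.

Lemma pos_le_trans : transitive pos_le.
Proof.
move=> q p r /asboolP[a Xa ea] /asboolP[b Xb eb]; apply/asboolP.
exists (b + a); last by rewrite pos_piD ea eb addrA subrK.
by have [_ XD _] := pos_positive X; exact: XD.
Qed.

Lemma pos_le_total : total pos_le.
Proof.
move=> p q; have [a ea] := pos_pi_surj (q - p).
have [XT _ _] := pos_positive X.
have : (pos_set X `|` (-%R @` pos_set X)) a by rewrite XT.
case=> [Xa|[b Xb eb]]; apply/orP; [left|right]; apply/asboolP.
  by exists a.
by exists b => //; rewrite -[b]opprK eb pos_piN -ea opprB.
Qed.

HB.instance Definition _ := Order.Le_isPOrder.Build ring_display pos_quot
  pos_le_refl pos_le_anti pos_le_trans.

Lemma pos_leD2r (p q r : pos_quot) : p <= q -> p + r <= q + r.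
Proof.
by move=> /asboolP[a Xa ea]; apply/asboolP; exists a => //; rewrite opprD addrACA subrr addr0.
Qed.

HB.instance Definition _ := isTotallyOrderedZmodule.Build pos_quot
  pos_le_total pos_leD2r.

End PositiveQuotient.

Section Arrangements.
Variables (L : zmodType) (A : set (set (pos L))).

Definition arrangement : Prop :=
  finite_set A /\ forall H, A H -> exists2 a : L, a != 0 & H = posH a.

Definition arr_equiv (X Y : pos L) : Prop :=
  forall a : L, a != 0 -> A (posH a) ->
  [/\ posU [set a] X <-> posU [set a] Y, posH a X <-> posH a Y
    & posU [set - a] X <-> posU [set - a] Y].

Definition facet (F : set (pos L)) : Prop :=
  exists X, F = [set Y | arr_equiv X Y].

Definition chamber (C : set (pos L)) : Prop :=
  facet C /\ forall H, A H -> C `&` H = set0.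

End Arrangements.

Definition facet_le (L : zmodType) (F F' : set (pos L)) : Prop :=
  closure F `<=` closure F'.

Section Coxeter.
Variables (W : groupType) (S : set W).
Local Open Scope group_scope.

Definition mul_subgroup (G : set W) : Prop :=
  G 1 /\ forall x y, G x -> G y -> G (x * y^-1).

(* [cox_presentation] says that W has the presentation
   < S | (st)^n = 1 whenever this holds in W >, as a universal property; the
   relations s^2 = 1 are the case s = t, n = 1. *)
Record coxeter_system : Prop := {
  cox_involution : forall s, S s -> s != 1 /\ s * s = 1;
  cox_generated : smallest mul_subgroup S = setT;
  cox_presentation : forall (G : groupType) (f : W -> G),
    (forall s t n, S s -> S t -> (s * t) ^+ n = 1 -> (f s * f t) ^+ n = 1) ->
    exists2 g : W -> G, {morph g : x y / x * y} & forall s, S s -> g s = f s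
}.

Definition is_expression (w : W) (u : seq W) : Prop :=
  (forall s, s \in u -> S s) /\ \prod_(s <- u) s = w.

Definition cox_length (w : W) : nat :=
  xget 0%N [set n | (exists2 u, is_expression w u & size u = n) /\
                    forall u, is_expression w u -> (n <= size u)%N].

Definition gen_class (s : W) : set W := [set r | S r /\ exists g, r = s ^ g].

Definition Sbar : choiceType := set_type (gen_class @` S).

Definition Sbar_class (s : W) (Ss : S s) : Sbar :=
  SigSub (mem_set (imageP gen_class Ss)).

End Coxeter.

Inductive side := LeftSide | RightSide | TwoSided.

(* A module over Z[W], given by the operators of the elements of W.  That they
   define a W-action on the modules attached to cells is a property of Hecke
   algebras, hence not part of the structure. *)
Record opmod (W : Type) := Opmod {
  opmod_sort :> zmodType;
  opmod_act : W -> opmod_sort -> opmod_sort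
}.

Section OperatorModules.
Variable W : Type.

Definition opmod_stable (M : opmod W) (A : zmodClosed M) : Prop :=
  forall w x, x \in A -> opmod_act w x \in A.

Definition opmod_iso (M N : opmod W) : Prop :=
  exists2 f : {additive M -> N}, bijective f &
    forall w x, f (opmod_act w x) = opmod_act w (f x).

(* A / (A :&: B), with w acting through any representative. *)
Definition opmod_subquot (M : opmod W) (A B : zmodClosed M) : opmod W :=
  @Opmod W (subquot A B) (fun w u =>
    \pi_(subquot A B)
      (insubd (0 : subgrp A) (opmod_act w (val (repr (u : subquot A B)))))).

End OperatorModules.

Section Hecke.
Variables (W : groupType) (S : set W) (G : tozmodType) (phi : Sbar S -> G).

Local Notation R := (group_ring G).
Local Notation H := {malg R[W]}.

Definition heckeT (w : W) : H := << w >>.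

(* The relations and associativity determine the multiplication uniquely, since
   they express every heckeT w as a product of the heckeT s. *)
Definition is_hecke_mul (m : H -> H -> H) : Prop :=
  [/\ (forall h, linear (m h)) /\ (forall h, linear (m^~ h)),
      associative m,
      (forall w w', cox_length S (w * w')%g = (cox_length S w + cox_length S w')%N ->
         m (heckeT w) (heckeT w') = heckeT (w * w')%g)
    & forall (o : Sbar S) s, val o s ->
        m (heckeT s - gexp (phi o) *: heckeT 1%g)
          (heckeT s + gexp (- phi o) *: heckeT 1%g) = 0].

Definition hecke_mul : H -> H -> H := xget (fun _ _ => 0) is_hecke_mul.

Definition hecke_inv (h : H) : H :=
  xget 0 [set h' | hecke_mul h h' = heckeT 1%g /\ hecke_mul h' h = heckeT 1%g].

(* The additive map that is semilinear for gr_bar and sends heckeT w to the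
   inverse of heckeT w^-1; that it is a ring automorphism is a theorem. *)
Definition hecke_bar (h : H) : H :=
  \sum_(w <- msupp h) gr_bar h@_w *: hecke_inv (heckeT w^-1%g).

Definition gr_neg (a : R) : Prop := forall c, c \in msupp a -> c < 0.

Definition klC (w : W) : H :=
  xget 0 [set c | hecke_bar c = c /\ forall x, gr_neg (c - heckeT w)@_x].

Definition klC_comb (a : H) : H := \sum_(x <- msupp a) a@_x *: klC x.

Definition klC_occurs (x : W) (h : H) : Prop :=
  exists2 a : H, h = klC_comb a & a@_x != 0.

Definition cell_step (k : side) (x y : W) : Prop :=
  match k with
  | LeftSide => exists h, klC_occurs x (hecke_mul h (klC y))
  | RightSide => exists h, klC_occurs x (hecke_mul (klC y) h)
  | TwoSided => exists h h', klC_occurs x (hecke_mul (hecke_mul h (klC y)) h')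
  end.

Definition cell_le (k : side) : W -> W -> Prop := clos_trans W (cell_step k).

Definition cell_eq (k : side) (x y : W) : Prop := cell_le k x y /\ cell_le k y x.

Definition is_cell (k : side) (D : set W) : Prop :=
  exists w, D = [set x | cell_eq k x w].

Definition klC_span (E : set W) : {pred H} :=
  [pred h : H |
    `[< exists2 a : H, (forall x, a@_x != 0 -> E x) & h = klC_comb a >]].

Lemma klC_combEw (d : {fset W}) (a : H) :
  (msupp a `<=` d)%fset -> klC_comb a = \sum_(x <- d) a@_x *: klC x.
Proof.
move=> le; rewrite /klC_comb (big_fset_incl _ le) //= => x _ xa.
by rewrite (mcoeff_outdom xa) scale0r.
Qed.

Lemma klC_combB (a b : H) : klC_comb (a - b) = klC_comb a - klC_comb b.
Proof.
pose d := (msupp (a - b) `|` (msupp a `|` msupp b))%fset.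
have sab : (msupp (a - b) `<=` d)%fset by rewrite fsubsetUl.
have sa : (msupp a `<=` d)%fset.
  by apply: fsubsetU; rewrite fsubsetUl orbT.
have sb : (msupp b `<=` d)%fset.
  by apply: fsubsetU; rewrite fsubsetUr orbT.
rewrite (klC_combEw sab) (klC_combEw sa) (klC_combEw sb) -sumrB.
by apply: eq_bigr => x _; rewrite mcoeffB scalerBl.
Qed.

Lemma klC_span_closed (E : set W) : zmod_closed (klC_span E).
Proof.
split=> [|h h']; rewrite !inE.
  apply/asboolP; exists 0; first by move=> x; rewrite mcoeff0 eqxx.
  by rewrite /klC_comb msupp0 big_seq_fset0.
move=> /asboolP[a Ea ->] /asboolP[b Eb ->]; apply/asboolP.
exists (a - b); last by rewrite klC_combB.
move=> x; rewrite mcoeffB; have [a0|/Ea //] := eqVneq (a@_x) 0.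
by rewrite a0 sub0r oppr_eq0 => /Eb.
Qed.

HB.instance Definition _ (E : set W) :=
  GRing.isZmodClosed.Build H (klC_span E) (klC_span_closed E).

Definition hecke_opmod : opmod W := @Opmod W H (fun w h => hecke_mul (heckeT w) h).

Definition below (D : set W) : set W :=
  [set x | exists2 w, D w & cell_le LeftSide x w].

(* For a left cell D, the cell module M_D is the quotient of klC_span (below D)
   by klC_span (below D `\` D).  Tensoring with Z along the surjection
   [augmentation] further divides out the elements r m - augmentation r m. *)
Definition cell_relations (D : set W) : set H :=
  [set h | h \in klC_span (below D `\` D)] `|`
  [set h | exists (r : R) (m : H),
     m \in klC_span (below D) /\ h = r *: m - m *~ augmentation r].

Definition ZM (D : set W) : opmod W :=
  @opmod_subquot W hecke_opmod (klC_span (below D)) (gen_add (cell_relations D)).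

End Hecke.

Section CellArrangements.
Variables (W : groupType) (S : set W).

Definition ZSbar : zmodType := {malg int[Sbar S]}.

Definition ZSbar_elt (o : Sbar S) : ZSbar := << o >>.

Definition phi_of (X : pos ZSbar) (o : Sbar S) : pos_quot X := pos_pi X (ZSbar_elt o).

(* When conjA_a holds, this is cell_eq (phi_of X) for any X in the facet F. *)
Definition cell_eqF (F : set (pos ZSbar)) (k : side) (x y : W) : Prop :=
  forall X, F X -> cell_eq (phi_of X) k x y.

Definition complete_arr (A : set (set (pos ZSbar))) : Prop :=
  forall o, A (posH (ZSbar_elt o)).

Definition W_facet (F : set (pos ZSbar)) : set W :=
  smallest (@mul_subgroup W)
    [set s | exists2 o : Sbar S, F `<=` posH (ZSbar_elt o) & val o s].

Definition stable_under (k : side) (P D : set W) : Prop :=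
  forall g x, P g -> D x ->
  match k with
  | LeftSide => D (g * x)%g
  | RightSide => D (x * g)%g
  | TwoSided => D (g * x)%g /\ D (x * g)%g
  end.

Definition conjA_a (A : set (set (pos ZSbar))) (k : side) : Prop :=
  forall F, facet A F -> forall X Y, F X -> F Y ->
  forall x y, cell_eq (phi_of X) k x y <-> cell_eq (phi_of Y) k x y.

Definition admissible (A : set (set (pos ZSbar))) (k : side)
    (F : set (pos ZSbar)) (D : set W) : Prop :=
  [/\ D !=set0,
      forall Ch, chamber A Ch -> facet_le F Ch ->
        forall x y, D x -> cell_eqF Ch k x y -> D y
    & stable_under k (W_facet F) D].

Definition conjA_b (A : set (set (pos ZSbar))) (k : side) : Prop :=
  forall F, facet A F -> forall D : set W,
  (exists w, D = [set x | cell_eqF F k x w]) <->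
  (admissible A k F D /\
   forall D', admissible A k F D' -> D' `<=` D -> D' = D).

Definition conjA_arrangement (A : set (set (pos ZSbar))) : Prop :=
  [/\ arrangement A, complete_arr A & forall k, conjA_a A k /\ conjA_b A k].

Definition conjectureA : Prop := exists A, conjA_arrangement A.

Definition essential_set (A : set (set (pos ZSbar))) : Prop :=
  conjA_arrangement A /\ forall A', conjA_arrangement A' -> A `<=` A'.

Definition cell_filtration (X Y : pos ZSbar) (D : set W) : Prop :=
  exists (d : nat) (Ds : 'I_d -> set W),
  [/\ forall i, is_cell (phi_of Y) LeftSide (Ds i),
      trivIset setT Ds, D = \bigcup_i Ds i
    & exists (M : nat -> zmodClosed (ZM (phi_of X) D)) (sigma : 'S_d),
      [/\ forall i, (i <= d)%N -> opmod_stable (M i),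
          M 0%N =i pred1 0, M d =i predT,
          forall i, (i < d)%N -> {subset M i <= M i.+1}
        & forall i : 'I_d, opmod_iso (opmod_subquot (M i.+1) (M i))
                                     (ZM (phi_of Y) (Ds (sigma i)))]].

Definition conjectureB : Prop :=
  exists2 A, essential_set A &
  forall (X : pos ZSbar) (D : set W), is_cell (phi_of X) LeftSide D ->
  forall Ch, chamber A Ch -> closure Ch X -> forall Y, Ch Y ->
  cell_filtration X Y D.

End CellArrangements.

(* Main.v *)
Require Import Defs.
From HB Require Import structures.
From mathcomp Require Import all_boot all_order all_algebra.
From mathcomp Require Import generic_quotient ring_quotient perm.
From mathcomp Require Import boolp classical_sets cardinality topology.
From mathcomp Require Import finmap monalg.
From mathcomp Require Import zify ring.
From Stdlib Require Import Relation_Operators.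

Set Implicit Arguments.
Unset Strict Implicit.
Unset Printing Implicit Defensive.

Import Order.TTheory GRing.Theory Num.Theory.
Local Open Scope classical_set_scope.
Local Open Scope quotient_scope.
Local Open Scope ring_scope.

(* Multiplying T_w by a sign makes all weights nonnegative, and the Kazhdan-Lusztig basis
   of the infinite dihedral group can then be computed: with a = |phi s| and b = |phi t|,
   the elements C_w obey explicit two- or three-term recursions.  They give the left cells
   - {1}, {t}, {w <> 1 ending in s}, {w <> t ending in t} if 0 < b < a, where {1} and {t}
     merge if b = 0 < a;
   - {1}, {w <> 1 ending in s}, {w <> 1 ending in t} if 0 < a = b, and W if a = b = 0;
   so that only the signs of s, t, s - t and s + t matter.  Conjecture A follows by comparing
   these partitions, a point X of a facet being approached from a chamber by ordering the
   kernel of X lexicographically.  If A does not contain H_(s-t), say, then some point of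
   H_(s-t) is A-equivalent to a point with b < a, although t and s t are in the same left
   cell only when a = b.

   For Conjecture B, let c_w in Z[W] be the specialization of C_w at e^gamma = 1.  The cell
   module of C is the quotient of two spans of c_w's, over sets of w closed under <=_L.  For
   b < a, the c_w with w ending in s span the space I of eigenvectors of the right
   translation by s with eigenvalue sign(phi s), and those with w <> t ending in t span
   I (1 +- t) or, if b = 0, I t.  Hence the spans for X are spans for Y as well, with one
   exception up to isomorphism, and a chain of <=_L-closed sets for Y filters the cell
   module at X. *)

(** * Alternating words in the infinite dihedral group *)

Section InfiniteDihedral.
Variable W : groupType.
Local Open Scope group_scope.

(** The Hecke multiplication, the bar involution and the [klC] are given only by characterizations,
    so existence and uniqueness must be settled before anything is computed. Both are elementary
    because W is a free product of two groups of order 2: every element has one reduced word,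
    operators can be defined letter by letter, and only quadratic relations have to be checked. In
    the computation of C_w two requirements pull apart: one recursion makes the negativity of the
    coefficients visible, another one the bar-invariance and the left action. The core is that both
    define the same elements. A weight 0 is a further obstacle: v_t^-1 = 1 is then not negative, and
    T_t replaces T_t + v_t^-1. A parameter [kap], equal to v_t^-1 or to 0, covers both cases.
    Finally, the cell modules at X and Y come from different Hecke algebras; they become comparable
    once each is presented as a quotient P/Q of left submodules of the single group ring Z[W]. *)

Definition is_dihedral (S : set W) (s t : W) : Prop :=
  [/\ forall x, S x <-> x = s \/ x = t,
      s * s = 1, t * t = 1,
      smallest (@mul_subgroup W) S = setT
    & forall n, (0 < n)%N -> (s * t) ^+ n <> 1].

(** Letters are counted from the right, starting at 0: [letter x y k] is the one that lengthens
    [alt x y k]. *)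
Definition letter (x y : W) (k : nat) : W := if odd k then y else x.

(* Letters are added on the left: [alt x y k] ends in [x]. *)
Fixpoint alt (x y : W) (k : nat) : W :=
  if k is k'.+1 then letter x y k' * alt x y k' else 1.

Lemma letterS x y k : letter x y k.+1 = letter y x k.
Proof. by rewrite /letter /=; case: odd. Qed.

Lemma letterSS x y k : letter x y k.+2 = letter x y k.
Proof. by rewrite !letterS. Qed.

Lemma altS x y k : alt x y k.+1 = letter x y k * alt x y k.
Proof. by []. Qed.

Lemma altSr x y k : alt x y k.+1 = alt y x k * x.
Proof.
elim: k => [|k IH]; first by rewrite /= mulg1 mul1g.
by rewrite altS IH mulgA letterS.
Qed.

Lemma alt_add x y i d :
  alt x y (d + i) = alt (letter x y i) (letter x y i.+1) d * alt x y i.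
Proof.
elim: d => [|d IH]; first by rewrite mul1g.
rewrite addSn !altS IH mulgA; congr (_ * _ * _).
by rewrite /letter oddD /=; case: (odd d); case: (odd i).
Qed.

End InfiniteDihedral.

Section DihedralGroup.
Variables (W : groupType) (S : set W) (s t : W).
Hypothesis D : is_dihedral S s t.
Local Open Scope group_scope.

Lemma dihedral_sym : is_dihedral S t s.
Proof.
have [hS ss tt gS inf] := D; split=> // [x|n n0]; first by rewrite hS; tauto.
have e : t * s = (s * t)^-1.
  by symmetry; apply: mulg1_eq; rewrite mulgA -[s * t * t]mulgA tt mulg1 ss.
rewrite e => h; apply: (inf n n0).
by apply: invg_inj; rewrite -expVgn h invg1.
Qed.

Lemma dih_ss : s * s = 1. Proof. by have [] := D. Qed.
Lemma dih_Ss : S s. Proof. by have [hS _ _ _ _] := D; apply/hS; left. Qed.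

Lemma dihV : s^-1 = s.
Proof. exact/mulg1_eq/dih_ss. Qed.

Lemma dihK w : s * (s * w) = w.
Proof. by rewrite mulgA dih_ss mul1g. Qed.

Lemma dihKr w : w * s * s = w.
Proof. by rewrite -mulgA dih_ss mulg1. Qed.

End DihedralGroup.

Section DihedralWords.
Variables (W : groupType) (S : set W).
Local Open Scope group_scope.
Implicit Types s t : W.

Lemma dih_SP s t x : is_dihedral S s t -> S x -> x = s \/ x = t.
Proof. by move=> [hS _ _ _ _] /hS. Qed.

Lemma alt_even s t m : alt s t m.*2 = (t * s) ^+ m.
Proof.
elim: m => [|m IH] //.
by rewrite doubleS !altS IH /letter /= odd_double /= expgS mulgA.
Qed.

Lemma letter_S s t k : is_dihedral S s t -> S (letter s t k).
Proof.
by move=> [hS _ _ _ _]; apply/hS; rewrite /letter; case: odd; [right|left].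
Qed.

Lemma letterK s t k w : is_dihedral S s t ->
  letter s t k * (letter s t k * w) = w.
Proof.
move=> D; rewrite /letter; case: odd; last exact: (dihK D).
exact: (dihK (dihedral_sym D)).
Qed.

Lemma letter_dih s t k : is_dihedral S s t ->
  is_dihedral S (letter s t k) (letter s t k.+1).
Proof.
by move=> D; rewrite /letter /=; case: odd => //=; apply: dihedral_sym.
Qed.

(** Even words are powers of [t * s], which has infinite order. An odd word equal to 1 would make a
    power of [s * t] equal to [s]; then [s] commutes with [s * t], which forces
    [(s * t) ^+ 2 = 1]. *)
Lemma alt_neq1 s t k : is_dihedral S s t -> alt s t k.+1 <> 1.
Proof.
move=> D; have [_ ss tt _ inf] := D; have [_ _ _ _ inf'] := dihedral_sym D.
have [m [->|->]] : exists m, k.+1 = m.+1.*2 \/ k.+1 = m.*2.+1.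
- have := odd_double_half k.+1; case: odd; case: (k.+1./2) => [|m] // <-.
  + by exists 0%N; right.
  + by exists m.+1; right.
  + by exists m; left.
- by rewrite alt_even; apply: inf'.
rewrite altSr alt_even => h.
have sE : (s * t) ^+ m = s.
  by rewrite -[LHS]invgK (mulg1_eq h) (dihV D).
have c : s * (s * t) = s * t * s.
  by rewrite -[X in X * _]sE -[X in _ = _ * X]sE -expgSr -expgS.
apply: (inf 2%N) => //; rewrite expgS expg1 mulgA -c.
by rewrite (dihK D) tt.
Qed.

Lemma alt_inj s t i j : is_dihedral S s t -> alt s t i = alt s t j -> i = j.
Proof.
move=> D; wlog le : i j / (i <= j)%N.
  by move=> h e; have [le|/ltnW le] := leqP i j; [apply: h|apply/esym/h].
rewrite -(subnK le) alt_add => e.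
have := @alt_neq1 _ _ (j - i).-1 (letter_dih i D).
case: (j - i)%N e => [|d] //= e []; apply: (mulIg (alt s t i)).
by rewrite -e mul1g.
Qed.

(** Right multiplication by [s] shortens one word and lengthens the other, so an equality reappears
    with the letters exchanged and the first length reduced by one. At length 1 it makes a nonempty
    alternating word trivial. *)
Lemma alt_disj s t i j : is_dihedral S s t -> alt s t i.+1 <> alt t s j.+1.
Proof.
elim: i s t j => [|i IH] s t j D e.
  apply: (@alt_neq1 _ _ j.+1 D); rewrite altSr -e /= mulg1.
  exact: dih_ss D.
have : alt s t i.+2 * s = alt t s j.+1 * s by rewrite e.
rewrite altSr (dihKr D) -altSr => /(IH _ _ _ (dihedral_sym D)).
by [].
Qed.

Lemma alt_mulr s t k : is_dihedral S s t -> alt s t k.+1 * s = alt t s k.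
Proof. by move=> D; rewrite altSr (dihKr D). Qed.

Lemma alt_mull s t k : is_dihedral S s t ->
  letter s t k * alt s t k.+1 = alt s t k.
Proof. by move=> D; rewrite altS letterK. Qed.

Lemma altV s t k : is_dihedral S s t ->
  (alt s t k)^-1 = if odd k then alt s t k else alt t s k.
Proof.
elim: k s t => [|k IH] s t D; first by rewrite invg1.
rewrite [in LHS]altSr invgM (IH _ _ (dihedral_sym D)) (dihV D) /=.
by rewrite /letter; case: odd.
Qed.

(** A letter multiplied on the left either cancels the first letter of an alternating word or is
    added to it, so the alternating words form a subgroup containing the generators. *)
Lemma dih_cases s t w : is_dihedral S s t ->
  [\/ w = 1, exists k, w = alt s t k.+1 | exists k, w = alt t s k.+1].
Proof.
move=> D; have [hS ss tt gS _] := D.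
pose G := [set w | (exists k, w = alt s t k) \/ (exists k, w = alt t s k)].
have mulG s' t' k : is_dihedral S s' t' -> forall g, S g -> G (g * alt s' t' k) \/
    (exists j, g * alt s' t' k = alt s' t' j) \/ (exists j, g * alt s' t' k = alt t' s' j).
  move=> D' g /(dih_SP D') gE; right; case: k => [|k].
    by case: gE => ->; rewrite mulg1; [left|right]; exists 1%N; rewrite /= mulg1.
  have : g = letter s' t' k \/ g = letter s' t' k.+1.
    by rewrite letterS /letter; case: odd; case: gE; tauto.
  by case=> ->; left; [exists k; rewrite alt_mull|exists k.+2].
have GS g w' : S g -> G w' -> G (g * w').
  move=> Sg [[k ->]|[k ->]].
    by have [|[[j ->]|[j ->]]] := mulG s t k D g Sg; [|left; exists j|right; exists j].
  by have [|[[j ->]|[j ->]]] := mulG t s k (dihedral_sym D) g Sg;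
     [|right; exists j|left; exists j].
have G1 : G 1 by left; exists 0%N.
have Galt s' t' k : is_dihedral S s' t' -> forall w', G w' -> G (alt s' t' k * w').
  move=> D' w' Gw; elim: k => [|k IH]; first by rewrite mul1g.
  by rewrite altS -mulgA; apply: GS => //; apply: letter_S.
have GM u v : G u -> G v -> G (u * v).
  by move=> [[k ->]|[k ->]] Gv; apply: Galt => //; apply: dihedral_sym.
have GV u : G u -> G u^-1.
  move=> [[k ->]|[k ->]].
    rewrite (altV _ D); case: ifP => _; [left|right]; by exists k.
  rewrite (altV _ (dihedral_sym D)); case: ifP => _; [right|left]; by exists k.
have : smallest (@mul_subgroup W) S w by rewrite gS.
move=> /(_ G); case.
  split=> [|x /hS xE]; first by split=> // u v Gu Gv; apply: GM => //; apply: GV.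
  by rewrite -[x]mulg1; apply: GS => //; apply/hS.
- by move=> [[|k] ->]; [constructor 1|constructor 2; exists k].
- by move=> [[|k] ->]; [constructor 1|constructor 3; exists k].
Qed.

(** Gives the lower bound in [length_alt]: cancelling letters only shortens an expression, and
    alternating words of different lengths are different elements. *)
Lemma expr_alt s t u : is_dihedral S s t -> (forall x, x \in u -> S x) ->
  exists2 j, (j <= size u)%N &
    \prod_(x <- u) x = alt s t j \/ \prod_(x <- u) x = alt t s j.
Proof.
move=> D; elim: u => [|x u IH] Su; first by exists 0%N; rewrite ?big_nil //; left.
have [|j le h] := IH; first by move=> y yu; apply: Su; rewrite inE yu orbT.
have Sx : S x by apply: Su; rewrite inE eqxx.
rewrite big_cons.
have aux s' t' : is_dihedral S s' t' -> \prod_(x <- u) x = alt s' t' j ->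
  exists2 j, (j <= size (x :: u))%N &
    x * \prod_(x <- u) x = alt s' t' j \/ x * \prod_(x <- u) x = alt t' s' j.
  move=> D' ->; have xE := dih_SP D' Sx; case: j le {h} => [|k] le.
    by exists 1%N => //; case: xE => ->; rewrite !mulg1; [left|right];
       rewrite /= mulg1.
  have : x = letter s' t' k \/ x = letter s' t' k.+1.
    by rewrite letterS /letter; case: odd; case: xE; tauto.
  case=> ->; last by exists k.+2 => //; left.
  by exists k; [rewrite /= (leq_trans _ (leqW le))|left; rewrite alt_mull].
case: h => h; first exact: aux D h.
by have [i ? ?] := aux _ _ (dihedral_sym D) h; exists i => //; tauto.
Qed.

Lemma alt_expr s t k : is_dihedral S s t ->
  is_expression S (alt s t k) (rev (mkseq (letter s t) k)).
Proof.
move=> D; split.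
  by move=> x; rewrite mem_rev => /mapP[i _ ->]; apply: letter_S.
elim: k => [|k IH]; first by rewrite big_nil.
by rewrite /mkseq -[k.+1]addn1 iotaD map_cat rev_cat big_cons add0n addn1 altS -IH.
Qed.

Lemma length_alt s t k : is_dihedral S s t -> cox_length S (alt s t k) = k.
Proof.
move=> D; rewrite /cox_length; case: xgetP => [n -> [[u eu <-] min]|].
  apply/eqP; rewrite eqn_leq; apply/andP; split.
    by have := min _ (alt_expr k D); rewrite size_rev size_mkseq.
  have [Su eq] := eu; have [j le [h|h]] := expr_alt D Su; rewrite eq in h.
    by rewrite (alt_inj D h).
  case: j k le h {eu eq min} => [|j] [|k] le // h.
    by case: (@alt_neq1 _ _ k D); rewrite h.
  by case: (alt_disj D h).
move=> /(_ k) []; split.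
  by exists (rev (mkseq (letter s t) k)); [apply: alt_expr|rewrite size_rev size_mkseq].
move=> u [Su eq]; have [j le [h|h]] := expr_alt D Su; rewrite eq in h.
  by rewrite (alt_inj D h).
case: j k le h {eq} => [|j] [|k] le // h.
  by case: (@alt_neq1 _ _ k D); rewrite h.
by case: (alt_disj D h).
Qed.

(** With [g] an alternating word, both sides of [g * t = s * g] are alternating words. Their last
    letters differ unless one of them is trivial, and the short words are excluded one by one. *)
Lemma dih_not_conj s t g : is_dihedral S s t -> t <> s ^ g.
Proof.
move=> D; have D' := dihedral_sym D; rewrite conjgE => e.
have {}e : g * t = s * g by rewrite e !mulgA mulgV mul1g.
have [gE|[k gE]|[k gE]] := dih_cases g D; rewrite {g}gE in e.
- apply: (@alt_disj _ _ 0 0 D); rewrite /= !mulg1.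
  by move: e; rewrite mulg1 mul1g => ->.
- have := e; rewrite -altSr => e'.
  have : s = letter s t k \/ s = letter s t k.+1.
    by rewrite letterS /letter; case: odd; tauto.
  case=> sE; rewrite [X in _ = X * _]sE in e'.
    rewrite alt_mull // in e'.
    by case: k e' {e sE} => [/(alt_neq1 D')|k /esym /(alt_disj D)].
  exact: (alt_disj D (esym e')).
- have := e; rewrite alt_mulr // => e'.
  have : s = letter t s k \/ s = letter t s k.+1.
    by rewrite letterS /letter; case: odd; tauto.
  case=> sE; rewrite [X in _ = X * _]sE in e'.
    rewrite alt_mull // in e'; case: k e' sE {e} => [_|k /(alt_disj D)//].
    rewrite /letter /= => st; apply: (@alt_disj _ _ 0 0 D).
    by rewrite /= st.
  case: k e' {e sE} => [/esym/(alt_neq1 D')//|k /(alt_disj D)//].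
Qed.

End DihedralWords.

(** * Semilinear extensions and reflection of linear identities *)

Lemma malgUZ (K : choiceType) (R : nzRingType) (r : R) (k : K) :
  << r *g k >> = r *: << k >> :> {malg R[K]}.
Proof. by apply/malgP => j; rewrite mcoeffZ !mcoeffU mulrnAr mulr1. Qed.

Lemma malg_ind (K : choiceType) (R : nzRingType) (P : {malg R[K]} -> Prop) :
  P 0 -> (forall x y, P x -> P y -> P (x + y)) -> (forall r k, P (r *: << k >>)) ->
  forall h, P h.
Proof.
move=> P0 PD PU h; rewrite (monalgE h); apply: big_ind => // k _.
by rewrite malgUZ.
Qed.

(** The twist by [sigma] lets one construction serve for linear maps, for the bar involution and for
    the specialization along the augmentation. *)
HB.lock Definition sext (K : choiceType) (R R' : nzRingType) (M : lmodType R')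
    (sigma : {rmorphism R -> R'}) (f : K -> M) (h : {malg R[K]}) : M :=
  \sum_(k <- msupp h) sigma h@_k *: f k.

Section SemilinearExtension.
Variables (K : choiceType) (R R' : nzRingType) (M : lmodType R').
Variables (sigma : {rmorphism R -> R'}) (f : K -> M).

Local Notation sext := (@sext K R R' M sigma f).

Lemma sextEw (d : {fset K}) (h : {malg R[K]}) :
  (msupp h `<=` d)%fset -> sext h = \sum_(k <- d) sigma h@_k *: f k.
Proof.
move=> le; rewrite unlock (big_fset_incl _ le) //= => x _ xa.
by rewrite (mcoeff_outdom xa) rmorph0 scale0r.
Qed.

Lemma sext_is_zmod_morphism : zmod_morphism sext.
Proof.
move=> a b.
pose d := (msupp (a - b) `|` (msupp a `|` msupp b))%fset.
have sab : (msupp (a - b) `<=` d)%fset by rewrite fsubsetUl.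
have sa : (msupp a `<=` d)%fset by apply: fsubsetU; rewrite fsubsetUl orbT.
have sb : (msupp b `<=` d)%fset by apply: fsubsetU; rewrite fsubsetUr orbT.
rewrite (sextEw sab) (sextEw sa) (sextEw sb) -sumrB.
by apply: eq_bigr => x _; rewrite mcoeffB rmorphB scalerBl.
Qed.

HB.instance Definition _ :=
  GRing.isZmodMorphism.Build {malg R[K]} M sext sext_is_zmod_morphism.

Lemma sextU k : sext << k >> = f k.
Proof.
rewrite (@sextEw [fset k]%fset) ?msuppU_le // big_seq_fset1.
by rewrite mcoeffUU rmorph1 scale1r.
Qed.

Lemma sextZ r h : sext (r *: h) = sigma r *: sext h.
Proof.
rewrite (sextEw (msuppZ_le r h)) [in RHS]unlock scaler_sumr.
by apply: eq_bigr => k _; rewrite mcoeffZ rmorphM scalerA.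
Qed.

Lemma sext_unique (g : {malg R[K]} -> M) :
  (forall x y, g (x + y) = g x + g y) -> (forall r x, g (r *: x) = sigma r *: g x) ->
  (forall k, g << k >> = f k) -> g =1 sext.
Proof.
move=> gD gZ gU; elim/malg_ind => [|x y IHx IHy|r k].
- by rewrite -[in LHS](scale0r 0) gZ rmorph0 scale0r raddf0.
- by rewrite gD IHx IHy raddfD.
- by rewrite gZ gU sextZ sextU.
Qed.

End SemilinearExtension.

Notation lext f := (sext idfun f).

Section LinearExtension.
Variables (K : choiceType) (R : nzRingType) (M : lmodType R) (f : K -> M).

Lemma lextU k : lext f << k >> = f k. Proof. exact: sextU. Qed.

Lemma lextZ r h : lext f (r *: h) = r *: lext f h. Proof. exact: sextZ. Qed.

Lemma lext_unique (g : {malg R[K]} -> M) :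
  (forall x y, g (x + y) = g x + g y) -> (forall r x, g (r *: x) = r *: g x) ->
  (forall k, g << k >> = f k) -> g =1 lext f.
Proof. by move=> gD gZ gU; apply: sext_unique. Qed.

End LinearExtension.

Lemma lext_linear_unique (K : choiceType) (R : nzRingType) (M : lmodType R)
    (g1 g2 : {malg R[K]} -> M) :
  linear g1 -> linear g2 -> (forall k, g1 << k >> = g2 << k >>) -> g1 =1 g2.
Proof.
move=> l1 l2 e h.
have aux (g : {malg R[K]} -> M) : linear g -> g =1 lext (fun k => g << k >>).
  move=> lg; have gD x y : g (x + y) = g x + g y.
    by rewrite -[x in LHS]scale1r lg scale1r.
  have g0 : g 0 = 0 by apply: (addrI (g 0)); rewrite -gD !addr0.
  apply: lext_unique => // r x.
  by rewrite -[r *: x in LHS]addr0 lg g0 addr0.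
rewrite (aux _ l1) (aux _ l2); congr (lext _ h).
by apply/funext.
Qed.

Lemma lext_linear (K : choiceType) (R : nzRingType) (M : lmodType R) (f : K -> M) :
  linear (lext f).
Proof. by move=> r x y; rewrite raddfD /= lextZ. Qed.

Section ModuleReflection.
Variables (R : nzRingType) (V : lmodType R).

Inductive mexp :=
  | MAtom of nat | MZero | MAdd of mexp & mexp | MOpp of mexp | MScale of R & mexp.

Fixpoint meval (env : seq V) (m : mexp) : V :=
  match m with
  | MAtom i => env`_i
  | MZero => 0
  | MAdd a b => meval env a + meval env b
  | MOpp a => - meval env a
  | MScale r a => r *: meval env a
  end.

(** The test is [Nat.eqb] so that [module_eq] can evaluate it by [cbn] on closed indices. *)
Fixpoint mexp_coef (m : mexp) (i : nat) : R :=
  match m with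
  | MAtom j => if Nat.eqb i j then 1 else 0
  | MZero => 0
  | MAdd a b => mexp_coef a i + mexp_coef b i
  | MOpp a => - mexp_coef a i
  | MScale r a => r * mexp_coef a i
  end.

Fixpoint mexp_same (n : nat) (a b : mexp) : Prop :=
  if n is n'.+1 then mexp_coef a n' = mexp_coef b n' /\ mexp_same n' a b else True.

Lemma mevalE env m : meval env m = \sum_(i < size env) mexp_coef m i *: env`_i.
Proof.
elim: m => [j||a IHa b IHb|a IHa|r a IHa] /=.
- have [lt|ge] := ltnP j (size env).
    rewrite (bigD1 (Ordinal lt)) //= PeanoNat.Nat.eqb_refl scale1r big1 ?addr0 // => i.
    case: PeanoNat.Nat.eqb_spec => [ij /eqP[]|_ _]; last exact: scale0r.
    exact: val_inj.
  rewrite nth_default // big1 // => i _.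
  case: PeanoNat.Nat.eqb_spec => [ij|_]; last exact: scale0r.
  by have := ltn_ord i; rewrite ij ltnNge ge.
- by rewrite big1 // => i _; rewrite scale0r.
- by rewrite IHa IHb -big_split; apply: eq_bigr => i _; rewrite scalerDl.
- by rewrite IHa -sumrN; apply: eq_bigr => i _; rewrite scaleNr.
- by rewrite IHa scaler_sumr; apply: eq_bigr => i _; rewrite scalerA.
Qed.

Lemma mexp_eq env a b : mexp_same (size env) a b -> meval env a = meval env b.
Proof.
rewrite !mevalE; move: (size env) => n; elim: n => [|n IH] /=; first by rewrite !big_ord0.
by case=> e /IH h; rewrite !big_ord_recr /= h e.
Qed.

End ModuleReflection.

Ltac env_index x env :=
  match env with
  | x :: _ => constr:(0%N)
  | _ :: ?env' => let i := env_index x env' in constr:(i.+1)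
  end.

Ltac env_mem x env :=
  match env with
  | x :: _ => constr:(true)
  | _ :: ?env' => env_mem x env'
  | _ => constr:(false)
  end.

Ltac mexp_env e env :=
  match e with
  | Algebra.zero => env
  | Algebra.add ?a ?b => let env' := mexp_env a env in mexp_env b env'
  | Algebra.opp ?a => mexp_env a env
  | GRing.scale _ ?a => mexp_env a env
  | _ => match env_mem e env with true => env | false => constr:(e :: env) end
  end.

Ltac mexp_reify R e env :=
  match e with
  | Algebra.zero => constr:(@MZero R)
  | Algebra.add ?a ?b => let x := mexp_reify R a env in
      let y := mexp_reify R b env in constr:(@MAdd R x y)
  | Algebra.opp ?a => let x := mexp_reify R a env in constr:(@MOpp R x)
  | GRing.scale ?r ?a => let x := mexp_reify R a env in constr:(@MScale R r x)
  | _ => let i := env_index e env in constr:(@MAtom R i)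
  end.

(* Reduces an equation in a module to equations between the coefficients of its atoms. *)
Ltac module_eq R :=
  lazymatch goal with |- @eq ?T ?a ?b =>
    let env0 := mexp_env a (@nil T) in
    let env := mexp_env b env0 in
    let x := mexp_reify R a env in
    let y := mexp_reify R b env in
    refine (@mexp_eq R _ env x y _);
    cbn [mexp_same mexp_coef size Nat.eqb]; repeat split
  end.

(** * Quadratic relations, group rings and their negative parts *)

Section Bilinear.
Variables (K : choiceType) (R : nzRingType).
Local Notation V := {malg R[K]}.
Variables (m : V -> V -> V) (ml : forall h, linear (m^~ h)) (mr : forall h, linear (m h)).

Lemma bilinDl f g h : m (f + g) h = m f h + m g h.
Proof. by rewrite -[f in LHS]scale1r ml scale1r. Qed.

Lemma bilinDr f g h : m h (f + g) = m h f + m h g.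
Proof. by rewrite -[f in LHS]scale1r mr scale1r. Qed.

Lemma bilin0l h : m 0 h = 0.
Proof. by apply: (addrI (m 0 h)); rewrite -bilinDl !addr0. Qed.

Lemma bilin0r h : m h 0 = 0.
Proof. by apply: (addrI (m h 0)); rewrite -bilinDr !addr0. Qed.

Lemma bilinZl r f h : m (r *: f) h = r *: m f h.
Proof. by rewrite -[_ *: _ in LHS]addr0 ml bilin0l addr0. Qed.

Lemma bilinZr r f h : m h (r *: f) = r *: m h f.
Proof. by rewrite -[_ *: _ in LHS]addr0 mr bilin0r addr0. Qed.

Variables (x e : V) (q q' : R).
Hypotheses (me : forall h, m e h = h) (mxe : m x e = x) (qq : q * q' = 1) (q'q : q' * q = 1).

Lemma quadratic_relation :
  m (x - q *: e) (x + q' *: e) = 0 <-> m x x = e + (q - q') *: x.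
Proof.
have -> : m (x - q *: e) (x + q' *: e) = m x x - (e + (q - q') *: x).
  rewrite -scaleNr bilinDl !bilinDr !(bilinZl, bilinZr, me, mxe).
  rewrite scalerBl !scaleNr ?scalerN !scalerA ?qq ?q'q scale1r.
  move: (m x x) (q *: x) (q' *: x) => a b c.
  by rewrite -addrA opprD opprB; congr (_ + _); rewrite addrA addrC.
by split=> [/eqP|->]; rewrite ?subrr // subr_eq0 => /eqP.
Qed.

(** The version needed for an anti-automorphism, which exchanges the two factors. *)
Lemma quadratic_relation_rev :
  m (x + q' *: e) (x - q *: e) = 0 <-> m x x = e + (q - q') *: x.
Proof.
have -> : m (x + q' *: e) (x - q *: e) = m x x - (e + (q - q') *: x).
  rewrite -scaleNr bilinDl !bilinDr !(bilinZl, bilinZr, me, mxe).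
  rewrite scalerBl !scaleNr ?scalerN !scalerA ?qq ?q'q scale1r.
  move: (m x x) (q *: x) (q' *: x) => a b c.
  by rewrite -addrA opprD opprB; congr (_ + _); rewrite addrCA addrA addrC addrA addrC.
by split=> [/eqP|->]; rewrite ?subrr // subr_eq0 => /eqP.
Qed.

End Bilinear.

Section GroupRingMorphisms.
Variable G : zmodType.
Implicit Types f g : group_ring G.

Lemma gexpD (a b : G) : gexp (a + b) = gexp a * gexp b.
Proof.
have := gr_mulUU 1 1 a b; rewrite mulr1 => e.
by rewrite /gexp -e.
Qed.

Lemma gexp0 : gexp (0 : G) = 1. Proof. by []. Qed.

Lemma gexpN (a : G) : gexp a * gexp (- a) = 1.
Proof. by rewrite -gexpD subrr. Qed.

Lemma gexpNr (a : G) : gexp (- a) * gexp a = 1.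
Proof. by rewrite -gexpD addNr. Qed.

Lemma group_ring_ind (P : group_ring G -> Prop) :
  P 0 -> (forall x y, P x -> P y -> P (x + y)) ->
  (forall (n : int) a, P (gexp a *~ n)) -> forall h, P h.
Proof.
move=> P0 PD PU h; rewrite (monalgE h); apply: big_ind => // k _.
suff -> : << h@_k *g k >> = gexp k *~ h@_k by [].
rewrite /gexp; case: (h@_k) => n.
  by rewrite -pmulrn -monalgUMn natz.
by rewrite NegzE mulrNz -pmulrn -monalgUMn -raddfN natz.
Qed.

Lemma gr_barEw (d : {fset G}) f :
  (msupp f `<=` d)%fset -> gr_bar f = \sum_(a <- d) << f@_a *g - a >>.
Proof.
move=> le; rewrite /gr_bar (big_fset_incl _ le) //= => x _ xa.
by rewrite (mcoeff_outdom xa) monalgU0.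
Qed.

Lemma gr_bar_is_zmod_morphism : zmod_morphism (@gr_bar G).
Proof.
move=> a b.
pose d := (msupp (a - b) `|` (msupp a `|` msupp b))%fset.
have sab : (msupp (a - b) `<=` d)%fset by rewrite fsubsetUl.
have sa : (msupp a `<=` d)%fset by apply: fsubsetU; rewrite fsubsetUl orbT.
have sb : (msupp b `<=` d)%fset by apply: fsubsetU; rewrite fsubsetUr orbT.
rewrite (gr_barEw sab) (gr_barEw sa) (gr_barEw sb) -sumrB.
by apply: eq_bigr => x _; rewrite mcoeffB raddfB.
Qed.

HB.instance Definition _ :=
  GRing.isZmodMorphism.Build (group_ring G) (group_ring G) (@gr_bar G)
    gr_bar_is_zmod_morphism.

Lemma gr_bar_exp (a : G) : gr_bar (gexp a) = gexp (- a).
Proof.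
rewrite (@gr_barEw [fset a]%fset) ?msuppU_le // big_seq_fset1.
by rewrite mcoeffUU.
Qed.

Lemma gr_bar_is_monoid_morphism : monoid_morphism (@gr_bar G).
Proof.
split; first by rewrite -gexp0 gr_bar_exp oppr0.
move=> f g; elim/group_ring_ind: f => [|x y IHx IHy|n a].
- by rewrite !(mul0r, raddf0).
- by rewrite mulrDl !raddfD /= mulrDl IHx IHy.
elim/group_ring_ind: g => [|x y IHx IHy|m b].
- by rewrite !(mulr0, raddf0).
- by rewrite mulrDr !raddfD /= mulrDr IHx IHy.
rewrite mulrzAl mulrzAr !raddfMz /= mulrzAl mulrzAr -gexpD !gr_bar_exp.
by rewrite -gexpD opprD.
Qed.

HB.instance Definition _ :=
  GRing.isMonoidMorphism.Build (group_ring G) (group_ring G) (@gr_bar G)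
    gr_bar_is_monoid_morphism.

Lemma gr_bar_coeff f a : (gr_bar f)@_a = f@_(- a).
Proof.
elim/group_ring_ind: f => [|x y IHx IHy|n b]; first by rewrite raddf0 !mcoeff0.
  by rewrite raddfD !mcoeffD IHx IHy.
rewrite !raddfMz /= gr_bar_exp; congr (_ *~ _).
by rewrite /gexp !mcoeffU eqr_oppLR.
Qed.

Lemma augmentationEw (d : {fset G}) f :
  (msupp f `<=` d)%fset -> augmentation f = \sum_(a <- d) f@_a.
Proof.
move=> le; rewrite /augmentation (big_fset_incl _ le) //= => x _ xa.
by rewrite (mcoeff_outdom xa).
Qed.

Lemma augmentation_is_zmod_morphism : zmod_morphism (@augmentation G).
Proof.
move=> a b.
pose d := (msupp (a - b) `|` (msupp a `|` msupp b))%fset.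
have sab : (msupp (a - b) `<=` d)%fset by rewrite fsubsetUl.
have sa : (msupp a `<=` d)%fset by apply: fsubsetU; rewrite fsubsetUl orbT.
have sb : (msupp b `<=` d)%fset by apply: fsubsetU; rewrite fsubsetUr orbT.
rewrite (augmentationEw sab) (augmentationEw sa) (augmentationEw sb) -sumrB.
by apply: eq_bigr => x _; rewrite mcoeffB.
Qed.

HB.instance Definition _ :=
  GRing.isZmodMorphism.Build (group_ring G) int (@augmentation G)
    augmentation_is_zmod_morphism.

Lemma augmentation_exp (a : G) : augmentation (gexp a) = 1.
Proof.
rewrite (@augmentationEw [fset a]%fset) ?msuppU_le // big_seq_fset1.
by rewrite mcoeffUU.
Qed.

Lemma augmentation_is_monoid_morphism : monoid_morphism (@augmentation G).
Proof.
split; first by rewrite -gexp0 augmentation_exp.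
move=> f g; elim/group_ring_ind: f => [|x y IHx IHy|n a].
- by rewrite !(mul0r, raddf0).
- by rewrite mulrDl !raddfD /= mulrDl IHx IHy.
elim/group_ring_ind: g => [|x y IHx IHy|m b].
- by rewrite !(mulr0, raddf0).
- by rewrite mulrDr !raddfD /= mulrDr IHx IHy.
rewrite mulrzAl mulrzAr !raddfMz /= mulrzAl mulrzAr -gexpD !augmentation_exp.
by rewrite mulr1.
Qed.

HB.instance Definition _ :=
  GRing.isMonoidMorphism.Build (group_ring G) int (@augmentation G)
    augmentation_is_monoid_morphism.

End GroupRingMorphisms.

Section NegativeElements.
Variable G : tozmodType.
Implicit Types a b : group_ring G.

Lemma gr_negP a : gr_neg a <-> forall c, 0 <= c -> a@_c = 0.
Proof.
split=> [na c c0|h c ca].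
  apply/eqP; rewrite mcoeff_eq0; apply/negP => /na.
  by move=> c1; have := lt_le_trans c1 c0; rewrite ltxx.
have /orP[//|] := tozmod_total c 0; rewrite le_eqVlt => cs; last first.
  by move: ca; rewrite -mcoeff_neq0 h ?eqxx // le_eqVlt.
move: cs; rewrite -le_eqVlt lt_neqAle => ->; rewrite andbT.
by apply: contraL ca => /eqP ->; rewrite -mcoeff_eq0 h.
Qed.

Lemma gr_neg0 : gr_neg (0 : group_ring G).
Proof. by apply/gr_negP => c _; rewrite mcoeff0. Qed.

Lemma gr_negD a b : gr_neg a -> gr_neg b -> gr_neg (a + b).
Proof.
move=> /gr_negP na /gr_negP nb; apply/gr_negP => c c0.
by rewrite mcoeffD na // nb // addr0.
Qed.

Lemma gr_negN a : gr_neg a -> gr_neg (- a).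
Proof. by move=> /gr_negP na; apply/gr_negP => c c0; rewrite mcoeffN na // oppr0. Qed.

Lemma gr_neg_exp (c : G) : c < 0 -> gr_neg (gexp c).
Proof.
by move=> c0 d; rewrite -mcoeff_neq0 mcoeffU; have [<-//|_] := eqVneq c d; rewrite eqxx.
Qed.

Lemma to_ltD (x y z : G) : x < y -> x + z < y + z.
Proof.
rewrite !lt_neqAle => /andP[ne le].
by rewrite (inj_eq (addIr z)) ne tozmod_leD2r.
Qed.

Lemma gr_negM a b : gr_neg a -> gr_neg b -> gr_neg (a * b).
Proof.
move=> na nb; apply/gr_negP => c c0.
rewrite -[a * b]/(gr_mul a b) /gr_mul raddf_sum big_seq big1 // => x /na xa.
rewrite raddf_sum big_seq big1 // => y /nb yb.
rewrite /= mcoeffU; case: eqP => // e.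
have : c < 0.
  by rewrite -e; apply: (lt_trans (to_ltD y xa)); rewrite add0r.
by move=> c1; have := lt_le_trans c1 c0; rewrite ltxx.
Qed.

(** By invariance the coefficients at [c] and [- c] agree, and one of these two exponents is
    nonnegative. *)
Lemma gr_neg_bar a : gr_neg a -> gr_bar a = a -> a = 0.
Proof.
move=> /gr_negP na ba; apply/malgP => c; rewrite mcoeff0.
have /orP[c0|c0] := tozmod_total 0 c; first exact: na.
rewrite -ba gr_bar_coeff na //.
by have := tozmod_leD2r _ _ (- c) c0; rewrite subrr add0r.
Qed.

End NegativeElements.

Lemma klC_comb_lext (W : groupType) (S : set W) (G : tozmodType) (phi : Sbar S -> G) a :
  klC_comb phi a = lext (klC phi) a.
Proof. by rewrite unlock. Qed.

Lemma hecke_bar_sext (W : groupType) (S : set W) (G : tozmodType) (phi : Sbar S -> G) a :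
  hecke_bar phi a = sext (@gr_bar G) (fun w => hecke_inv phi (heckeT G w^-1%g)) a.
Proof. by rewrite unlock. Qed.

(** * Lengths and the multiplication of the Hecke algebra *)

Section WordRecursion.
Variables (W : groupType) (S : set W).
Local Open Scope group_scope.
Local Notation len := (cox_length S).

(** A letter either extends the reduced word of [w] or cancels its first letter. A suitable naming
    of the two generators places both cases in one alternating word; the length lemmas below rest on
    this. *)
Lemma left_step s t x w : is_dihedral S s t -> S x ->
  exists s' t' k, [/\ is_dihedral S s' t', (s' = s /\ t' = t) \/ (s' = t /\ t' = s),
    x = letter s' t' k & w = alt s' t' k \/ w = alt s' t' k.+1].
Proof.
move=> D Sx; have D' := dihedral_sym D.
have aux s' t' k : is_dihedral S s' t' -> (s' = s /\ t' = t) \/ (s' = t /\ t' = s) ->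
  w = alt s' t' k.+1 -> exists s' t' k, [/\ is_dihedral S s' t',
    (s' = s /\ t' = t) \/ (s' = t /\ t' = s),
    x = letter s' t' k & w = alt s' t' k \/ w = alt s' t' k.+1].
  move=> D1 st wE; have : x = letter s' t' k \/ x = letter s' t' k.+1.
    rewrite letterS /letter.
    by case: odd; case: (dih_SP D1 Sx); tauto.
  case=> xE; first by exists s', t', k; split=> //; right.
  by exists s', t', k.+1; split=> //; left.
have [wE|[k wE]|[k wE]] := dih_cases w D.
- have [xE|xE] := dih_SP D Sx; rewrite xE wE.
    by exists s, t, 0%N; split=> //; left.
  by exists t, s, 0%N; split=> //; [right|left].
- by apply: aux wE => //; left.
- by apply: aux wE => //; right.
Qed.

Section Rec.
Variables (s t : W).
Hypothesis D : is_dihedral S s t.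

(** The condition on the second component discards one of the two codes of 1, so that [xget] meets a
    unique value. *)
Definition dih_code (w : W) : bool * nat :=
  xget (true, 0%N) [set c | w = (if c.1 then alt s t c.2 else alt t s c.2) /\
                            (c.2 = 0%N -> c.1 = true)].

Lemma dih_code_alt k : dih_code (alt s t k) = (true, k).
Proof.
apply: xget_unique => [|[[] j] /= []]; first by [].
  by move=> /(alt_inj D) ->.
case: j => [|j] h; first by move/(_ erefl).
by case: k h => [|k] => [/esym /(alt_neq1 (dihedral_sym D))|/(alt_disj D)].
Qed.

Lemma dih_code_alt' k : dih_code (alt t s k.+1) = (false, k.+1).
Proof.
apply: xget_unique => [|[[] j] [e _]]; first by [].
  have {}e : alt t s k.+1 = alt s t j := e.
  by case: j e => [/(alt_neq1 (dihedral_sym D))|j /esym /(alt_disj D)].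
have {}e : alt t s k.+1 = alt t s j := e.
by rewrite (alt_inj (dihedral_sym D) e).
Qed.

Variables (T : Type) (z : T) (f : W -> T -> T).

Fixpoint altrec (x y : W) (k : nat) : T :=
  if k is k'.+1 then f (letter x y k') (altrec x y k') else z.

(** Recursion along a reduced word gives a function on W without any compatibility condition,
    because that word is unique. *)
Definition wrec (w : W) : T :=
  let c := dih_code w in if c.1 then altrec s t c.2 else altrec t s c.2.

Lemma wrec_alt k : wrec (alt s t k) = altrec s t k.
Proof. by rewrite /wrec dih_code_alt. Qed.

Lemma wrec_alt' k : wrec (alt t s k) = altrec t s k.
Proof. by case: k => [|k]; [exact: (wrec_alt 0)|rewrite /wrec dih_code_alt']. Qed.

Lemma wrec1 : wrec 1 = z. Proof. exact: (wrec_alt 0). Qed.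

Lemma wrec_up x w : S x -> (len w < len (x * w))%N -> wrec (x * w) = f x (wrec w).
Proof.
move=> Sx; have [s' [t' [k [D' st -> [->|->]]]]] := left_step w D Sx.
  move=> _; rewrite -altS.
  by case: st => [] [-> ->]; rewrite ?wrec_alt ?wrec_alt'.
by rewrite (alt_mull _ D') !(length_alt _ D') ltnNge leqnSn.
Qed.

End Rec.

Lemma len1 s t : is_dihedral S s t -> len 1 = 0%N.
Proof. by move=> D; have := length_alt 0 D. Qed.

Lemma len_mull s t x w : is_dihedral S s t -> S x ->
  len (x * w) = (if (len w < len (x * w))%N then (len w).+1 else (len w).-1).
Proof.
move=> D Sx; have [s' [t' [k [D' _ -> [->|->]]]]] := left_step w D Sx.
  by rewrite -altS !(length_alt _ D') ltnSn.
by rewrite (alt_mull _ D') !(length_alt _ D') ltnNge leqnSn.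
Qed.

Lemma len_down s t x w : is_dihedral S s t -> S x ->
  (len w < len (x * w))%N = ~~ (len (x * w) < len w)%N.
Proof.
move=> D Sx; have [s' [t' [k [D' _ -> [->|->]]]]] := left_step w D Sx.
  by rewrite -altS !(length_alt _ D') ltnSn ltnNge leqnSn.
by rewrite (alt_mull _ D') !(length_alt _ D') ltnSn ltnNge leqnSn.
Qed.

Lemma len_gt0 s t w : is_dihedral S s t -> w <> 1 ->
  exists x, S x /\ len w = (len (x * w)).+1.
Proof.
move=> D; have [//|[k ->] _|[k ->] _] := dih_cases w D.
  by exists (letter s t k); split; [exact: letter_S|rewrite (alt_mull _ D) ?(length_alt _ D)].
have D' := dihedral_sym D.
by exists (letter t s k); split; [exact: letter_S|rewrite (alt_mull _ D') ?(length_alt _ D')].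
Qed.

Lemma len_ind s t (P : W -> Prop) : is_dihedral S s t -> P 1 ->
  (forall x w, S x -> (len w < len (x * w))%N -> P w -> P (x * w)) -> forall w, P w.
Proof.
move=> D P1 PS w; move: {2}(len w) (leqnn (len w)) => n.
elim: n w => [|n IH] w le.
  have [->//|w1] := eqVneq w 1.
  have [x [_ e]] := len_gt0 D (elimN eqP w1).
  by rewrite e in le.
have [->//|w1] := eqVneq w 1.
have [x [Sx e]] := len_gt0 D (elimN eqP w1).
have xx : x * (x * w) = w.
  by case: (dih_SP D Sx) => ->; rewrite ?(dihK D) ?(dihK (dihedral_sym D)).
by rewrite -xx; apply: PS; rewrite ?xx -?e //; apply: IH; rewrite -ltnS -e.
Qed.

Lemma S_K s t x w : is_dihedral S s t -> S x -> x * (x * w) = w.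
Proof. by move=> D /(dih_SP D) [] ->; [exact: (dihK D)|exact: (dihK (dihedral_sym D))]. Qed.

Lemma S_V s t x : is_dihedral S s t -> S x -> x^-1 = x.
Proof. by move=> D /(dih_SP D) [] ->; [exact: (dihV D)|exact: (dihV (dihedral_sym D))]. Qed.

Lemma lenV s t w : is_dihedral S s t -> len w^-1 = len w.
Proof.
move=> D; have D' := dihedral_sym D; have [->|[k ->]|[k ->]] := dih_cases w D.
- by rewrite invg1.
- by rewrite (altV _ D); case: ifP; rewrite ?(length_alt _ D) ?(length_alt _ D').
- by rewrite (altV _ D'); case: ifP; rewrite ?(length_alt _ D) ?(length_alt _ D').
Qed.

Lemma len_up s t x w : is_dihedral S s t -> S x -> (len w < len (x * w))%N ->
  len (x * w) = (len w).+1.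
Proof. by move=> D Sx up; rewrite (len_mull _ D Sx) up. Qed.

Lemma len_dn s t x w : is_dihedral S s t -> S x -> (len w < len (x * w))%N = false ->
  len w = (len (x * w)).+1.
Proof.
move=> D Sx dn; rewrite -{1}(S_K w D Sx) (len_up D Sx) // (S_K w D Sx).
by move: dn; rewrite (len_down _ D Sx) => /negbFE.
Qed.

Lemma len_S s t x : is_dihedral S s t -> S x -> len x = 1%N.
Proof.
move=> D /(dih_SP D) [] ->; [have := length_alt 1 D|have := length_alt 1 (dihedral_sym D)];
  by rewrite /= mulg1.
Qed.

Lemma len_le s t v w : is_dihedral S s t -> (len (v * w) <= len v + len w)%N.
Proof.
move=> D; move: v; apply: (len_ind D) => [|x v Sx up IH]; first by rewrite mul1g leq_addl.
rewrite -mulgA (len_up D Sx up); have := len_mull (v * w) D Sx.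
case: ifP => _ ->; first by rewrite addSn ltnS.
by rewrite (leq_trans (leq_pred _)) // (leq_trans IH) // leq_add2r.
Qed.

End WordRecursion.

Section HeckeMultiplication.
Variables (W : groupType) (S : set W) (s t : W) (G : tozmodType).
Variables (phi : Sbar S -> G) (wt : W -> G).
Hypothesis D : is_dihedral S s t.
Hypothesis phiE : forall (o : Sbar S) x, val o x -> phi o = wt x.

Local Notation R := (group_ring G).
Local Notation H := {malg R[W]}.
Local Notation len := (cox_length S).
Local Notation T := (@heckeT W G).

Definition hxi (x : W) : R := gexp (wt x) - gexp (- wt x).

Lemma hxi_bar x : gr_bar (hxi x) = - hxi x.
Proof. by rewrite /hxi raddfB /= !gr_bar_exp opprK opprB. Qed.

(** Left multiplication by [T x] in the Hecke algebra under construction. *)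
Definition Lop (x : W) : H -> H :=
  lext (fun w => T (x * w)%g + (if (len w < len (x * w)%g)%N then 0 else hxi x) *: T w).

Lemma LopT x w : Lop x (T w) =
  T (x * w)%g + (if (len w < len (x * w)%g)%N then 0 else hxi x) *: T w.
Proof. exact: lextU. Qed.

Lemma LopD x g h : Lop x (g + h) = Lop x g + Lop x h. Proof. exact: raddfD. Qed.
Lemma LopB x g h : Lop x (g - h) = Lop x g - Lop x h. Proof. exact: raddfB. Qed.
Lemma LopZ x r h : Lop x (r *: h) = r *: Lop x h. Proof. exact: lextZ. Qed.
Lemma Lop_linear x : linear (Lop x). Proof. exact: lext_linear. Qed.

Lemma Lop2 x h : S x -> Lop x (Lop x h) = h + hxi x *: Lop x h.
Proof.
move=> Sx; apply: (@lext_linear_unique _ _ _ (fun h => Lop x (Lop x h))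
    (fun h => h + hxi x *: Lop x h)) => [r g g'|r g g'|w].
- by rewrite !Lop_linear.
- rewrite Lop_linear !scalerDr !scalerA (mulrC _ r) -!addrA; congr (_ + _).
  by rewrite addrCA.
rewrite -/(T w) LopT LopD LopZ !LopT (S_K _ D Sx) (len_down _ D Sx).
case: (_ < _)%N => /=; rewrite ?scale0r ?addr0 -?addrA -?scalerDr //.
Qed.

Definition hop (w : W) : H -> H := wrec s t id (fun x F h => Lop x (F h)) w.

Lemma hop1 h : hop 1%g h = h. Proof. by rewrite /hop (wrec1 D). Qed.

Lemma Sbar_val (o : Sbar S) x : val o x -> S x.
Proof. by have [r Sr <-] := set_mem (valP o); case. Qed.

Lemma hopM x w h : S x -> (len w < len (x * w)%g)%N -> hop (x * w)%g h = Lop x (hop w h).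
Proof. by move=> Sx up; rewrite /hop (wrec_up D _ _ Sx up). Qed.

Lemma hopS x h : S x -> hop x h = Lop x h.
Proof.
by move=> Sx; have := @hopM x 1%g h Sx; rewrite mulg1 hop1 (len1 D) (len_S D Sx) => ->.
Qed.

Lemma hop_linear w : linear (hop w).
Proof.
move: w; apply: (len_ind D) => [|x w Sx up IH] r g h; first by rewrite !hop1.
by rewrite !hopM // IH Lop_linear.
Qed.

Definition hmul (g h : H) : H := lext (fun w => hop w h) g.

Lemma hmulT w h : hmul (T w) h = hop w h. Proof. exact: lextU. Qed.

Lemma hmul_linearl h : linear (hmul^~ h). Proof. exact: lext_linear. Qed.

Lemma hmul_linearr g : linear (hmul g).
Proof.
have h0 h : hmul 0 h = 0 by exact: raddf0.
have hD x y h : hmul (x + y) h = hmul x h + hmul y h by exact: raddfD.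
have hZ r x h : hmul (r *: x) h = r *: hmul x h by exact: lextZ.
move=> r h h'; move: g; elim/malg_ind => [|g g' IHg IHg'|c w].
- by rewrite !h0 scaler0 addr0.
- rewrite !hD IHg IHg' scalerDr.
  by rewrite -!addrA; congr (_ + _); rewrite addrCA.
- by rewrite !hZ !hmulT hop_linear scalerDr !scalerA mulrC.
Qed.

(** Associativity with a generator as first factor. If [x] lengthens [w], this is the recursion for
    [hop]; otherwise [w] begins with [x] and the quadratic relation [Lop2] suffices, as W has no
    braid relation. *)
Lemma hmul_Lop x g h : S x -> hmul (Lop x g) h = Lop x (hmul g h).
Proof.
move=> Sx; apply: (@lext_linear_unique _ _ _ (fun g => hmul (Lop x g) h)
    (fun g => Lop x (hmul g h))) => [r a b|r a b|w].
- by rewrite Lop_linear hmul_linearl.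
- by rewrite hmul_linearl Lop_linear.
rewrite -/(T w) LopT hmulT addrC hmul_linearl addrC !hmulT.
case: ifP => up; first by rewrite scale0r addr0 hopM.
have dn : (len (x * w)%g < len (x * (x * w))%g)%N.
  by rewrite (S_K _ D Sx); move: up; rewrite (len_down _ D Sx) => /negbFE.
have -> : hop w h = Lop x (hop (x * w)%g h) by rewrite -hopM // (S_K w D Sx).
by rewrite Lop2.
Qed.

Lemma hmulA : associative hmul.
Proof.
move=> f g h; have aux w : hmul (hop w g) h = hop w (hmul g h).
  move: w; apply: (len_ind D) => [|x w Sx up IH]; first by rewrite !hop1.
  by rewrite (hopM _ Sx up) (hmul_Lop _ _ Sx) IH -(hopM _ Sx up).
apply: (@lext_linear_unique _ _ _ (fun f => hmul f (hmul g h))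
    (fun f => hmul (hmul f g) h)) => [|r a b|w]; first exact: hmul_linearl.
  by rewrite !hmul_linearl.
by rewrite -/(T w) !hmulT aux.
Qed.

Lemma hopT v w : len (v * w)%g = (len v + len w)%N -> hop v (T w) = T (v * w)%g.
Proof.
move: v; apply: (len_ind D) => [|x v Sx up IH]; first by rewrite hop1 mul1g.
rewrite -mulgA (len_up D Sx up) => e.
have le := len_le v w D; have := len_mull (v * w)%g D Sx; case: ifP => up' e'; last first.
  by move: le e'; rewrite e; case: (len (v * w)%g) => [|n] /=; lia.
rewrite hopM // IH; last by apply/eq_add_S; rewrite -e' e addSn.
by rewrite LopT up' scale0r addr0.
Qed.

Lemma Sbar_class_val x (Sx : S x) : val (Sbar_class Sx) x.
Proof. by split=> //; exists 1%g; rewrite conjg1. Qed.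

(** If [x] shortens [w], then [T w] is the product of [T x] and [T (x * w)]; associativity and the
    quadratic relation leave no choice for the product. Uniqueness of the multiplication follows
    from this. *)
Lemma hTT x w m : is_hecke_mul phi m -> S x -> m (T x) (T w) = Lop x (T w).
Proof.
move=> [[mr ml] mA mT mQ] Sx.
have lxw := len_mull w D Sx; have lx := len_S D Sx.
have m1 h : m (T 1%g) h = h.
  apply: (@lext_linear_unique _ _ _ (m (T 1%g)) id) => [||v] //.
  by rewrite -/(T v) mT ?mul1g ?(len1 D).
have mx1 : m (T x) (T 1%g) = T x by rewrite mT ?mulg1 ?(len1 D) ?addn0.
rewrite LopT; case: ifP lxw => up lxw.
  by rewrite mT ?lx ?lxw ?add1n // scale0r addr0.
have /(quadratic_relation ml mr m1 mx1 (gexpN _)) xx := mQ _ _ (Sbar_class_val Sx).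
rewrite (phiE (Sbar_class_val Sx)) in xx.
have wE : T w = m (T x) (T (x * w)%g).
  by rewrite mT (S_K w D Sx) // lx (len_dn D Sx up).
rewrite [in LHS]wE mA xx (bilinDl ml) m1 (bilinZl ml) -wE /hxi; reflexivity.
Qed.

Lemma hmul_is_hecke_mul : is_hecke_mul phi hmul.
Proof.
have hl := hmul_linearl; have hr := hmul_linearr.
split; [exact: (conj hr hl)|exact: hmulA|by move=> w w' e; rewrite hmulT hopT|].
move=> o x ox; have Sx := Sbar_val ox; rewrite (phiE ox).
have h1 h : hmul (T 1%g) h = h by rewrite hmulT hop1.
have hx1 : hmul (T x) (T 1%g) = T x.
  by rewrite hmulT hopT ?mulg1 ?(len1 D) ?addn0.
apply/(quadratic_relation hl hr h1 hx1 (gexpN _)).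
rewrite hmulT (hopS _ Sx) LopT /hxi.
have xx : (x * x)%g = 1%g by have := S_K 1%g D Sx; rewrite mulg1.
by rewrite xx (len1 D) (len_S D Sx).
Qed.

Lemma hecke_mul_unique m : is_hecke_mul phi m -> m = hmul.
Proof.
move=> hm; have [[lr ll] mA mT mQ] := hm.
apply/funext => g; apply/funext => h; move: g.
apply: lext_linear_unique => [r a b|r a b|w]; [exact: ll|exact: hmul_linearl|].
rewrite -/(T w) hmulT; move: h.
apply: lext_linear_unique => [r a b|r a b|v]; [exact: lr|exact: hop_linear|].
rewrite -/(T v); move: w; apply: (len_ind D) => [|x w Sx up IH].
  by rewrite hop1 mT ?mul1g ?(len1 D).
rewrite hopM // -IH -mT ?(len_up D Sx up) ?(len_S D Sx) //.
rewrite -mA; move: (m (T w) (T v)) => h.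
apply: (@lext_linear_unique _ _ _ (m (T x)) (Lop x)) => [r a b|r a b|u].
- exact: lr.
- exact: Lop_linear.
- exact: hTT.
Qed.

Lemma hecke_mulE : hecke_mul phi = hmul.
Proof. by apply: xget_unique; [exact: hmul_is_hecke_mul|exact: hecke_mul_unique]. Qed.

End HeckeMultiplication.

(* Locked copies: conversion problems on the bodies do not terminate in practice. *)
HB.lock Definition hM (W : groupType) (S : set W) (G : tozmodType) (phi : Sbar S -> G) :=
  hecke_mul phi.

HB.lock Definition iota (W : groupType) (G : tozmodType) :
    {malg (group_ring G)[W]} -> {malg (group_ring G)[W]} :=
  lext (fun w => heckeT G w^-1%g).

Section HeckeStructure.
Variables (W : groupType) (S : set W) (s t : W) (G : tozmodType).
Variables (phi : Sbar S -> G) (wt : W -> G).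
Hypothesis D : is_dihedral S s t.
Hypothesis phiE : forall (o : Sbar S) x, val o x -> phi o = wt x.

Local Notation R := (group_ring G).
Local Notation H := {malg R[W]}.
Local Notation len := (cox_length S).
Local Notation T := (@heckeT W G).
Local Notation M := (hM phi).
Local Notation iota := (@iota W G).
Local Notation xi := (hxi wt).
Local Notation L := (Lop S wt).

Lemma hME : M = hmul S s t wt.
Proof. by rewrite unlock (hecke_mulE D phiE). Qed.

Lemma hecke_mulP : is_hecke_mul phi M.
Proof. rewrite hME; exact: hmul_is_hecke_mul. Qed.

Lemma hmA : associative M. Proof. by case: hecke_mulP. Qed.

Lemma hm_linl h : linear (M^~ h). Proof. by case: hecke_mulP => [[]]. Qed.

Lemma hm_linr h : linear (M h). Proof. by case: hecke_mulP => [[]]. Qed.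

Lemma hmDl f g h : M (f + g) h = M f h + M g h.
Proof. exact: (bilinDl hm_linl). Qed.

Lemma hmDr f g h : M h (f + g) = M h f + M h g.
Proof. exact: (bilinDr hm_linr). Qed.

Lemma hmZl r f h : M (r *: f) h = r *: M f h.
Proof. exact: (bilinZl hm_linl). Qed.

Lemma hmZr r f h : M h (r *: f) = r *: M h f.
Proof. exact: (bilinZr hm_linr). Qed.

Lemma hmTT v w : len (v * w)%g = (len v + len w)%N -> M (T v) (T w) = T (v * w)%g.
Proof. by case: hecke_mulP => _ _ h _; apply: h. Qed.

Lemma hm1l h : M (T 1%g) h = h.
Proof. by rewrite hME hmulT (hop1 _ D). Qed.

Lemma hmL x h : S x -> M (T x) h = L x h.
Proof. by move=> Sx; rewrite hME hmulT (hopS _ D). Qed.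

Lemma hm1r h : M h (T 1%g) = h.
Proof.
apply: (@lext_linear_unique _ _ _ (M^~ (T 1%g)) id) => [||w] //; first exact: hm_linl.
by rewrite -/(T w) hmTT ?mulg1 ?(len1 D) ?addn0.
Qed.

Lemma iotaT w : iota (T w) = T w^-1%g. Proof. by rewrite unlock lextU. Qed.

Lemma iota_linear : linear iota. Proof. by rewrite unlock; exact: lext_linear. Qed.

Lemma iotaD a b : iota (a + b) = iota a + iota b.
Proof. by rewrite -[a in LHS]scale1r iota_linear scale1r. Qed.

Lemma iotaZ r a : iota (r *: a) = r *: iota a.
Proof.
have i0 : iota 0 = 0 by apply: (addrI (iota 0)); rewrite -iotaD !addr0.
by rewrite -[_ *: _ in LHS]addr0 iota_linear i0 addr0.
Qed.

Lemma iotaB a b : iota (a - b) = iota a - iota b.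
Proof. by rewrite iotaD -(scaleN1r b) iotaZ scaleN1r. Qed.

Lemma iotaK : involutive iota.
Proof.
apply: (@lext_linear_unique _ _ _ (fun h => iota (iota h)) id) => [r a b||w] //.
  by rewrite !iota_linear.
by rewrite -/(T w) !iotaT invgK.
Qed.

(** The opposite multiplication transported by [iota] satisfies the same characterization, so
    uniqueness identifies it with [M]. *)
Lemma iotaM g h : iota (M g h) = M (iota h) (iota g).
Proof.
suff hm : is_hecke_mul phi (fun g h => iota (M (iota h) (iota g))).
  have := hecke_mul_unique D phiE hm; rewrite -hME => e.
  by rewrite -[in LHS]e !iotaK.
split.
- split=> f r a b; first by rewrite iota_linear hm_linl iota_linear.
  by rewrite iota_linear hm_linr iota_linear.
- by move=> a b c; rewrite !iotaK hmA.
- move=> v w e; rewrite !iotaT hmTT ?iotaT ?invgM ?invgK //.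
  by rewrite -invgM !(lenV _ D) e addnC.
move=> o x ox; have Sx := Sbar_val ox; rewrite (phiE ox).
have [_ _ _ /(_ _ _ ox)] := hecke_mulP; rewrite (phiE ox).
move=> /(quadratic_relation hm_linl hm_linr hm1l (hm1r _) (gexpN _)).
move=> /(quadratic_relation_rev hm_linl hm_linr hm1l (hm1r _) (gexpNr _)) e.
have i0 : iota 0 = 0 by apply: (addrI (iota 0)); rewrite -iotaD !addr0.
have e1 r : iota (T x + r *: T 1%g) = T x + r *: T 1%g.
  by rewrite (iotaD (T x)) iotaZ !iotaT (S_V D Sx) invg1.
rewrite -[in LHS]scaleNr [X in M X _](e1 _) [X in M _ X](e1 _) scaleNr e; exact: i0.
Qed.

End HeckeStructure.

(** * Kazhdan-Lusztig bases *)

(* [E] models the basis [T_w + v_s^-1 T_(ws)], [w] ending in [s], of the left ideal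
   generated by [T_s + v_s^-1]; [P], [Q] stand for [v_s^-1], [v_t^-1]. *)

Section UnequalRecursion.
Variables (R : comNzRingType) (V : lmodType R).
Variables (ls lt : V -> V) (lsL : linear ls) (ltL : linear lt).
Variables (P P' Q Q' : R) (PP : P * P' = 1) (QQ : Q * Q' = 1) (E : nat -> V).
Hypothesis ltE : forall k, lt (E k.*2) = E k.*2.+1.
Hypothesis lsE : forall k, ls (E k.*2.+1) = E k.*2.+2.
Hypothesis ltE' : forall k, lt (E k.*2.+1) = E k.*2 + (Q' - Q) *: E k.*2.+1.
Hypothesis lsE' : forall k, ls (E k.*2.+2) = E k.*2.+1 + (P' - P) *: E k.*2.+2.
Hypothesis lsE0 : ls (E 0) = P' *: E 0.

(** For k > 0 this is [ls + P] applied to [E (2k - 1)], hence an eigenvector of [ls]. *)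
Definition uneqF (k : nat) : V := if k is k'.+1 then E k.*2 + P *: E k'.*2.+1 else E 0.

(** This recursion makes the lower coefficients on [E] visibly negative. The scalar [P * Q - P * Q']
    is the one for which [Phi] below commutes with the bar involution on bar-invariant eigenvectors
    of [ls]. *)
Fixpoint uneqD (k : nat) : V :=
  match k with
  | 0 => uneqF 0
  | 1 => uneqF 1 + (P * Q - P * Q') *: uneqF 0
  | (k'.+1 as k1).+1 => uneqF k + (P * Q - P * Q') *: uneqD k1 + (P * P) *: uneqD k'
  end.

Let opD (f : V -> V) (fL : linear f) a b : f (a + b) = f a + f b.
Proof. by rewrite -[a in LHS]scale1r fL scale1r. Qed.

Let opZ (f : V -> V) (fL : linear f) r a : f (r *: a) = r *: f a.
Proof.
have f0 : f 0 = 0 by apply: (addrI (f 0)); rewrite -(opD fL) !addr0.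
by rewrite -[_ *: _ in LHS]addr0 fL f0 addr0.
Qed.

Let Ks (h : V) : V := ls h + P *: h.
Let Phi (h : V) : V := Ks (lt h) + (P * Q - P * Q') *: h.

Let PhiD a b : Phi (a + b) = Phi a + Phi b.
Proof.
rewrite /Phi /Ks (opD ltL) (opD lsL); module_eq R; ring.
Qed.

Let PhiZ r a : Phi (r *: a) = r *: Phi a.
Proof.
rewrite /Phi /Ks (opZ ltL) (opZ lsL); module_eq R; ring.
Qed.

Let PhiF0 : Phi (uneqF 0) = uneqF 1 + (P * Q - P * Q') *: uneqF 0.
Proof. by rewrite /Phi /Ks /= (ltE 0) (lsE 0). Qed.

Let PhiF1 : Phi (uneqF 1) = uneqF 2 + (1 + P * P) *: uneqF 0.
Proof.
have [[[t1 t0] s1] s0] := (ltE 1, ltE' 0, lsE 1, lsE 0).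
rewrite /double /= in t1 t0 s1 s0.
rewrite /Phi /Ks /= (opD ltL) (opZ ltL) t1 t0.
rewrite (opD lsL) (opZ lsL) (opD lsL) (opZ lsL) lsE0 s1 s0.
rewrite /double /=; module_eq R; ring: PP QQ.
Qed.

Let PhiF k : Phi (uneqF k.+2) = uneqF k.+3 + uneqF k.+1.
Proof.
have [[[t1 t0] s1] s0] := (ltE k.+2, ltE' k.+1, lsE k.+2, lsE k.+1).
rewrite !doubleS in t1 t0 s1 s0.
rewrite /Phi /Ks /= !doubleS (opD ltL) (opZ ltL) t1 t0.
rewrite (opD lsL) (opZ lsL) (opD lsL) (opZ lsL) s1 s0 lsE'.
module_eq R; ring: PP QQ.
Qed.

Let PhiD0 : Phi (uneqD 0) = uneqD 1.
Proof. exact: PhiF0. Qed.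

Let uneqDSS k : uneqD k.+2 =
  uneqF k.+2 + (P * Q - P * Q') *: uneqD k.+1 + (P * P) *: uneqD k.
Proof. by []. Qed.

Let uneqD1 : uneqD 1 = uneqF 1 + (P * Q - P * Q') *: uneqF 0.
Proof. by []. Qed.

Let uneqD0 : uneqD 0 = uneqF 0.
Proof. by []. Qed.

(** The second description of the [uneqD], a Chebyshev recursion for [Phi]; bar-invariance and the
    left action are read off from it. On the [uneqF] the operator [Phi] obeys the same recursion up
    to corrections in degrees 0 and 1, which the definition of [uneqD] compensates. *)
Let PhiDS k : Phi (uneqD k.+1) = uneqD k.+2 + uneqD k.
Proof.
elim/ltn_ind: k => -[|[|k]] IH.
- rewrite uneqDSS uneqD1 uneqD0 PhiD PhiZ PhiF1 PhiF0.
  module_eq R; ring.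
- rewrite (uneqDSS 1) !(uneqDSS 0) 2!PhiD 2!PhiZ (PhiF 0) PhiD0 (IH 0) //.
  rewrite (uneqDSS 0) uneqD1 uneqD0.
  module_eq R; ring.
- rewrite (uneqDSS k.+2) (uneqDSS k.+1) 2!PhiD 2!PhiZ (PhiF k.+1) (IH k.+1) // (IH k) //.
  rewrite (uneqDSS k.+1) (uneqDSS k).
  module_eq R; ring.
Qed.

Lemma uneq_step0 :
  ls (lt (uneqD 0)) + P *: lt (uneqD 0) = uneqD 1 - (P * Q - P * Q') *: uneqD 0.
Proof. by rewrite -PhiD0 /Phi addrK. Qed.

Lemma uneq_step k :
  ls (lt (uneqD k.+1)) + P *: lt (uneqD k.+1) =
  uneqD k.+2 - (P * Q - P * Q') *: uneqD k.+1 + uneqD k.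
Proof. by rewrite addrAC -PhiDS /Phi addrK. Qed.

Lemma uneq_eigen k : ls (uneqD k) = P' *: uneqD k.
Proof.
have F n : ls (uneqF n) = P' *: uneqF n.
  case: n => [|n]; first exact: lsE0.
  rewrite /= doubleS (opD lsL) (opZ lsL) lsE lsE'.
  module_eq R; ring: PP.
elim/ltn_ind: k => -[|[|k]] IH; first exact: F.
  rewrite uneqD1 (opD lsL) (opZ lsL) (F 0%N) (F 1%N).
  module_eq R; ring.
rewrite uneqDSS 2!(opD lsL) 2!(opZ lsL) (F k.+2) (IH k.+1) // (IH k) //.
module_eq R; ring.
Qed.

End UnequalRecursion.

Section EqualRecursion.
Variables (R : comNzRingType) (V : lmodType R).
Variables (l : nat -> V -> V) (lL : forall k, linear (l k)) (lSS : forall k, l k.+2 = l k).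
Variables (P P' : R) (PP : P * P' = 1) (E : nat -> V).
Hypothesis lE : forall k, l k.+1 (E k) = E k.+1.
Hypothesis lE' : forall k, l k.+1 (E k.+1) = E k + (P' - P) *: E k.+1.
Hypothesis lE0 : l 0 (E 0) = P' *: E 0.

(** The sum of the [P ^+ (k - j) *: E j] for [j <= k], so its coefficients are negative below the
    leading term. *)
Fixpoint eqG (k : nat) : V := if k is k'.+1 then E k + P *: eqG k' else E 0.

Let opD k a b : l k (a + b) = l k a + l k b.
Proof. by rewrite -[a in LHS]scale1r lL scale1r. Qed.

Let opZ k r a : l k (r *: a) = r *: l k a.
Proof.
have f0 : l k 0 = 0 by apply: (addrI (l k 0)); rewrite -opD !addr0.
by rewrite -[_ *: _ in LHS]addr0 lL f0 addr0.
Qed.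

Lemma eqGS k : eqG k.+1 = E k.+1 + P *: eqG k.
Proof. by []. Qed.

Lemma eq_step0 : l 1 (eqG 0) + P *: eqG 0 = eqG 1.
Proof. by rewrite eqGS /= lE. Qed.

(** The relation C_x C_w = C_(xw) + C_(yw) for equal weights, where x lengthens w and y shortens
    it. *)
Lemma eq_step k : l k.+2 (eqG k.+1) + P *: eqG k.+1 = eqG k.+2 + eqG k.
Proof.
elim/ltn_ind: k => -[|[|k]] IH.
- rewrite !eqGS [eqG 0]/= opD opZ lE lSS lE0.
  module_eq R; ring: PP.
- rewrite !eqGS [eqG 0]/= opD opZ lE lSS opD opZ lE' lE.
  module_eq R; ring: PP.
have {}IH : l k.+2 (eqG k.+1) = eqG k.+2 + eqG k - P *: eqG k.+1.
  by rewrite -IH ?addrK // ltnS leqnSn.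
rewrite (eqGS k.+2) (eqGS k.+1) opD opZ lE (lSS k.+2) opD opZ lE' IH.
rewrite (eqGS k.+3) (eqGS k.+2) (eqGS k.+1) (eqGS k).
module_eq R; ring: PP.
Qed.

Lemma eq_eigen k : l k (eqG k) = P' *: eqG k.
Proof.
elim/ltn_ind: k => -[|[|k]] IH; first exact: lE0.
  rewrite eqGS opD opZ lE' lE [eqG 0]/=.
  module_eq R; ring: PP.
rewrite (eqGS k.+1) (eqGS k) opD opZ lE' opD opZ lE lSS (IH k) //.
module_eq R; ring: PP.
Qed.

End EqualRecursion.

(** * The bar involution and the uniqueness of the elements C_w *)

HB.lock Definition hbar (W : groupType) (S : set W) (G : tozmodType) (phi : Sbar S -> G) :=
  hecke_bar phi.

HB.lock Definition barT (W : groupType) (S : set W) (G : tozmodType) (phi : Sbar S -> G)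
    (w : W) := hecke_inv phi (heckeT G w^-1%g).

Lemma sext_eq (K : choiceType) (R R' : nzRingType) (M : lmodType R')
    (sigma : {rmorphism R -> R'}) (g1 g2 : {malg R[K]} -> M) :
  (forall x y, g1 (x + y) = g1 x + g1 y) -> (forall x y, g2 (x + y) = g2 x + g2 y) ->
  (forall r x, g1 (r *: x) = sigma r *: g1 x) -> (forall r x, g2 (r *: x) = sigma r *: g2 x) ->
  (forall k, g1 << k >> = g2 << k >>) -> g1 =1 g2.
Proof.
move=> D1 D2 Z1 Z2 e h.
rewrite (@sext_unique _ _ _ _ sigma (fun k => g1 << k >>) g1) //.
by rewrite (@sext_unique _ _ _ _ sigma (fun k => g1 << k >>) g2).
Qed.

Section HeckeBar.
Variables (W : groupType) (S : set W) (s t : W) (G : tozmodType).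
Variables (phi : Sbar S -> G) (wt : W -> G).
Hypothesis D : is_dihedral S s t.
Hypothesis phiE : forall (o : Sbar S) x, val o x -> phi o = wt x.

Local Notation R := (group_ring G).
Local Notation H := {malg R[W]}.
Local Notation len := (cox_length S).
Local Notation T := (@heckeT W G).
Local Notation M := (hM phi).
Local Notation xi := (hxi wt).
Local Notation L := (Lop S wt).
Local Notation bT := (barT phi).
Local Notation bar := (hbar phi).

Let mA := hmA D phiE.
Let m1l := hm1l D phiE.
Let m1r := hm1r D phiE.

Lemma hecke_inv_unique h h' : M h h' = T 1%g -> M h' h = T 1%g -> hecke_inv phi h = h'.
Proof.
rewrite /hecke_inv => e1 e2; apply: xget_unique.
  by move: e1 e2; rewrite unlock.
move=> g [f1 f2]; have {}f2 : M g h = T 1%g by rewrite unlock.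
by rewrite -[LHS]m1r -e1 mA f2 m1l.
Qed.

Lemma Lop_inv x h : S x -> L x (L x h - xi x *: h) = h.
Proof. by move=> Sx; rewrite LopB LopZ (Lop2 _ D _ Sx) addrK. Qed.

Lemma Lop_inv' x h : S x -> L x (L x h) - xi x *: L x h = h.
Proof. by move=> Sx; rewrite (Lop2 _ D _ Sx) addrK. Qed.

Let Tinv x := T x + - xi x *: T 1%g.

Let TinvE x h : S x -> M (Tinv x) h = L x h - xi x *: h.
Proof.
move=> Sx; rewrite /Tinv (hmDl D phiE).
rewrite (hmZl D phiE).
rewrite m1l scaleNr.
by rewrite (hmL D phiE _ Sx).
Qed.

Let TTinv x : S x -> M (T x) (Tinv x) = T 1%g.
Proof.
move=> Sx; rewrite (hmL D phiE _ Sx) /Tinv LopD LopZ scaleNr.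
have e : L x (T 1%g) = T x by rewrite -(hmL D phiE _ Sx) m1r.
by rewrite -[in L x (T x)]e (Lop2 _ D _ Sx) e addrK.
Qed.

Let TinvT x : S x -> M (Tinv x) (T x) = T 1%g.
Proof.
move=> Sx; rewrite TinvE //.
have e : L x (T 1%g) = T x by rewrite -(hmL D phiE _ Sx) m1r.
by rewrite -e (Lop_inv' _ Sx).
Qed.

Let TVM x w : S x -> (len w < len (x * w)%g)%N ->
  T (x * w)^-1%g = M (T w^-1%g) (T x).
Proof.
move=> Sx up; have e : (x * w)^-1%g = (w^-1 * x)%g by rewrite invgM (S_V D Sx).
have l : len (w^-1 * x)%g = (len w^-1%g + len x)%N.
  by rewrite -e !(lenV _ D) (len_up D Sx up) (len_S D Sx) addn1.
by rewrite (hmTT D phiE l) e.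
Qed.

Lemma barT_spec w : M (T w^-1%g) (bT w) = T 1%g /\ M (bT w) (T w^-1%g) = T 1%g.
Proof.
suff [h [h1 h2]] : exists h, M (T w^-1%g) h = T 1%g /\ M h (T w^-1%g) = T 1%g.
  by rewrite barT.unlock (hecke_inv_unique h1 h2).
move: w; apply: (len_ind D) => [|x w Sx up [h [h1 h2]]].
  by exists (T 1%g); rewrite invg1 m1l.
have TT := TVM Sx up.
exists (M (Tinv x) h); rewrite TT; split.
  by rewrite -mA (mA (T x)) TTinv // m1l.
by rewrite -mA (mA h) h2 m1l TinvT.
Qed.

Lemma barT_unique w h : M h (T w^-1%g) = T 1%g -> bT w = h.
Proof.
by have [e1 e2] := barT_spec w => e; rewrite -[RHS]m1r -e1 mA e m1l.
Qed.

Lemma barT1 : bT 1%g = T 1%g.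
Proof. by apply: barT_unique; rewrite invg1 m1l. Qed.

Lemma barT_up x w : S x -> (len w < len (x * w)%g)%N ->
  bT (x * w)%g = L x (bT w) - xi x *: bT w.
Proof.
move=> Sx up; rewrite -TinvE //; apply: barT_unique.
rewrite (TVM Sx up).
by have [_ e2] := barT_spec w; rewrite -mA (mA (bT w)) e2 m1l TinvT.
Qed.

Lemma hbarE h : bar h = sext (@gr_bar G) bT h.
Proof. by rewrite hbar.unlock hecke_bar_sext barT.unlock. Qed.

Lemma hbarD g h : bar (g + h) = bar g + bar h.
Proof. by rewrite !hbarE raddfD. Qed.

Lemma hbarZ r h : bar (r *: h) = gr_bar r *: bar h.
Proof. by rewrite !hbarE sextZ. Qed.

Lemma hbarT w : bar (T w) = bT w.
Proof. by rewrite hbarE sextU. Qed.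

(** Multiplicativity of the bar involution for a left factor [T x], whose image is the inverse
    [T x - xi x]. Where [x] shortens [w], the formula [barT_up] for [x * w] is inverted. *)
Lemma hbar_Lop x h : S x -> bar (L x h) = L x (bar h) - xi x *: bar h.
Proof.
move=> Sx; apply: (@sext_eq _ _ _ _ (@gr_bar G) (fun h => bar (L x h))
   (fun h => L x (bar h) - xi x *: bar h)) => [a b|a b|r a|r a|w].
- by rewrite LopD hbarD.
- by rewrite hbarD LopD scalerDr opprD addrACA.
- by rewrite LopZ hbarZ.
- by rewrite hbarZ LopZ scalerBr !scalerA mulrC.
rewrite -/(T w) LopT hbarD hbarZ !hbarT; case: ifP => up.
  by rewrite raddf0 scale0r addr0 barT_up.
have up' : (len (x * w)%g < len (x * (x * w))%g)%N.
  by rewrite (S_K _ D Sx); move: up; rewrite (len_down _ D Sx) => /negbFE.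
have {2}-> : bT w = L x (bT (x * w)%g) - xi x *: bT (x * w)%g.
  by rewrite -barT_up // (S_K _ D Sx).
rewrite (Lop_inv _ Sx) hxi_bar scaleNr; reflexivity.
Qed.

Definition low (n : nat) (h : H) : Prop := forall v, (n <= len v)%N -> h@_v = 0.

Lemma lowD n g h : low n g -> low n h -> low n (g + h).
Proof. by move=> lg lh v nv; rewrite mcoeffD lg // lh // addr0. Qed.

Lemma lowZ n r h : low n h -> low n (r *: h).
Proof. by move=> lh v nv; rewrite mcoeffZ lh // mulr0. Qed.

Lemma lowT n w : (len w < n)%N -> low n (T w).
Proof.
move=> lt v nv; rewrite mcoeffU; case: eqP => // e.
by move: lt; rewrite e ltnNge nv.
Qed.

Lemma low_sum n (h : H) (f : W -> H) :
  (forall w, h@_w != 0 -> low n (f w)) -> low n (lext f h).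
Proof.
move=> lf v nv; rewrite unlock raddf_sum big_seq big1 // => w.
by rewrite -mcoeff_neq0 => /lf /(_ _ nv) e /=; rewrite mcoeffZ e mulr0.
Qed.

Lemma low_Lop n x h : S x -> low n h -> low n.+1 (L x h).
Proof.
move=> Sx lh; apply: low_sum => w hw.
have lw : (len w < n)%N by rewrite ltnNge; apply: contra hw => /lh ->.
apply: lowD; last by apply/lowZ/lowT/leqW.
apply: lowT; have := len_mull w D Sx; case: ifP => _ ->; first by [].
by rewrite (leq_ltn_trans (leq_pred _)) // leqW.
Qed.

(** Inverting each letter of the reduced word adds only a multiple of the identity, which
    contributes shorter words. *)
Lemma barT_low w : low (len w) (bT w - T w).
Proof.
move: w; apply: (len_ind D) => [|x w Sx up IH].
  by rewrite barT1 subrr => v _; rewrite mcoeff0.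
have e : T (x * w)%g = L x (T w) by rewrite LopT up scale0r addr0.
have -> : bT (x * w)%g - T (x * w)%g = L x (bT w - T w) + - xi x *: bT w.
  by rewrite barT_up // e LopB scaleNr addrAC.
rewrite (len_up D Sx up); apply: lowD; first exact: low_Lop.
apply: lowZ; rewrite -[bT w](subrK (T w)); apply: lowD; last exact: lowT.
by move=> v nv; apply: IH; apply: ltnW.
Qed.

(* The coefficient of a bar-invariant element at a longest element of its support is
   bar-invariant. *)
Lemma neg_bar_eq0 h : bar h = h -> (forall x, gr_neg h@_x) -> h = 0.
Proof.
move=> bh nh; suff lown n : low n h -> h = 0.
  have [n ln] : exists n, low n h.
    exists (\max_(w <- msupp h) len w).+1 => v lt; apply: mcoeff_outdom.
    by apply/negP => vh; move: lt; rewrite ltnNge (leq_bigmax_seq (F := cox_length S)).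
  exact: lown ln.
elim: n => [|n IH] ln; first by apply/malgP => v; rewrite mcoeff0 ln.
apply: IH => v nv; move: nv; rewrite leq_eqVlt => /predU1P[nv|]; last exact: ln.
apply: gr_neg_bar => //; rewrite -[in RHS]bh hbarE.
rewrite unlock raddf_sum /=.
have [vh|vh] := boolP (v \in msupp h); last first.
  rewrite (mcoeff_outdom vh) raddf0 big_seq big1 // => w wh.
  rewrite mcoeffZ -[bT w](subrK (T w)) mcoeffD.
  have lw : (len w <= len v)%N.
    by rewrite -nv -ltnS ltnNge; apply: contraTN wh => /ln e; rewrite -mcoeff_eq0 e.
  rewrite (barT_low lw) mcoeffU; case: eqP => [wv|]; last by rewrite addr0 mulr0.
  by move: vh; rewrite -wv wh.
rewrite (big_fsetD1 v) //= [X in _ = _ + X]big_seq big1 ?addr0 => [|w].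
  rewrite mcoeffZ -[bT v](subrK (T v)) mcoeffD (barT_low (leqnn _)) add0r.
  by rewrite mcoeffUU mulr1.
rewrite !inE => /andP[wv wh]; rewrite mcoeffZ -[bT w](subrK (T w)) mcoeffD.
have lw : (len w <= len v)%N.
  by rewrite -nv -ltnS ltnNge; apply: contraTN wh => /ln e; rewrite -mcoeff_eq0 e.
by rewrite (barT_low lw) mcoeffU (negbTE wv) addr0 mulr0.
Qed.

Lemma klC_unique w c : bar c = c -> (forall x, gr_neg (c - T w)@_x) -> klC phi w = c.
Proof.
move=> bc nc; apply: xget_unique; first by split=> //; move: bc; rewrite hbar.unlock.
move=> c' [bc' nc']; apply/eqP; rewrite -subr_eq0; apply/eqP/neg_bar_eq0.
  have bN a : bar (- a) = - bar a by rewrite -scaleN1r hbarZ rmorphN rmorph1 scaleN1r.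
  by rewrite hbarD bN bc; congr (_ - _); rewrite hbar.unlock.
move=> x; have -> : c' - c = (c' - T w) - (c - T w) by rewrite opprB addrA subrK.
by rewrite mcoeffB; apply: gr_negD => //; apply: gr_negN.
Qed.

End HeckeBar.

(** * Reduction to nonnegative weights by signs *)

Definition neg_wt (W : groupType) (G : tozmodType) (wt : W -> G) (x : W) : bool :=
  ~~ (0 <= wt x).

Definition abs_wt (W : groupType) (G : tozmodType) (wt : W -> G) (x : W) : G :=
  if 0 <= wt x then wt x else - wt x.

HB.lock Definition sgw (W : groupType) (s t : W) (G : tozmodType) (wt : W -> G) (w : W) :
    group_ring G :=
  wrec s t 1 (fun x r => (-1) ^+ neg_wt wt x * r) w.

(* Replacing [T_w] by [sgw w T_w] makes all the parameters nonnegative. *)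
HB.lock Definition eT (W : groupType) (s t : W) (G : tozmodType) (wt : W -> G) (w : W) :
    {malg (group_ring G)[W]} :=
  sgw s t wt w *: heckeT G w.

HB.lock Definition klT (W : groupType) (S : set W) (s t : W) (G : tozmodType)
    (phi : Sbar S -> G) (wt : W -> G) (w : W) : {malg (group_ring G)[W]} :=
  sgw s t wt w *: klC phi w.

HB.lock Definition lo (W : groupType) (S : set W) (G : tozmodType) (phi : Sbar S -> G)
    (wt : W -> G) (x : W) (h : {malg (group_ring G)[W]}) : {malg (group_ring G)[W]} :=
  (-1) ^+ neg_wt wt x *: hM phi (heckeT G x) h.

HB.lock Definition ro (W : groupType) (S : set W) (G : tozmodType) (phi : Sbar S -> G)
    (wt : W -> G) (x : W) (h : {malg (group_ring G)[W]}) : {malg (group_ring G)[W]} :=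
  (-1) ^+ neg_wt wt x *: hM phi h (heckeT G x).

Section TwistedBasis.
Variables (W : groupType) (S : set W) (s t : W) (G : tozmodType).
Variables (phi : Sbar S -> G) (wt : W -> G).
Hypothesis D : is_dihedral S s t.
Hypothesis phiE : forall (o : Sbar S) x, val o x -> phi o = wt x.

Local Notation R := (group_ring G).
Local Notation H := {malg R[W]}.
Local Notation len := (cox_length S).
Local Notation T := (@heckeT W G).
Local Notation M := (hM phi).
Local Notation xi := (hxi wt).
Local Notation bar := (hbar phi).
Local Notation sg := (sgw s t wt).
Local Notation e := (eT s t wt).
Local Notation lo := (lo phi wt).
Local Notation ro := (ro phi wt).
Local Notation kl := (klT s t phi wt).
Local Notation sr x := ((-1) ^+ neg_wt wt x : R).
Local Notation pv x := (gexp (- abs_wt wt x)).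
Local Notation pv' x := (gexp (abs_wt wt x)).

Lemma sr_sq x : sr x * sr x = 1.
Proof. by case: neg_wt; rewrite ?expr0 ?expr1 ?mulr1 // mulrNN mulr1. Qed.

Lemma sr_bar x : gr_bar (sr x) = sr x.
Proof. by rewrite rmorphXn rmorphN rmorph1. Qed.

Lemma sr_xi x : sr x * xi x = pv' x - pv x.
Proof.
rewrite /hxi /neg_wt /abs_wt; case: ifP => _ /=; first by rewrite expr0 mul1r.
by rewrite expr1 mulN1r opprB opprK.
Qed.

Lemma sg1 : sg 1%g = 1.
Proof. by rewrite unlock (wrec1 D). Qed.

Lemma sgM x w : S x -> sg (x * w)%g = sr x * sg w.
Proof.
move=> Sx; case up : (len w < len (x * w)%g)%N.
  by rewrite unlock (wrec_up D _ _ Sx up).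
have up' : (len (x * w)%g < len (x * (x * w))%g)%N.
  by rewrite (S_K _ D Sx); move: up; rewrite (len_down _ D Sx) => /negbFE.
rewrite -[in RHS](S_K w D Sx) [in RHS]sgw.unlock (wrec_up D _ _ Sx up').
by rewrite mulrA sr_sq mul1r sgw.unlock.
Qed.

Lemma sgMr x w : S x -> sg (w * x)%g = sr x * sg w.
Proof.
move=> Sx; move: w; apply: (len_ind D) => [|y w Sy up IH].
  by rewrite mul1g -{1}[x]mulg1 (sgM _ Sx).
by rewrite -mulgA !(sgM _ Sy) IH mulrCA.
Qed.

Lemma sgV w : sg w^-1%g = sg w.
Proof.
move: w; apply: (len_ind D) => [|x w Sx up IH]; first by rewrite invg1.
by rewrite invgM (S_V D Sx) (sgMr _ Sx) IH (sgM _ Sx).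
Qed.

Lemma sg_sq w : sg w * sg w = 1.
Proof.
move: w; apply: (len_ind D) => [|x w Sx up IH]; first by rewrite sg1 mulr1.
by rewrite (sgM _ Sx) mulrACA sr_sq IH mulr1.
Qed.

Lemma sg_bar w : gr_bar (sg w) = sg w.
Proof.
move: w; apply: (len_ind D) => [|x w Sx up IH]; first by rewrite sg1 rmorph1.
by rewrite (sgM _ Sx) rmorphM /= sr_bar IH.
Qed.

Lemma sg_pm w : sg w = 1 \/ sg w = -1.
Proof.
move: w; apply: (len_ind D) => [|x w Sx up IH]; first by rewrite sg1; left.
rewrite (sgM _ Sx); have [->|->] : sr x = 1 \/ sr x = -1.
- by case: neg_wt; [right; exact: expr1|left; exact: expr0].
- by rewrite mul1r.
- by rewrite mulN1r; case: IH => ->; [right|left; exact: opprK].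
Qed.

Lemma sg_neg w r : gr_neg r -> gr_neg (r * sg w).
Proof. by case: (sg_pm w) => -> nr; rewrite ?mulr1 // mulrN1; apply: gr_negN. Qed.

Lemma e1E : e 1%g = T 1%g.
Proof. by rewrite eT.unlock sg1 scale1r. Qed.

Lemma eTE w : e w = sg w *: T w. Proof. by rewrite eT.unlock. Qed.

Lemma TeE w : T w = sg w *: e w. Proof. by rewrite eTE scalerA sg_sq scale1r. Qed.

Lemma loE x h : S x -> lo x h = sr x *: Lop S wt x h.
Proof. by move=> Sx; rewrite lo.unlock (hmL D phiE _ Sx). Qed.

Lemma loMT x h : lo x h = sr x *: M (T x) h. Proof. by rewrite lo.unlock. Qed.

Lemma roMT x h : ro x h = sr x *: M h (T x). Proof. by rewrite ro.unlock. Qed.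

Lemma loD x g h : lo x (g + h) = lo x g + lo x h.
Proof. by rewrite !loMT (hmDr D phiE) scalerDr. Qed.

Lemma loZ x r h : lo x (r *: h) = r *: lo x h.
Proof. by rewrite !loMT (hmZr D phiE) !scalerA mulrC. Qed.

Lemma roD x g h : ro x (g + h) = ro x g + ro x h.
Proof. by rewrite !roMT (hmDl D phiE) scalerDr. Qed.

Lemma roZ x r h : ro x (r *: h) = r *: ro x h.
Proof. by rewrite !roMT (hmZl D phiE) !scalerA mulrC. Qed.

Lemma loB x g h : lo x (g - h) = lo x g - lo x h.
Proof. by rewrite loD -(scaleN1r h) loZ scaleN1r. Qed.

Lemma roB x g h : ro x (g - h) = ro x g - ro x h.
Proof. by rewrite roD -(scaleN1r h) roZ scaleN1r. Qed.

Lemma lo_ro x y h : lo x (ro y h) = ro y (lo x h).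
Proof.
rewrite !loMT !roMT (hmZr D phiE) (hmZl D phiE) (hmA D phiE) !scalerA.
by rewrite mulrC.
Qed.

Lemma lo_lo x h : S x -> lo x (lo x h) = h + (pv' x - pv x) *: lo x h.
Proof.
move=> Sx; rewrite !(loE _ Sx) LopZ !scalerA sr_sq scale1r (Lop2 _ D _ Sx).
by rewrite -sr_xi mulrAC sr_sq mul1r.
Qed.

Lemma lo_up x w : S x -> (len w < len (x * w)%g)%N -> lo x (e w) = e (x * w)%g.
Proof.
move=> Sx up; by rewrite (loE _ Sx) !eTE LopZ LopT up scale0r addr0 scalerA (sgM _ Sx).
Qed.

Lemma iota_e w : iota (e w) = e w^-1%g.
Proof. by rewrite !eTE sgV iotaZ iotaT. Qed.

Lemma iota_lo x h : S x -> iota (lo x h) = ro x (iota h).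
Proof.
by move=> Sx; rewrite loMT roMT iotaZ (iotaM D phiE) iotaT (S_V D Sx).
Qed.

Lemma ro_ro x h : S x -> ro x (ro x h) = h + (pv' x - pv x) *: ro x h.
Proof.
move=> Sx; rewrite -[h]iotaK; move: (iota h) => g.
by rewrite -!(iota_lo _ Sx) (lo_lo _ Sx) iotaD iotaZ.
Qed.

Lemma ro_up x w : S x -> (len w < len (w * x)%g)%N -> ro x (e w) = e (w * x)%g.
Proof.
move=> Sx up.
have up' : (len w^-1%g < len (x * w^-1)%g)%N.
  by rewrite -[in X in (_ < X)%N](S_V D Sx) -invgM !(lenV _ D).
rewrite -[w in LHS]invgK -iota_e -(iota_lo _ Sx) (lo_up Sx up').
by rewrite iota_e invgM invgK (S_V D Sx).
Qed.

Lemma bar_lo x h : S x -> bar (lo x h) = lo x (bar h) - (pv' x - pv x) *: bar h.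
Proof.
move=> Sx; rewrite !(loE _ Sx) hbarZ sr_bar (hbar_Lop D phiE _ Sx).
by rewrite scalerBr scalerA sr_xi.
Qed.

Lemma bar_e1 : bar (e 1%g) = e 1%g.
Proof. by rewrite e1E hbarT (barT1 D phiE). Qed.

End TwistedBasis.

(** * Negativity of the coefficients in the recursions *)

Section NegativeCombinations.
Variables (R : comNzRingType) (V : lmodType R) (neg : R -> Prop).
Hypotheses (neg0 : neg 0) (negD : forall a b, neg a -> neg b -> neg (a + b)).
Hypothesis negM : forall a b, neg a -> neg b -> neg (a * b).
Variable E : nat -> V.

Definition neg_comb (n : nat) (h : V) : Prop :=
  exists2 r : nat -> R, (forall k, neg (r k)) & h = \sum_(k < n) r k *: E k.

Lemma neg_comb0 n : neg_comb n 0.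
Proof. by exists (fun=> 0) => //; rewrite big1 // => k _; rewrite scale0r. Qed.

Lemma neg_combD n g h : neg_comb n g -> neg_comb n h -> neg_comb n (g + h).
Proof.
move=> [r nr ->] [q nq ->]; exists (fun k => r k + q k); first by move=> k; apply: negD.
by rewrite -big_split; apply: eq_bigr => k _; rewrite scalerDl.
Qed.

Lemma neg_combZ n r h : neg r -> neg_comb n h -> neg_comb n (r *: h).
Proof.
move=> nr [q nq ->]; exists (fun k => r * q k); first by move=> k; apply: negM.
by rewrite scaler_sumr; apply: eq_bigr => k _; rewrite scalerA.
Qed.

Lemma neg_combE n r k : neg r -> (k < n)%N -> neg_comb n (r *: E k).
Proof.
move=> nr kn; exists (fun j => if j == k then r else 0); first by move=> j; case: eqP.
rewrite (bigD1 (Ordinal kn)) //= eqxx big1 ?addr0 // => i.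
by rewrite -val_eqE /= => /negbTE ->; rewrite scale0r.
Qed.

Lemma neg_comb_le m n h : (m <= n)%N -> neg_comb m h -> neg_comb n h.
Proof.
move=> mn [r nr ->]; apply: (big_ind (neg_comb n)).
- exact: neg_comb0.
- by move=> *; apply: neg_combD.
- by move=> k _; apply: neg_combE => //; apply: leq_trans mn.
Qed.

Lemma neg_comb_map (U : lmodType R) (f : V -> U) (P : U -> Prop) n h :
  linear f -> P 0 -> (forall a b, P a -> P b -> P (a + b)) ->
  (forall k r, (k < n)%N -> neg r -> P (r *: f (E k))) -> neg_comb n h -> P (f h).
Proof.
move=> fL P0 PD PE [r nr ->].
have fD a b : f (a + b) = f a + f b by rewrite -[a in LHS]scale1r fL scale1r.
have f0 : f 0 = 0 by apply: (addrI (f 0)); rewrite -fD !addr0.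
suff : forall m (mn : (m <= n)%N), P (f (\sum_(k < m) r k *: E k)) by apply.
elim=> [|m IH] mn; first by rewrite big_ord0 f0.
rewrite big_ord_recr /= addrC fL;
   by apply: PD; [exact: PE|apply/IH/ltnW].
Qed.

Variables (P P' Q Q' : R).
Hypothesis nP : neg P.

Lemma neg_eqG k : neg_comb k (eqG P E k - E k).
Proof.
elim: k => [|k IH]; first by rewrite subrr; exact: neg_comb0.
rewrite eqGS addrAC subrr add0r -[eqG P E k](subrK (E k)) scalerDr.
apply: neg_combD; last exact: neg_combE.
exact/(neg_comb_le (leqnSn k))/neg_combZ.
Qed.

Variables (ls lt : V -> V) (ltL : linear lt) (kap : R).
Hypotheses (nu : neg (P * Q - P * Q')) (nPQ : neg (P * Q' - P * Q)).
Hypotheses (nkap : neg kap).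
Hypothesis ltE : forall k, lt (E k.*2) = E k.*2.+1.
Hypothesis ltE' : forall k, lt (E k.*2.+1) = E k.*2 + (Q' - Q) *: E k.*2.+1.

Local Notation u := (P * Q - P * Q').
Local Notation F := (uneqF P E).
Local Notation Dk := (uneqD P Q Q' E).

Let DSS k : Dk k.+2 = F k.+2 + u *: Dk k.+1 + (P * P) *: Dk k.
Proof. by []. Qed.

Let D1 : Dk 1 = F 1 + u *: Dk 0.
Proof. by []. Qed.

Let Fk k : neg_comb k.*2 (F k - E k.*2).
Proof.
case: k => [|k]; first by rewrite subrr; exact: neg_comb0.
by rewrite /= addrAC subrr add0r; apply: neg_combE; rewrite // doubleS.
Qed.

Lemma neg_uneqD k : neg_comb k.*2 (Dk k - E k.*2).
Proof.
have scal r j n : neg r -> (j.*2 < n)%N -> neg_comb j.*2 (Dk j - E j.*2) ->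
    neg_comb n (r *: Dk j).
  move=> nr jn h; rewrite -[Dk j](subrK (E j.*2)) scalerDr; apply: neg_combD.
    by apply: (@neg_comb_le j.*2); [exact: ltnW|exact: neg_combZ].
  exact: neg_combE.
elim/ltn_ind: k => -[|[|k]] IH; first exact: (Fk 0).
  rewrite D1 addrAC; apply: neg_combD; first exact: (Fk 1).
  by apply: scal => //; apply: IH.
rewrite DSS.
rewrite (_ : _ - _ = (F k.+2 - E k.+2.*2) + (u *: Dk k.+1 + (P * P) *: Dk k)); last first.
  by module_eq R; ring.
apply: neg_combD; first exact: (Fk k.+2).
apply: neg_combD; apply: scal.
- exact: nu.
- by rewrite !doubleS; lia.
- by apply: IH; lia.
- exact: negM.
- by rewrite !doubleS; lia.
- by apply: IH; lia.
Qed.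

Let opD a b : lt (a + b) = lt a + lt b.
Proof. by rewrite -[a in LHS]scale1r ltL scale1r. Qed.

Let opZ r a : lt (r *: a) = r *: lt a.
Proof.
have f0 : lt 0 = 0 by apply: (addrI (lt 0)); rewrite -opD !addr0.
by rewrite -[_ *: _ in LHS]addr0 ltL f0 addr0.
Qed.

Let Kt h := lt h + kap *: h.

Let KtD a b : Kt (a + b) = Kt a + Kt b.
Proof. by rewrite /Kt opD scalerDr addrACA. Qed.

Let KtZ r a : Kt (r *: a) = r *: Kt a.
Proof. by rewrite /Kt opZ scalerDr !scalerA mulrC. Qed.

(** [lt] brings in [Q'], which need not be negative. It only occurs multiplied by [P], and
    [P * Q' - P * Q] is negative when the weight of [t] is smaller than that of [s]. *)
Let KtF k : neg_comb k.*2.+1 (Kt (F k) - E k.*2.+1).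
Proof.
have KE j : Kt (E j.*2) - E j.*2.+1 = kap *: E j.*2.
  by rewrite /Kt ltE addrAC subrr add0r.
case: k => [|k]; first by rewrite (KE 0%N); apply: neg_combE.
rewrite /= KtD KtZ addrAC KE; apply: neg_combD; first exact: neg_combE.
rewrite /Kt ltE' (_ : P *: _ =
  P *: E k.*2 + ((P * Q' - P * Q) *: E k.*2.+1 + (P * kap) *: E k.*2.+1)).
  apply: neg_combD; first by apply: neg_combE; rewrite // !doubleS; lia.
  apply: neg_combD; first by apply: neg_combE; rewrite // !doubleS; lia.
  by apply: neg_combE; [exact: negM|rewrite !doubleS; lia].
by module_eq R; ring.
Qed.

Lemma neg_uneqKD k : neg_comb k.*2.+1 (lt (Dk k) + kap *: Dk k - E k.*2.+1).
Proof.
rewrite -/(Kt _).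
have scal r j n : neg r -> (j.*2.+1 < n)%N -> neg_comb j.*2.+1 (Kt (Dk j) - E j.*2.+1) ->
    neg_comb n (r *: Kt (Dk j)).
  move=> nr jn h; rewrite -[Kt _](subrK (E j.*2.+1)) scalerDr; apply: neg_combD.
    by apply: (@neg_comb_le j.*2.+1); [exact: ltnW|exact: neg_combZ].
  exact: neg_combE.
elim/ltn_ind: k => -[|[|k]] IH; first exact: (KtF 0).
  rewrite D1 KtD KtZ addrAC; apply: neg_combD; first exact: (KtF 1).
  by apply: scal => //; apply: IH.
rewrite DSS 2!KtD 2!KtZ.
rewrite (_ : _ - _ = (Kt (F k.+2) - E k.+2.*2.+1) + (u *: Kt (Dk k.+1) + (P * P) *: Kt (Dk k)));
  last by module_eq R; ring.
apply: neg_combD; first exact: (KtF k.+2).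
apply: neg_combD; apply: scal.
- exact: nu.
- by rewrite !doubleS; lia.
- by apply: IH; lia.
- exact: negM.
- by rewrite !doubleS; lia.
- by apply: IH; lia.
Qed.

End NegativeCombinations.

Lemma unit_mod_rearr (R : comNzRingType) (V : lmodType R) (a b c d : V) (x y : R) :
  a - y *: b - x *: (c - y *: d) = a - x *: c - y *: (b - x *: d).
Proof. module_eq R; ring. Qed.

Section LeadingTerms.
Variables (W : groupType) (S : set W) (s t : W) (G : tozmodType).
Variables (phi : Sbar S -> G) (wt : W -> G).
Hypothesis D : is_dihedral S s t.
Hypothesis phiE : forall (o : Sbar S) x, val o x -> phi o = wt x.

Local Notation R := (group_ring G).
Local Notation H := {malg R[W]}.
Local Notation len := (cox_length S).
Local Notation T := (@heckeT W G).
Local Notation bar := (hbar phi).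
Local Notation sg := (sgw s t wt).
Local Notation e := (eT s t wt).
Local Notation lo := (lo phi wt).
Local Notation ro := (ro phi wt).
Local Notation kl := (klT s t phi wt).
Local Notation pv x := (gexp (- abs_wt wt x)).
Local Notation pv' x := (gexp (abs_wt wt x)).

Lemma eT_ext (g1 g2 : H -> H) :
  (forall x y, g1 (x + y) = g1 x + g1 y) -> (forall x y, g2 (x + y) = g2 x + g2 y) ->
  (forall r x, g1 (r *: x) = gr_bar r *: g1 x) ->
  (forall r x, g2 (r *: x) = gr_bar r *: g2 x) ->
  (forall w, g1 (e w) = g2 (e w)) -> g1 =1 g2.
Proof.
move=> D1 D2 Z1 Z2 h; apply: (sext_eq D1 D2 Z1 Z2) => w.
rewrite -/(T w) (TeE wt D) Z1 Z2 h; reflexivity.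
Qed.

(** Left and right multiplications commute, so the formula passes from [e w] to [e (y * w)]; at
    [w = 1] left and right multiplication by a letter agree and [bar_lo] applies. *)
Lemma bar_ro x h : S x -> bar (ro x h) = ro x (bar h) - (pv' x - pv x) *: bar h.
Proof.
move=> Sx.
have Kl w : bar (ro x (e w)) = ro x (bar (e w)) - (pv' x - pv x) *: bar (e w).
  move: w; apply: (len_ind D) => [|y w Sy up IH].
    have e1x : ro x (e 1%g) = lo x (e 1%g).
      rewrite (lo_up D phiE Sx) ?(ro_up D phiE Sx) ?mulg1 ?mul1g //;
        by rewrite (len1 D) (len_S D Sx).
    by rewrite (bar_e1 D phiE) !e1x (bar_lo D phiE _ Sx) (bar_e1 D phiE).
  rewrite -(lo_up D phiE Sy up) -(lo_ro D phiE) (bar_lo D phiE _ Sy) IH.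
  rewrite (bar_lo D phiE _ Sy).
  rewrite (loB D phiE) (loZ D phiE) (roB D phiE) (roZ D phiE) (lo_ro D phiE).
  exact: unit_mod_rearr.
apply: (eT_ext (g1 := fun h => bar (ro x h))
   (g2 := fun h => ro x (bar h) - (pv' x - pv x) *: bar h)) => [a b|a b|r a|r a|w].
- by rewrite (roD D phiE) hbarD.
- by rewrite hbarD (roD D phiE) scalerDr opprD addrACA.
- by rewrite (roZ D phiE) hbarZ.
- rewrite hbarZ (roZ D phiE) scalerBr !scalerA (mulrC (gr_bar r)); reflexivity.
- exact: Kl.
Qed.

Definition neg_low (n : nat) (h : H) : Prop :=
  forall x, gr_neg h@_x /\ ((n <= len x)%N -> h@_x = 0).

Lemma neg_low0 n : neg_low n 0.
Proof. by move=> x; rewrite mcoeff0; split=> //; exact: gr_neg0. Qed.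

Lemma neg_lowD n g h : neg_low n g -> neg_low n h -> neg_low n (g + h).
Proof.
move=> lg lh x; have [a b] := lg x; have [c d] := lh x; rewrite mcoeffD.
by split=> [|nx]; [exact: gr_negD|rewrite b // d // addr0].
Qed.

Lemma eT_coeff w x : (e w)@_x = if w == x then sg w else 0.
Proof. by rewrite eTE mcoeffZ mcoeffU; case: eqP => _ /=; rewrite ?mulr1 ?mulr0. Qed.

Lemma neg_low_e n r w : gr_neg r -> (len w < n)%N -> neg_low n (r *: e w).
Proof.
move=> nr wn x; rewrite mcoeffZ eT_coeff; case: eqP => [<-|_].
  by split=> [|nw]; [exact: (sg_neg D)|move: wn; rewrite ltnNge nw].
by rewrite mulr0; split=> //; exact: gr_neg0.
Qed.

Definition leads (w : W) (c : H) : Prop := neg_low (len w) (c - e w).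

Lemma kl_unique w c : bar c = c -> leads w c -> kl w = c.
Proof.
move=> bc lc; rewrite klT.unlock (@klC_unique _ _ _ _ _ _ _ D phiE _ (sg w *: c)).
- by rewrite scalerA (sg_sq wt D) scale1r.
- by rewrite hbarZ (sg_bar wt D) bc.
move=> x; have -> : sg w *: c - T w = sg w *: (c - e w).
  by rewrite scalerBr eTE [sg w *: (sg w *: _)]scalerA (sg_sq wt D) scale1r.
by rewrite mcoeffZ mulrC; apply: (sg_neg D); case: (lc x).
Qed.

End LeadingTerms.

(* The properties of the twisted Hecke algebra used to compute Kazhdan-Lusztig bases;
   [p x] stands for [v_x^-1] and [NL n] for negative coefficients on lengths < n. *)
Record kl_model (W : groupType) (S : set W) (R : comNzRingType) (V : lmodType R)
    (sigma : {rmorphism R -> R}) (neg : R -> Prop) (NL : nat -> V -> Prop)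
    (e kl : W -> V) (l r : W -> V -> V) (bar : V -> V) (p p' : W -> R) : Prop := {
  klm_neg0 : neg 0;
  klm_negD : forall a b, neg a -> neg b -> neg (a + b);
  klm_negM : forall a b, neg a -> neg b -> neg (a * b);
  klm_NL0 : forall n, NL n 0;
  klm_NLD : forall n g h, NL n g -> NL n h -> NL n (g + h);
  klm_NLe : forall n a w, neg a -> (cox_length S w < n)%N -> NL n (a *: e w);
  klm_lD : forall x g h, l x (g + h) = l x g + l x h;
  klm_lZ : forall x a h, l x (a *: h) = a *: l x h;
  klm_rD : forall x g h, r x (g + h) = r x g + r x h;
  klm_rZ : forall x a h, r x (a *: h) = a *: r x h;
  klm_lr : forall x y h, l x (r y h) = r y (l x h);
  klm_ll : forall x h, S x -> l x (l x h) = h + (p' x - p x) *: l x h;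
  klm_rr : forall x h, S x -> r x (r x h) = h + (p' x - p x) *: r x h;
  klm_lup : forall x w, S x -> (cox_length S w < cox_length S (x * w)%g)%N ->
    l x (e w) = e (x * w)%g;
  klm_rup : forall x w, S x -> (cox_length S w < cox_length S (w * x)%g)%N ->
    r x (e w) = e (w * x)%g;
  klm_pp : forall x, p x * p' x = 1;
  klm_sp : forall x, sigma (p x) = p' x;
  klm_sp' : forall x, sigma (p' x) = p x;
  klm_bD : forall g h, bar (g + h) = bar g + bar h;
  klm_bZ : forall a h, bar (a *: h) = sigma a *: bar h;
  klm_bl : forall x h, S x -> bar (l x h) = l x (bar h) - (p' x - p x) *: bar h;
  klm_br : forall x h, S x -> bar (r x h) = r x (bar h) - (p' x - p x) *: bar h;
  klm_be : bar (e 1%g) = e 1%g;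
  klm_kl : forall w c, NL (cox_length S w) (c - e w) -> bar c = c -> kl w = c
}.

(** * Kazhdan-Lusztig elements and the left action on them *)

Section KLComputation.
Variables (W : groupType) (S : set W) (R : comNzRingType) (V : lmodType R).
Variables (sigma : {rmorphism R -> R}) (neg : R -> Prop) (NL : nat -> V -> Prop).
Variables (e kl : W -> V) (l r : W -> V -> V) (bar : V -> V) (p p' : W -> R).
Hypothesis m : kl_model S sigma neg NL e kl l r bar p p'.
Local Notation len := (cox_length S).

Lemma klm_l_linear x : linear (l x).
Proof. by move=> a g h; rewrite (klm_lD m) (klm_lZ m). Qed.

Lemma klm_bN h : bar (- h) = - bar h.
Proof. by rewrite -scaleN1r (klm_bZ m) rmorphN1 scaleN1r. Qed.

Definition kl_spec (w : W) : Prop :=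
  NL (len w) (kl w - e w) /\ bar (kl w) = kl w.

Lemma klm_kl1 : kl 1%g = e 1%g.
Proof. by apply: (klm_kl m); [rewrite subrr; exact: (klm_NL0 m)|exact: klm_be m]. Qed.

Lemma kl_spec1 : kl_spec 1%g.
Proof. by rewrite /kl_spec klm_kl1 subrr; split; [exact: (klm_NL0 m)|exact: klm_be m]. Qed.

Section Letters.
Variables (s t : W).
Hypothesis D : is_dihedral S s t.

Definition Ebasis (k : nat) : V := e (alt s t k.+1) + p s *: e (alt t s k).

Let Ss : S s. Proof. exact: dih_Ss D. Qed.
Let St : S t. Proof. exact: dih_Ss (dihedral_sym D). Qed.
Let D' : is_dihedral S t s. Proof. exact: dihedral_sym. Qed.

Lemma e_up k : l (letter s t k) (e (alt s t k)) = e (alt s t k.+1).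
Proof.
by rewrite (klm_lup m) ?altS //; [exact: letter_S|rewrite -altS !(length_alt _ D)].
Qed.

Lemma e_up' k : l (letter t s k) (e (alt t s k)) = e (alt t s k.+1).
Proof.
by rewrite (klm_lup m) ?altS //; [exact: letter_S|rewrite -altS !(length_alt _ D')].
Qed.

Lemma Ebasis_up k : l (letter s t k.+1) (Ebasis k) = Ebasis k.+1.
Proof.
by rewrite /Ebasis (klm_lD m) (klm_lZ m) e_up letterS e_up'.
Qed.

Lemma Ebasis_down k : l (letter s t k.+1) (Ebasis k.+1) =
  Ebasis k + (p' (letter s t k.+1) - p (letter s t k.+1)) *: Ebasis k.+1.
Proof. by rewrite -Ebasis_up (klm_ll m) //; exact: letter_S. Qed.

Lemma Ebasis0 : l s (Ebasis 0) = p' s *: Ebasis 0.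
Proof.
have -> : Ebasis 0 = l s (e 1%g) + p s *: e 1%g.
  by rewrite /Ebasis /= mulg1 (klm_lup m) ?mulg1 // (len1 D) (len_S D Ss).
rewrite (klm_lD m) (klm_lZ m) (klm_ll m) //.
by module_eq R; ring: (klm_pp m s).
Qed.

Lemma letter_even k : letter s t k.*2 = s.
Proof. by rewrite /letter odd_double. Qed.

Lemma letter_odd k : letter s t k.*2.+1 = t.
Proof. by rewrite /letter /= odd_double. Qed.

Lemma e_neg_comb n h : neg (p s) -> neg_comb neg Ebasis n h -> NL n.+1 h.
Proof.
move=> np; apply: (@neg_comb_map R V neg Ebasis V id (NL n.+1)) => //.
- exact: (klm_NL0 m).
- exact: (klm_NLD m).
move=> k a kn na; rewrite /Ebasis scalerDr scalerA; apply: (klm_NLD m).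
  by apply: (klm_NLe m); rewrite // (length_alt _ D).
by apply: (klm_NLe m); [exact: (klm_negM m)|rewrite (length_alt _ D') ltnW].
Qed.

Lemma neg_comb_leads n c : neg (p s) -> neg_comb neg Ebasis n (c - Ebasis n) ->
  NL (len (alt s t n.+1)) (c - e (alt s t n.+1)).
Proof.
move=> np cn; rewrite (length_alt _ D).
rewrite -[c](subrK (Ebasis n)) -addrA; apply: (klm_NLD m); first exact: e_neg_comb.
rewrite /Ebasis addrAC subrr add0r; apply: (klm_NLe m) => //.
by rewrite (length_alt _ D').
Qed.

Lemma kl_alt n c : neg (p s) -> bar c = c -> neg_comb neg Ebasis n (c - Ebasis n) ->
  kl (alt s t n.+1) = c.
Proof. by move=> np bc cn; apply: (klm_kl m) => //; exact: neg_comb_leads. Qed.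

Lemma klm_bK x h : S x -> bar (l x h + p x *: h) = l x (bar h) + p x *: bar h.
Proof.
move=> Sx; rewrite (klm_bD m) (klm_bl m) // (klm_bZ m) (klm_sp m).
by module_eq R; ring.
Qed.

Lemma klm_bK' x h : S x -> bar (r x h + p x *: h) = r x (bar h) + p x *: bar h.
Proof.
move=> Sx; rewrite (klm_bD m) (klm_br m) // (klm_bZ m) (klm_sp m).
by module_eq R; ring.
Qed.

Lemma bar_Ebasis0 : bar (Ebasis 0) = Ebasis 0.
Proof.
have -> : Ebasis 0 = l s (e 1%g) + p s *: e 1%g.
  by rewrite /Ebasis /= mulg1 (klm_lup m) ?mulg1 // (len1 D) (len_S D Ss).
by rewrite klm_bK // (klm_be m).
Qed.

Section Equal.
Hypotheses (np : neg (p s)) (pst : p s = p t).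

Let pst' : p' s = p' t.
Proof. by rewrite -(klm_sp m) pst (klm_sp m). Qed.

Let pl k : p (letter s t k) = p s. Proof. by rewrite /letter; case: odd. Qed.
Let pl' k : p' (letter s t k) = p' s. Proof. by rewrite /letter; case: odd. Qed.

Local Notation Gk := (eqG (p s) Ebasis).

Let lk k := l (letter s t k).
Let lkL k : linear (lk k). Proof. exact: klm_l_linear. Qed.
Let lkSS k : lk k.+2 = lk k. Proof. by rewrite /lk letterSS. Qed.
Let lkE k : lk k.+1 (Ebasis k) = Ebasis k.+1. Proof. exact: Ebasis_up. Qed.
Let lkE' k : lk k.+1 (Ebasis k.+1) = Ebasis k + (p' s - p s) *: Ebasis k.+1.
Proof. by rewrite /lk Ebasis_down pl pl'. Qed.

Let eq_bar n : bar (Gk n) = Gk n.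
Proof.
elim/ltn_ind: n => -[|[|n]] IH; first exact: bar_Ebasis0.
  have <- := eq_step0 (p s) lkE; rewrite -[X in lk 1 X + _]/(Gk 0) -[X in X *: _](pl 1).
  rewrite klm_bK; last exact: letter_S.
  by rewrite [bar _](IH 0%N).
have -> : Gk n.+2 = lk n.+2 (Gk n.+1) + p s *: Gk n.+1 - Gk n.
  by rewrite (eq_step lkL lkSS (klm_pp m s) lkE lkE' Ebasis0) addrK.
rewrite (klm_bD m) klm_bN (IH n) // -[X in X *: _](pl n.+2) klm_bK; last exact: letter_S.
by rewrite IH.
Qed.

Lemma eq_kl n : kl (alt s t n.+1) = Gk n.
Proof.
apply: kl_alt => //.
apply: neg_eqG np n; [exact: (klm_neg0 m)|exact: (klm_negD m)|exact: (klm_negM m)].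
Qed.

Lemma eq_kl_leads n : kl_spec (alt s t n.+1).
Proof.
split; last by rewrite eq_kl eq_bar.
rewrite eq_kl; apply: neg_comb_leads => //.
apply: neg_eqG np n; [exact: (klm_neg0 m)|exact: (klm_negD m)|exact: (klm_negM m)].
Qed.

Lemma eq_down n : l (letter s t n) (kl (alt s t n.+1)) = p' s *: kl (alt s t n.+1).
Proof.
rewrite eq_kl; exact: (eq_eigen lkL lkSS (klm_pp m s) lkE lkE' Ebasis0).
Qed.

Lemma eq_up0 : l t (kl (alt s t 1)) = kl (alt s t 2) - p s *: kl (alt s t 1).
Proof.
by rewrite !eq_kl -(eq_step0 (p s) lkE) addrK.
Qed.

Lemma eq_up n : l (letter s t n) (kl (alt s t n.+2)) =
  kl (alt s t n.+3) + kl (alt s t n.+1) - p s *: kl (alt s t n.+2).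
Proof.
rewrite !eq_kl -(eq_step lkL lkSS (klm_pp m s) lkE lkE' Ebasis0) addrK.
by rewrite lkSS.
Qed.

End Equal.

(** [Ebasis k] is [e (alt t s k)] multiplied on the right by T_s + v_s^-1, and this factor is an
    eigenvector of T_s. *)
Lemma Ebasis_right k : r s (Ebasis k) = p' s *: Ebasis k.
Proof.
have up : (len (alt t s k) < len (alt t s k * s)%g)%N.
  by rewrite -altSr (length_alt _ D) (length_alt _ D').
have -> : Ebasis k = r s (e (alt t s k)) + p s *: e (alt t s k).
  by rewrite (klm_rup m Ss up) -altSr.
rewrite (klm_rD m) (klm_rZ m) (klm_rr m) //.
by module_eq R; ring: (klm_pp m s).
Qed.

Lemma neg_comb_right n h : neg_comb neg Ebasis n (h - Ebasis n) -> r s h = p' s *: h.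
Proof.
move=> hn; have : r s (h - Ebasis n) - p' s *: (h - Ebasis n) = 0.
  apply: (@neg_comb_map R V neg Ebasis V (fun g => r s g - p' s *: g) (fun g => g = 0) n
    (h - Ebasis n)) => // [a g k|a b -> ->|k a _ _].
  - rewrite (klm_rD m) (klm_rZ m); module_eq R; ring.
  - by rewrite addr0.
  - by rewrite Ebasis_right subrr scaler0.
rewrite (klm_rD m) -[- Ebasis n]scaleN1r (klm_rZ m) Ebasis_right => h0.
apply/eqP; rewrite -subr_eq0 -[X in _ == X]h0; apply/eqP.
module_eq R; ring.
Qed.

Lemma eq_right_eigen n : neg (p s) -> p s = p t ->
  r s (kl (alt s t n.+1)) = p' s *: kl (alt s t n.+1).
Proof.
move=> np pst; apply: (@neg_comb_right n); rewrite (eq_kl np pst).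
apply: neg_eqG np n; [exact: (klm_neg0 m)|exact: (klm_negD m)|exact: (klm_negM m)].
Qed.

(** [X n] stands for C_w with [w = alt s t n.+1], whose first letter is [letter s t n]. In the last
    clause the acting letter is the one that lengthens the word of [X n.+1], since [letter] has
    period 2. *)
Definition eq_relations (X : nat -> V) : Prop :=
  [/\ forall n, l (letter s t n) (X n) = p' s *: X n,
      l t (X 0) = X 1 - p s *: X 0
    & forall n, l (letter s t n) (X n.+1) = X n.+2 + X n - p s *: X n.+1].

Lemma eq_relations_kl : neg (p s) -> p s = p t -> eq_relations (fun n => kl (alt s t n.+1)).
Proof. by move=> np pst; split=> [n||n]; [exact: eq_down|exact: eq_up0|exact: eq_up]. Qed.

Section Unequal.
(** C_t is T_t + [kap]: for weight 0 the coefficient v_t^-1 = 1 is not negative, but T_t is then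
    bar-invariant by itself. *)
Variable kap : R.
Hypotheses (np : neg (p s)) (nk : neg kap).
Hypotheses (nu : neg (p s * p t - p s * p' t)) (nu' : neg (p s * p' t - p s * p t)).
Hypothesis kapE : kap = p t \/ kap = 0 /\ p t = p' t.

Local Notation u := (p s * p t - p s * p' t).
Local Notation Dk := (uneqD (p s) (p t) (p' t) Ebasis).
Local Notation Kt h := (l t h + kap *: h).
Local Notation Ktr h := (r t h + kap *: h).

Let ltE k : l t (Ebasis k.*2) = Ebasis k.*2.+1.
Proof. by have := Ebasis_up k.*2; rewrite letter_odd. Qed.
Let lsE k : l s (Ebasis k.*2.+1) = Ebasis k.*2.+2.
Proof. by have := Ebasis_up k.*2.+1; rewrite -doubleS letter_even. Qed.
Let ltE' k : l t (Ebasis k.*2.+1) = Ebasis k.*2 + (p' t - p t) *: Ebasis k.*2.+1.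
Proof. by have := Ebasis_down k.*2; rewrite letter_odd. Qed.
Let lsE' k : l s (Ebasis k.*2.+2) = Ebasis k.*2.+1 + (p' s - p s) *: Ebasis k.*2.+2.
Proof. by have := Ebasis_down k.*2.+1; rewrite -doubleS letter_even. Qed.

Let lL x : linear (l x). Proof. exact: klm_l_linear. Qed.

Let ls_D k : l s (Dk k) = p' s *: Dk k.
Proof. exact: (uneq_eigen (lL s) (p t) (p' t) (klm_pp m s) lsE lsE' Ebasis0 k). Qed.

Let step0 : l s (l t (Dk 0)) = Dk 1 - u *: Dk 0 - p s *: l t (Dk 0).
Proof. by rewrite -(uneq_step0 (p s) (p t) (p' t) ltE lsE) addrK. Qed.

Let step k : l s (l t (Dk k.+1)) = Dk k.+2 - u *: Dk k.+1 + Dk k - p s *: l t (Dk k.+1).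
Proof.
rewrite -(uneq_step (lL s) (lL t) (klm_pp m s) (klm_pp m t) ltE lsE ltE' lsE' Ebasis0).
by rewrite addrK.
Qed.

Let bKt h : bar (Kt h) = Kt (bar h).
Proof.
case: kapE => [->|[-> pt]]; first exact: klm_bK.
by rewrite !scale0r !addr0 (klm_bl m) // pt subrr scale0r subr0.
Qed.

Let bKtr h : bar (Ktr h) = Ktr (bar h).
Proof.
case: kapE => [->|[-> pt]]; first exact: klm_bK'.
by rewrite !scale0r !addr0 (klm_br m) // pt subrr scale0r subr0.
Qed.

(** Origin of [u]: on a bar-invariant eigenvector X of [l s], the bar involution subtracts
    [(p' t - p t) * (p' s + p s)] times X from [l s (l t X) + p s *: l t X], and [u] is a negative
    scalar that differs from its bar image by exactly this amount. *)
Let bar_step X : bar X = X -> l s X = p' s *: X ->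
  bar (l s (l t X) + p s *: l t X + u *: X) = l s (l t X) + p s *: l t X + u *: X.
Proof.
move=> bX sX; rewrite (klm_bD m) klm_bK // (klm_bl m) // bX (klm_bZ m) bX.
rewrite (klm_lD m) -scaleNr (klm_lZ m) sX rmorphB !rmorphM /= !(klm_sp m) (klm_sp' m).
module_eq R; ring.
Qed.

Let bar_D k : bar (Dk k) = Dk k.
Proof.
elim/ltn_ind: k => -[|[|k]] IH; first exact: bar_Ebasis0.
  have -> : Dk 1 = l s (l t (Dk 0)) + p s *: l t (Dk 0) + u *: Dk 0.
    by rewrite step0 subrK subrK.
  by apply: bar_step; [exact: (IH 0%N)|exact: ls_D].
have -> : Dk k.+2 = l s (l t (Dk k.+1)) + p s *: l t (Dk k.+1) + u *: Dk k.+1 - Dk k.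
  rewrite step; module_eq R; ring.
by rewrite (klm_bD m) klm_bN (IH k) // bar_step ?IH.
Qed.

Let n0 := klm_neg0 m.
Let nD := klm_negD m.
Let nM := klm_negM m.

Lemma uneq_kl_odd k : kl (alt s t k.*2.+1) = Dk k.
Proof. by apply: kl_alt => //; exact: (neg_uneqD n0 nD nM _ np nu). Qed.

Lemma uneq_kl_even k : kl (alt s t k.*2.+2) = Kt (Dk k).
Proof.
apply: kl_alt => //; first by rewrite bKt bar_D.
exact: (neg_uneqKD n0 nD nM np (lL t) nu nu' nk ltE ltE').
Qed.

Lemma uneq_kl_comb n : neg_comb neg Ebasis n (kl (alt s t n.+1) - Ebasis n).
Proof.
rewrite -[n]odd_double_half; case: odd; rewrite ?add1n ?add0n.
  rewrite uneq_kl_even; exact: (neg_uneqKD n0 nD nM np (lL t) nu nu' nk ltE ltE').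
rewrite uneq_kl_odd; exact: (neg_uneqD n0 nD nM _ np nu).
Qed.

Lemma uneq_kl_bar n : bar (kl (alt s t n.+1)) = kl (alt s t n.+1).
Proof.
rewrite -[n]odd_double_half; case: odd; rewrite ?add1n ?add0n.
  by rewrite uneq_kl_even bKt bar_D.
by rewrite uneq_kl_odd bar_D.
Qed.

Let t_leads : NL (len t) (Kt (e 1%g) - e t).
Proof.
have up' : (len 1%g < len (t * 1%g)%g)%N by rewrite mulg1 (len1 D) (len_S D St).
rewrite (klm_lup m St up') mulg1 addrAC subrr add0r.
by apply: (klm_NLe m); rewrite // (len1 D) (len_S D St).
Qed.

Lemma uneq_kl_t : kl t = Kt (e 1%g).
Proof. by apply: (klm_kl m t_leads); rewrite bKt (klm_be m). Qed.

Let re_up k : r t (e (alt s t k.+1)) = e (alt t s k.+2).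
Proof.
have up : (len (alt s t k.+1) < len (alt s t k.+1 * t)%g)%N.
  by rewrite -altSr (length_alt _ D) (length_alt _ D').
by rewrite (klm_rup m St up) -altSr.
Qed.

Let rE0 : r t (e (alt t s 0)) = e (alt t s 1).
Proof.
have up : (len 1%g < len (1%g * t)%g)%N by rewrite mul1g (len1 D) (len_S D St).
by rewrite (klm_rup m St up) mul1g /= mulg1.
Qed.

Let rE k : r t (e (alt t s k.+1)) =
  e (alt s t k) + (p' t - p t) *: e (alt t s k.+1).
Proof.
case: k => [|k]; first by rewrite -rE0 (klm_rr m).
by rewrite -re_up (klm_rr m).
Qed.

(** The factor [p' t - p t] produced by [r t] always comes with a factor [p s], so right
    multiplication by T_t + [kap] keeps the lower coefficients negative. *)
Let right_leads n :
  NL n.+2 (Ktr (kl (alt s t n.+1)) - e (alt t s n.+2)).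
Proof.
have KtE k N a : (k < N)%N -> neg a \/ a = 1 ->
    NL N.+1 (a *: (Ktr (Ebasis k) - e (alt t s k.+2))).
  move=> kN na.
  have aN b : neg b -> neg (a * b).
    by case: na => [na nb|-> nb]; [exact: nM|rewrite mul1r].
  have -> : Ktr (Ebasis k) - e (alt t s k.+2) = p s *: r t (e (alt t s k)) +
      (kap *: e (alt s t k.+1) + (kap * p s) *: e (alt t s k)).
    rewrite /Ebasis (klm_rD m) (klm_rZ m) re_up; module_eq R; ring.
  rewrite !scalerDr !scalerA; apply: (klm_NLD m); last first.
    apply: (klm_NLD m); apply: (klm_NLe m).
    - exact: aN.
    - by rewrite (length_alt _ D).
    - exact/aN/nM.
    - by rewrite (length_alt _ D') ltnW.
  case: k kN => [|k] kN.
    by rewrite rE0; apply: (klm_NLe m); [exact: aN|rewrite (length_alt _ D')].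
  rewrite rE scalerDr scalerA; apply: (klm_NLD m); apply: (klm_NLe m).
  - exact: aN.
  - by rewrite (length_alt _ D); lia.
  - by rewrite -mulrA mulrBr; apply: aN.
  - by rewrite (length_alt _ D') ltnW.
have -> : Ktr (kl (alt s t n.+1)) - e (alt t s n.+2) =
    1 *: (Ktr (Ebasis n) - e (alt t s n.+2)) + Ktr (kl (alt s t n.+1) - Ebasis n).
  rewrite [r t (_ - _)](klm_rD m) -[- Ebasis n]scaleN1r (klm_rZ m); module_eq R; ring.
apply: (klm_NLD m); first by apply: KtE; [exact: ltnSn|right].
apply: (neg_comb_map (f := fun h => Ktr h) _ _ _ _ (uneq_kl_comb n)).
- move=> a g h; rewrite (klm_rD m) (klm_rZ m); module_eq R; ring.
- exact: (klm_NL0 m).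
- exact: (klm_NLD m).
move=> k a kn na; rewrite -[Ktr _](subrK (e (alt t s k.+2))) scalerDr.
apply: (klm_NLD m); first by apply: KtE; [exact: ltnW|left].
by apply: (klm_NLe m); rewrite // (length_alt _ D').
Qed.

(** Reduces the words ending in [t] to those ending in [s]: the left action can then be copied,
    since left and right multiplications commute. *)
Lemma uneq_kl_right n : kl (alt t s n.+2) = Ktr (kl (alt s t n.+1)).
Proof.
apply: (klm_kl m); last by rewrite bKtr uneq_kl_bar.
by rewrite (length_alt _ D'); exact: right_leads.
Qed.

Local Notation cc := (kap * (p s + p' s) - u).

(** [kap] makes the formulas uniform. For [kap = p t], the third clause is an eigenvector relation
    because [p t * p' t = 1], and [cc] is v_s v_t^-1 + v_s^-1 v_t. For [kap = 0] and [p t = p' t],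
    the operator [l t] exchanges [X k.*2] and [X k.*2.+1], and [cc] vanishes. *)
Definition uneq_relations (X : nat -> V) : Prop :=
  [/\ forall k, l s (X k.*2) = p' s *: X k.*2,
      forall k, l t (X k.*2) = X k.*2.+1 - kap *: X k.*2,
      forall k, l t (X k.*2.+1) = (p' t - p t + kap) *: X k.*2.+1 +
                                  (1 - kap * (p' t - p t + kap)) *: X k.*2,
      l s (X 1) = X 2 + cc *: X 0 - p s *: X 1
    & forall k, l s (X k.*2.+3) =
        X k.*2.+4 + cc *: X k.*2.+2 + X k.*2 - p s *: X k.*2.+3].

Lemma uneq_relations_kl : uneq_relations (fun n => kl (alt s t n.+1)).
Proof.
have sE k : l s (kl (alt s t k.*2.+1)) = p' s *: kl (alt s t k.*2.+1).
  by rewrite uneq_kl_odd ls_D.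
have tE k : l t (kl (alt s t k.*2.+1)) =
    kl (alt s t k.*2.+2) - kap *: kl (alt s t k.*2.+1).
  by rewrite uneq_kl_even uneq_kl_odd addrK.
split=> // [k||k].
- rewrite uneq_kl_even uneq_kl_odd (klm_lD m) (klm_lZ m) (klm_ll m) //.
  module_eq R; ring.
- have -> : kl (alt s t 3) = Dk 1 by exact: (uneq_kl_odd 1).
  have -> : kl (alt s t 2) = Kt (Dk 0) by exact: (uneq_kl_even 0).
  have -> : kl (alt s t 1) = Dk 0 by exact: (uneq_kl_odd 0).
  rewrite (klm_lD m) (klm_lZ m) step0 (ls_D 0); module_eq R; ring.
have -> : kl (alt s t k.*2.+4.+1) = Dk k.+2 by rewrite -!doubleS uneq_kl_odd.
have -> : kl (alt s t k.*2.+4) = Kt (Dk k.+1).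
  by have := uneq_kl_even k.+1; rewrite doubleS.
have -> : kl (alt s t k.*2.+3) = Dk k.+1 by rewrite -!doubleS uneq_kl_odd.
rewrite uneq_kl_odd (klm_lD m) (klm_lZ m) step (ls_D k.+1); module_eq R; ring.
Qed.

Lemma uneq_relations_kl' : uneq_relations (fun n => kl (alt t s n.+2)).
Proof.
have [h1 h2 h3 h4 h5] := uneq_relations_kl.
have lK x h : l x (Ktr h) = Ktr (l x h) by rewrite (klm_lD m) (klm_lZ m) (klm_lr m).
have KD g h : Ktr (g + h) = Ktr g + Ktr h by rewrite (klm_rD m) scalerDr addrACA.
have KZ a h : Ktr (a *: h) = a *: Ktr h.
  by rewrite (klm_rZ m) scalerDr !scalerA mulrC.
have KN h : Ktr (- h) = - Ktr h by rewrite -scaleN1r KZ scaleN1r.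
split=> [k|k|k||k]; rewrite !uneq_kl_right lK ?h1 ?h2 ?h3 ?h4 ?h5 !(KD, KN, KZ) //.
Qed.

Lemma uneq_right_eigen n : r s (kl (alt s t n.+1)) = p' s *: kl (alt s t n.+1).
Proof. exact/neg_comb_right/uneq_kl_comb. Qed.

Lemma uneq_right_eigen_t n : kap = p t ->
  r t (kl (alt t s n.+1)) = p' t *: kl (alt t s n.+1).
Proof.
move=> kE.
have KtE h : r t (Ktr h) = p' t *: Ktr h.
  rewrite (klm_rD m) (klm_rZ m) (klm_rr m) // kE.
  by module_eq R; ring: (klm_pp m t).
case: n => [|n]; last by rewrite uneq_kl_right KtE.
have e1t : r t (e 1%g) = l t (e 1%g).
  have up : (len 1%g < len (1%g * t)%g)%N by rewrite mul1g (len1 D) (len_S D St).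
  have up' : (len 1%g < len (t * 1%g)%g)%N by rewrite mulg1 (len1 D) (len_S D St).
  by rewrite (klm_rup m St up) (klm_lup m St up') mul1g mulg1.
by rewrite /= mulg1 uneq_kl_t -e1t KtE.
Qed.

(** C_(st) is C_s C_t: a right multiple of C_s by [uneq_kl_right], and read here as a left multiple
    of C_t. *)
Lemma uneq_s_t : l s (kl t) = kl (alt t s 2) - p s *: kl t.
Proof.
have e1t : r t (e 1%g) = l t (e 1%g).
  have up : (len 1%g < len (1%g * t)%g)%N by rewrite mul1g (len1 D) (len_S D St).
  have up' : (len 1%g < len (t * 1%g)%g)%N by rewrite mulg1 (len1 D) (len_S D St).
  by rewrite (klm_rup m St up) (klm_lup m St up') mul1g mulg1.
have sE : kl (alt s t 1) = l s (e 1%g) + p s *: e 1%g.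
  have up' : (len 1%g < len (s * 1%g)%g)%N by rewrite mulg1 (len1 D) (len_S D Ss).
  by rewrite (uneq_kl_odd 0) /= /Ebasis /= (klm_lup m Ss up') mulg1.
rewrite (uneq_kl_right 0) sE uneq_kl_t !(klm_lD m) !(klm_lZ m) !(klm_rD m) !(klm_rZ m).
rewrite -(klm_lr m) e1t; module_eq R; ring.
Qed.

Lemma uneq_t_t : l t (kl t) = (p' t - p t + kap) *: kl t +
                              (1 - kap * (p' t - p t + kap)) *: kl 1%g.
Proof.
rewrite uneq_kl_t klm_kl1 (klm_lD m) (klm_lZ m) (klm_ll m) //.
module_eq R; ring.
Qed.

Lemma uneq_t_1 : l t (kl 1%g) = kl t - kap *: kl 1%g.
Proof. by rewrite uneq_kl_t klm_kl1 addrK. Qed.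

Lemma uneq_leads w : kl_spec w.
Proof.
have [->|[k ->]|[[|k] ->]] := dih_cases w D; first exact: kl_spec1.
- by split; [exact/neg_comb_leads/uneq_kl_comb|exact: uneq_kl_bar].
- rewrite /= mulg1; split; first by rewrite uneq_kl_t; exact: t_leads.
  by rewrite uneq_kl_t bKt (klm_be m).
- split; first by rewrite uneq_kl_right (length_alt _ D'); exact: right_leads.
  by rewrite uneq_kl_right bKtr uneq_kl_bar.
Qed.

End Unequal.

Section Zero.
Hypotheses (ps : p s = p' s) (pt : p t = p' t).

Let pS x : S x -> p x = p' x.
Proof. by move=> /(dih_SP D) [] ->. Qed.

Let zero_bar w : bar (e w) = e w.
Proof.
move: w; apply: (len_ind D) => [|x w Sx up IH]; first exact: klm_be m.
by rewrite -(klm_lup m Sx up) (klm_bl m) // pS // subrr scale0r subr0 IH.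
Qed.

Lemma zero_kl w : kl w = e w.
Proof. by apply: (klm_kl m); [rewrite subrr; exact: (klm_NL0 m)|exact: zero_bar]. Qed.

Lemma zero_l x w : S x -> l x (kl w) = kl (x * w)%g.
Proof.
move=> Sx; rewrite !zero_kl; case up : (len w < len (x * w)%g)%N.
  exact: (klm_lup m Sx up).
have dn : (len (x * w)%g < len (x * (x * w))%g)%N.
  by rewrite (S_K _ D Sx); move: up; rewrite (len_down _ D Sx) => /negbFE.
have -> : e w = l x (e (x * w)%g) by rewrite (klm_lup m Sx dn) (S_K _ D Sx).
by rewrite (klm_ll m) // pS // subrr scale0r addr0.
Qed.

Lemma zero_leads w : kl_spec w.
Proof.
by rewrite /kl_spec zero_kl subrr; split; [exact: (klm_NL0 m)|exact: zero_bar].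
Qed.

End Zero.

End Letters.
End KLComputation.

(** * Cells *)

Section Triangular.
Variables (K : choiceType) (R : nzRingType) (len : K -> nat) (f : K -> {malg R[K]}).
Hypothesis tri : forall w v, (len w <= len v)%N -> (f w)@_v = if w == v then 1 else 0.

Lemma malg_low (h : {malg R[K]}) : exists n, forall v, (n <= len v)%N -> h@_v = 0.
Proof.
exists (\max_(w <- msupp h) len w).+1 => v lt; apply: mcoeff_outdom.
by apply/negP => vh; move: lt; rewrite ltnNge (leq_bigmax_seq (F := len)).
Qed.

Lemma tri_coeff n (h : {malg R[K]}) v : (forall w, (n < len w)%N -> h@_w = 0) ->
  (n <= len v)%N -> (lext f h)@_v = h@_v.
Proof.
move=> ln nv; rewrite unlock raddf_sum /=.
have tr w : w \in msupp h -> (h@_w *: f w)@_v = if w == v then h@_v else 0.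
  move=> wh; have lw : (len w <= n)%N.
    by rewrite leqNgt; apply: contraTN wh => /ln e; rewrite -mcoeff_eq0 e.
  rewrite mcoeffZ tri ?(leq_trans lw nv) //.
  by case: eqP => [->|_]; rewrite ?mulr1 ?mulr0.
rewrite big_seq (eq_bigr _ tr) -big_seq.
have [vh|vh] := boolP (v \in msupp h); last first.
  rewrite (mcoeff_outdom vh) big_seq big1 // => w wh.
  by case: eqP => // e; move: vh; rewrite -e wh.
rewrite (big_fsetD1 v) //= eqxx [X in _ + X]big_seq big1 ?addr0 // => w.
by rewrite !inE => /andP[/negbTE ->].
Qed.

Lemma tri_inj (a b : {malg R[K]}) : lext f a = lext f b -> a = b.
Proof.
move=> e; apply/eqP; rewrite -subr_eq0; apply/eqP; set h := a - b.
have {e} h0 : lext f h = 0 by rewrite raddfB /= e subrr.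
have [n] := malg_low h; elim: n => [|n IH] ln; first by apply/malgP => v; rewrite mcoeff0 ln.
apply: IH => v nv; have := tri_coeff ln nv.
by rewrite h0 mcoeff0 => <-.
Qed.

(** [h - lext f h] has shorter support than [h], so induction on the length bound applies. *)
Lemma tri_surj (h : {malg R[K]}) : exists a, h = lext f a.
Proof.
have [n] := malg_low h; elim: n h => [|n IH] h ln.
  exists 0; rewrite raddf0; apply/malgP => v; by rewrite mcoeff0 ln.
have [v nv|a ha] := IH (h - lext f h).
  by rewrite mcoeffB (tri_coeff ln nv) subrr.
by exists (a + h); rewrite raddfD /= -ha subrK.
Qed.

End Triangular.

Section Span.
Variables (K : choiceType) (R : nzRingType).

Definition lspan (V : lmodType R) (f : K -> V) (E : set K) (h : V) : Prop :=
  exists2 a : {malg R[K]}, (forall x, a@_x != 0 -> E x) & h = lext f a.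

Lemma lspan_gen (V : lmodType R) (f : K -> V) (E : set K) x : E x -> lspan f E (f x).
Proof.
move=> Ex; exists << x >>; last by rewrite sextU.
by move=> y; rewrite mcoeffU; have [<-//|_] := eqVneq x y; rewrite eqxx.
Qed.

Lemma lspanD (V : lmodType R) (f : K -> V) (E : set K) g h :
  lspan f E g -> lspan f E h -> lspan f E (g + h).
Proof.
move=> [a Ea ->] [b Eb ->]; exists (a + b); last by rewrite raddfD.
move=> x; rewrite mcoeffD; have [a0|/Ea //] := eqVneq (a@_x) 0.
by rewrite a0 add0r => /Eb.
Qed.

Lemma lspanZ (V : lmodType R) (f : K -> V) (E : set K) r h :
  lspan f E h -> lspan f E (r *: h).
Proof.
move=> [a Ea ->]; exists (r *: a); last by rewrite sextZ.
move=> x; rewrite mcoeffZ => ra; apply: Ea; apply: contraNneq ra => ->.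
by rewrite mulr0.
Qed.

Lemma lspan0 (V : lmodType R) (f : K -> V) (E : set K) : lspan f E 0.
Proof. by exists 0; [move=> x; rewrite mcoeff0 eqxx|rewrite raddf0]. Qed.

Lemma lspanN (V : lmodType R) (f : K -> V) (E : set K) h : lspan f E h -> lspan f E (- h).
Proof. by rewrite -scaleN1r; apply: lspanZ. Qed.

Lemma lspan_sub (V : lmodType R) (f : K -> V) (E F : set K) h :
  E `<=` F -> lspan f E h -> lspan f F h.
Proof. by move=> EF [a Ea ->]; exists a => // x /Ea /EF. Qed.

Lemma lspan_map (V U : lmodType R) (f : K -> V) (E : set K) (P : U -> Prop) (g : V -> U) h :
  linear g -> P 0 -> (forall a b, P a -> P b -> P (a + b)) ->
  (forall r a, P a -> P (r *: a)) -> (forall x, E x -> P (g (f x))) ->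
  lspan f E h -> P (g h).
Proof.
move=> gL P0 PD PZ PE [a Ea ->].
have gD x y : g (x + y) = g x + g y by rewrite -[x in LHS]scale1r gL scale1r.
have g0 : g 0 = 0 by apply: (addrI (g 0)); rewrite -gD !addr0.
have gZ r x : g (r *: x) = r *: g x by rewrite -[_ *: _ in LHS]addr0 gL g0 addr0.
rewrite unlock big_seq; apply: (big_ind (fun h => P (g h))).
- by rewrite g0.
- by move=> x y Px Py; rewrite gD; apply: PD.
by move=> x xa; rewrite gZ; apply/PZ/PE/Ea; rewrite mcoeff_neq0.
Qed.

End Span.

Section CellTheory.
Variables (W : groupType) (S : set W) (R : comNzRingType) (V : lmodType R).
Variables (f T : W -> V) (M : V -> V -> V) (iota : V -> V).

(** An abstract copy of the cell relations, which keeps the arguments independent of the concrete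
    Hecke algebra; [cell_eq_locked] provides the return. *)
Definition occurs (x : W) (h : V) : Prop :=
  exists2 a : {malg R[W]}, h = lext f a & a@_x != 0.

Definition step (k : side) (x y : W) : Prop :=
  match k with
  | LeftSide => exists h, occurs x (M h (f y))
  | RightSide => exists h, occurs x (M (f y) h)
  | TwoSided => exists h h', occurs x (M (M h (f y)) h')
  end.

Definition cle (k : side) : W -> W -> Prop := clos_trans W (step k).

Definition ceq (k : side) (x y : W) : Prop := cle k x y /\ cle k y x.

Record cell_model : Prop := {
  cm_inj : forall a b, lext f a = lext f b -> a = b;
  cm_surj : forall h, exists a, h = lext f a;
  cm_gen : forall h, exists a, h = lext T a;
  cm_linl : forall h, linear (M^~ h);
  cm_linr : forall h, linear (M h);
  cm_A : associative M;
  cm_1l : forall h, M (T 1%g) h = h;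
  cm_1r : forall h, M h (T 1%g) = h;
  cm_up : forall x w, S x -> (cox_length S w < cox_length S (x * w)%g)%N ->
    T (x * w)%g = M (T x) (T w);
  cm_iL : linear iota;
  cm_iK : involutive iota;
  cm_iM : forall g h, iota (M g h) = M (iota h) (iota g);
  cm_if : forall w, iota (f w) = f w^-1%g
}.

Hypothesis m : cell_model.

Lemma occurs_span (E : set W) x h : lspan f E h -> occurs x h -> E x.
Proof. by move=> [a Ea ->] [b e bx]; apply: Ea; rewrite (cm_inj m e). Qed.

Lemma occurs_lead x r h : r != 0 -> lspan f [set v | v <> x] h -> occurs x (r *: f x + h).
Proof.
move=> r0 [a Ea ->]; exists (r *: << x >> + a); first by rewrite raddfD /= sextZ sextU.
rewrite mcoeffD mcoeffZ mcoeffUU mulr1.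
have [->|/Ea] := eqVneq (a@_x) 0; first by rewrite addr0.
by move=> /(_ erefl).
Qed.

Lemma step_refl k x : step k x x.
Proof.
have o : occurs x (f x).
  exists << x >>; first by rewrite sextU.
  by rewrite mcoeffUU oner_eq0.
case: k => /=; first by exists (T 1%g); rewrite (cm_1l m).
  by exists (T 1%g); rewrite (cm_1r m).
by exists (T 1%g), (T 1%g); rewrite (cm_1l m) (cm_1r m).
Qed.

Lemma cle_refl k x : cle k x x.
Proof. exact/t_step/step_refl. Qed.

Lemma cle_trans k y x z : cle k x y -> cle k y z -> cle k x z.
Proof. exact: t_trans. Qed.

Lemma ceq_refl k x : ceq k x x.
Proof. by split; exact: cle_refl. Qed.

Lemma ceq_sym k x y : ceq k x y -> ceq k y x.
Proof. by case. Qed.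

Lemma ceq_trans k y x z : ceq k x y -> ceq k y z -> ceq k x z.
Proof. by move=> [a b] [c d]; split; [exact: cle_trans c|exact: cle_trans b]. Qed.

(** [iota] reverses products and sends [f w] to [f w^-1], so it exchanges left and right
    multiples. *)
Lemma step_right x y : step RightSide x y <-> step LeftSide x^-1%g y^-1%g.
Proof.
have oi z h : occurs z h -> occurs z^-1%g (iota h).
  move=> [a -> az].
  exists (lext (fun w => << w^-1%g >>) a).
    have iD := cm_iL m; move: {az}a.
    apply: lext_linear_unique => [r a b|r a b|w].
    - by rewrite lext_linear iD.
    - by rewrite !lext_linear.
    - by rewrite !sextU (cm_if m).
  suff -> : (lext (fun w => << w^-1%g >>) a)@_(z^-1)%g = a@_z by [].
  apply: (@lext_linear_unique _ _ R^o
    (fun a => (lext (fun w => << w^-1%g >>) a)@_(z^-1)%g) (fun a => a@_z)) => [r b c|r b c|w].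
  - by rewrite lext_linear mcoeffD mcoeffZ.
  - by rewrite mcoeffD mcoeffZ.
  - by rewrite sextU !mcoeffU eqg_inv.
split=> [[h o]|[h o]]; exists (iota h).
  by have := oi _ _ o; rewrite (cm_iM m) (cm_if m).
by have := oi _ _ o; rewrite (cm_iM m) (cm_if m) !invgK.
Qed.

Lemma cle_right x y : cle RightSide x y <-> cle LeftSide x^-1%g y^-1%g.
Proof.
split=> [|h].
  elim=> [u v /step_right h|u v w _ IH1 _ IH2]; first exact: t_step.
  exact: t_trans IH2.
rewrite -[x]invgK -[y]invgK.
elim: h => [u v h|u v w _ IH1 _ IH2]; last exact: t_trans IH2.
by apply/t_step/step_right; rewrite !invgK.
Qed.

Lemma ceq_right x y : ceq RightSide x y <-> ceq LeftSide x^-1%g y^-1%g.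
Proof. by rewrite /ceq !cle_right. Qed.

Lemma cle_LR_left x y : cle LeftSide x y -> cle TwoSided x y.
Proof.
elim=> [u v [h o]|u v w _ IH1 _ IH2]; last exact: t_trans IH2.
by apply: t_step; exists h, (T 1%g); rewrite (cm_1r m).
Qed.

Lemma cle_LR_right x y : cle RightSide x y -> cle TwoSided x y.
Proof.
elim=> [u v [h o]|u v w _ IH1 _ IH2]; last exact: t_trans IH2.
by apply: t_step; exists (T 1%g), h; rewrite (cm_1l m).
Qed.

(** Testing generators suffices for the span to be a left ideal ([left_closed_mul]). Such sets are
    closed downwards for [cle], hence they separate cells. *)
Definition left_closed (E : set W) : Prop :=
  forall z w, S z -> E w -> lspan f E (M (T z) (f w)).

Section Dihedral.
Variables (s t : W).
Hypothesis D : is_dihedral S s t.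

Lemma left_closed_mul (E : set W) g h : left_closed E -> lspan f E h -> lspan f E (M g h).
Proof.
move=> Ec Eh; have [a ->] := cm_gen m g.
have zE z k : S z -> lspan f E k -> lspan f E (M (T z) k).
  move=> Sz; apply: (lspan_map (cm_linr m (T z))) => [||r c|x Ex].
  - exact: lspan0.
  - exact: lspanD.
  - exact: lspanZ.
  - exact: Ec.
have wE w : lspan f E (M (T w) h).
  move: w; apply: (len_ind D) => [|x w Sx up IH]; first by rewrite (cm_1l m).
  by rewrite (cm_up m Sx up) -(cm_A m); apply: zE.
have : lspan T setT (lext T a) by exists a.
apply: (lspan_map (cm_linl m h)) => [||r c|x _ //].
- exact: lspan0.
- exact: lspanD.
- exact: lspanZ.
Qed.

Lemma left_closed_le (E : set W) x y : left_closed E -> cle LeftSide x y -> E y -> E x.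
Proof.
move=> Ec; elim=> [u v [h o] Ev|u v w _ IH1 _ IH2 /IH2 /IH1 //].
by apply: occurs_span o; apply: left_closed_mul Ec _; apply: lspan_gen.
Qed.

(** A left ideal stable under the anti-automorphism [iota] is two-sided. *)
Lemma left_closed_LR (E : set W) x y : left_closed E ->
  (forall w, E w -> E w^-1%g) -> cle TwoSided x y -> E y -> E x.
Proof.
move=> Ec Ei; have sI h : lspan f E h -> lspan f E (iota h).
  apply: (lspan_map (cm_iL m)) => [||r c|w Ew].
  - exact: lspan0.
  - exact: lspanD.
  - exact: lspanZ.
  - by rewrite (cm_if m); apply/lspan_gen/Ei.
elim=> [u v [h [h' o]] Ev|u v w _ IH1 _ IH2 /IH2 /IH1 //].
apply: occurs_span o; rewrite -[M _ h'](cm_iK m) (cm_iM m).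
apply/sI/left_closed_mul => //; apply/sI/left_closed_mul => //; exact: lspan_gen.
Qed.

End Dihedral.

End CellTheory.

(** * Numerical invariants labelling the cells *)

Section CellInvariants.
Variables (W : groupType) (S : set W).
Local Notation len := (cox_length S).

(* Left (resp. two-sided) cells are the fibres: [kappaU] for |phi t| < |phi s|, with
   [b] telling whether [phi t <> 0], and [kappaE] for |phi s| = |phi t| <> 0. *)
Definition kappaU (b : bool) (s t w : W) : nat :=
  if w == 1%g then 0%N else if w == t then nat_of_bool b else if (len (w * s)%g < len w)%N then 2%N else 3%N.

Definition kappaE (s w : W) : nat :=
  if w == 1%g then 0%N else if (len (w * s)%g < len w)%N then 2%N else 3%N.

Definition lambdaU (b : bool) (t w : W) : nat :=
  if w == 1%g then 0%N else if w == t then nat_of_bool b else 2%N.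

Definition lambdaE (w : W) : nat := if w == 1%g then 0%N else 2%N.

Variables (s t : W).
Hypothesis D : is_dihedral S s t.
Let D' : is_dihedral S t s. Proof. exact: dihedral_sym. Qed.

Lemma altS_neq1 k : (alt s t k.+1 == 1%g) = false.
Proof. by apply/eqP/(alt_neq1 D). Qed.

Lemma altS_neq1' k : (alt t s k.+1 == 1%g) = false.
Proof. by apply/eqP/(alt_neq1 D'). Qed.

Let tE : t = alt t s 1. Proof. by rewrite /= mulg1. Qed.

Lemma alt_neq_t k : (alt s t k.+1 == t) = false.
Proof. by apply/eqP; rewrite [RHS]tE; apply: (alt_disj D). Qed.

Lemma alt_neq_t' k : (alt t s k.+2 == t) = false.
Proof. by apply/eqP; rewrite [RHS]tE => /(alt_inj D'). Qed.

Lemma descent_alt k : (len (alt s t k.+1 * s)%g < len (alt s t k.+1))%N.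
Proof. by rewrite (alt_mulr _ D) (length_alt _ D) (length_alt _ D'). Qed.

Lemma descent_alt' k : (len (alt t s k * s)%g < len (alt t s k))%N = false.
Proof. by rewrite -altSr (length_alt _ D) (length_alt _ D') ltnNge leqnSn. Qed.

Lemma kappaU1 b : kappaU b s t 1%g = 0%N.
Proof. by rewrite /kappaU eqxx. Qed.

Lemma kappaU_alt b k : kappaU b s t (alt s t k.+1) = 2%N.
Proof. by rewrite /kappaU altS_neq1 alt_neq_t descent_alt. Qed.

Lemma kappaU_t b : kappaU b s t (alt t s 1) = b.
Proof. by rewrite /kappaU altS_neq1' -tE eqxx. Qed.

Lemma kappaU_alt' b k : kappaU b s t (alt t s k.+2) = 3%N.
Proof. by rewrite /kappaU altS_neq1' alt_neq_t' descent_alt'. Qed.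

Lemma kappaE1 : kappaE s 1%g = 0%N.
Proof. by rewrite /kappaE eqxx. Qed.

Lemma kappaE_alt k : kappaE s (alt s t k.+1) = 2%N.
Proof. by rewrite /kappaE altS_neq1 descent_alt. Qed.

Lemma kappaE_alt' k : kappaE s (alt t s k.+1) = 3%N.
Proof. by rewrite /kappaE altS_neq1' descent_alt'. Qed.

Lemma lambdaU1 b : lambdaU b t 1%g = 0%N.
Proof. by rewrite /lambdaU eqxx. Qed.

Lemma lambdaU_alt b k : lambdaU b t (alt s t k.+1) = 2%N.
Proof. by rewrite /lambdaU altS_neq1 alt_neq_t. Qed.

Lemma lambdaU_t b : lambdaU b t (alt t s 1) = b.
Proof. by rewrite /lambdaU altS_neq1' -tE eqxx. Qed.

Lemma lambdaU_alt' b k : lambdaU b t (alt t s k.+2) = 2%N.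
Proof. by rewrite /lambdaU altS_neq1' alt_neq_t'. Qed.

Lemma dih_cases2 w : [\/ w = 1%g, w = alt t s 1, exists k, w = alt s t k.+1 |
  exists k, w = alt t s k.+2].
Proof.
have [->|h|[[|k] ->]] := dih_cases w D; [by constructor 1|by constructor 3|
  by constructor 2|by constructor 4; exists k].
Qed.

Lemma kappa_lambdaU b w : lambdaU b t w = minn 2 (kappaU b s t w).
Proof.
have [->|->|[k ->]|[k ->]] := dih_cases2 w.
- by rewrite lambdaU1 kappaU1.
- by rewrite lambdaU_t kappaU_t; case: b.
- by rewrite lambdaU_alt kappaU_alt.
- by rewrite lambdaU_alt' kappaU_alt'.
Qed.

Lemma lambdaUV b w : lambdaU b t w^-1%g = lambdaU b t w.
Proof.
by rewrite /lambdaU invg_eq1 eqg_invLR (dihV D').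
Qed.

Lemma lambdaEV w : lambdaE w^-1%g = lambdaE w.
Proof. by rewrite /lambdaE invg_eq1. Qed.

End CellInvariants.

(** * Determination of the left and two-sided cells *)

Section Classification.
Variables (W : groupType) (S : set W) (R : comNzRingType) (V : lmodType R).
Variables (sigma : {rmorphism R -> R}) (neg : R -> Prop) (NL : nat -> V -> Prop).
Variables (e kl : W -> V) (l r : W -> V -> V) (bar : V -> V) (p p' : W -> R).
Hypothesis m : kl_model S sigma neg NL e kl l r bar p p'.
Variables (f T : W -> V) (M : V -> V -> V) (iota : V -> V).
Hypothesis c : cell_model S f T M iota.
Variables (sg sr : W -> R).
Hypotheses (klE : forall w, kl w = sg w *: f w) (sg_sq : forall w, sg w * sg w = 1).
Hypotheses (lE : forall z h, l z h = sr z *: M (T z) h) (sr_sq : forall z, sr z * sr z = 1).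
Local Notation len := (cox_length S).

Let MD g h k : M g (h + k) = M g h + M g k.
Proof. by rewrite -[h in LHS]scale1r (cm_linr c) scale1r. Qed.

Let M0 g : M g 0 = 0.
Proof. by apply: (addrI (M g 0)); rewrite -MD !addr0. Qed.

Let MZr a g h : M g (a *: h) = a *: M g h.
Proof. by rewrite -[_ *: _ in LHS]addr0 (cm_linr c) M0 addr0. Qed.

Let MZl a g h : M (a *: g) h = a *: M g h.
Proof.
have M0l : M 0 h = 0.
  apply: (addrI (M 0 h)).
  have MDl x y : M (x + y) h = M x h + M y h.
    by rewrite -[x in LHS]scale1r (cm_linl c) scale1r.
  by rewrite -MDl !addr0.
by rewrite -[_ *: _ in LHS]addr0 (cm_linl c) M0l addr0.
Qed.

Lemma span_kl (E : set W) x : E x -> lspan f E (kl x).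
Proof. by move=> Ex; rewrite klE; apply/lspanZ/lspan_gen. Qed.

Lemma step_lo z x y a g : l z (kl y) = a *: kl x + g -> a != 0 ->
  lspan f [set v | v <> x] g -> step f M LeftSide x y.
Proof.
move=> e1 a0 gx; exists ((sr z * sg y) *: T z).
have -> : M ((sr z * sg y) *: T z) (f y) = l z (kl y).
  by rewrite lE klE MZl MZr scalerA.
rewrite e1 klE scalerA; apply: occurs_lead => //.
apply: contraNneq a0 => h; have := congr1 ( *%R^~ (sg x)) h.
by rewrite mul0r -mulrA sg_sq mulr1 => ->.
Qed.

Lemma closed_lo (E : set W) : (forall z w, S z -> E w -> lspan f E (l z (kl w))) ->
  left_closed S f T M E.
Proof.
move=> h z w Sz Ew; have := lspanZ (sr z * sg w) (h z w Sz Ew).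
rewrite lE klE MZr !scalerA.
rewrite (_ : _ * _ = 1) ?scale1r //; ring: (sr_sq z) (sg_sq w).
Qed.

Let ceqT k x y z : ceq f M k x y -> ceq f M k y z -> ceq f M k x z.
Proof. exact: ceq_trans. Qed.

Let leT k x y z : cle f M k x y -> cle f M k y z -> cle f M k x z.
Proof. exact: cle_trans. Qed.

Let st_le k x y : step f M k x y -> cle f M k x y.
Proof. exact: t_step. Qed.

Section Unequal.
Variables (s t : W) (kap : R).
Hypothesis D : is_dihedral S s t.
Let D' : is_dihedral S t s. Proof. exact: dihedral_sym. Qed.

Section Family.
Variables (w : nat -> W).
Hypothesis w_inj : injective w.
Hypothesis rel : uneq_relations l p p' s t kap (fun n => kl (w n)).

Lemma uneq_family_closed (E : set W) z n : (forall k, E (w k)) -> S z ->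
  lspan f E (l z (kl (w n))).
Proof.
move=> Ew Sz; have [h1 h2 h3 h4 h5] := rel.
have wE k : lspan f E (kl (w k)) by exact: span_kl.
have aE a k : lspan f E (a *: kl (w k)) by exact: lspanZ.
have oE a k : lspan f E (- (a *: kl (w k))) by exact/lspanN.
have [->|->] := dih_SP D Sz; rewrite -[n]odd_double_half; case: odd;
  rewrite ?add1n ?add0n ?h1 ?h2 ?h3; do ?exact: wE; do ?exact: aE; do ?apply: lspanD;
  do ?exact: wE; do ?exact: aE; do ?exact: oE.
case: (n./2) => [|k]; first by rewrite h4; do ![apply: lspanD].
by rewrite doubleS h5; do ![apply: lspanD].
Qed.

Let neqw (i j : nat) : i <> j -> w i <> w j.
Proof. by move=> ij /w_inj. Qed.

Let nspan (a : R) (i j : nat) : i <> j -> lspan f [set v | v <> w j] (a *: kl (w i)).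
Proof. by move=> ij; apply/lspanZ/span_kl/neqw. Qed.

Let nspan1 (i j : nat) : i <> j -> lspan f [set v | v <> w j] (kl (w i)).
Proof. by move=> ij; apply/span_kl/neqw. Qed.

Let nspanN (a : R) (i j : nat) : i <> j ->
  lspan f [set v | v <> w j] (- (a *: kl (w i))).
Proof. by move=> ij; apply/lspanN/lspanZ/span_kl/neqw. Qed.

Lemma uneq_family_up n : cle f M LeftSide (w n.+1) (w n).
Proof.
have [h1 h2 h3 h4 h5] := rel; apply: st_le.
rewrite -[n]odd_double_half; case: odd; rewrite ?add1n ?add0n; last first.
  apply: (@step_lo t _ _ 1 (- (kap *: kl (w (n./2).*2)))); first by rewrite scale1r h2.
    exact: oner_neq0.
  by apply: nspanN; lia.
case: (n./2) => [|k].
  apply: (@step_lo s _ _ 1 _ _ (oner_neq0 _)); first by rewrite scale1r h4 -addrA.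
  by apply: lspanD; [apply: nspan|apply: nspanN].
rewrite doubleS; apply: (@step_lo s _ _ 1 _ _ (oner_neq0 _)).
  by rewrite scale1r h5 -!addrA.
do ![apply: lspanD]; [apply: nspan|apply: nspan1|apply: nspanN]; lia.
Qed.

(** The coefficient of [w k.*2] in this product is 1 for all weights, whereas that of [w k.*2.+2]
    vanishes if [t] has weight 0. Hence the way down jumps by three, and [uneq_family_up] corrects
    the parity. *)
Lemma uneq_family_down k : cle f M LeftSide (w k.*2) (w k.*2.+3).
Proof.
have [h1 h2 h3 h4 h5] := rel; apply: st_le.
apply: (@step_lo s _ _ 1 _ _ (oner_neq0 _)).
  by rewrite scale1r h5 addrAC [in LHS]addrC -!addrA.
do ![apply: lspanD]; do ?[apply: nspanN]; do ?[apply: nspan]; do ?[apply: nspan1]; lia.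
Qed.

Lemma uneq_family_ceq i j : ceq f M LeftSide (w i) (w j).
Proof.
suff h n : ceq f M LeftSide (w n) (w 0).
  exact: ceqT (h i) (ceq_sym (h j)).
have up n' : cle f M LeftSide (w n') (w 0).
  by elim: n' => [|n' IH]; [exact: cle_refl c _ _|exact: leT (uneq_family_up n') IH].
split; first exact: up.
have d k := uneq_family_down k.
elim/ltn_ind: n => -[|[|[|n]]] IH; first exact: (cle_refl c).
- exact: leT (d 0%N) (leT (uneq_family_up 2) (uneq_family_up 1)).
- exact: leT (d 0%N) (uneq_family_up 2).
have := odd_double_half n; case: odd => nE; rewrite ?add1n ?add0n in nE.
  have dk := d (n./2).+1; rewrite doubleS nE in dk.
  have lt : (n.+1 < n.+3)%N by lia.
  apply: leT (IH _ lt) _; apply: leT dk _; exact: uneq_family_up.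
have dk := d (n./2); rewrite nE in dk.
apply: leT (IH n _) dk; lia.
Qed.

End Family.

Variable b : bool.
Hypothesis kapE : if b then kap = p t else kap = 0 /\ p t = p' t.
Hypothesis rel : uneq_relations l p p' s t kap (fun n => kl (alt s t n.+1)).
Hypothesis rel' : uneq_relations l p p' s t kap (fun n => kl (alt t s n.+2)).
Hypothesis st : l s (kl t) = kl (alt t s 2) - p s *: kl t.
Hypothesis tt : l t (kl t) = (p' t - p t + kap) *: kl t +
                             (1 - kap * (p' t - p t + kap)) *: kl 1%g.
Hypothesis t1 : l t (kl 1%g) = kl t - kap *: kl 1%g.
Hypothesis s1 : l s (kl 1%g) = kl s - p s *: kl 1%g.

Let ka := kappaU S b s t.
Let la := lambdaU b t.

Let inj_p : injective (fun n => alt s t n.+1).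
Proof. by move=> i j /(alt_inj D) []. Qed.

Let inj_q : injective (fun n => alt t s n.+2).
Proof. by move=> i j /(alt_inj D') []. Qed.

Let tE : t = alt t s 1. Proof. by rewrite /= mulg1. Qed.

Let ka1 : ka 1%g = 0%N := kappaU1 S s t b.
Let ka_p k : ka (alt s t k.+1) = 2%N := kappaU_alt D b k.
Let ka_t : ka (alt t s 1) = b := kappaU_t D b.
Let ka_q k : ka (alt t s k.+2) = 3%N := kappaU_alt' D b k.

Let closed_p (E : set W) z k : (forall k, E (alt s t k.+1)) -> S z ->
  lspan f E (l z (kl (alt s t k.+1))).
Proof. by move=> Ew Sz; apply: (uneq_family_closed rel). Qed.

Let closed_q (E : set W) z k : (forall k, E (alt t s k.+2)) -> S z ->
  lspan f E (l z (kl (alt t s k.+2))).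
Proof. by move=> Ew Sz; apply: (uneq_family_closed rel'). Qed.

Let closed_t (E : set W) z : b -> E t -> E (alt t s 2) -> S z -> lspan f E (l z (kl t)).
Proof.
move=> bT Et E2; have kE := kapE; rewrite bT in kE.
move=> /(dih_SP D) [] ->; last first.
  rewrite tt kE addrC subrK mulrC [p' t * _]mulrC (klm_pp m) subrr scale0r add0r.
  exact/lspanZ/span_kl.
by rewrite st; apply: lspanD; [exact: span_kl|exact/lspanN/lspanZ/span_kl].
Qed.

Lemma uneq_closed_p : left_closed S f T M [set x | ka x = 2%N].
Proof.
apply: closed_lo => z w Sz /=; have [->|->|[k ->]|[k ->]] := dih_cases2 D w.
- by rewrite ka1.
- by rewrite ka_t; case: b.
- by move=> _; apply: closed_p => // j /=; rewrite ka_p.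
- by rewrite ka_q.
Qed.

Lemma uneq_closed_q : left_closed S f T M [set x | ka x = 3%N].
Proof.
apply: closed_lo => z w Sz /=; have [->|->|[k ->]|[k ->]] := dih_cases2 D w.
- by rewrite ka1.
- by rewrite ka_t; case: b.
- by rewrite ka_p.
- by move=> _; apply: closed_q => // j /=; rewrite ka_q.
Qed.

Lemma uneq_closed_t : b -> left_closed S f T M [set x | ka x = 1%N \/ ka x = 3%N].
Proof.
move=> bT; apply: closed_lo => z w Sz /=; have [->|->|[k ->]|[k ->]] := dih_cases2 D w.
- by rewrite ka1; case.
- move=> _; rewrite -tE; apply: closed_t => //=; last by right; rewrite ka_q.
  by rewrite [X in ka X]tE ka_t bT; left.
- by rewrite ka_p; case.
- by move=> _; apply: closed_q => // j /=; rewrite ka_q; right.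
Qed.

Lemma uneq_closed_LR : left_closed S f T M [set x | la x = 2%N].
Proof.
apply: closed_lo => z w Sz /=; have [->|->|[k ->]|[k ->]] := dih_cases2 D w.
- by rewrite /la lambdaU1.
- by rewrite /la (lambdaU_t D); case: b.
- by move=> _; apply: closed_p => // j /=; rewrite /la (lambdaU_alt D).
- by move=> _; apply: closed_q => // j /=; rewrite /la (lambdaU_alt' D).
Qed.

Lemma uneq_closed_1 : b -> left_closed S f T M [set x | la x <> 0%N].
Proof.
move=> bT; apply: closed_lo => z w Sz /=; have [->|->|[k ->]|[k ->]] := dih_cases2 D w.
- by rewrite /la lambdaU1.
- move=> _; rewrite -tE; apply: closed_t => //=; last by rewrite /la (lambdaU_alt' D).
  by rewrite [X in la X]tE /la (lambdaU_t D) bT.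
- by move=> _; apply: closed_p => // j /=; rewrite /la (lambdaU_alt D).
- by move=> _; apply: closed_q => // j /=; rewrite /la (lambdaU_alt' D).
Qed.

Let t_neq1 : t <> 1%g.
Proof. by rewrite [t]tE; exact: (alt_neq1 D'). Qed.

(** For weight 0 the operator [l t] exchanges C_1 and C_t. *)
Let ceq_t1 : ~~ b -> ceq f M LeftSide t 1%g.
Proof.
move=> /negbTE bF; have := kapE; rewrite bF => -[k0 pt]; split.
  apply/st_le/(@step_lo t _ _ 1 (- (kap *: kl 1%g)) _ (oner_neq0 _)); first by rewrite scale1r t1.
  by apply/lspanN/lspanZ/span_kl => h; apply: t_neq1.
apply/st_le/(@step_lo t _ _ 1 0 _ (oner_neq0 _)); last exact: lspan0.
by rewrite tt k0 pt mul0r subr0 subrr addr0 scale0r add0r addr0.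
Qed.

(** The closed sets separate different values of [ka]; [uneq_family_ceq] for the two families, and
    [ceq_t1] for weight 0, connect equal values. *)
Theorem uneq_left_cells x y : ceq f M LeftSide x y <-> ka x = ka y.
Proof.
split=> [[xy yx]|].
  have cl E : left_closed S f T M E -> E x <-> E y.
    by move=> Ec; split; apply: (left_closed_le c D Ec).
  have /= h2 := cl _ uneq_closed_p; have /= h3 := cl _ uneq_closed_q.
  case bE : b.
    have /= h1 := cl _ (uneq_closed_t bE); move: h1 h2 h3.
    have [->|->|[k ->]|[k ->]] := dih_cases2 D x;
    have [->|->|[j ->]|[j ->]] := dih_cases2 D y;
      rewrite ?ka1 ?ka_t ?ka_p ?ka_q ?bE //=; move=> [h1 h1'] [h2 h2'] [h3 h3'] //;
      do ?[by have := h2 erefl | by have := h2' erefl | by have := h3 erefl |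
           by have := h3' erefl | by have := h1 (or_introl erefl); case |
           by have := h1' (or_introl erefl); case].
  move: h2 h3; have [->|->|[k ->]|[k ->]] := dih_cases2 D x;
    have [->|->|[j ->]|[j ->]] := dih_cases2 D y;
      rewrite ?ka1 ?ka_t ?ka_p ?ka_q ?bE //=; move=> [h2 h2'] [h3 h3'] //;
      do ?[by have := h2 erefl | by have := h2' erefl | by have := h3 erefl |
           by have := h3' erefl].
have rfl z : ceq f M LeftSide z z by exact: (ceq_refl c).
have pp i j : ceq f M LeftSide (alt s t i.+1) (alt s t j.+1).
  exact: (uneq_family_ceq inj_p rel).
have qq i j : ceq f M LeftSide (alt t s i.+2) (alt t s j.+2).
  exact: (uneq_family_ceq inj_q rel').
case bE : b (ceq_t1); move=> ct;
have [->|->|[k ->]|[k ->]] := dih_cases2 D x;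
have [->|->|[j ->]|[j ->]] := dih_cases2 D y;
  rewrite ?ka1 ?ka_t ?ka_p ?ka_q ?bE // -?tE; move=> _.
- by apply/ceq_sym/ct.
- exact: ct.
Qed.

Theorem uneq_two_sided_cells x y : ceq f M TwoSided x y <-> la x = la y.
Proof.
have LtoLR u v : ceq f M LeftSide u v -> ceq f M TwoSided u v.
  by case=> h1 h2; split; apply: (cle_LR_left c).
have RtoLR u v : ceq f M RightSide u v -> ceq f M TwoSided u v.
  by case=> h1 h2; split; apply: (cle_LR_right c).
split=> [[xy yx]|].
  have laV n : forall w, la w = n -> la w^-1%g = n by move=> w; rewrite /la (lambdaUV D).
  have cl E : left_closed S f T M E -> (forall w, E w -> E w^-1%g) -> E x <-> E y.
    by move=> Ec Ei; split; apply: (left_closed_LR c D Ec Ei).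
  have /= h2 := cl _ uneq_closed_LR (laV 2%N).
  case bE : b.
    have /= h1 := cl _ (uneq_closed_1 bE) _; move: h1 h2.
    rewrite /la; have [->|->|[k ->]|[k ->]] := dih_cases2 D x;
    have [->|->|[j ->]|[j ->]] := dih_cases2 D y;
      rewrite ?lambdaU1 ?(lambdaU_t D) ?(lambdaU_alt D) ?(lambdaU_alt' D) ?bE //=;
      move=> h1 [h2 h2']; do ?[by have := h2 erefl | by have := h2' erefl].
    - have [|_ h] := h1; first by move=> w; rewrite (lambdaUV D).
      by case: h.
    - have [|h _] := h1; first by move=> w; rewrite (lambdaUV D).
      by case: h.
  move: h2; rewrite /la; have [->|->|[k ->]|[k ->]] := dih_cases2 D x;
    have [->|->|[j ->]|[j ->]] := dih_cases2 D y;
      rewrite ?lambdaU1 ?(lambdaU_t D) ?(lambdaU_alt D) ?(lambdaU_alt' D) ?bE //=;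
      move=> [h2 h2']; do ?[by have := h2 erefl | by have := h2' erefl].
have kk u v : ka u = ka v -> ceq f M TwoSided u v by move=> /uneq_left_cells /LtoLR.
(* The inverses [t * s] and [s] of these two elements both end in [s], so the elements are right
   equivalent; this links the two left cells of long words. *)
have qp : ceq f M TwoSided (alt t s 2) (alt s t 1).
  apply/RtoLR/(ceq_right c)/uneq_left_cells.
  by rewrite (altV _ D) (altV _ D') /= -[X in ka X]/(alt s t 2) -[X in _ = ka X]/(alt s t 1) !ka_p.
have qp' k j : ceq f M TwoSided (alt t s k.+2) (alt s t j.+1).
  apply: ceqT (kk _ (alt t s 2) _) (ceqT qp (kk _ _ _)); by rewrite ?ka_p ?ka_q.
have [->|->|[k ->]|[k ->]] := dih_cases2 D x;
have [->|->|[j ->]|[j ->]] := dih_cases2 D y => h; first [apply: qp' | exact/ceq_sym/qp' |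
  apply: kk; move: h; rewrite /la ?lambdaU1 ?(lambdaU_t D) ?(lambdaU_alt D) ?(lambdaU_alt' D);
  rewrite ?ka1 ?ka_t ?ka_p ?ka_q; by [|case: b]].
Qed.

End Unequal.

Section Equal.

Section Family.
Variables (s t : W).
Hypothesis D : is_dihedral S s t.
Hypothesis rel : eq_relations l p p' s t (fun n => kl (alt s t n.+1)).

Lemma eq_family_closed (E : set W) z n : (forall k, E (alt s t k.+1)) -> S z ->
  lspan f E (l z (kl (alt s t n.+1))).
Proof.
move=> Ew Sz; have [h1 h2 h3] := rel.
have [->|] : z = letter s t n \/ z = letter s t n.+1.
  by rewrite letterS /letter; case: odd; case: (dih_SP D Sz); tauto.
  by rewrite h1; apply/lspanZ/span_kl.
case: n => [->|n ->].
  by rewrite h2; apply: lspanD; [exact: span_kl|exact/lspanN/lspanZ/span_kl].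
rewrite letterSS h3; apply: lspanD; last exact/lspanN/lspanZ/span_kl.
by apply: lspanD; exact: span_kl.
Qed.

Let neqw (i j : nat) : i <> j -> alt s t i.+1 <> alt s t j.+1.
Proof. by move=> ij /(alt_inj D) []. Qed.

Let ups n : cle f M LeftSide (alt s t n.+2) (alt s t n.+1).
Proof.
have [h1 h2 h3] := rel; apply: st_le; case: n => [|n].
  apply: (@step_lo t _ _ 1 _ _ (oner_neq0 _)); first by rewrite scale1r h2.
  by apply/lspanN/lspanZ/span_kl/(@neqw 0 1).
apply: (@step_lo (letter s t n) _ _ 1 _ _ (oner_neq0 _)).
  by rewrite scale1r h3 -addrA.
apply: lspanD; first by apply/span_kl/neqw; lia.
by apply/lspanN/lspanZ/span_kl/neqw; lia.
Qed.

Let downs n : cle f M LeftSide (alt s t n.+1) (alt s t n.+2).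
Proof.
have [h1 h2 h3] := rel; apply: st_le.
apply: (@step_lo (letter s t n) _ _ 1 _ _ (oner_neq0 _)).
  by rewrite scale1r h3 addrAC [in LHS]addrC.
apply: lspanD; first by apply/span_kl/neqw; lia.
by apply/lspanN/lspanZ/span_kl/neqw; lia.
Qed.

Lemma eq_family_ceq i j : ceq f M LeftSide (alt s t i.+1) (alt s t j.+1).
Proof.
suff h n : ceq f M LeftSide (alt s t n.+1) (alt s t 1).
  exact: ceqT (h i) (ceq_sym (h j)).
elim: n => [|n IH]; first exact: (ceq_refl c).
by apply: ceqT IH; split.
Qed.

End Family.

Variables (s t : W).
Hypothesis D : is_dihedral S s t.
Let D' : is_dihedral S t s. Proof. exact: dihedral_sym. Qed.
Hypothesis rel : eq_relations l p p' s t (fun n => kl (alt s t n.+1)).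
Hypothesis rel' : eq_relations l p p' t s (fun n => kl (alt t s n.+1)).

Local Notation ka := (kappaE S s).

Lemma eq_closed_p : left_closed S f T M [set x | ka x = 2%N].
Proof.
apply: closed_lo => z w Sz /=; have [->|[k ->]|[k ->]] := dih_cases w D.
- by rewrite kappaE1.
- by move=> _; apply: (eq_family_closed D rel) => // j /=; rewrite (kappaE_alt D).
- by rewrite (kappaE_alt' D).
Qed.

Lemma eq_closed_q : left_closed S f T M [set x | ka x = 3%N].
Proof.
apply: closed_lo => z w Sz /=; have [->|[k ->]|[k ->]] := dih_cases w D.
- by rewrite kappaE1.
- by rewrite (kappaE_alt D).
- by move=> _; apply: (eq_family_closed D' rel') => // j /=; rewrite (kappaE_alt' D).
Qed.

Lemma eq_closed_LR : left_closed S f T M [set x | lambdaE x = 2%N].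
Proof.
apply: closed_lo => z w Sz /=; have [->|[k ->]|[k ->]] := dih_cases w D.
- by rewrite /lambdaE eqxx.
- move=> _; apply: (eq_family_closed D rel) => // j /=.
  by rewrite /lambdaE (altS_neq1 D).
- move=> _; apply: (eq_family_closed D' rel') => // j /=.
  by rewrite /lambdaE (altS_neq1' D).
Qed.

Theorem eq_left_cells x y : ceq f M LeftSide x y <-> ka x = ka y.
Proof.
split=> [[xy yx]|].
  have cl E : left_closed S f T M E -> E x <-> E y.
    by move=> Ec; split; apply: (left_closed_le c D Ec).
  have /= h2 := cl _ eq_closed_p; have /= h3 := cl _ eq_closed_q.
  move: h2 h3; have [->|[k ->]|[k ->]] := dih_cases x D;
    have [->|[j ->]|[j ->]] := dih_cases y D;
      rewrite ?kappaE1 ?(kappaE_alt D) ?(kappaE_alt' D) //=; move=> [h2 h2'] [h3 h3'] //;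
      do ?[by have := h2 erefl | by have := h2' erefl | by have := h3 erefl |
           by have := h3' erefl].
have [->|[k ->]|[k ->]] := dih_cases x D;
have [->|[j ->]|[j ->]] := dih_cases y D;
  rewrite ?kappaE1 ?(kappaE_alt D) ?(kappaE_alt' D) // => _.
- exact: (ceq_refl c).
- exact: (eq_family_ceq D rel).
- exact: (eq_family_ceq D' rel').
Qed.

Theorem eq_two_sided_cells x y : ceq f M TwoSided x y <-> lambdaE x = lambdaE y.
Proof.
have LtoLR u v : ceq f M LeftSide u v -> ceq f M TwoSided u v.
  by case=> h1 h2; split; apply: (cle_LR_left c).
have RtoLR u v : ceq f M RightSide u v -> ceq f M TwoSided u v.
  by case=> h1 h2; split; apply: (cle_LR_right c).
have lp k : lambdaE (alt s t k.+1) = 2%N by rewrite /lambdaE (altS_neq1 D).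
have lq k : lambdaE (alt t s k.+1) = 2%N by rewrite /lambdaE (altS_neq1' D).
have l1 : lambdaE (1%g : W) = 0%N by rewrite /lambdaE eqxx.
split=> [[xy yx]|].
  have cl E : left_closed S f T M E -> (forall w, E w -> E w^-1%g) -> E x <-> E y.
    by move=> Ec Ei; split; apply: (left_closed_LR c D Ec Ei).
  have laV (w : W) : lambdaE w = 2%N -> lambdaE w^-1%g = 2%N by rewrite lambdaEV.
  have /= [h2 h2'] := cl _ eq_closed_LR laV.
  move: h2 h2'; have [->|[k ->]|[k ->]] := dih_cases x D;
    have [->|[j ->]|[j ->]] := dih_cases y D;
      rewrite ?l1 ?lp ?lq //= => h2 h2'; do ?[by have := h2 erefl | by have := h2' erefl].
have pp i j : ceq f M TwoSided (alt s t i.+1) (alt s t j.+1).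
  exact/LtoLR/(eq_family_ceq D rel).
have qq i j : ceq f M TwoSided (alt t s i.+1) (alt t s j.+1).
  exact/LtoLR/(eq_family_ceq D' rel').
(* The inverses [s * t] and [t] of these two elements both end in [t]. *)
have pq : ceq f M TwoSided (alt s t 2) (alt t s 1).
  apply/RtoLR/(ceq_right c).
  by rewrite (altV _ D) (altV _ D'); exact: (eq_family_ceq D' rel' 1 0).
have pq' i j : ceq f M TwoSided (alt s t i.+1) (alt t s j.+1).
  exact: ceqT (pp i 1%N) (ceqT pq (qq 0%N j)).
have [->|[k ->]|[k ->]] := dih_cases x D;
have [->|[j ->]|[j ->]] := dih_cases y D;
  rewrite ?l1 ?lp ?lq // => _; first [exact: (ceq_refl c)|exact/ceq_sym/pq'].
Qed.

End Equal.

Theorem zero_cells (s t : W) : is_dihedral S s t ->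
  (forall x w, S x -> l x (kl w) = kl (x * w)%g) -> forall k x y, ceq f M k x y.
Proof.
move=> D lz; have st x w : S x -> cle f M LeftSide (x * w)%g w.
  move=> Sx; apply/st_le/(@step_lo x _ _ 1 0 _ (oner_neq0 _)); last exact: lspan0.
  by rewrite lz // scale1r addr0.
have c1 w : ceq f M LeftSide w 1%g.
  move: w; apply: (len_ind D) => [|x w Sx up IH]; first exact: (ceq_refl c).
  apply: ceqT IH; split; first exact: st.
  by rewrite -{1}(S_K w D Sx); apply: st.
have L x y : ceq f M LeftSide x y by exact: ceqT (c1 x) (ceq_sym (c1 y)).
case=> x y; first exact: L; first exact/(ceq_right c)/L.
by have [h1 h2] := L x y; split; apply: (cle_LR_left c).
Qed.

End Classification.

(** * The Hecke algebra with arbitrary weights *)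

HB.lock Definition klL (W : groupType) (S : set W) (G : tozmodType) (phi : Sbar S -> G) :=
  klC phi.

Definition toabs (G : tozmodType) (a : G) : G := if 0 <= a then a else - a.

Section TotallyOrdered.
Variable G : tozmodType.
Implicit Types a b : G.

Lemma to_subr_lt0 a b : a < b -> a - b < 0.
Proof. by move=> ab; have := to_ltD (- b) ab; rewrite subrr. Qed.

Lemma to_oppr_lt0 a : 0 < a -> - a < 0.
Proof. by move/to_subr_lt0; rewrite sub0r. Qed.

Lemma to_oppr_gt0 a : a < 0 -> 0 < - a.
Proof. by move/(to_ltD (- a)); rewrite subrr add0r. Qed.

Lemma to_ltVge a b : a < b \/ b <= a.
Proof.
have /orP[] := tozmod_total a b; last by right.
by rewrite le_eqVlt => /predU1P[->|]; [right|left].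
Qed.

Lemma to_trichotomy a b : [\/ a < b, a = b | b < a].
Proof.
have [|] := to_ltVge a b; first by constructor 1.
by rewrite le_eqVlt => /predU1P[->|]; [constructor 2|constructor 3].
Qed.

Lemma toabs_ge0 a : 0 <= toabs a.
Proof.
rewrite /toabs; case: ifP => // /negP h.
have [|//] := to_ltVge 0 a; first by move/ltW.
by rewrite le_eqVlt => /predU1P[e|/to_oppr_gt0/ltW//]; case: h; rewrite e.
Qed.

Lemma abs_wt_ge0 (W : groupType) (wt : W -> G) x : 0 <= abs_wt wt x.
Proof. exact: toabs_ge0. Qed.

End TotallyOrdered.

Section HeckeModel.
Variables (W : groupType) (S : set W) (s t : W) (G : tozmodType).
Variables (phi : Sbar S -> G) (wt : W -> G).
Hypothesis D : is_dihedral S s t.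
Hypothesis phiE : forall (o : Sbar S) x, val o x -> phi o = wt x.

Local Notation len := (cox_length S).
Local Notation R := (group_ring G : comNzRingType).
Local Notation V := ({malg (group_ring G)[W]} : lmodType (group_ring G : comNzRingType)).
Local Notation p := (fun x => gexp (- abs_wt wt x)).
Local Notation p' := (fun x => gexp (abs_wt wt x)).
Local Notation T := (@heckeT W G).

Lemma hecke_kl_model :
  @kl_model W S R V (@gr_bar G) (@gr_neg G) (@neg_low W S G) (eT s t wt)
    (klT s t phi wt) (lo phi wt) (ro phi wt) (hbar phi) p p'.
Proof.
split.
- exact: gr_neg0.
- exact: gr_negD.
- exact: gr_negM.
- exact: neg_low0.
- exact: neg_lowD.
- move=> n a w na lt; exact: (@neg_low_e W S s t G wt D n a w na lt).
- exact: (loD D phiE).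
- exact: (loZ D phiE).
- exact: (roD D phiE).
- exact: (roZ D phiE).
- exact: (lo_ro D phiE).
- exact: (lo_lo D phiE).
- exact: (ro_ro D phiE).
- exact: (lo_up D phiE).
- exact: (ro_up D phiE).
- by move=> x; exact: gexpNr.
- by move=> x; apply: (etrans (gr_bar_exp _)); rewrite opprK.
- by move=> x; exact: gr_bar_exp.
- exact: hbarD.
- exact: hbarZ.
- exact: (bar_lo D phiE).
- exact: (bar_ro D phiE).
- exact: (bar_e1 D phiE).
- move=> w c nc bc; exact: (kl_unique D phiE bc nc).
Qed.

(** Existence of the C_w, established separately for each type of weights; it makes them
    unitriangular for the length and compatible with [iota]. *)
Hypothesis good : forall w,
  kl_spec S (@neg_low W S G) (eT s t wt) (klT s t phi wt) (hbar phi) w.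

Local Notation sg := (sgw s t wt).

Lemma klL_E w : klL phi w = sg w *: klT s t phi wt w.
Proof. by rewrite klT.unlock klL.unlock scalerA (sg_sq wt D) scale1r. Qed.

Lemma klL_tri w v : (len w <= len v)%N -> (klL phi w)@_v = if w == v then 1 else 0.
Proof.
move=> le; have [g _] := good w; have [_ /(_ le) h] := g v.
rewrite klL_E mcoeffZ -[klT s t phi wt w](subrK (eT s t wt w)) mcoeffD h add0r.
rewrite (eT_coeff s t wt w v).
by case: eqP => _; rewrite ?mulr0 ?(sg_sq wt D).
Qed.

Lemma bar_iota (h : {malg (group_ring G)[W]}) : hbar phi (iota h) = iota (hbar phi h).
Proof.
have K w : hbar phi (iota (eT s t wt w)) = iota (hbar phi (eT s t wt w)).
  move: w; apply: (len_ind D) => [|x w Sx up IH].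
    by rewrite (iota_e wt D) invg1 (bar_e1 D phiE) (iota_e wt D) invg1.
  rewrite -(lo_up D phiE Sx up) (iota_lo D phiE _ Sx) (bar_ro D phiE _ Sx) IH.
  rewrite (bar_lo D phiE _ Sx) -(iota_lo D phiE _ Sx).
  symmetry; rewrite iotaB iotaZ; reflexivity.
apply: (eT_ext (wt := wt) D (g1 := fun h => hbar phi (iota h))
   (g2 := fun h => iota (hbar phi h))) => [a b|a b|r a|r a|w].
- by rewrite iotaD hbarD.
- by rewrite hbarD iotaD.
- by rewrite iotaZ hbarZ.
- by rewrite hbarZ iotaZ.
- exact: K.
Qed.

Lemma iota_coeff (h : {malg (group_ring G)[W]}) v : (iota h)@_v = h@_(v^-1)%g.
Proof.
apply: (@lext_linear_unique _ (group_ring G) ((group_ring G)^o)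
    (fun h => (iota h)@_v) (fun h => h@_(v^-1)%g)) => [r a b|r a b|w].
- by rewrite iotaD iotaZ mcoeffD mcoeffZ.
- by rewrite mcoeffD mcoeffZ.
- by rewrite -/(T w) iotaT !mcoeffU eqg_invLR.
Qed.

Lemma klL_bar w : hbar phi (klL phi w) = klL phi w.
Proof.
have [_ b] := good w; by rewrite klL_E hbarZ (sg_bar wt D) b.
Qed.

Lemma klL_neg w x : gr_neg (klL phi w - T w)@_x.
Proof.
have -> : klL phi w - T w = sg w *: (klT s t phi wt w - eT s t wt w).
  rewrite klL_E scalerBr; congr (_ - _).
  by rewrite eTE scalerA (sg_sq wt D) scale1r.
rewrite mcoeffZ mulrC; apply: (sg_neg D); have [g _] := good w.
by case: (g x).
Qed.

(** [iota] commutes with the bar involution and preserves negativity, so the uniqueness of the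
    element attached to [w^-1] applies. *)
Lemma klL_inv w : iota (klL phi w) = klL phi w^-1%g.
Proof.
symmetry; rewrite {1}klL.unlock; apply: (klC_unique D phiE).
  by rewrite bar_iota klL_bar.
move=> x; have -> : iota (klL phi w) - T w^-1%g = iota (klL phi w - T w).
  by rewrite iotaB iotaT.
by rewrite iota_coeff; exact: klL_neg.
Qed.

Lemma hecke_cell_model : @cell_model W S R V (klL phi) T (hM phi) (@iota W G).
Proof.
split.
- exact: (tri_inj klL_tri).
- exact: (tri_surj klL_tri).
- move=> h; exists h.
  apply: (@lext_linear_unique _ _ _ id (lext T)) => [||w].
  + by move=> r a b.
  + exact: lext_linear.
  + by rewrite sextU.
- exact: (hm_linl D phiE).
- exact: (hm_linr D phiE).
- exact: (hmA D phiE).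
- exact: (hm1l D phiE).
- exact: (hm1r D phiE).
- move=> x w Sx up; rewrite (hmTT D phiE) //.
  by rewrite (len_up D Sx up) (len_S D Sx).
- exact: iota_linear.
- exact: iotaK.
- exact: (iotaM D phiE).
- exact: klL_inv.
Qed.

Lemma klC_occurs_locked x h : klC_occurs phi x h <-> occurs (klL phi : W -> V) x h.
Proof.
rewrite klL.unlock; split=> -[a e ax]; exists a => //.
  by rewrite -klC_comb_lext.
by rewrite klC_comb_lext.
Qed.

Lemma cell_step_locked k x y :
  cell_step phi k x y <-> step (klL phi : W -> V) (hM phi) k x y.
Proof.
have eM : hecke_mul phi = hM phi by rewrite hM.unlock.
have eL : klC phi = klL phi by rewrite klL.unlock.
case: k => /=; rewrite eM eL.
- by split=> -[h /klC_occurs_locked o]; exists h.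
- by split=> -[h /klC_occurs_locked o]; exists h.
- by split=> -[h [h' /klC_occurs_locked o]]; exists h, h'.
Qed.

Lemma cell_eq_locked k x y :
  cell_eq phi k x y <-> ceq (klL phi : W -> V) (hM phi) k x y.
Proof.
have le u v : cell_le phi k u v <-> cle (klL phi : W -> V) (hM phi) k u v.
  split; elim=> [a b /cell_step_locked h|a b d _ IH1 _ IH2];
    by [apply: t_step|apply: t_trans IH2].
by rewrite /cell_eq /ceq !le.
Qed.

End HeckeModel.

Definition cell_inv (W : groupType) (ka la : W -> nat) (k : side) (x : W) : nat :=
  match k with LeftSide => ka x | RightSide => ka x^-1%g | TwoSided => la x end.

Section WeightTypes.
Variables (W : groupType) (S : set W) (s t : W) (G : tozmodType).
Variables (phi : Sbar S -> G) (wt : W -> G).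
Hypothesis D : is_dihedral S s t.
Hypothesis phiE : forall (o : Sbar S) x, val o x -> phi o = wt x.
Let D' : is_dihedral S t s. Proof. exact: dihedral_sym. Qed.

Local Notation R := (group_ring G : comNzRingType).
Local Notation V := ({malg (group_ring G)[W]} : lmodType (group_ring G : comNzRingType)).
Local Notation p := (fun x => gexp (- abs_wt wt x)).
Local Notation p' := (fun x => gexp (abs_wt wt x)).
Local Notation T := (@heckeT W G).
Local Notation kl := (klT s t phi wt).
Local Notation f := (klL phi : W -> V).
Local Notation sg := (sgw s t wt).
Local Notation spec := (kl_spec S (@neg_low W S G) (eT s t wt) (klT s t phi wt) (hbar phi)).

Let m := hecke_kl_model D phiE.

Let klE w : kl w = sg w *: f w.
Proof. by rewrite klT.unlock klL.unlock. Qed.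

Let sr_sq' x : ((-1) ^+ neg_wt wt x : R) * (-1) ^+ neg_wt wt x = 1.
Proof. exact: sr_sq. Qed.

Lemma cells_from_left (ka la : W -> nat) :
  (forall w, spec w) ->
  (forall x y, ceq f (hM phi) LeftSide x y <-> ka x = ka y) ->
  (forall x y, ceq f (hM phi) TwoSided x y <-> la x = la y) ->
  forall k x y, cell_eq phi k x y <-> cell_inv ka la k x = cell_inv ka la k y.
Proof.
move=> good hL hLR [] x y; rewrite (cell_eq_locked phi); [exact: hL| |exact: hLR].
have cm := hecke_cell_model D phiE good.
by rewrite (ceq_right cm) hL.
Qed.

Section Unequal.
Variable b : bool.
Hypothesis lt_ts : abs_wt wt t < abs_wt wt s.
Hypothesis bE : b = (abs_wt wt t != 0).

Definition kap_wt : R := if b then p t else 0.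

Let s_gt0 : 0 < abs_wt wt s.
Proof. exact: le_lt_trans (abs_wt_ge0 wt t) lt_ts. Qed.

Let np : gr_neg (p s).
Proof. exact/gr_neg_exp/to_oppr_lt0. Qed.

Let t_gt0 : b -> 0 < abs_wt wt t.
Proof. by rewrite bE lt_neqAle eq_sym abs_wt_ge0 andbT. Qed.

Let nk : gr_neg kap_wt.
Proof.
rewrite /kap_wt; case: ifP => [/t_gt0 h|_]; last exact: gr_neg0.
exact/gr_neg_exp/to_oppr_lt0.
Qed.

Let n1 : gr_neg (p s * p t).
Proof.
rewrite -gexpD; apply: gr_neg_exp.
apply: le_lt_trans (to_oppr_lt0 s_gt0).
have : - abs_wt wt t <= 0.
  have := abs_wt_ge0 wt t; rewrite le_eqVlt => /predU1P[<-|/to_oppr_lt0/ltW //].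
  by rewrite oppr0.
by move=> /(@tozmod_leD2r G _ _ (- abs_wt wt s)); rewrite add0r addrC.
Qed.

(** The exponent is |phi t| - |phi s|; this is where the strict inequality between the weights
    enters. *)
Let n2 : gr_neg (p s * p' t).
Proof. by rewrite -gexpD; apply: gr_neg_exp; rewrite addrC; apply: to_subr_lt0. Qed.

Let nu : gr_neg (p s * p t - p s * p' t).
Proof. exact: (gr_negD n1 (gr_negN n2)). Qed.

Let nu' : gr_neg (p s * p' t - p s * p t).
Proof. exact: (gr_negD n2 (gr_negN n1)). Qed.

Let t_eq0 : ~~ b -> p t = p' t.
Proof. by rewrite bE negbK => /eqP ->; rewrite oppr0. Qed.

Let kapE : kap_wt = p t \/ kap_wt = 0 /\ p t = p' t.
Proof. by rewrite /kap_wt; case: ifP => [_|/negbT/t_eq0 h]; [left|right; split]. Qed.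

Let kapE' : if b then kap_wt = p t else kap_wt = 0 /\ p t = p' t.
Proof.
rewrite /kap_wt; have [bT|bF] := boolP b; first by [].
by split=> //; exact: t_eq0.
Qed.

Lemma unequal_good w : spec w.
Proof. exact: (uneq_leads m D np nk nu nu' kapE). Qed.

Let cm := hecke_cell_model D phiE unequal_good.

Let rel := uneq_relations_kl m D np nk nu nu' kapE.
Let rel' := uneq_relations_kl' m D np nk nu nu' kapE.
Let st := uneq_s_t m D np nk nu nu' kapE.
Let tt := uneq_t_t m D nk kapE.
Let t1 := uneq_t_1 m D nk kapE.

Let sgE := sg_sq wt D.
Let lE z h : lo phi wt z h = ((-1) ^+ neg_wt wt z : R) *: hM phi (T z) h.
Proof. exact: loMT. Qed.

Lemma unequal_cells k x y : cell_eq phi k x y <->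
  cell_inv (kappaU S b s t) (lambdaU b t) k x = cell_inv (kappaU S b s t) (lambdaU b t) k y.
Proof.
apply: (cells_from_left unequal_good).
  exact: (uneq_left_cells m cm klE sgE lE sr_sq' D kapE' rel rel' st tt t1).
exact: (uneq_two_sided_cells m cm klE sgE lE sr_sq' D kapE' rel rel' st tt t1).
Qed.

Lemma unequal_closed_p : left_closed S f T (hM phi) [set x | kappaU S b s t x = 2%N].
Proof. exact: (uneq_closed_p cm klE sgE lE sr_sq' D rel). Qed.

Lemma unequal_closed_q : left_closed S f T (hM phi) [set x | kappaU S b s t x = 3%N].
Proof. exact: (uneq_closed_q cm klE sgE lE sr_sq' D rel'). Qed.

Lemma unequal_closed_t : b ->
  left_closed S f T (hM phi) [set x | kappaU S b s t x = 1%N \/ kappaU S b s t x = 3%N].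
Proof. exact: (uneq_closed_t m cm klE sgE lE sr_sq' D kapE' rel' st tt). Qed.

Lemma unequal_right n : ro phi wt s (kl (alt s t n.+1)) = gexp (abs_wt wt s) *: kl (alt s t n.+1).
Proof. exact: (uneq_right_eigen m D np nk nu nu' kapE). Qed.

Lemma unequal_right_t n : b ->
  ro phi wt t (kl (alt t s n.+1)) = gexp (abs_wt wt t) *: kl (alt t s n.+1).
Proof.
move=> bT; apply: (uneq_right_eigen_t m D np nk nu nu' kapE).
by rewrite /kap_wt bT.
Qed.

Lemma unequal_right_q n :
  kl (alt t s n.+2) = ro phi wt t (kl (alt s t n.+1)) + kap_wt *: kl (alt s t n.+1).
Proof. exact: (uneq_kl_right m D np nk nu nu' kapE). Qed.

End Unequal.

Section Equal.
Hypothesis st_eq : abs_wt wt s = abs_wt wt t.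
Hypothesis s_gt0 : 0 < abs_wt wt s.

Let np : gr_neg (p s).
Proof. exact/gr_neg_exp/to_oppr_lt0. Qed.

Let pst : p s = p t.
Proof. by rewrite /= st_eq. Qed.

Let np' : gr_neg (p t).
Proof. by have := np; rewrite pst. Qed.

Lemma equal_good w : spec w.
Proof.
have [->|[k ->]|[k ->]] := dih_cases w D; first exact: (kl_spec1 m).
  exact: (eq_kl_leads m D np pst).
exact: (eq_kl_leads m D' np' (esym pst)).
Qed.

Let cm := hecke_cell_model D phiE equal_good.
Let rel := eq_relations_kl m D np pst.
Let rel' := eq_relations_kl m D' np' (esym pst).
Let sgE := sg_sq wt D.
Let lE z h : lo phi wt z h = ((-1) ^+ neg_wt wt z : R) *: hM phi (T z) h.
Proof. exact: loMT. Qed.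

Lemma equal_cells k x y : cell_eq phi k x y <->
  cell_inv (kappaE S s) (@lambdaE W) k x = cell_inv (kappaE S s) (@lambdaE W) k y.
Proof.
apply: (cells_from_left equal_good).
  exact: (eq_left_cells cm klE sgE lE sr_sq' D rel rel').
exact: (eq_two_sided_cells cm klE sgE lE sr_sq' D rel rel').
Qed.

Lemma equal_closed_p : left_closed S f T (hM phi) [set x | kappaE S s x = 2%N].
Proof. exact: (eq_closed_p cm klE sgE lE sr_sq' D rel). Qed.

Lemma equal_closed_q : left_closed S f T (hM phi) [set x | kappaE S s x = 3%N].
Proof. exact: (eq_closed_q cm klE sgE lE sr_sq' D rel'). Qed.

Lemma equal_right n : ro phi wt s (kl (alt s t n.+1)) = gexp (abs_wt wt s) *: kl (alt s t n.+1).
Proof. exact: (eq_right_eigen m D n np pst). Qed.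

End Equal.

Section Zero.
Hypotheses (s0 : abs_wt wt s = 0) (t0 : abs_wt wt t = 0).

Let ps : p s = p' s. Proof. by rewrite /= s0 oppr0. Qed.
Let pt : p t = p' t. Proof. by rewrite /= t0 oppr0. Qed.

Lemma zero_good w : spec w.
Proof. exact: (zero_leads m D ps pt). Qed.

Lemma all_cells_equal k x y : cell_eq phi k x y.
Proof.
apply/(cell_eq_locked phi); have cm := hecke_cell_model D phiE zero_good.
have lE z h : lo phi wt z h = ((-1) ^+ neg_wt wt z : R) *: hM phi (T z) h by exact: loMT.
apply: (zero_cells cm klE (sg_sq wt D) lE D).
exact: (zero_l m D ps pt).
Qed.

End Zero.

End WeightTypes.

(** * Positive subsets and facets *)

Section PositiveSubsets.
Variable L : zmodType.
Implicit Types (X Y Z : pos L) (a b : L).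

Lemma posN X a : ~ pos_set X a -> pos_set X (- a).
Proof.
have [XT _ _] := pos_positive X; have : (pos_set X `|` (-%R @` pos_set X)) a by rewrite XT.
by move=> [//|[b Xb <-] _]; rewrite opprK.
Qed.

Lemma pos_pi_eqP X a b : pos_pi X a = pos_pi X b <-> pos_set X (a - b) /\ pos_set X (b - a).
Proof.
split=> [/pos_pi_eq/asboolP[h [c Xc e]]|[h1 h2]].
  by split=> //; rewrite -[b - a]opprB -e opprK.
by apply/eqP; rewrite -subr_eq0 -pos_piB; apply/eqP/pos_pi_eq0; rewrite ?opprB.
Qed.

Lemma pos_pi0 X : pos_pi X 0 = 0.
Proof. by rewrite -(subrr 0) pos_piB subrr. Qed.

Lemma pos_ge0 X a : (0 <= pos_pi X a) <-> pos_set X a.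
Proof.
split=> [/asboolP[b Xb]|Xa]; last by apply/asboolP; exists a => //; rewrite subr0.
rewrite subr0 => /pos_pi_eqP [_ h]; have [_ XD _] := pos_positive X.
by rewrite -(subrK b a); apply: XD.
Qed.

Lemma pos_lt0 X a : (pos_pi X a < 0) <-> ~ pos_set X a.
Proof.
rewrite -pos_ge0; split=> [h /(lt_le_trans h)|h]; first by rewrite ltxx.
by have [//|/h] := to_ltVge (pos_pi X a) 0.
Qed.

Lemma pos_gt0 X a : (0 < pos_pi X a) <-> (pos_pi X (- a) < 0).
Proof.
rewrite pos_piN; split; first exact: to_oppr_lt0.
by move/to_oppr_gt0; rewrite opprK.
Qed.

Lemma posHP X a : posH a X <-> pos_pi X a = 0.
Proof.
split=> [[Xa [b Xb e]]|/eqP]; first by apply: pos_pi_eq0; rewrite // -e opprK.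
rewrite -(pos_pi0 X) => /eqP/pos_pi_eqP; rewrite subr0 sub0r => -[h1 h2].
by split=> //; exists (- a) => //; rewrite opprK.
Qed.

Lemma posUP X a : posU [set a] X <-> pos_pi X a < 0.
Proof.
rewrite pos_lt0; split=> [e Xa|Xa].
  by have : (pos_set X `&` [set a]) a by []; rewrite e.
by apply/seteqP; split=> // b [Xb e]; apply: Xa; rewrite -e.
Qed.

Lemma open_posU (E : set L) : finite_set E -> open (posU E).
Proof.
move=> fE; exists [set E]; first by move=> _ ->.
by rewrite bigcup_set1.
Qed.

Lemma pos_nbhs X (B : set (pos L)) : nbhs X B ->
  exists E, [/\ finite_set E, posU E X & posU E `<=` B].
Proof.
rewrite nbhsE => -[U [[D' sD e] UX] UB]; move: UX; rewrite -e => -[E DE EX].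
exists E; split=> // [|Y EY]; first exact: sD.
by apply: UB; rewrite -e; exists E.
Qed.

Lemma closure_lt0 X (C : set (pos L)) a : closure C X -> pos_pi X a < 0 ->
  exists2 Y, C Y & pos_pi Y a < 0.
Proof.
move=> cX /posUP Xa; have /cX[Y [CY /posUP Ya]] : nbhs X (posU [set a]).
  by apply: open_nbhs_nbhs; split=> //; apply: open_posU.
by exists Y.
Qed.

(* Breaking the ties of X by Z moves X off the hyperplanes through it, without crossing
   any other one. *)
Definition refine_set X Z : set L :=
  [set a | 0 < pos_pi X a \/ pos_pi X a = 0 /\ pos_set Z a].

Lemma refine_positive X Z : positive_subset (refine_set X Z).
Proof.
have [ZT ZD [[Z0 _] ZB]] := pos_positive Z.
split.
- apply/seteqP; split=> // a _.
  have [h|h|h] := to_trichotomy (pos_pi X a) 0.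
  + right; exists (- a); last by rewrite opprK.
    by left; apply/pos_gt0; rewrite opprK.
  + have [Za|/posN Za] := EM (pos_set Z a); first by left; right.
    right; exists (- a); last by rewrite opprK.
    by right; rewrite pos_piN h oppr0.
  + by left; left.
- move=> a b; rewrite /refine_set /= pos_piD => -[Xa|[-> Za]] [Xb|[-> Zb]].
  + left; apply: lt_trans Xa _.
    by have := to_ltD (pos_pi X a) Xb; rewrite add0r addrC.
  + by left; rewrite addr0.
  + by left; rewrite add0r.
  + by right; rewrite addr0; split=> //; apply: ZD.
(* The units of the refinement are the common units of X and Z, hence a subgroup. *)
have U a : (refine_set X Z `&` -%R @` refine_set X Z) a <->
    pos_pi X a = 0 /\ (pos_set Z a /\ pos_set Z (- a)).
  split=> [[h1 [b h2 e]]|[h [Za Zb]]].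
    move: h2; rewrite -[b]opprK e /refine_set /= pos_piN.
    case: h1 => [h1|[h1 Za]]; last first.
      by rewrite h1 oppr0 ltxx; move=> [//|[_ Zb]].
    by case=> [/(lt_trans (to_oppr_lt0 h1))|[/eqP]]; rewrite ?ltxx // oppr_eq0 => /eqP e0;
      move: h1; rewrite e0 ltxx.
  split; first by right.
  by exists (- a); rewrite ?opprK //; right; rewrite pos_piN h oppr0.
split; first by apply/U; rewrite pos_pi0 oppr0.
move=> a b /U[Xa [Za Za']] /U[Xb [Zb Zb']]; apply/U.
rewrite pos_piB Xa Xb subrr opprB; split=> //; split; first exact: ZD.
by apply: ZD.
Qed.

Definition refine X Z : pos L := Pos (refine_positive X Z).

Lemma refine_lt0 X Z a : pos_pi (refine X Z) a < 0 <->
  pos_pi X a < 0 \/ pos_pi X a = 0 /\ pos_pi Z a < 0.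
Proof.
have zl := pos_lt0 Z a; rewrite (pos_lt0 (refine X Z) a) /= /refine_set /=.
have [h|h|h] := to_trichotomy (pos_pi X a) 0.
- have n1 : ~ 0 < pos_pi X a by move/(lt_trans h); rewrite ltxx.
  have n2 : pos_pi X a <> 0 by move=> e; move: h; rewrite e ltxx.
  by split=> [_|_ []]; tauto.
- have n1 : ~ 0 < pos_pi X a by rewrite h ltxx.
  have n2 : ~ pos_pi X a < 0 by rewrite h ltxx.
  split=> [h'|[//|[_ /zl h'] [//|[]//]]]; right; split=> //; apply/zl => Za.
  by apply: h'; right.
- have n1 : ~ pos_pi X a < 0 by move/(lt_trans h); rewrite ltxx.
  have n2 : pos_pi X a <> 0 by move=> e; move: h; rewrite e ltxx.
  by split=> [h'|]; tauto.
Qed.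

Lemma refine_gt0 X Z a : 0 < pos_pi (refine X Z) a <->
  0 < pos_pi X a \/ pos_pi X a = 0 /\ 0 < pos_pi Z a.
Proof.
rewrite !pos_gt0 refine_lt0; have e : pos_pi X (- a) = 0 <-> pos_pi X a = 0.
  by rewrite pos_piN; split=> [/eqP|->]; rewrite ?oppr0 // oppr_eq0 => /eqP.
by split=> -[]; tauto.
Qed.

Variable f : {additive L -> int}.

Lemma half_positive : positive_subset [set a | 0 <= f a].
Proof.
split.
- apply/seteqP; split=> // a _ /=; have [h|h] := lerP 0 (f a); first by left.
  by right; exists (- a); rewrite ?opprK //= raddfN oppr_ge0 ltW.
- by move=> a b /= h1 h2; rewrite raddfD addr_ge0.
have U a : ([set a | 0 <= f a] `&` -%R @` [set a | 0 <= f a]) a <-> f a = 0.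
  split=> [[/= h [b /= hb e]]|h /=].
    by apply/eqP; rewrite eq_le h andbT -e raddfN oppr_le0.
  by rewrite /= h lexx; split=> //; exists (- a); rewrite ?opprK //= raddfN h.
split; first by apply/U; rewrite raddf0.
by move=> a b /U ha /U hb; apply/U; rewrite raddfB ha hb.
Qed.

Definition half : pos L := Pos half_positive.

Lemma half_lt0 a : pos_pi half a < 0 <-> f a < 0.
Proof. by rewrite pos_lt0 /= ltNge; split=> [/negP|/negP]. Qed.

Lemma half_gt0 a : 0 < pos_pi half a <-> 0 < f a.
Proof. by rewrite pos_gt0 half_lt0 raddfN oppr_lt0. Qed.

Lemma half_eq0 a : pos_pi half a = 0 <-> f a = 0.
Proof.
have h1 := half_lt0 a; have h2 := half_gt0 a.
have [h|h|h] := to_trichotomy (pos_pi half a) 0.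
- split=> e; first by move: h; rewrite e ltxx.
  by move: h => /h1; rewrite e ltxx.
- split=> // _; have [e|e|//] := ltgtP (f a) 0.
  + by move: e => /h1; rewrite h ltxx.
  + by move: e => /h2; rewrite h ltxx.
- split=> e; first by move: h; rewrite e ltxx.
  by move: h => /h2; rewrite e ltxx.
Qed.

End PositiveSubsets.

(** * Comparison of the cell partitions when weights degenerate *)

Section InvariantTransfer.
Variables (W : groupType) (S : set W) (s t : W).
Hypothesis D : is_dihedral S s t.
Let D' : is_dihedral S t s. Proof. exact: dihedral_sym. Qed.
Implicit Types (P : W -> Prop) (b : bool) (k : side).

Let tE : t = alt t s 1. Proof. by rewrite /= mulg1. Qed.
Let sE : s = alt s t 1. Proof. by rewrite /= mulg1. Qed.

Lemma kappaU_tt b x y : kappaU S true s t x = kappaU S true s t y ->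
  kappaU S b s t x = kappaU S b s t y.
Proof.
have [->|->|[i ->]|[i ->]] := dih_cases2 D x; have [->|->|[j ->]|[j ->]] := dih_cases2 D y;
  by rewrite ?kappaU1 ?(kappaU_t D) ?(kappaU_alt D) ?(kappaU_alt' D).
Qed.

Lemma lambdaU_tt b x y : lambdaU true t x = lambdaU true t y ->
  lambdaU b t x = lambdaU b t y.
Proof.
have [->|->|[i ->]|[i ->]] := dih_cases2 D x; have [->|->|[j ->]|[j ->]] := dih_cases2 D y;
  by rewrite ?lambdaU1 ?(lambdaU_t D) ?(lambdaU_alt D) ?(lambdaU_alt' D).
Qed.

Lemma kappaU_E x y : kappaU S true s t x = kappaU S true s t y ->
  kappaE S s x = kappaE S s y.
Proof.
have [->|->|[i ->]|[i ->]] := dih_cases2 D x; have [->|->|[j ->]|[j ->]] := dih_cases2 D y;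
  by rewrite ?kappaU1 ?(kappaU_t D) ?(kappaU_alt D) ?(kappaU_alt' D) ?kappaE1
    ?(kappaE_alt D) ?(kappaE_alt' D).
Qed.

Lemma lambdaU_E x y : lambdaU true t x = lambdaU true t y -> lambdaE x = lambdaE y.
Proof. by rewrite /lambdaU /lambdaE; do !case: (_ == _). Qed.

Lemma cell_inv_tt b k x y :
  cell_inv (kappaU S true s t) (lambdaU true t) k x =
  cell_inv (kappaU S true s t) (lambdaU true t) k y ->
  cell_inv (kappaU S b s t) (lambdaU b t) k x = cell_inv (kappaU S b s t) (lambdaU b t) k y.
Proof. by case: k; [exact: kappaU_tt|exact: kappaU_tt|exact: lambdaU_tt]. Qed.

Lemma cell_inv_E k x y :
  cell_inv (kappaU S true s t) (lambdaU true t) k x =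
  cell_inv (kappaU S true s t) (lambdaU true t) k y ->
  cell_inv (kappaE S s) (@lambdaE W) k x = cell_inv (kappaE S s) (@lambdaE W) k y.
Proof. by case: k; [exact: kappaU_E|exact: kappaU_E|exact: lambdaU_E]. Qed.

(** Left multiplication by [t] acts at the beginning of the word, so the last letter survives except
    for 1 and [t], which are exchanged. *)
Lemma mul_t_cases x : (x = 1%g \/ x = t) \/
  (exists i j, x = alt s t i.+1 /\ (t * x)%g = alt s t j.+1) \/
  (exists i j, x = alt t s i.+2 /\ (t * x)%g = alt t s j.+2).
Proof.
have [->|->|[i ->]|[i ->]] := dih_cases2 D x; first by left; left.
- by rewrite -tE; left; right.
- right; left; exists i; have [e|e] : t = letter s t i.+1 \/ t = letter s t i.
    by rewrite letterS /letter; case: odd; tauto.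
    by exists i.+1; split=> //; rewrite [RHS]altS -e.
  case: i e => [|i] e.
    by case: (@alt_disj _ _ _ _ 0 0 D); rewrite -sE -tE e.
  by exists i; split=> //; rewrite {1}e (alt_mull _ D).
- right; right; exists i; have [e|e] : t = letter t s i.+2 \/ t = letter t s i.+1.
    by rewrite letterS /letter; case: odd; tauto.
    by exists i.+1; split=> //; rewrite [RHS]altS -e.
  case: i e => [|i] e.
    by case: (@alt_disj _ _ _ _ 0 0 D); rewrite -sE -tE [RHS]e.
  by exists i; split=> //; rewrite {1}e (alt_mull _ D').
Qed.

Lemma kappaU_mul_t x : kappaU S false s t (t * x)%g = kappaU S false s t x.
Proof.
have [[->|->]|[[i [j [-> ->]]]|[i [j [-> ->]]]]] := mul_t_cases x.
- by rewrite mulg1 kappaU1 [X in kappaU _ _ _ _ X]tE (kappaU_t D).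
- by rewrite (dih_ss D') kappaU1 [X in _ = kappaU _ _ _ _ X]tE (kappaU_t D).
- by rewrite !(kappaU_alt D).
- by rewrite !(kappaU_alt' D).
Qed.

Lemma lambdaU_mul_t x : lambdaU false t (t * x)%g = lambdaU false t x.
Proof. by rewrite !(kappa_lambdaU D) kappaU_mul_t. Qed.

Lemma cell_inv_mul_t k x : 
  match k with
  | LeftSide => cell_inv (kappaU S false s t) (lambdaU false t) k (t * x)%g =
                cell_inv (kappaU S false s t) (lambdaU false t) k x
  | RightSide => cell_inv (kappaU S false s t) (lambdaU false t) k (x * t)%g =
                cell_inv (kappaU S false s t) (lambdaU false t) k x
  | TwoSided => cell_inv (kappaU S false s t) (lambdaU false t) k (t * x)%g =
                cell_inv (kappaU S false s t) (lambdaU false t) k x /\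
                cell_inv (kappaU S false s t) (lambdaU false t) k (x * t)%g =
                cell_inv (kappaU S false s t) (lambdaU false t) k x
  end.
Proof.
case: k => /=; first exact: kappaU_mul_t.
  by rewrite invgM (dihV D') kappaU_mul_t.
split; first exact: lambdaU_mul_t.
by rewrite -(lambdaUV D) invgM (dihV D') lambdaU_mul_t (lambdaUV D).
Qed.

Definition inv_closed (P : W -> Prop) (ka : W -> nat) : Prop :=
  forall x y, ka x = ka y -> P x -> P y.

Lemma inv_closedV P ka la : inv_closed P (cell_inv ka la RightSide) ->
  inv_closed (fun x => P x^-1%g) ka.
Proof. by move=> Pc x y e; apply: Pc; rewrite /= !invgK. Qed.

Let closed_false_L P : inv_closed P (kappaU S true s t) -> (forall x, P x -> P (t * x)%g) ->
  inv_closed P (kappaU S false s t).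
Proof.
move=> h1 ht x y.
have P1t : P 1%g -> P t by move/ht; rewrite mulg1.
have Pt1 : P t -> P 1%g by move/ht; rewrite (dih_ss D').
have [->|->|[i ->]|[i ->]] := dih_cases2 D x; have [->|->|[j ->]|[j ->]] := dih_cases2 D y;
  rewrite ?kappaU1 ?(kappaU_t D) ?(kappaU_alt D) ?(kappaU_alt' D) -?tE // => _;
  apply: h1; by rewrite ?(kappaU_alt D) ?(kappaU_alt' D).
Qed.

Let closed_false_LR P : inv_closed P (lambdaU true t) -> (forall x, P x -> P (t * x)%g) ->
  inv_closed P (lambdaU false t).
Proof.
move=> h1 ht x y.
have P1t : P 1%g -> P t by move/ht; rewrite mulg1.
have Pt1 : P t -> P 1%g by move/ht; rewrite (dih_ss D').
have [->|->|[i ->]|[i ->]] := dih_cases2 D x; have [->|->|[j ->]|[j ->]] := dih_cases2 D y;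
  rewrite ?lambdaU1 ?(lambdaU_t D) ?(lambdaU_alt D) ?(lambdaU_alt' D) -?tE // => _;
  apply: h1; by rewrite ?(lambdaU_alt D) ?(lambdaU_alt' D).
Qed.

(** The partitions for [true] and [false] differ only in that the second one merges 1 and [t], and
    stability under [t] forces this. Right cells follow by inversion. *)
Lemma cell_inv_false k P :
  inv_closed P (cell_inv (kappaU S true s t) (lambdaU true t) k) ->
  stable_under k [set t] P ->
  inv_closed P (cell_inv (kappaU S false s t) (lambdaU false t) k).
Proof.
case: k => h1 h2.
- by apply: closed_false_L => // x; apply: h2.
- have := inv_closedV h1 => {}h1 x y e Px; rewrite -[y]invgK.
  apply: (closed_false_L h1 _ e); last by rewrite invgK.
  by move=> u Pu; rewrite invgM (dihV D'); apply: h2.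
- by apply: closed_false_LR => // x Px; case: (h2 t x).
Qed.

Let closed_E_L P : inv_closed P (kappaU S true s t) -> inv_closed P (kappaU S true t s) ->
  inv_closed P (kappaE S s).
Proof.
move=> h1 h2 x y.
have [->|[i ->]|[i ->]] := dih_cases x D; have [->|[j ->]|[j ->]] := dih_cases y D;
  rewrite ?kappaE1 ?(kappaE_alt D) ?(kappaE_alt' D) // => _.
  by apply: h1; rewrite !(kappaU_alt D).
by apply: h2; rewrite !(kappaU_alt D').
Qed.

Let closed_E_LR P : inv_closed P (lambdaU true t) -> inv_closed P (lambdaU true s) ->
  inv_closed P (@lambdaE W).
Proof.
move=> h1 h2 x y.
have st : (s == t) = false by apply/eqP; rewrite [LHS]sE [RHS]tE; exact: (alt_disj D).
rewrite /lambdaE; case: (eqVneq x 1%g) => [->|x1]; case: (eqVneq y 1%g) => [->|y1] // _.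
have s1 : s != 1%g by rewrite [s]sE (altS_neq1 D).
have t1 : t != 1%g by rewrite [t]tE (altS_neq1' D).
have q1 : alt s t 2 != 1%g by rewrite (altS_neq1 D).
have qt : alt s t 2 != t by rewrite (alt_neq_t D).
have qs : alt s t 2 != s by apply/eqP; rewrite [RHS]sE => /(alt_inj D).
have Pt u v : u != 1%g -> v != 1%g -> u != t -> v != t -> P u -> P v.
  by move=> u1 v1 ut vt; apply: h1; rewrite /lambdaU (negbTE u1) (negbTE v1) (negbTE ut) (negbTE vt).
have Ps u v : u != 1%g -> v != 1%g -> u != s -> v != s -> P u -> P v.
  by move=> u1 v1 us vs; apply: h2; rewrite /lambdaU (negbTE u1) (negbTE v1) (negbTE us) (negbTE vs).
have ts : t != s by rewrite eq_sym st.
(* [alt s t 2] is none of 1, [s], [t], so every nontrivial element is joined to it by one of the two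
   partitions. *)
have to u : u != 1%g -> P u -> P (alt s t 2).
  by move=> u1; have [->|ut] := eqVneq u t; [apply: Ps|apply: Pt].
have from u : u != 1%g -> P (alt s t 2) -> P u.
  by move=> u1; have [->|ut] := eqVneq u t; [apply: Ps|apply: Pt].
by move=> /(to x x1) /(from y y1).
Qed.

(** When [s] dominates, the words ending in [s] form a class; when [t] dominates, those ending in
    [t] do. Saturation for both partitions therefore restores the partition for equal weights. *)
Lemma cell_inv_of_both k P :
  inv_closed P (cell_inv (kappaU S true s t) (lambdaU true t) k) ->
  inv_closed P (cell_inv (kappaU S true t s) (lambdaU true s) k) ->
  inv_closed P (cell_inv (kappaE S s) (@lambdaE W) k).
Proof.
case: k => h1 h2; [exact: closed_E_L| |exact: closed_E_LR].
have := closed_E_L (inv_closedV h1) (inv_closedV h2).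
by move=> h x y e Px; rewrite -[y]invgK; apply: (h _ _ e); rewrite invgK.
Qed.

End InvariantTransfer.

(** * Absolute values of weights and the four hyperplanes *)

Section AbsoluteValue.
Variable G : tozmodType.
Implicit Types a b x : G.

Lemma to_subr_gt0 a b : 0 < a - b <-> b < a.
Proof.
split=> [/(to_ltD b)|/(to_ltD (- b))]; first by rewrite subrK add0r.
by rewrite subrr.
Qed.

Lemma to_subr_lt0P a b : a - b < 0 <-> a < b.
Proof.
split=> [/(to_ltD b)|]; first by rewrite subrK add0r.
exact: to_subr_lt0.
Qed.

Lemma to_oppr_lt0P a : - a < 0 <-> 0 < a.
Proof. by split; [move/to_oppr_gt0; rewrite opprK|exact: to_oppr_lt0]. Qed.

Lemma to_ltN a b : a < b -> - b < - a.
Proof. by move/to_subr_lt0P => h; apply/to_subr_lt0P; rewrite opprK addrC. Qed.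

Lemma to_lt_neq a b : a < b -> a = b -> False.
Proof. by move=> ab e; move: ab; rewrite e ltxx. Qed.

Lemma toabs_eq0 a : (toabs a == 0) = (a == 0).
Proof. by rewrite /toabs; case: ifP; rewrite ?oppr_eq0. Qed.

Lemma toabs_lt b x : toabs b < x <-> b < x /\ - b < x.
Proof.
have := toabs_ge0 b; rewrite /toabs; case: ifP => [b0 _|nb0 nb].
  split=> [h|[]//]; split=> //; apply: le_lt_trans h.
  move: b0; rewrite le_eqVlt => /predU1P[<-|b0]; first by rewrite oppr0.
  by apply/ltW/(lt_trans (to_oppr_lt0 b0)).
split=> [h|[]//]; split=> //; apply: lt_trans h; apply: lt_le_trans nb.
by have [//|] := to_ltVge b 0; rewrite nb0.
Qed.

(** Formally, |b| < |a| means that (a - b)(a + b) is positive. This is where the hyperplanes of s -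
    t and s + t come from. *)
Lemma toabs_lt_sign a b : toabs b < toabs a <->
  (0 < a - b /\ 0 < a + b) \/ (a - b < 0 /\ a + b < 0).
Proof.
have e1 := to_subr_gt0 a b; have e2 := to_subr_gt0 a (- b).
have e3 := to_subr_lt0P a b; have e4 := to_subr_lt0P a (- b).
rewrite opprK in e2 e4; rewrite toabs_lt /toabs.
case: ifP => [a0|na0].
  split=> [[/e1 ? /e2 ?]|]; first by left.
  case=> [[/e1 h1 /e2 h2] //|[/e3 /(le_lt_trans a0) b0 /e4 /(le_lt_trans a0)]].
  by move=> /to_oppr_lt0; rewrite opprK => /(lt_trans b0); rewrite ltxx.
split=> [[/to_ltN + /to_ltN]|]; first by rewrite !opprK => /e4 ? /e3 ?; right.
case=> [[/e1 h1 /e2 h2]|[/e3/to_ltN h1 /e4/to_ltN]]; last by rewrite opprK.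
have a0 : a < 0 by have [//|] := to_ltVge a 0; rewrite na0.
have /to_oppr_gt0 := lt_trans h1 a0.
by move=> /(lt_trans (lt_trans h2 a0)); rewrite ltxx.
Qed.

End AbsoluteValue.

HB.lock Definition nrm (W : groupType) (S : set W) (X : pos (ZSbar S)) (o : Sbar S) : pos_quot X :=
  toabs (phi_of X o).

Section Facets.
Variables (W : groupType) (S : set W).
Local Notation L := (ZSbar S).
Local Notation ze := (@ZSbar_elt W S).
Implicit Types (X Y Z : pos (ZSbar S)) (o : Sbar S) (a : ZSbar S).

Lemma nrmE X o : nrm X o = toabs (phi_of X o).
Proof. by rewrite nrm.unlock. Qed.

Lemma nrm_lt X c d : nrm X d < nrm X c <->
  (0 < phi_of X c - phi_of X d /\ 0 < phi_of X c + phi_of X d) \/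
  (phi_of X c - phi_of X d < 0 /\ phi_of X c + phi_of X d < 0).
Proof. by rewrite !nrmE; exact: toabs_lt_sign. Qed.

Lemma phi_ofE X o : phi_of X o = pos_pi X (ze o).
Proof. by []. Qed.

Definition normals (c d : Sbar S) : set L :=
  [set a | [\/ a = ze c, a = ze d, a = ze c - ze d | a = ze c + ze d]].

Definition arr4 (c d : Sbar S) : set (set (pos L)) :=
  [set posH (ze c); posH (ze d); posH (ze c - ze d); posH (ze c + ze d)].

(** Y is a generization of X with respect to the four normals: a sign may degenerate to 0 at X but
    is never reversed. *)
Definition spz (c d : Sbar S) X Y : Prop := forall a, normals c d a ->
  (pos_pi X a < 0 -> pos_pi Y a < 0) /\ (0 < pos_pi X a -> 0 < pos_pi Y a).

Lemma spz_sym c d X Y : spz c d X Y -> spz d c X Y.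
Proof.
move=> h a [->|->|->|->]; first by apply: h; constructor 2.
- by apply: h; constructor 1.
- have [|h1 h2] := h (ze c - ze d); first by constructor 3.
  have e Z : pos_pi Z (ze d - ze c) = - pos_pi Z (ze c - ze d) by rewrite -pos_piN opprB.
  rewrite (e X) (e Y); split=> [/to_oppr_lt0P/h2/to_oppr_lt0P //|].
  by move=> /to_oppr_lt0; rewrite opprK => /h1/to_oppr_gt0.
- by rewrite addrC; apply: h; constructor 4.
Qed.

Lemma spz_dom c d X Y : spz c d X Y -> nrm X d < nrm X c -> nrm Y d < nrm Y c.
Proof.
move=> h /nrm_lt; rewrite !phi_ofE -pos_piB -pos_piD => e.
apply/nrm_lt; rewrite !phi_ofE -pos_piB -pos_piD.
have [|h1 h2] := h (ze c - ze d); first by constructor 3.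
have [|h3 h4] := h (ze c + ze d); first by constructor 4.
by case: e => -[e1 e2]; [left|right]; split; auto.
Qed.

Lemma nrm_eq0 X o : (nrm X o == 0) = (phi_of X o == 0).
Proof. by rewrite nrmE; exact: toabs_eq0. Qed.

Lemma spz_ne0 c d X Y : spz c d X Y -> nrm X c != 0 -> nrm Y c != 0.
Proof.
rewrite !nrm_eq0 => h; have [|h1 h2] := h (ze c); first by constructor 1.
have [e|e|e] := to_trichotomy (phi_of X c) 0.
- by move=> _; apply/eqP => e0; move: (h1 e); rewrite -phi_ofE e0 ltxx.
- by rewrite e eqxx.
- by move=> _; apply/eqP => e0; move: (h2 e); rewrite -phi_ofE e0 ltxx.
Qed.

Lemma spz_neg_wt c d X Y : spz c d X Y -> phi_of X c != 0 ->
  (0 <= phi_of X c) = (0 <= phi_of Y c).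
Proof.
move=> h; have [|h1 h2] := h (ze c); first by constructor 1.
have [e|e|e] := to_trichotomy (phi_of X c) 0.
- have e' : phi_of Y c < 0 by exact: h1.
  by move=> _; apply/idP/idP => [/(lt_le_trans e)|/(lt_le_trans e')]; rewrite ltxx.
- by rewrite e eqxx.
- have e' : 0 < phi_of Y c by exact: h2.
  by rewrite !ltW.
Qed.

Lemma arr_equiv_sym A X Y : arr_equiv A X Y -> arr_equiv A Y X.
Proof. by move=> h a a0 Aa; have [h1 h2 h3] := h a a0 Aa; split; apply: iff_sym. Qed.

Lemma arr_equiv_refl A X : arr_equiv A X X.
Proof. by move=> a a0 Aa; split. Qed.

Lemma arr_equiv_trans A X Y Z : arr_equiv A X Y -> arr_equiv A Y Z -> arr_equiv A X Z.
Proof.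
move=> h h' a a0 Aa; have [h1 h2 h3] := h a a0 Aa; have [h4 h5 h6] := h' a a0 Aa.
by split; [rewrite h1|rewrite h2|rewrite h3].
Qed.

Lemma facet_equiv A F X Y : facet A F -> F X -> F Y -> arr_equiv A X Y.
Proof. by move=> [Z ->] h1 h2; apply: arr_equiv_trans (arr_equiv_sym h1) h2. Qed.

Lemma arr_equivP A X Y : arr_equiv A X Y <-> forall a, a != 0 -> A (posH a) ->
  (pos_pi X a < 0 <-> pos_pi Y a < 0) /\ (0 < pos_pi X a <-> 0 < pos_pi Y a).
Proof.
split=> h a a0 Aa; have := h a a0 Aa.
  move=> [/=]; rewrite !posUP => h1 _ h3; split=> //; rewrite !pos_gt0.
  exact: h3.
rewrite !pos_gt0 => -[h1 h2]; split; [by rewrite !posUP| |by rewrite !posUP].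
rewrite !posHP; have t1 := to_trichotomy (pos_pi X a) 0.
have t2 := to_trichotomy (pos_pi Y a) 0; rewrite -!pos_gt0 in h2.
split=> e; [case: t2 => //; [move/h1|move/h2]|case: t1 => //; [move/h1|move/h2]];
  by rewrite e ltxx.
Qed.

Section TwoClasses.
Variables (c d : Sbar S).
Hypothesis cd : c <> d.

Lemma coef_zec : (ze c)@_c = 1. Proof. by rewrite mcoeffUU. Qed.
Lemma coef_zedc : (ze d)@_c = 0.
Proof. by rewrite mcoeffU; case: eqP => // e; case: cd. Qed.

Lemma normals_neq0 a : normals c d a -> a != 0.
Proof.
have nz (o : Sbar S) b : b@_o <> 0 :> int -> b != 0 :> L.
  by move=> h; apply/eqP => e; apply: h; rewrite e mcoeff0.
move=> [->|->|->|->].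
- by apply: (nz c); rewrite coef_zec.
- by apply: (nz d); rewrite mcoeffUU.
- have e : (ze c - ze d)@_c = 1 - 0.
    exact: etrans (mcoeffB _ _ _) (congr2 (fun x y => x - y) coef_zec coef_zedc).
  by apply: (nz c); rewrite e.
- have e : (ze c + ze d)@_c = 1 + 0.
    exact: etrans (mcoeffD _ _ _) (congr2 (fun x y => x + y) coef_zec coef_zedc).
  by apply: (nz c); rewrite e.
Qed.

Lemma normals_arr4 a : normals c d a -> arr4 c d (posH a).
Proof.
by move=> [->|->|->|->]; rewrite /arr4; [left; left; left|left; left; right|left; right|right].
Qed.

Lemma arr4_arrangement : arrangement (arr4 c d).
Proof.
split; first by rewrite !finite_setU; do !split; exact: finite_set1.
move=> H [[[]|]|] ->.
- by exists (ze c); first exact/normals_neq0/Or41.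
- by exists (ze d); first exact/normals_neq0/Or42.
- by exists (ze c - ze d); first exact/normals_neq0/Or43.
- by exists (ze c + ze d); first exact/normals_neq0/Or44.
Qed.

Lemma arr4_spz X Y : arr_equiv (arr4 c d) X Y -> spz c d X Y.
Proof.
move=> /arr_equivP h a na.
by have [[h1 _] [h2 _]] := h a (normals_neq0 na) (normals_arr4 na).
Qed.

(** A strict sign is an open condition, so one that holds at X holds at some point of the facet, and
    then at all its points. *)
Lemma closure_spz X Ch Y : facet (arr4 c d) Ch -> closure Ch X -> Ch Y -> spz c d X Y.
Proof.
move=> fC cX CY a na.
have sp Z : Ch Z -> spz c d Z Y by move=> CZ; apply/arr4_spz/(facet_equiv fC).
split=> [/(closure_lt0 cX)[Z CZ /(proj1 (sp Z CZ a na)) //]|].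
move=> /pos_gt0/(closure_lt0 cX)[Z CZ /pos_gt0].
exact: (proj2 (sp Z CZ a na)).
Qed.

Lemma chamber_ne0 Ch Y a : chamber (arr4 c d) Ch -> Ch Y -> normals c d a -> pos_pi Y a <> 0.
Proof.
move=> [_ nC] CY na /posHP Ya; have := nC _ (normals_arr4 na).
by move=> e; have : (Ch `&` posH a) Y by []; rewrite e.
Qed.

Lemma chamber_dom Ch Y : chamber (arr4 c d) Ch -> Ch Y ->
  nrm Y d < nrm Y c \/ nrm Y c < nrm Y d.
Proof.
move=> hC CY; have n1 := chamber_ne0 hC CY (Or43 _ _ _ erefl).
have n2 := chamber_ne0 hC CY (Or44 _ _ _ erefl).
have eA : phi_of Y c - phi_of Y d = pos_pi Y (ze c - ze d) by rewrite pos_piB.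
have eA' : phi_of Y d - phi_of Y c = - pos_pi Y (ze c - ze d) by rewrite -pos_piN opprB pos_piB.
have eB : phi_of Y c + phi_of Y d = pos_pi Y (ze c + ze d) by rewrite pos_piD.
have [h1|/n1 //|h1] := to_trichotomy (pos_pi Y (ze c - ze d)) 0;
  have [h2|/n2 //|h2] := to_trichotomy (pos_pi Y (ze c + ze d)) 0;
  [left|right|right|left]; apply/nrm_lt.
- by rewrite eA eB; right.
- by rewrite eA' [phi_of Y d + _]addrC eB; left; split=> //; apply: to_oppr_gt0.
- by rewrite eA' [phi_of Y d + _]addrC eB; right; split=> //; apply: to_oppr_lt0.
- by rewrite eA eB; left.
Qed.

Lemma refine_spz X Z : spz c d X (refine X Z).
Proof. by move=> a _; split=> h; [apply/refine_lt0|apply/refine_gt0]; left. Qed.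

Lemma refine_equiv A X Y Z : arr_equiv A X Y -> arr_equiv A (refine X Z) (refine Y Z).
Proof.
move=> h; apply/arr_equivP => a a0 Aa; have [_] := h a a0 Aa; rewrite !posHP => e0.
have [e1 e2] := (arr_equivP A X Y).1 h a a0 Aa.
rewrite !refine_lt0 !refine_gt0 e1 e2 e0; by split.
Qed.

(** A basic neighbourhood [posU E] of a limit point of F contains some Y in F. Refining Y by the
    same Z stays in [posU E], because strictly negative elements remain so, and leads into the facet
    of [refine X Z]. *)
Lemma refine_facet_le A F X Z : facet A F -> F X ->
  facet_le F [set Y | arr_equiv A (refine X Z) Y].
Proof.
move=> fF FX Y0 cY B /pos_nbhs[E [fE EY EB]].
have [Y [FY UY]] := cY _ (open_nbhs_nbhs (conj (open_posU fE) EY)).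
exists (refine Y Z); split; first exact/refine_equiv/(facet_equiv fF).
apply: EB; apply/seteqP; split=> // a [/= h Ea].
have : pos_pi Y a < 0.
  by apply/posUP/seteqP; split=> // b [Yb eb]; rewrite -UY; split=> //; rewrite eb.
by case: h => [h /(lt_trans h)|[-> _]]; rewrite ltxx.
Qed.

End TwoClasses.

End Facets.

Record two_classes (W : groupType) (S : set W) (s t : W) (cs ct : Sbar S) : Prop := {
  tc_dih : is_dihedral S s t;
  tc_s : forall x, val cs x <-> x = s;
  tc_t : forall x, val ct x <-> x = t;
  tc_all : forall o, o = cs \/ o = ct
}.

Section TwoClasses.
Variables (W : groupType) (S : set W).

Lemma two_classes_sym s t (cs ct : Sbar S) :
  two_classes s t cs ct -> two_classes t s ct cs.
Proof.
by move=> [D hs ht ha]; split=> // [|o]; [exact: dihedral_sym|case: (ha o); [right|left]].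
Qed.

Variables (s t : W) (cs ct : Sbar S).
Hypothesis H : two_classes s t cs ct.
Let D := tc_dih H.

Lemma tc_st : t != s.
Proof.
apply/eqP => e; apply: (@alt_disj _ _ s t 0 0 D).
by rewrite /= /letter /= e.
Qed.

Lemma tc_neq : cs <> ct.
Proof.
move=> e; have v : val ct s by rewrite -e; apply/(tc_s H).
by have /eqP := tc_st; apply; symmetry; apply/(tc_t H).
Qed.

Definition wt_of (X : pos (ZSbar S)) (x : W) : pos_quot X :=
  if x == s then phi_of X cs else phi_of X ct.

Lemma wt_ofE X (o : Sbar S) x : val o x -> phi_of X o = wt_of X x.
Proof.
rewrite /wt_of; have [->|->] := tc_all H o; first by move=> /(tc_s H) ->; rewrite eqxx.
by move=> /(tc_t H) ->; rewrite (negbTE tc_st).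
Qed.

Lemma wt_of_s X : wt_of X s = phi_of X cs. Proof. by rewrite /wt_of eqxx. Qed.
Lemma wt_of_t X : wt_of X t = phi_of X ct. Proof. by rewrite /wt_of (negbTE tc_st). Qed.

Lemma abs_wt_of_s X : abs_wt (wt_of X) s = nrm X cs.
Proof. by rewrite nrmE /abs_wt wt_of_s. Qed.

Lemma abs_wt_of_t X : abs_wt (wt_of X) t = nrm X ct.
Proof. by rewrite nrmE /abs_wt wt_of_t. Qed.

Lemma dom_cells X k x y b : b = (nrm X ct != 0) -> nrm X ct < nrm X cs ->
  cell_eq (phi_of X) k x y <->
  cell_inv (kappaU S b s t) (lambdaU b t) k x = cell_inv (kappaU S b s t) (lambdaU b t) k y.
Proof.
rewrite -abs_wt_of_s -abs_wt_of_t => bE lt.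
exact: (unequal_cells D (@wt_ofE X) lt bE).
Qed.

Lemma eq_cells X k x y : nrm X cs = nrm X ct -> nrm X cs != 0 -> cell_eq (phi_of X) k x y <->
  cell_inv (kappaE S s) (@lambdaE W) k x = cell_inv (kappaE S s) (@lambdaE W) k y.
Proof.
rewrite -abs_wt_of_s -abs_wt_of_t => e n0.
apply: (equal_cells D (@wt_ofE X) e).
by rewrite lt_neqAle eq_sym n0 abs_wt_ge0.
Qed.

Lemma nil_cells X k x y : nrm X cs = 0 -> nrm X ct = 0 -> cell_eq (phi_of X) k x y.
Proof.
rewrite -abs_wt_of_s -abs_wt_of_t => e1 e2.
exact: (all_cells_equal D (@wt_ofE X) e1 e2).
Qed.

End TwoClasses.

(** * Conjecture A for the four hyperplanes *)

Section ConjectureA.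
Variables (W : groupType) (S : set W).
Implicit Types (X Y Z : pos (ZSbar S)) (k : side).
Local Notation ze := (@ZSbar_elt W S).

Lemma spz_cells s t (cs ct : Sbar S) X Y : two_classes s t cs ct -> spz cs ct X Y ->
  spz cs ct Y X -> nrm X ct < nrm X cs ->
  forall k x y, cell_eq (phi_of X) k x y <-> cell_eq (phi_of Y) k x y.
Proof.
move=> H h1 h2 lt k x y; have e : (nrm X ct != 0) = (nrm Y ct != 0).
  by apply/idP/idP; [exact: spz_ne0 (spz_sym h1)|exact: spz_ne0 (spz_sym h2)].
apply: (iff_trans (dom_cells H k x y (esym e) lt)); apply: iff_sym.
exact: (dom_cells H k x y erefl (spz_dom h1 lt)).
Qed.

Lemma nrm_cases s t (cs ct : Sbar S) X : two_classes s t cs ct ->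
  [\/ nrm X ct < nrm X cs, nrm X cs < nrm X ct, nrm X cs = nrm X ct /\ nrm X cs != 0 |
      nrm X cs = 0 /\ nrm X ct = 0].
Proof.
move=> H; have [h|h|h] := to_trichotomy (nrm X cs) (nrm X ct); first by constructor 2.
  have [e|e] := eqVneq (nrm X cs) 0; last by constructor 3.
  by constructor 4; split=> //; exact: etrans (esym h) e.
by constructor 1.
Qed.

Lemma arr4_conjA_a s t (cs ct : Sbar S) k : two_classes s t cs ct ->
  conjA_a (arr4 cs ct) k.
Proof.
move=> H F fF X Y FX FY x y; have cn := tc_neq H.
have h1 := arr4_spz cn (facet_equiv fF FX FY).
have h2 := arr4_spz cn (facet_equiv fF FY FX).
have H' := two_classes_sym H.
have z1 (c d : Sbar S) : spz c d X Y -> spz c d Y X -> (nrm X c == 0) = (nrm Y c == 0).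
  by move=> g1 g2; apply: negb_inj; apply/idP/idP; [exact: spz_ne0 g1|exact: spz_ne0 g2].
have zs := z1 _ _ h1 h2; have zt := z1 _ _ (spz_sym h1) (spz_sym h2).
have [lt|lt|[e n0]|[e1 e2]] := nrm_cases X H; first exact: (spz_cells H).
- exact: (spz_cells H' (spz_sym h1) (spz_sym h2)).
- have e' : nrm Y cs = nrm Y ct.
    have [h|//|h] := to_trichotomy (nrm Y cs) (nrm Y ct).
      by case: (to_lt_neq (spz_dom (spz_sym h2) h) e).
    by case: (to_lt_neq (spz_dom h2 h) (esym e)).
  have n0' : nrm Y cs != 0 by rewrite -zs.
  exact: (iff_trans (eq_cells H k x y e n0) (iff_sym (eq_cells H k x y e' n0'))).
- have e1' : nrm Y cs = 0 by apply/eqP; rewrite -zs e1.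
  have e2' : nrm Y ct = 0 by apply/eqP; rewrite -zt e2.
  split=> _; [exact: (nil_cells H k x y e1' e2')|exact: (nil_cells H k x y e1 e2)].
Qed.

(** If the classes of [E] are admissible and every admissible set is a union of such classes, then
    the minimal admissible sets are exactly the classes. *)
Lemma conjA_b_facet (A : set (set (pos (ZSbar S)))) k F (E : W -> W -> Prop) :
  (forall x y, cell_eqF F k x y <-> E x y) ->
  (forall x, E x x) -> (forall x y, E x y -> E y x) ->
  (forall x y z, E x y -> E y z -> E x z) ->
  (forall Ch, chamber A Ch -> facet_le F Ch -> forall x y, cell_eqF Ch k x y -> E x y) ->
  (forall w, stable_under k (W_facet F) [set x | E x w]) ->
  (forall D, admissible A k F D -> forall x y, E x y -> D x -> D y) ->
  forall D : set W, (exists w, D = [set x | cell_eqF F k x w]) <->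
  (admissible A k F D /\ forall D', admissible A k F D' -> D' `<=` D -> D' = D).
Proof.
move=> hE rE sE tE h1 h2 h3.
have cl w : [set x | cell_eqF F k x w] = [set x | E x w].
  by apply/seteqP; split=> x /hE.
have ad w : admissible A k F [set x | E x w].
  split; [by exists w; exact: rE| |exact: h2].
  by move=> Ch hC le x y xw /(h1 Ch hC le)/sE yx; apply: tE yx xw.
move=> D; split=> [[w ->]|[aD mD]].
  rewrite cl; split=> // D' aD' sD'; apply/seteqP; split=> // x xw.
  have [[v D'v] _ _] := aD'; apply: (h3 D' aD' _ _ _ D'v).
  exact: tE (sD' _ D'v) (sE _ _ xw).
have [[w Dw] _ _] := aD; exists w; rewrite cl; symmetry; apply: mD => // x xw.
exact: h3 aD _ _ (sE _ _ xw) Dw.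
Qed.

Section Facet.
Variables (s t : W) (cs ct : Sbar S).
Hypothesis H : two_classes s t cs ct.
Variables (F : set (pos (ZSbar S))) (X : pos (ZSbar S)).
Hypotheses (fF : facet (arr4 cs ct) F) (FX : F X).
Let D := tc_dih H.
Let D' := dihedral_sym D.
Let cn := tc_neq H.

Lemma cell_eqF_any k C Y x y : facet (arr4 cs ct) C -> C Y ->
  cell_eqF C k x y <-> cell_eq (phi_of Y) k x y.
Proof.
move=> fC CY; split=> [|h Z CZ]; first exact.
exact/(arr4_conjA_a k H fC CY CZ).
Qed.

(** When no normal vanishes at [refine X Z], its facet is a chamber adjacent to F, so its cells
    constrain the admissible sets. *)
Lemma refine_admissible k Z E x y : admissible (arr4 cs ct) k F E ->
  (forall a, normals cs ct a -> pos_pi (refine X Z) a <> 0) ->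
  cell_eq (phi_of (refine X Z)) k x y -> E x -> E y.
Proof.
move=> [_ hE _] n0 xy Ex.
set C : set (pos (ZSbar S)) := [set Y | arr_equiv (arr4 cs ct) (refine X Z) Y].
have fC : facet (arr4 cs ct) C by exists (refine X Z).
have CX : C (refine X Z) by exact: arr_equiv_refl.
have key a Y : normals cs ct a -> C Y -> posH a Y -> False.
  move=> na CY /posHP Y0; have [h1 h2] := arr4_spz cn CY na.
  have [/h1 h|/(n0 _ na)//|/h2 h] := to_trichotomy (pos_pi (refine X Z) a) 0.
    exact: to_lt_neq h Y0.
  exact: to_lt_neq h (esym Y0).
have hC : chamber (arr4 cs ct) C.
  split=> // _ [[[]|]|] ->; apply/seteqP; split=> // Y [CY h].
  - exact: (key _ _ (Or41 _ _ _ erefl) CY h).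
  - exact: (key _ _ (Or42 _ _ _ erefl) CY h).
  - exact: (key _ _ (Or43 _ _ _ erefl) CY h).
  - exact: (key _ _ (Or44 _ _ _ erefl) CY h).
apply: (hE C hC) Ex _; first exact: refine_facet_le.
exact/(cell_eqF_any _ _ _ fC CX).
Qed.

Lemma W_facet_sub (G : set W) : mul_subgroup G ->
  (nrm X cs = 0 -> G s) -> (nrm X ct = 0 -> G t) -> W_facet F `<=` G.
Proof.
move=> sG Gs Gt x; apply=> //; split=> // y [o Fo oy].
have /posHP e := Fo _ FX.
have [eo|eo] := tc_all H o; rewrite eo in e oy.
  by move: oy => /(tc_s H) ->; apply: Gs; apply/eqP; rewrite nrm_eq0; apply/eqP.
by move: oy => /(tc_t H) ->; apply: Gt; apply/eqP; rewrite nrm_eq0; apply/eqP.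
Qed.

Lemma W_facet_mem o x : val o x -> nrm X o = 0 -> W_facet F x.
Proof.
move=> ox /eqP; rewrite nrm_eq0 => /eqP e G [_ sG]; apply: sG; exists o => // Y FY.
have eq := facet_equiv fF FX FY; apply/posHP; move: e; rewrite phi_ofE => /posHP e.
have no : normals cs ct (ze o).
  by have [->|->] := tc_all H o; [exact: Or41|exact: Or42].
have [_ h _] := eq (ze o) (normals_neq0 cn no) (normals_arr4 no).
exact/posHP/h.
Qed.

Lemma stable_trivial k (E : set W) : (forall g, W_facet F g -> g = 1%g) ->
  stable_under k (W_facet F) E.
Proof.
by move=> h g x /h -> Ex; case: k; rewrite ?mul1g ?mulg1.
Qed.

End Facet.

End ConjectureA.

Lemma toabs_ge (G : tozmodType) (a : G) : a <= toabs a /\ - a <= toabs a.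
Proof.
rewrite /toabs; case: ifP => [|a0].
  rewrite le_eqVlt => /predU1P[<-|a0]; first by rewrite oppr0.
  by split=> //; apply/ltW/(lt_trans _ a0)/to_oppr_lt0.
have {}a0 : a < 0 by have [//|] := to_ltVge a 0; rewrite a0.
by split=> //; apply/ltW/(lt_trans a0)/to_oppr_gt0.
Qed.

Lemma pos_pi_opprB (L : zmodType) (X : pos L) a b : pos_pi X (a - b) = - pos_pi X (b - a).
Proof. by rewrite -pos_piN opprB. Qed.

Lemma posH4_sym (L : zmodType) (a b : L) :
  [set posH a; posH b; posH (a - b); posH (a + b)] =
  [set posH b; posH a; posH (b - a); posH (b + a)].
Proof.
have e : posH (a - b) = posH (b - a).
  by apply/seteqP; split=> X /posHP h; apply/posHP; rewrite pos_pi_opprB h oppr0.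
by rewrite e (addrC a b) (setUC [set posH a]).
Qed.

Section Functionals.
Variables (W : groupType) (S : set W) (c d : Sbar S) (m n : int).
Local Notation ze := (@ZSbar_elt W S).

Definition coordf (a : ZSbar S) : int :=
  (a : {malg int[Sbar S]})@_c * m + (a : {malg int[Sbar S]})@_d * n.

Lemma coordf_is_zmod_morphism : zmod_morphism coordf.
Proof.
move=> a b; rewrite /coordf.
have e o : ((a - b : ZSbar S) : {malg int[Sbar S]})@_o =
  (a : {malg int[Sbar S]})@_o - (b : {malg int[Sbar S]})@_o by exact: mcoeffB.
rewrite (e c) (e d); ring.
Qed.

HB.instance Definition _ := GRing.isZmodMorphism.Build _ _ coordf coordf_is_zmod_morphism.

Hypothesis cd : c <> d.

Lemma coordf_c : coordf (ze c) = m.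
Proof.
have e1 : (ze c : {malg int[Sbar S]})@_c = 1 by exact: mcoeffUU.
have e2 : (ze c : {malg int[Sbar S]})@_d = 0.
  by rewrite mcoeffU; case: eqP.
by rewrite /coordf e1 e2 mul1r mul0r addr0.
Qed.

Lemma coordf_d : coordf (ze d) = n.
Proof.
have e1 : (ze d : {malg int[Sbar S]})@_d = 1 by exact: mcoeffUU.
have e2 : (ze d : {malg int[Sbar S]})@_c = 0.
  by rewrite mcoeffU; case: eqP => // e; case: cd.
by rewrite /coordf e1 e2 mul1r mul0r add0r.
Qed.

End Functionals.

Section ConjectureAFacets.
Variables (W : groupType) (S : set W).
Implicit Types (X Y Z : pos (ZSbar S)) (k : side).
Local Notation ze := (@ZSbar_elt W S).

Lemma arr4_sym (c d : Sbar S) : arr4 c d = arr4 d c.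
Proof. exact: posH4_sym. Qed.

Definition generic (c d : Sbar S) X : Prop := forall a, normals c d a -> pos_pi X a <> 0.

Lemma generic_nrm c d X : generic c d X -> nrm X c != 0.
Proof.
move=> g; rewrite nrm_eq0; apply/eqP; rewrite phi_ofE; apply: g; exact: Or41.
Qed.

Lemma generic_sym c d X : generic c d X -> generic d c X.
Proof.
move=> g a [->|->|->|->]; [apply: g; exact: Or42|apply: g; exact: Or41| |].
  move=> h; apply: (g _ (Or43 _ _ _ erefl)).
  exact: etrans (pos_pi_opprB _ _ _) (etrans (congr1 -%R h) (oppr0 _)).
by rewrite (addrC (ze d)); apply: g; exact: Or44.
Qed.

(** The inequality already makes c, c - d and c + d nonzero at X; the functional [coordf c d 0 1]
    has only to move d off 0. *)
Lemma dom_refine (c d : Sbar S) X : c <> d -> nrm X d < nrm X c -> exists Z,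
  nrm (refine X Z) d < nrm (refine X Z) c /\ generic c d (refine X Z).
Proof.
move=> cd lt; pose Z := half (coordf c d 0 1 : {additive ZSbar S -> int}).
have sp := @refine_spz _ _ c d X Z.
have ne a : normals c d a -> pos_pi X a <> 0 -> pos_pi (refine X Z) a <> 0.
  move=> na X0; have [h1 h2] := sp a na.
  have [/h1 h|//|/h2 h] := to_trichotomy (pos_pi X a) 0; first exact: to_lt_neq h.
  by move=> /esym; exact: to_lt_neq h.
exists Z; split; first exact: spz_dom sp lt.
have [[d1 d2] [s1 s2]] : (phi_of X c - phi_of X d <> 0 /\ phi_of X c + phi_of X d <> 0) /\
    (phi_of X c <> 0 /\ True).
  split; last first.
    split=> //; apply/eqP; rewrite -nrm_eq0; apply/eqP => /esym.
    apply: to_lt_neq; apply: le_lt_trans lt; rewrite nrmE; exact: toabs_ge0.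
  have /nrm_lt[[h1 h2]|[h1 h2]] := lt.
    by split=> /esym; [exact: to_lt_neq h1|exact: to_lt_neq h2].
  by split; [exact: to_lt_neq h1|exact: to_lt_neq h2].
move=> a [->|->|->|->].
- by apply: ne; first exact: Or41.
- have [e|e] := EM (pos_pi X (ze d) = 0); last by apply: ne; first exact: Or42.
  have h : 0 < pos_pi (refine X Z) (ze d).
    apply/refine_gt0; right; split; first exact: e.
    apply/half_gt0; have cE := coordf_d 0 1 cd.
    by rewrite -[X in 0 < X]/(coordf c d 0 1 (ze d)) cE.
  by move=> /esym; exact: to_lt_neq h.
- by apply: ne; [exact: Or43|rewrite pos_piB].
- by apply: ne; [exact: Or44|rewrite pos_piD].
Qed.

End ConjectureAFacets.

Section ConjectureAFacets.
Variables (W : groupType) (S : set W).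
Implicit Types (X Y Z : pos (ZSbar S)) (k : side).
Local Notation ze := (@ZSbar_elt W S).

Lemma to_le_gt0 (G : tozmodType) (a : G) : 0 <= a -> 0 < a \/ a = 0.
Proof. by rewrite le_eqVlt => /predU1P[->|]; [right|left]. Qed.

Lemma nonneg_refine_gt0 X Z (a : ZSbar S) : 0 <= pos_pi X a -> 0 < pos_pi Z a ->
  0 < pos_pi (refine X Z) a.
Proof.
by move=> /to_le_gt0[h _|h hZ]; apply/refine_gt0; [left|right].
Qed.

Lemma nonpos_refine_lt0 X Z (a : ZSbar S) : pos_pi X a <= 0 -> pos_pi Z a < 0 ->
  pos_pi (refine X Z) a < 0.
Proof.
by rewrite le_eqVlt => /predU1P[h hZ|h _]; apply/refine_lt0; [right|left].
Qed.

Lemma to_le_sub (G : tozmodType) (a b : G) : b <= a -> 0 <= a - b.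
Proof. by move=> /(@tozmod_leD2r G _ _ (- b)); rewrite subrr. Qed.

Lemma to_sub_le (G : tozmodType) (a b : G) : a <= b -> a - b <= 0.
Proof. by move=> /(@tozmod_leD2r G _ _ (- b)); rewrite subrr. Qed.

Lemma to_le_opp (G : tozmodType) (a b : G) : - b <= - a -> a <= b.
Proof. by move=> /(@tozmod_leD2r G _ _ (a + b)); rewrite addrC addrK addKr. Qed.

(** Here c - d or c + d vanishes at X. Enlarging c in the direction of its own sign breaks the tie
    in favour of c, hence the functional [coordf c d m 0] with [m] the sign of c. *)
Lemma eq_refine (c d : Sbar S) X : c <> d -> nrm X c = nrm X d -> nrm X c != 0 ->
  exists Z, nrm (refine X Z) d < nrm (refine X Z) c /\ generic c d (refine X Z).
Proof.
move=> cd e c0; have sp := @refine_spz _ _ c d X.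
have d0 : nrm X d != 0 by rewrite -e.
have gen Z : pos_pi (refine X Z) (ze c - ze d) <> 0 -> pos_pi (refine X Z) (ze c + ze d) <> 0 ->
    generic c d (refine X Z).
  move=> h1 h2 a [->|->|->|->] //; rewrite -phi_ofE; apply/eqP; rewrite -nrm_eq0.
    exact: (spz_ne0 (sp Z) c0).
  exact: (spz_ne0 (spz_sym (sp Z)) d0).
have [l1 l2] := toabs_ge (phi_of X d); rewrite -nrmE -e in l1 l2.
have ph0 : phi_of X c <> 0 by apply/eqP; rewrite -nrm_eq0.
pose f (m : int) := (coordf c d m 0 : {additive ZSbar S -> int}).
have fB (m : int) : f m (ze c - ze d) = m.
  have h1 := coordf_c m 0 cd; have h2 := coordf_d m 0 cd.
  have -> : f m (ze c - ze d) = coordf c d m 0 (ze c) - coordf c d m 0 (ze d) by exact: raddfB.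
  exact: etrans (congr2 (fun x y => x - y) h1 h2) (subr0 m).
have fD (m : int) : f m (ze c + ze d) = m.
  have h1 := coordf_c m 0 cd; have h2 := coordf_d m 0 cd.
  have -> : f m (ze c + ze d) = coordf c d m 0 (ze c) + coordf c d m 0 (ze d) by exact: raddfD.
  exact: etrans (congr2 (fun x y => x + y) h1 h2) (addr0 m).
have eB Y : pos_pi Y (ze c - ze d) = phi_of Y c - phi_of Y d by exact: pos_piB.
have eD Y : pos_pi Y (ze c + ze d) = phi_of Y c + phi_of Y d by exact: pos_piD.
have [p|//|p] := to_trichotomy (phi_of X c) 0.
  have nE : nrm X c = - phi_of X c.
    by rewrite nrmE /toabs; case: ifP => // /(lt_le_trans p); rewrite ltxx.
  rewrite nE in l1 l2; pose Z := half (f (-1)).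
  have h1 : pos_pi (refine X Z) (ze c - ze d) < 0.
    apply: nonpos_refine_lt0; last by apply/half_lt0; rewrite fB.
    by rewrite eB; apply: to_sub_le; apply: to_le_opp.
  have h2 : pos_pi (refine X Z) (ze c + ze d) < 0.
    apply: nonpos_refine_lt0; last by apply/half_lt0; rewrite fD.
    rewrite eD addrC -[phi_of X c]opprK; apply: to_sub_le; exact: l1.
  exists Z; split; last by apply: gen; [exact: to_lt_neq h1|exact: to_lt_neq h2].
  by apply/nrm_lt; rewrite -eB -eD; right.
have nE : nrm X c = phi_of X c.
  by rewrite nrmE /toabs; case: ifP => //; rewrite ltW.
rewrite nE in l1 l2; pose Z := half (f 1).
have h1 : 0 < pos_pi (refine X Z) (ze c - ze d).
  apply: nonneg_refine_gt0; last by apply/half_gt0; rewrite fB.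
  by rewrite eB; apply: to_le_sub.
have h2 : 0 < pos_pi (refine X Z) (ze c + ze d).
  apply: nonneg_refine_gt0; last by apply/half_gt0; rewrite fD.
  by rewrite eD -[phi_of X d]opprK; apply: to_le_sub.
exists Z; split; last by apply: gen => /esym; [exact: to_lt_neq h1|exact: to_lt_neq h2].
by apply/nrm_lt; rewrite -eB -eD; left.
Qed.

Lemma chamber_inhabited A (Ch : set (pos (ZSbar S))) : chamber A Ch -> exists Y, Ch Y.
Proof. by move=> [[Y ->] _]; exists Y; exact: arr_equiv_refl. Qed.

Lemma conjA_b_inv (A : set (set (pos (ZSbar S)))) k F (inv : W -> nat) :
  (forall x y, cell_eqF F k x y <-> inv x = inv y) ->
  (forall Ch, chamber A Ch -> facet_le F Ch -> forall x y, cell_eqF Ch k x y -> inv x = inv y) ->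
  (forall w, stable_under k (W_facet F) [set x | inv x = inv w]) ->
  (forall D, admissible A k F D -> inv_closed D inv) ->
  forall D : set W, (exists w, D = [set x | cell_eqF F k x w]) <->
  (admissible A k F D /\ forall D', admissible A k F D' -> D' `<=` D -> D' = D).
Proof.
by move=> h1 h2 h3 h4; apply: (conjA_b_facet h1) => // x y z ->.
Qed.

Section OneFacet.
Variables (s t : W) (cs ct : Sbar S).
Hypothesis H : two_classes s t cs ct.
Variables (F : set (pos (ZSbar S))) (X : pos (ZSbar S)).
Hypotheses (fF : facet (arr4 cs ct) F) (FX : F X).
Let D := tc_dih H.
Let D' := dihedral_sym D.
Let cn := tc_neq H.

Lemma adjacent_cells Ch : chamber (arr4 cs ct) Ch -> facet_le F Ch -> exists Y,
  [/\ spz cs ct X Y, generic cs ct Y, forall k x y, cell_eqF Ch k x y -> cell_eq (phi_of Y) k x y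
    & nrm Y ct < nrm Y cs \/ nrm Y cs < nrm Y ct].
Proof.
move=> hC le; have [Y CY] := chamber_inhabited hC; exists Y; split.
- apply: (closure_spz cn hC.1 _ CY); apply: le; exact: subset_closure.
- by move=> a na; exact: (chamber_ne0 hC CY na).
- by move=> k x y; apply.
- exact: (chamber_dom hC CY).
Qed.

Lemma conjA_b_dom k : nrm X ct < nrm X cs -> forall E : set W,
  (exists w, E = [set x | cell_eqF F k x w]) <->
  (admissible (arr4 cs ct) k F E /\
   forall E', admissible (arr4 cs ct) k F E' -> E' `<=` E -> E' = E).
Proof.
move=> lt; pose b := nrm X ct != 0.
have cs0 : nrm X cs <> 0.
  by move=> /esym; apply: to_lt_neq; apply: le_lt_trans lt; rewrite nrmE; exact: toabs_ge0.
apply: (@conjA_b_inv _ _ _ (cell_inv (kappaU S b s t) (lambdaU b t) k)) => [x y|Ch hC le x y|w|E aE].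
- exact: iff_trans (cell_eqF_any H k x y fF FX) (dom_cells H k x y erefl lt).
- have [Y [sp g hY _] /hY] := adjacent_cells hC le.
  move=> /(dom_cells H k x y (esym (generic_nrm (generic_sym g))) (spz_dom sp lt)).
  exact: cell_inv_tt.
- have [bT|bF] := boolP b.
    apply: stable_trivial => g; apply: (W_facet_sub H FX (G := [set 1%g])).
    + by split=> // x y -> ->; rewrite invg1 mulg1.
    + by move=> e; case: cs0.
    + by move=> e; move: bT; rewrite /b e eqxx.
  have Wt g : W_facet F g -> g = 1%g \/ g = t.
    apply: (W_facet_sub H FX (G := [set g | g = 1%g \/ g = t])).
    + split=> [|x y]; first by left.
      by move=> [->|->] [->|->]; rewrite /= ?invg1 ?(dihV D') ?mulg1 ?mul1g ?(dih_ss D'); tauto.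
    + by move=> e; case: cs0.
    + by move=> _; right.
  move=> g x /Wt [->|->].
    by case: k => /=; rewrite ?mul1g ?mulg1.
  have := cell_inv_mul_t D k x; case: k => /=; [move=> -> //|move=> -> //|].
  by move=> [e1 e2] xw; split; rewrite ?e1 ?e2.
(* One adjacent chamber already gives saturation for the generic partition; if [t] has weight 0,
   stability under [t] gives the rest. *)
- have [Z [ltZ gZ]] := dom_refine cn lt.
  have cl : inv_closed E (cell_inv (kappaU S true s t) (lambdaU true t) k).
    move=> x y e; apply: (refine_admissible H fF FX aE gZ).
    by apply/(dom_cells H k x y (esym (generic_nrm (generic_sym gZ))) ltZ).
  rewrite /b; have [bT|bF] := boolP (nrm X ct != 0); first exact: cl.
  apply: (cell_inv_false D cl) => g x ->; have [_ _ st] := aE; apply: st.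
  apply: (W_facet_mem H fF FX (o := ct)); first exact/(tc_t H).
  by apply/eqP; move: bF; rewrite negbK.
Qed.

Lemma conjA_b_eq k : nrm X cs = nrm X ct -> nrm X cs != 0 -> forall E : set W,
  (exists w, E = [set x | cell_eqF F k x w]) <->
  (admissible (arr4 cs ct) k F E /\
   forall E', admissible (arr4 cs ct) k F E' -> E' `<=` E -> E' = E).
Proof.
move=> e n0; have H' := two_classes_sym H.
have n0' : nrm X ct != 0 by rewrite -e.
apply: (@conjA_b_inv _ _ _ (cell_inv (kappaE S s) (@lambdaE W) k)) => [x y|Ch hC le x y|w|E aE].
- exact: iff_trans (cell_eqF_any H k x y fF FX) (eq_cells H k x y e n0).
- have [Y [sp g hY dY] /hY] := adjacent_cells hC le; case: dY => dY.
    move=> /(dom_cells H k x y (esym (generic_nrm (generic_sym g))) dY); exact: cell_inv_E.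
  move=> /(dom_cells H' k x y (esym (generic_nrm g)) dY) /(cell_inv_E D') i.
  by apply/(eq_cells H k x y e n0)/(eq_cells H' k x y (esym e) n0').
- apply: stable_trivial => g; apply: (W_facet_sub H FX (G := [set 1%g])).
  + by split=> // x y -> ->; rewrite invg1 mulg1.
  + by move=> e0; move: n0; rewrite e0 eqxx.
  + by move=> e0; move: n0'; rewrite e0 eqxx.
(* The tie is broken once in favour of each letter, which yields saturation for both generic
   partitions. *)
- have [Z [ltZ gZ]] := eq_refine cn e n0.
  have [Z' [ltZ' gZ']] := eq_refine (nesym cn) (esym e) n0'.
  apply: (cell_inv_of_both D) => x y i.
    apply: (refine_admissible H fF FX aE gZ).
    by apply/(dom_cells H k x y (esym (generic_nrm (generic_sym gZ))) ltZ).
  apply: (refine_admissible H fF FX aE (generic_sym gZ')).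
  by apply/(dom_cells H' k x y (esym (generic_nrm (generic_sym gZ'))) ltZ').
Qed.

Lemma conjA_b_nil k : nrm X cs = 0 -> nrm X ct = 0 -> forall E : set W,
  (exists w, E = [set x | cell_eqF F k x w]) <->
  (admissible (arr4 cs ct) k F E /\
   forall E', admissible (arr4 cs ct) k F E' -> E' `<=` E -> E' = E).
Proof.
move=> e1 e2; apply: (@conjA_b_inv _ _ _ (fun _ => 0%N)) => [x y|||E aE x y _ Ex] //.
- split=> // _; apply/(cell_eqF_any H k x y fF FX); exact: (nil_cells H).
- by move=> w g x; case: k.
(* Both generators lie in [W_facet F], which is therefore all of W, and translations act
   transitively. *)
have [_ _ st] := aE; have WT g : W_facet F g.
  have [_ _ _ gS _] := D.
  have : smallest (@mul_subgroup W) S g by rewrite gS.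
  apply; split=> [|z Sz].
    split=> [G [[] //]|u v Wu Wv G GG].
    by have [[_ GB] _] := GG; apply: GB; [exact: Wu|exact: Wv].
  have [->|->] := dih_SP D Sz.
    apply: (W_facet_mem H fF FX (o := cs)) => //; exact/(tc_s H).
  apply: (W_facet_mem H fF FX (o := ct)) => //; exact/(tc_t H).
move: st; clear -Ex WT; case: k => st.
- by have := st (y * x^-1)%g x (WT _) Ex; rewrite mulgVK.
- by have := st (x^-1 * y)%g x (WT _) Ex; rewrite mulgA mulgV mul1g.
- by have [] := st (y * x^-1)%g x (WT _) Ex; rewrite mulgVK.
Qed.

End OneFacet.

Lemma facet_inhabited A (F : set (pos (ZSbar S))) : facet A F -> exists X, F X.
Proof. by move=> [X ->]; exists X; exact: arr_equiv_refl. Qed.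

Theorem arr4_conjA s t (cs ct : Sbar S) : two_classes s t cs ct ->
  conjA_arrangement (arr4 cs ct).
Proof.
move=> H; have cn := tc_neq H; split; first exact: (arr4_arrangement cn).
  by move=> o; apply: normals_arr4; have [->|->] := tc_all H o; [exact: Or41|exact: Or42].
move=> k; split; first exact: (arr4_conjA_a k H).
move=> F fF; have [X FX] := facet_inhabited fF.
have [h|h|[h1 h2]|[h1 h2]] := nrm_cases X H.
- exact: (conjA_b_dom H fF FX).
- move: fF; rewrite arr4_sym => fF.
  exact: (conjA_b_dom (two_classes_sym H) fF FX).
- exact: (conjA_b_eq H fF FX).
- exact: (conjA_b_nil H fF FX).
Qed.

Lemma to_mulrn_gt0 (G : tozmodType) (x : G) n : 0 < x -> 0 < x *+ n.+1.
Proof.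
move=> x0; elim: n => [|n IH]; first by rewrite mulr1n.
rewrite mulrS; apply: (lt_trans x0); have := to_ltD x IH.
by rewrite add0r addrC.
Qed.

Lemma to_mulrn_eq0 (G : tozmodType) (x : G) n : x *+ n.+1 = 0 -> x = 0.
Proof.
move=> e; have [h|//|h] := to_trichotomy x 0; last first.
  by case: (to_lt_neq (to_mulrn_gt0 n h) (esym e)).
have := to_mulrn_gt0 n (to_oppr_gt0 h).
by rewrite mulNrn e oppr0 ltxx.
Qed.

Lemma to_mulrz_eq0 (G : tozmodType) (x : G) (n : int) : n != 0 -> x *~ n = 0 -> x = 0.
Proof.
case: n => [[|n]|n] //= _; first exact: to_mulrn_eq0.
by rewrite NegzE mulrNz => /eqP; rewrite oppr_eq0 => /eqP; apply: to_mulrn_eq0.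
Qed.

(** The quotients by units are totally ordered groups, hence torsion-free. *)
Lemma posH_mulz (L : zmodType) (a : L) (n : int) : n != 0 -> posH (a *~ n) = posH a.
Proof.
move=> n0; have e (X : pos L) : pos_pi X (a *~ n) = pos_pi X a *~ n.
  exact: (raddfMz (\pi_(Quotient.quot (pos_units X)) : {additive L -> _}) n a).
apply/seteqP; split=> X /posHP h; apply/posHP.
  by move: h; rewrite e; apply: to_mulrz_eq0.
by rewrite e h mul0rz.
Qed.

End ConjectureAFacets.

Lemma sub_add0_sym (G : zmodType) (a b : G) :
  a - b = 0 \/ a + b = 0 -> b - a = 0 \/ b + a = 0.
Proof.
move=> [h|h]; [left|right]; last by rewrite addrC.
by apply: oppr_inj; rewrite opprB oppr0.
Qed.

Lemma nrm_ngt (W : groupType) (S : set W) (X : pos (ZSbar S)) (c d : Sbar S) :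
  phi_of X c - phi_of X d = 0 \/ phi_of X c + phi_of X d = 0 -> ~ nrm X d < nrm X c.
Proof.
by move=> z /nrm_lt[[h1 h2]|[h1 h2]]; case: z => z; [exact: (to_lt_neq h1 (esym z))|
  exact: (to_lt_neq h2 (esym z))|exact: (to_lt_neq h1 z)|exact: (to_lt_neq h2 z)].
Qed.

(** * Necessity of the hyperplanes of s - t and s + t *)

Section Essential.
Variables (W : groupType) (S : set W) (s t : W) (cs ct : Sbar S).
Hypothesis H : two_classes s t cs ct.
Implicit Types (X Y Z : pos (ZSbar S)).
Local Notation ze := (@ZSbar_elt W S).
Let D := tc_dih H.
Let D' := dihedral_sym D.
Let cn := tc_neq H.

Variable eps : int.
Hypothesis epsE : eps = 1 \/ eps = -1.

Let f (m n : int) := (coordf cs ct m n : {additive ZSbar S -> int}).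
Let e : ZSbar S := ze cs - ze ct *~ eps.
(** The weights of [s] and [t] at [X0] are 1 and [eps], so that one sign treats both hyperplanes;
    [e] generates the kernel. [X1] breaks the tie in favour of [s]. *)
Let X0 : pos (ZSbar S) := half (f 1 eps).
Let X1 : pos (ZSbar S) := refine X0 (half (f 1 0)).

Let fs m n : f m n (ze cs) = m. Proof. exact: coordf_c. Qed.
Let ft m n : f m n (ze ct) = n. Proof. exact: coordf_d. Qed.

(** Together with [posH_mulz], this makes [posH e] the only rational hyperplane through [X0]. *)
Lemma kernel_multiple (a : ZSbar S) : f 1 eps a = 0 -> a = e *~ (a : {malg int[Sbar S]})@_cs.
Proof.
rewrite -[f 1 eps a]/(coordf cs ct 1 eps a) /coordf; set u := _@_cs; set v := _@_ct.
rewrite mulr1 => uv; have {uv}vE : v = - (u * eps).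
  by case: epsE uv => ->; lia.
have cE (o : Sbar S) : ((e *~ u : ZSbar S) : {malg int[Sbar S]})@_o =
    ((ze cs : {malg int[Sbar S]})@_o - (ze ct : {malg int[Sbar S]})@_o *~ eps) *~ u.
  have c1 : ((e *~ u : ZSbar S) : {malg int[Sbar S]})@_o = (e : {malg int[Sbar S]})@_o *~ u.
    exact: (raddfMz (mcoeff o : {additive {malg int[Sbar S]} -> int}) u e).
  have c2 : (e : {malg int[Sbar S]})@_o = (ze cs : {malg int[Sbar S]})@_o -
      ((ze ct *~ eps : ZSbar S) : {malg int[Sbar S]})@_o by exact: mcoeffB.
  have c3 : ((ze ct *~ eps : ZSbar S) : {malg int[Sbar S]})@_o = (ze ct : {malg int[Sbar S]})@_o *~ eps.
    exact: (raddfMz (mcoeff o : {additive {malg int[Sbar S]} -> int}) eps (ze ct)).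
  by rewrite c1 c2 c3.
have zs (o : Sbar S) : (ze cs : {malg int[Sbar S]})@_o = if cs == o then 1 else 0.
  by rewrite mcoeffU; case: ifP.
have zt (o : Sbar S) : (ze ct : {malg int[Sbar S]})@_o = if ct == o then 1 else 0.
  by rewrite mcoeffU; case: ifP.
have n1 : (cs == ct) = false by apply/eqP.
have n2 : (ct == cs) = false by apply/eqP/nesym.
apply/malgP => o; rewrite cE zs zt; have [->|->] := tc_all H o; rewrite eqxx ?n1 ?n2.
  by rewrite mul0rz subr0 intz.
by rewrite -/v vE; case: epsE => ->; lia.
Qed.

Let fB m n : f m n (ze cs - ze ct) = m - n.
Proof. exact: etrans (raddfB _ _ _) (congr2 (fun x y => x - y) (fs m n) (ft m n)). Qed.

Let fD m n : f m n (ze cs + ze ct) = m + n.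
Proof. exact: etrans (raddfD _ _ _) (congr2 (fun x y => x + y) (fs m n) (ft m n)). Qed.

Let eB X : pos_pi X (ze cs - ze ct) = phi_of X cs - phi_of X ct.
Proof. exact: pos_piB. Qed.
Let eD X : pos_pi X (ze cs + ze ct) = phi_of X cs + phi_of X ct.
Proof. exact: pos_piD. Qed.

Let X0_cs : nrm X0 cs != 0.
Proof.
rewrite nrm_eq0; apply/eqP => /esym; apply: to_lt_neq.
by apply/half_gt0; rewrite fs.
Qed.

Let X0_ct : nrm X0 ct != 0.
Proof.
rewrite nrm_eq0; apply/eqP => h; have : f 1 eps (ze ct) = 0 by apply/half_eq0.
by rewrite ft; case: epsE => ->.
Qed.

Let X0_eq : nrm X0 cs = nrm X0 ct.
Proof.
have z : phi_of X0 cs - phi_of X0 ct = 0 \/ phi_of X0 cs + phi_of X0 ct = 0.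
  case: epsE => h; [left|right].
    by rewrite -eB; apply/half_eq0; rewrite fB h.
  by rewrite -eD; apply/half_eq0; rewrite fD h.
have [/(nrm_ngt (sub_add0_sym z))//|//|/(nrm_ngt z)//] := to_trichotomy (nrm X0 cs) (nrm X0 ct).
Qed.

Let sp : spz cs ct X0 X1. Proof. exact: refine_spz. Qed.

Let X1_dom : nrm X1 ct < nrm X1 cs.
Proof.
have key a : f 1 0 a = 1 -> 0 <= f 1 eps a -> 0 < pos_pi X1 a.
  move=> fa pa; apply: nonneg_refine_gt0; last by apply/half_gt0; rewrite fa.
  have [h|->//|h] := to_trichotomy (pos_pi X0 a) 0; last exact: ltW.
  by have := half_lt0 (f 1 eps) a; case=> /(_ h); rewrite ltNge pa.
apply/nrm_lt; left; rewrite -eB -eD; split; apply: key; rewrite ?fB ?fD //;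
  by case: epsE => ->.
Qed.

Lemma essential_hyperplane A : conjA_arrangement A -> A (posH e).
Proof.
move=> [_ _ hA]; apply: contrapT => nA.
(* No hyperplane of A passes through [X0], and a refinement leaves all nonzero signs unchanged. *)
have eq01 : arr_equiv A X0 X1.
  apply/arr_equivP => a a0 Aa.
  have f0 : f 1 eps a <> 0.
    move=> fa; apply: nA; move: Aa; have aE := kernel_multiple fa.
    rewrite aE posH_mulz //; apply: contraNneq a0 => u0.
    by rewrite aE u0 mulr0z.
  have ne : pos_pi X0 a <> 0 by move/half_eq0.
  split; split.
  - by move=> h; apply/refine_lt0; left.
  - by move/refine_lt0 => [//|[]].
  - by move=> h; apply/refine_gt0; left.
  - by move/refine_gt0 => [//|[]].
have [ha _] := hA LeftSide.
pose F : set (pos (ZSbar S)) := [set Y | arr_equiv A X0 Y].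
have fF : facet A F by exists X0.
have cell := ha F fF X0 X1 (@arr_equiv_refl _ _ A X0) eq01 (alt t s 1) (alt t s 2).
have n1 : nrm X1 ct != 0 by exact: (spz_ne0 (spz_sym sp) X0_ct).
have /cell : cell_eq (phi_of X0) LeftSide (alt t s 1) (alt t s 2).
  by apply/(eq_cells H LeftSide _ _ X0_eq X0_cs); rewrite /cell_inv !(kappaE_alt' D).
move/(dom_cells H LeftSide _ _ (esym n1) X1_dom).
by rewrite /cell_inv (kappaU_t D) (kappaU_alt' D).
Qed.

End Essential.

Theorem arr4_essential (W : groupType) (S : set W) (s t : W) (cs ct : Sbar S) :
  two_classes s t cs ct -> essential_set (arr4 cs ct).
Proof.
move=> H; split; first exact: (arr4_conjA H).
move=> A cA; have [_ cpl _] := cA; move=> _ [[[]|]|] ->.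
- exact: cpl.
- exact: cpl.
- exact: (essential_hyperplane H (or_introl (erefl (1 : int))) cA).
- have := essential_hyperplane H (or_intror (erefl (-1 : int))) cA.
  by rewrite mulrN1z opprK.
Qed.

(** * Cell modules *)

HB.lock Definition ltr (W : groupType) (w : W) (x : {malg int[W]}) : {malg int[W]} :=
  lext (fun v => << (w * v)%g >>) x.

Section Presentations.
Variable W : groupType.
Local Notation ZW := {malg int[W]}.
Implicit Types (U : opmod W) (P Q N : ZW -> Prop).

Lemma ltrB (w : W) x y : ltr w (x - y) = ltr w x - ltr w y :> ZW.
Proof. by rewrite unlock; exact: raddfB. Qed.

Lemma ltrD (w : W) x y : ltr w (x + y) = ltr w x + ltr w y :> ZW.
Proof. by rewrite unlock; exact: raddfD. Qed.

Lemma ltr_linear (w : W) : linear (ltr w).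
Proof. by rewrite unlock; exact: lext_linear. Qed.

Lemma ltrU (w v : W) : ltr w << v >> = << (w * v)%g >> :> ZW.
Proof. by rewrite unlock sextU. Qed.

Definition submod P : Prop :=
  [/\ P 0, forall x y, P x -> P y -> P (x - y) & forall (w : W) x, P x -> P (ltr w x)].

Lemma submodD P x y : submod P -> P x -> P y -> P (x + y).
Proof.
by move=> [P0 PB _] Px Py; rewrite -[y]opprK; apply: (PB _ _ Px); rewrite -sub0r; apply: PB.
Qed.

(** U is isomorphic to P/Q as a module over Z[W]. The map is total but constrained only on P, so
    that no type has to be formed for P. *)
Definition presents U P Q : Prop := exists f : ZW -> U,
  [/\ forall x y, P x -> P y -> f (x - y) = f x - f y,
      forall (w : W) x, P x -> f (ltr w x) = opmod_act w (f x),
      forall u, exists2 x, P x & f x = u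
    & forall x, P x -> (f x = 0 <-> Q x)].

Lemma presents_ext U P Q P' Q' : (forall x, P x <-> P' x) -> (forall x, Q x <-> Q' x) ->
  presents U P Q -> presents U P' Q'.
Proof.
move=> eP eQ [f [fB fa fs fk]]; exists f; split.
- by move=> x y /eP Px /eP; exact: fB.
- by move=> w x /eP; exact: fa.
- by move=> u; have [x /eP Px <-] := fs u; exists x.
- by move=> x /eP Px; rewrite -eQ; exact: fk.
Qed.

Lemma presents_map U P Q P' Q' (g : ZW -> ZW) : submod P' ->
  (forall x, P x -> P' (g x)) ->
  (forall x y, P x -> P y -> g (x - y) = g x - g y) ->
  (forall (w : W) x, P x -> g (ltr w x) = ltr w (g x)) ->
  (forall x', P' x' -> exists2 x, P x & Q' (x' - g x)) ->
  (forall x, P x -> (Q x <-> Q' (g x))) ->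
  presents U P' Q' -> presents U P Q.
Proof.
move=> [_ PB _] gP gB ga gs gk [f [fB fa fs fk]]; exists (fun x => f (g x)); split.
- by move=> x y Px Py; rewrite gB // fB //; exact: gP.
- by move=> w x Px; rewrite ga // fa //; exact: gP.
- move=> u; have [x' Px' <-] := fs u; have [x Px h] := gs x' Px'; exists x => //.
  have Pgx := gP x Px; apply/eqP; rewrite eq_sym -subr_eq0 -fB //.
  by apply/eqP/fk => //; exact: PB.
- by move=> x Px; rewrite (gk x Px); apply: fk; exact: gP.
Qed.

(** Both modules are P/Q: the isomorphism sends [u] to the image under the second map of any
    preimage in P under the first. *)
Lemma presents_iso U U' P Q : submod P -> presents U P Q -> presents U' P Q -> opmod_iso U U'.
Proof.
move=> [P0 PB Pl] [f [fB fa fs fk]] [f' [fB' fa' fs' fk']].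
have /choice[z zP] : forall u, exists x, P x /\ f x = u by move=> u; have [x] := fs u; exists x.
have /choice[z' zP'] : forall u, exists x, P x /\ f' x = u.
  by move=> u; have [x] := fs' u; exists x.
have f'e x y : P x -> P y -> f x = f y -> f' x = f' y.
  move=> Px Py e; apply/eqP; rewrite -subr_eq0 -fB' //; apply/eqP/fk'; first exact: PB.
  by apply/fk; [exact: PB|rewrite fB // e subrr].
have fe x y : P x -> P y -> f' x = f' y -> f x = f y.
  move=> Px Py e; apply/eqP; rewrite -subr_eq0 -fB //; apply/eqP/fk; first exact: PB.
  by apply/fk'; [exact: PB|rewrite fB' // e subrr].
pose F u := f' (z u).
have FB : zmod_morphism F.
  move=> u v; have [Pu eu] := zP u; have [Pv ev] := zP v; have [Puv euv] := zP (u - v).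
  rewrite /F -fB' //; apply: f'e => //; first exact: PB.
  by rewrite fB // eu ev euv.
pose Fm := GRing.isZmodMorphism.Build U U' F FB.
pose FA : {additive U -> U'} := HB.pack F Fm.
exists FA.
  exists (fun u' => f (z' u')).
    move=> u; have [Pu {2}<-] := zP u; have [Pu' eu'] := zP' (F u).
    by apply: fe => //; rewrite eu'.
  move=> u'; have [Pu' {2}<-] := zP' u'; have [Pu eu] := zP (f (z' u')).
  exact: f'e.
move=> w x; change (F (opmod_act w x) = opmod_act w (F x)).
have [Px ex] := zP x; have [Pw ew] := zP (opmod_act w x).
by rewrite /F -fa' //; apply: f'e; rewrite ?ew ?fa ?ex //; exact: Pl.
Qed.

Section Subquotient.
Variables (M : opmod W) (A B : zmodClosed M) (P Q : ZW -> Prop) (l : ZW -> M).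
Hypotheses (sP : submod P) (lA : forall x, P x -> l x \in A)
  (lB : forall x y, P x -> P y -> l (x - y) = l x - l y)
  (la : forall (w : W) x, P x -> opmod_act w (l x) - l (ltr w x) \in B)
  (ls : forall a, a \in A -> exists2 x, P x & a - l x \in B)
  (lk : forall x, P x -> (l x \in B <-> Q x))
  (actA : forall w a, a \in A -> opmod_act w a \in A)
  (actB : forall w a b, a \in A -> b \in A -> a - b \in B ->
    opmod_act w a - opmod_act w b \in B).

Let pr (a : M) : opmod_subquot A B := \pi_(subquot A B) (insubd (0 : subgrp A) a).

Let val_pr a : a \in A -> val (insubd (0 : subgrp A) a) = a.
Proof. by move=> h; rewrite insubdK. Qed.

Let pr_eq a b : a \in A -> b \in A -> (pr a = pr b) <-> (a - b \in B).
Proof.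
move=> Aa Ab; rewrite /pr; set u := insubd _ a; set v := insubd _ b.
have -> : (a - b \in B) = ((u : subgrp A) - v \in @sub_trace _ A B).
  by rewrite inE raddfB /= !val_pr.
rewrite Quotient.idealrBE; split; first by move=> e; apply/eqP.
by move/eqP.
Qed.

Let pr_val (u : opmod_subquot A B) : pr (val (repr (u : subquot A B))) = u.
Proof.
rewrite /pr valKd; exact: reprK.
Qed.

(** [l] is equivariant and surjective only modulo [B]; this latitude is what allows a choice of
    lifts to the Hecke algebra. *)
Lemma subquot_presents : presents (opmod_subquot A B) P Q.
Proof.
have [P0 PB Pl] := sP; exists (fun x => pr (l x)); split.
- move=> x y Px Py; rewrite lB //.
  have -> : pr (l x - l y) = pr (l x) - pr (l y).
    rewrite /pr -[RHS]raddfB; congr (\pi _); apply: val_inj.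
    by rewrite raddfB /= !val_pr ?rpredB //; exact: lA.
  by [].
- move=> w x Px; rewrite -[RHS]/(pr (opmod_act w (val (repr (pr (l x) : subquot A B))))).
  set r := val _; have rA : r \in A by exact: valP.
  have e : pr r = pr (l x) by exact: pr_val.
  have {}e := (pr_eq rA (lA Px)).1 e.
  symmetry; apply/pr_eq; [exact: actA|exact/lA/Pl|].
  rewrite -[opmod_act w r](subrK (opmod_act w (l x))) -addrA; apply: rpredD; last exact: la.
  by apply: actB => //; exact: lA.
- move=> u; have rA := valP (repr (u : subquot A B)).
  have [x Px h] := ls rA; exists x => //; rewrite -[u in RHS]pr_val.
  by symmetry; apply/pr_eq => //; exact: lA.
- move=> x Px; rewrite -(lk Px) -[l x in X in _ <-> X]subr0.
  have pr0 : pr 0 = 0.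
    rewrite /pr -[RHS](raddf0 (\pi_(subquot A B))); congr (\pi _); apply: val_inj.
    by rewrite val_pr ?rpred0 // raddf0.
  by rewrite -pr0; apply: pr_eq; [exact: lA|exact: rpred0].
Qed.

End Subquotient.

End Presentations.

Lemma gen_add_id (V : zmodType) (E : set V) x : add_subgroup E ->
  (x \in @gen_add V E) <-> E x.
Proof.
move=> sE; rewrite inE; split=> [/asboolP|Ex]; first by apply; split.
by apply/asboolP => G [_]; exact.
Qed.

(** * Filtrations from chains of submodules *)

Section Filtrations.
Variable W : groupType.
Local Notation ZW := {malg int[W]}.
Implicit Types (P Q N : ZW -> Prop).

Section Image.
Variables (U : opmod W) (P Q : ZW -> Prop) (f : ZW -> U).
Hypotheses (sP : submod P) (fB : forall x y, P x -> P y -> f (x - y) = f x - f y)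
  (fa : forall (w : W) x, P x -> f (ltr w x) = opmod_act w (f x))
  (fk : forall x, P x -> (f x = 0 <-> Q x)).

(** On a submodule of P, [gen_add] adds nothing to the image ([imgP]); it supplies the [zmodClosed]
    structure for an arbitrary [N]. *)
Definition img N : zmodClosed U := @gen_add U [set u | exists2 x, N x & f x = u].

Lemma imgP N u : submod N -> (forall x, N x -> P x) ->
  (u \in img N) <-> exists2 x, N x & f x = u.
Proof.
move=> [N0 NB Nl] NP; apply: gen_add_id; split.
  by exists 0 => //; have := fB (NP _ N0) (NP _ N0); rewrite !subrr.
move=> _ _ [x Nx <-] [y Ny <-]; exists (x - y); first exact: NB.
by rewrite fB //; exact: NP.
Qed.

Lemma img_stable N : submod N -> (forall x, N x -> P x) -> opmod_stable (img N).
Proof.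
move=> sN NP w u /(imgP _ sN NP)[x Nx <-]; apply/imgP => //.
by have [_ _ Nl] := sN; exists (ltr w x); [exact: Nl|apply: fa; exact: NP].
Qed.

Lemma img_presents N1 N2 : submod N1 -> submod N2 -> (forall x, Q x -> N1 x) ->
  (forall x, N1 x -> N2 x) -> (forall x, N2 x -> P x) ->
  presents (opmod_subquot (img N2) (img N1)) N2 N1.
Proof.
move=> s1 s2 Q1 N12 N2P; have N1P x : N1 x -> P x by move/N12/N2P.
have [_ B1 l1] := s1; have [_ B2 l2] := s2.
have mem x : P x -> (f x \in img N1) <-> N1 x.
  move=> Px; split; last by move=> Nx; apply/imgP => //; exists x.
  move=> /(imgP _ s1 N1P)[y Ny e]; rewrite -[x](subrK y); apply: submodD => //.
  have [_ PB _] := sP; have Py := N1P _ Ny; have Pxy := PB _ _ Px Py.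
  apply/Q1/(fk Pxy).
  by rewrite fB // e subrr.
apply: (subquot_presents (l := f)) => //.
- by move=> x Nx; apply/imgP => //; exists x.
- by move=> x y Nx Ny; apply: fB; exact: N2P.
- by move=> w x Nx; rewrite fa ?subrr ?rpred0 //; exact: N2P.
- by move=> a /(imgP _ s2 N2P)[x Nx <-]; exists x; rewrite ?subrr ?rpred0.
- by move=> x /N2P; exact: mem.
- by move=> w a; exact: img_stable.
move=> w a b /(imgP _ s2 N2P)[x Nx <-] /(imgP _ s2 N2P)[y Ny <-].
have Px := N2P _ Nx; have Py := N2P _ Ny; have [_ PB _] := sP.
rewrite -fB // -!fa // => /mem h; rewrite -fB //; last 2 first.
- exact/N2P/l2.
- exact/N2P/l2.
apply/mem; first by apply: PB; exact/N2P/l2.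
by rewrite -ltrB; apply/l1/h/PB.
Qed.

End Image.

Lemma filtrationP (S : set W) (X Y : pos (ZSbar S)) (E : set W) d
    (Ds : nat -> set W) (N : nat -> ZW -> Prop) :
  (forall i, (i < d)%N -> is_cell (phi_of Y) LeftSide (Ds i)) ->
  (forall i j x, (i < d)%N -> (j < d)%N -> Ds i x -> Ds j x -> i = j) ->
  (forall x, E x <-> exists2 i, (i < d)%N & Ds i x) ->
  (forall i, (i <= d)%N -> submod (N i)) ->
  (forall i x, (i < d)%N -> N i x -> N i.+1 x) ->
  presents (ZM (phi_of X) E) (N d) (N 0%N) ->
  (forall i, (i < d)%N -> presents (ZM (phi_of Y) (Ds i)) (N i.+1) (N i)) ->
  cell_filtration X Y E.
Proof.
move=> hc hd hE sN mN [f [fB fa fs fk]] hY.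
have le i j x : (i <= j)%N -> (j <= d)%N -> N i x -> N j x.
  move=> ij; elim: j ij => [|j IH] ij jd; first by move: ij; rewrite leqn0 => /eqP ->.
  move: ij; rewrite leq_eqVlt => /predU1P[<- //|ij] Nx.
  by apply: mN => //; apply: IH => //; exact: ltnW.
have sP := sN _ (leqnn d).
exists d, (fun i : 'I_d => Ds i); split.
- by move=> i; apply: hc.
- apply/trivIsetP => i j _ _ ij; apply/seteqP; split=> // x [hi hj].
  by case/eqP: ij; apply: val_inj; exact: hd hi hj.
- apply/seteqP; split=> x; first by move=> /hE[i id Dx]; exists (Ordinal id).
  by move=> [i _ Dx]; apply/hE; exists i.
(* The cells are listed in the order of the chain, so the identity permutation works. *)
exists (fun i => img f (N i)), 1%g; split.
- move=> i id; apply: (img_stable fB fa (sN i id)) => x; exact: le.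
- move=> u; apply/idP/idP.
    move=> /(imgP fB _ (sN 0%N isT) (fun x => @le 0%N d x (leq0n d) (leqnn d)))[x Nx <-].
    by rewrite inE; apply/eqP/(fk _ (le _ _ _ (leq0n d) (leqnn d) Nx)).
  rewrite inE => /eqP ->; exact: rpred0.
- move=> u; have [x Nx <-] := fs u; rewrite [RHS]inE.
  by apply/(imgP fB _ sP) => //; exists x.
- move=> i id u /(imgP fB _ (sN i (ltnW id)) (fun x => @le i d x (ltnW id) (leqnn d)))[x Nx <-].
  apply/(imgP fB _ (sN i.+1 id) (fun x => @le i.+1 d x id (leqnn d))).
  by exists x => //; exact: mN.
- move=> i; rewrite perm1; apply: (presents_iso (sN _ _) _ (hY i _)) => //.
  apply: (img_presents sP fB fa fk) => [|||x|x].
  + by apply: sN; exact: ltnW.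
  + exact: sN.
  + by move=> x; apply: le => //; exact: ltnW.
  + exact: mN.
  + exact: le.
Qed.

End Filtrations.

(** * Specialization at e^gamma = 1 and presentations of cell modules *)

HB.lock Definition special (W : groupType) (G : tozmodType) (h : {malg (group_ring G)[W]}) :
    {malg int[W]} :=
  sext (@augmentation G) (fun w : W => (<< w >> : {malg int[W]})) h.

HB.lock Definition spkl (W : groupType) (S : set W) (G : tozmodType) (phi : Sbar S -> G)
  (w : W) : {malg int[W]} := special (klL phi w).

Section Specialization.
Variables (W : groupType) (G : tozmodType).
Implicit Types (h : {malg (group_ring G)[W]}).

Lemma specialD h g : special (h + g) = special h + special g.
Proof. by rewrite unlock; exact: raddfD. Qed.

Lemma specialB h g : special (h - g) = special h - special g.
Proof. by rewrite unlock; exact: raddfB. Qed.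

Lemma special0 : special (0 : {malg (group_ring G)[W]}) = 0.
Proof. by rewrite unlock; exact: raddf0. Qed.

Lemma specialZ r h : special (r *: h) = augmentation r *: special h.
Proof. by rewrite unlock; exact: sextZ. Qed.

Lemma specialT w : special (heckeT G w) = << w >> :> {malg int[W]}.
Proof. by rewrite unlock; exact: sextU. Qed.

Lemma special_coeff h v : (special h)@_v = augmentation h@_v.
Proof.
pose g2 h : int^o := augmentation h@_v.
apply: (@sext_eq W (group_ring G) int int^o (@augmentation G) (fun h => (special h)@_v) g2).
- by move=> x y; rewrite specialD mcoeffD.
- by move=> x y; rewrite /g2 mcoeffD raddfD.
- by move=> r x; rewrite specialZ mcoeffZ.
- by move=> r x; rewrite /g2 mcoeffZ rmorphM.
- move=> k; rewrite /g2 -/(heckeT G k) specialT !mcoeffU.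
  by case: eqP => _; rewrite ?rmorph1 ?raddf0.
Qed.

End Specialization.

Lemma ltrZ (W : groupType) (w : W) (r : int) (x : {malg int[W]}) : ltr w (r *: x) = r *: ltr w x.
Proof. by rewrite unlock sextZ. Qed.

Section SpecializedHecke.
Variables (W : groupType) (S : set W) (s t : W) (G : tozmodType).
Variables (phi : Sbar S -> G) (wt : W -> G).
Hypothesis D : is_dihedral S s t.
Hypothesis phiE : forall (o : Sbar S) x, val o x -> phi o = wt x.
Local Notation len := (cox_length S).
Local Notation H := ({malg (group_ring G)[W]}).
Local Notation T := (@heckeT W G).
Local Notation M := (hM phi).
Local Notation ZW := ({malg int[W]}).
Local Notation sp := (@special W G).

Lemma augmentation_hxi x : augmentation (hxi wt x) = 0.
Proof. by rewrite /hxi raddfB /= !augmentation_exp subrr. Qed.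

Lemma special_Lop x (h : H) : sp (Lop S wt x h) = ltr x (sp h).
Proof.
apply: (@sext_eq W (group_ring G) int ZW (@augmentation G)
  (fun h => sp (Lop S wt x h)) (fun h => ltr x (sp h))).
- by move=> a b; rewrite LopD specialD.
- by move=> a b; rewrite specialD ltrD.
- by move=> r a; rewrite LopZ specialZ.
- by move=> r a; rewrite specialZ ltrZ.
- move=> k; rewrite -/(T k) LopT specialD specialZ !specialT ltrU.
  have -> : augmentation (if (len k < len (x * k)%g)%N then 0 else hxi wt x) = 0.
    by case: ifP => _; [exact: raddf0|exact: augmentation_hxi].
  by rewrite scale0r addr0.
Qed.

Lemma ltr1 (z : ZW) : ltr 1%g z = z.
Proof.
apply: (@lext_linear_unique W int ZW (ltr 1%g) id) => [||w]; first exact: ltr_linear.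
  by [].
by rewrite ltrU mul1g.
Qed.

Lemma ltrM x y (z : ZW) : ltr (x * y)%g z = ltr x (ltr y z).
Proof.
apply: (@lext_linear_unique W int ZW (ltr (x * y)%g) (fun z => ltr x (ltr y z))) => [|r a b|w].
- exact: ltr_linear.
- by rewrite !ltr_linear.
- by rewrite !ltrU mulgA.
Qed.

Lemma special_mul w (h : H) : sp (M (T w) h) = ltr w (sp h).
Proof.
move: w; apply: (len_ind D) => [|x w Sx up IH].
  by rewrite (hm1l D phiE) ltr1.
have lE : len (x * w)%g = (len x + len w)%N.
  by rewrite (len_up D Sx up) (len_S D Sx).
by rewrite -(hmTT D phiE lE) -(hmA D phiE) (hmL D phiE _ Sx) special_Lop IH ltrM.
Qed.

End SpecializedHecke.

Lemma gen_add_sub (V : zmodType) (E G : set V) x :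
  add_subgroup G -> E `<=` G -> x \in @gen_add V E -> G x.
Proof. by move=> sG EG; rewrite inE => /asboolP; apply; split. Qed.

Lemma gen_add_gen (V : zmodType) (E : set V) x : E x -> x \in @gen_add V E.
Proof. by move=> Ex; rewrite inE; apply/asboolP => G [_]; exact. Qed.

Section CellModules.
Variables (W : groupType) (S : set W) (s t : W) (G : tozmodType).
Variables (phi : Sbar S -> G) (wt : W -> G).
Hypothesis D : is_dihedral S s t.
Hypothesis phiE : forall (o : Sbar S) x, val o x -> phi o = wt x.
Hypothesis good : forall w,
  kl_spec S (@neg_low W S G) (eT s t wt) (klT s t phi wt) (hbar phi) w.
Local Notation len := (cox_length S).
Local Notation R := (group_ring G : comNzRingType).
Local Notation V := ({malg (group_ring G)[W]} : lmodType (group_ring G : comNzRingType)).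
Local Notation f := (klL phi : W -> V).
Local Notation T := (@heckeT W G).
Local Notation M := (hM phi).
Local Notation ZW := ({malg int[W]}).
Local Notation sp := (@special W G).
Local Notation c := (spkl phi).

Let cm := hecke_cell_model D phiE good.

Lemma spklE w : c w = sp (f w). Proof. by rewrite spkl.unlock. Qed.

Lemma spkl_tri w v : (len w <= len v)%N -> (c w)@_v = if w == v then 1 else 0.
Proof.
move=> le; rewrite spkl.unlock special_coeff (klL_tri D good le).
by case: eqP => _; [exact: rmorph1|exact: raddf0].
Qed.

Let c_inj := tri_inj spkl_tri.
Let c_surj := tri_surj spkl_tri.

Lemma special_lext (a : {malg (group_ring G)[W]}) : sp (lext f a) = lext c (sp a).
Proof.
apply: (@sext_eq W (group_ring G) int ZW (@augmentation G)
  (fun a => sp (lext f a)) (fun a => lext c (sp a))).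
- by move=> x y; rewrite raddfD specialD.
- by move=> x y; rewrite specialD raddfD.
- by move=> r x; rewrite lextZ specialZ.
- by move=> r x; rewrite specialZ lextZ.
- by move=> k; rewrite sextU -/(heckeT G k) specialT sextU spkl.unlock.
Qed.

Lemma special_span (E : set W) h : lspan f E h -> lspan c E (sp h).
Proof.
move=> [a Ea ->]; exists (sp a); last exact: special_lext.
move=> x; rewrite special_coeff => n0; apply: Ea; apply: contraNneq n0 => ->.
by rewrite raddf0.
Qed.

Lemma klC_spanP (E : set W) h : (h \in klC_span phi E) <-> lspan f E h.
Proof.
rewrite inE klL.unlock; split=> [/asboolP[a Ea ->]|[a Ea ->]].
  by exists a => //; rewrite klC_comb_lext.
by apply/asboolP; exists a => //; rewrite klC_comb_lext.
Qed.

Lemma lspan_submod (E : set W) : left_closed S f T M E -> submod (lspan c E).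
Proof.
move=> Ec; split; first exact: lspan0.
  by move=> x y hx hy; apply: lspanD hx _; apply: lspanN.
move=> w x; apply: lspan_map; first exact: ltr_linear.
- exact: lspan0.
- exact: lspanD.
- by move=> r y; apply: lspanZ.
move=> y Ey; rewrite [spkl phi y]spklE -(special_mul D phiE); apply: special_span.
by apply: (left_closed_mul cm D _ Ec); exact: lspan_gen.
Qed.

Variables (C : set W) (w0 : W).
Hypothesis CE : C = [set x | cell_eq phi LeftSide x w0].

Local Notation U := (below phi C).
Local Notation le := (cell_le phi LeftSide).

Let le_trans' x y z : le x y -> le y z -> le x z.
Proof. exact: t_trans. Qed.

Lemma cell_below x : C x -> U x.
Proof.
move=> Cx; exists x => //; move: Cx; rewrite CE => -[h1 h2].
exact: le_trans' h1 h2.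
Qed.

Let step_closed (E : set W) : (forall x w, le x w -> E w -> E x) -> left_closed S f T M E.
Proof.
move=> Ele z w Sz Ew; have [a e] := cm_surj cm (M (T z) (f w)).
exists a => // x ax; apply: Ele Ew; apply: t_step.
apply/(cell_step_locked phi); exists (T z); exists a => //.
Qed.

Lemma below_closed : left_closed S f T M U.
Proof.
apply: step_closed => x w xw [v Cv wv]; exists v => //; exact: le_trans' xw wv.
Qed.

Lemma below_diff_closed : left_closed S f T M (U `\` C).
Proof.
apply: step_closed => x w xw [[v Cv wv] nC]; split.
  by exists v => //; exact: le_trans' xw wv.
move=> Cx; apply: nC; move: Cx Cv; rewrite CE => -[h1 h2] [h3 h4]; split.
  exact: le_trans' wv h3.
exact: le_trans' h2 xw.
Qed.

(** If [r] has augmentation 0, then [r *: f w] is itself one of the relations. Modulo them, only the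
    specialized coefficients on C remain. *)
Lemma cell_relationsP h : lspan f U h ->
  (h \in gen_add (cell_relations phi C)) <-> lspan c (U `\` C) (sp h).
Proof.
move=> hU; split.
  apply: (gen_add_sub (G := [set h | lspan c (U `\` C) (sp h)])).
    split; first by rewrite /= special0; exact: lspan0.
    by move=> x y hx hy /=; rewrite specialB; apply: lspanD hx _; apply: lspanN.
  move=> g [/klC_spanP h1|[r [m [hm ->]]]] /=; first exact: special_span.
  have -> : sp (r *: m - m *~ augmentation r) = 0; last exact: lspan0.
  rewrite specialB specialZ.
  have -> : sp (m *~ augmentation r) = augmentation r *: sp m.
    rewrite special.unlock raddfMz /= -scaler_int; congr (_ *: _); exact: intz.
  exact: subrr.
move: hU => [a Ea hE] [b Eb]; rewrite hE special_lext => /c_inj e.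
rewrite sext.unlock; apply: rpred_sum => w _.
have [->|aw] := eqVneq (a@_w) 0; first by rewrite rmorph0 scale0r rpred0.
have [Cw|nC] := EM (C w).
  have aug0 : augmentation (a@_w) = 0.
    rewrite -special_coeff e; apply/eqP; apply: contraT => /Eb [] //.
  have -> : idfun (a@_w) *: f w = a@_w *: f w - f w *~ augmentation a@_w.
    by rewrite aug0 mulr0z subr0.
  apply: gen_add_gen; right; exists (a@_w), (f w); split=> //.
  exact/klC_spanP/lspan_gen/cell_below.
apply: gen_add_gen; left; apply/klC_spanP/lspanZ/lspan_gen.
by split=> //; exact: Ea.
Qed.

Let coef (z : ZW) : ZW := xget 0 [set a | z = lext c a].

Let coefE z : z = lext c (coef z).
Proof. by have [a ea] := c_surj z; apply: (@xgetPex _ 0 [set a | z = lext c a]); exists a. Qed.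

Let coef_lext a : coef (lext c a) = a.
Proof. by apply: c_inj; rewrite -coefE. Qed.

Let coefB x y : coef (x - y) = coef x - coef y.
Proof. by apply: c_inj; rewrite -coefE raddfB /= -!coefE. Qed.

Let coefP (E : set W) z : lspan c E z <-> forall x, (coef z)@_x != 0 -> E x.
Proof.
split=> [[a Ea ->]|h]; first by rewrite coef_lext.
by exists (coef z) => //; exact: coefE.
Qed.

Let restr (a : ZW) : ZW := lext (fun w => if `[< C w >] then << w >> else 0) a.

Let restr_coeff a x : (restr a)@_x = if `[< C x >] then a@_x else 0.
Proof.
apply: (@lext_linear_unique W int int^o (fun a => (restr a)@_x)
   (fun a => if `[< C x >] then a@_x else 0)) => [r a' b|r a' b|w].
- by rewrite /restr lext_linear mcoeffD mcoeffZ.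
- by case: ifP => _; rewrite ?mcoeffD ?mcoeffZ // scaler0 addr0.
- rewrite /restr sextU; have [<-|n] := eqVneq w x; first by case: ifP => _; rewrite ?mcoeff0.
  have e : (<< w >> : ZW)@_x = 0 by rewrite mcoeffU (negbTE n).
  by rewrite e; do 2!case: ifP => _ //; rewrite mcoeff0.
Qed.

(** A Z-linear section of the specialization over the part of [z] supported on C, with integers as
    constants of the group ring. *)
Let lift (z : ZW) : V :=
  sext (intr : {rmorphism int -> group_ring G}) (fun w => if `[< C w >] then f w else 0) (coef z).

Let rho (z : ZW) : ZW := lext c (restr (coef z)).

Let special_lift z : sp (lift z) = rho z.
Proof.
rewrite /lift /rho; move: (coef z) => a.
apply: (@sext_eq W int int ZW idfun
  (fun a => sp (sext (intr : {rmorphism int -> group_ring G})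
     (fun w => if `[< C w >] then f w else 0) a)) (fun a => lext c (restr a))).
- by move=> x y; rewrite raddfD specialD.
- by move=> x y; rewrite /restr !raddfD.
- by move=> r x; rewrite sextZ specialZ rmorph_int intz.
- by move=> r x; rewrite /restr !lextZ.
- move=> k; rewrite sextU /restr sextU; case: ifP => _; last by rewrite special0 raddf0.
  by rewrite sextU spkl.unlock.
Qed.

Let lift_span z : lspan f C (lift z).
Proof.
rewrite /lift; move: (coef z) => a; elim/malg_ind: a => [|x y hx hy|r k].
- by rewrite raddf0; exact: lspan0.
- by rewrite raddfD; exact: lspanD.
- rewrite sextZ sextU; apply: lspanZ; case: ifP => [/asboolP Ck|_]; last exact: lspan0.
  exact: lspan_gen.
Qed.

Let coef_linear : linear coef.
Proof. by move=> r x y; apply: c_inj; rewrite -coefE lext_linear -!coefE. Qed.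

Let rho_linear : linear rho.
Proof. by move=> r x y; rewrite /rho coef_linear /restr !lext_linear. Qed.

Let rho_mem (E : set W) z : lspan c E z -> lspan c (E `&` C) (rho z).
Proof.
move=> /coefP h; apply/coefP => x; rewrite coef_lext restr_coeff.
by case: ifP => [/asboolP Cx /h Ex|_ /eqP].
Qed.

Let rho_diff (E : set W) z : lspan c E z -> lspan c (E `\` C) (z - rho z).
Proof.
move=> /coefP h; apply/coefP => x; rewrite coefB coef_lext mcoeffB restr_coeff.
by case: ifP => [_ /eqP|/asboolP nC]; rewrite ?subrr // subr0 => /h Ex.
Qed.

Let rho_id z : lspan c C z -> rho z = z.
Proof.
move=> /coefP h; rewrite [RHS]coefE /rho; congr (lext c _); apply/malgP => x.
rewrite restr_coeff; case: ifP => // /asboolP nC.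
by apply/esym/eqP; apply: contraT => /h.
Qed.

Let rho_eq0 z : rho z = 0 <-> forall x, (coef z)@_x != 0 -> ~ C x.
Proof.
split=> [h x n0 Cx|h].
  have e : restr (coef z) = 0 by apply: c_inj; rewrite raddf0.
  have := restr_coeff (coef z) x; rewrite e mcoeff0; case: asboolP => // _ /esym /eqP.
  by rewrite (negbTE n0).
rewrite /rho; have -> : restr (coef z) = 0; last exact: raddf0.
apply/malgP => x; rewrite restr_coeff mcoeff0; case: ifP => // /asboolP Cx.
by apply/eqP; apply: contraT => /h.
Qed.

Let lift_below z : lspan f U (lift z).
Proof. by apply: lspan_sub (lift_span z) => x; exact: cell_below. Qed.

(** Only the coordinates on C matter in the quotient, so the set [below] of the definition may be
    replaced by any closed E containing C whose difference with C is closed. This freedom lets the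
    same sets serve for X and Y. *)
Lemma ZM_presents (E : set W) : C `<=` E -> left_closed S f T M E ->
  left_closed S f T M (E `\` C) ->
  presents (ZM phi C) (lspan c E) (lspan c (E `\` C)).
Proof.
move=> sCE Ec ECc; have [sE0 sEB sEl] := lspan_submod Ec.
have [_ dB dl] := lspan_submod below_diff_closed.
have hUl := lspan_submod below_closed.
have actE w h : opmod_act w (h : hecke_opmod phi) = M (T w) h by rewrite hM.unlock.
have UM w h : lspan f U h -> lspan f U (M (T w) h).
  exact: (left_closed_mul cm D _ below_closed).
have UB g h : lspan f U g -> lspan f U h -> lspan f U (g - h).
  by move=> hg hh; apply: lspanD hg _; apply: lspanN.
have MB w g h : M (T w) (g - h) = M (T w) g - M (T w) h.
  have L := cm_linr cm (T w); rewrite -scaleN1r addrC L scaleN1r addrC; reflexivity.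
apply: (@subquot_presents W (hecke_opmod phi) _ _ (lspan c E) (lspan c (E `\` C)) lift).
- exact: lspan_submod.
- by move=> z _; apply/klC_spanP.
- by move=> x y _ _; rewrite /lift coefB raddfB.
- move=> w z hz; rewrite actE; have h1 := UM w _ (lift_below z).
  apply/cell_relationsP; first exact: UB.
  rewrite specialB (special_mul D phiE) !special_lift.
  apply: (lspan_map (g := fun z => ltr w (rho z) - rho (ltr w z))) hz.
  + by move=> r x y; rewrite rho_linear !ltr_linear rho_linear scalerBr opprD addrACA.
  + exact: lspan0.
  + exact: lspanD.
  + by move=> r y; apply: lspanZ.
  move=> x Ex; have [Cx|nC] := EM (C x).
    rewrite [rho (spkl phi x)]rho_id; last exact: lspan_gen.
    apply: rho_diff; have [_ _ Ul] := hUl; apply: Ul; exact/lspan_gen/cell_below.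
  have r1 : lspan c (E `\` C) (ltr w (spkl phi x)).
    by have [_ _ El] := lspan_submod ECc; apply: El; apply: lspan_gen.
  have -> : rho (ltr w (spkl phi x)) = 0.
    by apply/rho_eq0 => y; move/coefP: r1 => /[apply] -[].
  have -> : rho (spkl phi x) = 0.
    apply/rho_eq0 => y; have /coefP r2 : lspan c (E `\` C) (spkl phi x) by exact: lspan_gen.
    by move/r2 => -[].
  by rewrite -(subrr (0 : ZW)) ltrB !subrr; exact: lspan0.
- move=> a /klC_spanP aU; have sU := special_span aU.
  have rm : lspan c C (rho (sp a)) by apply: lspan_sub (rho_mem sU) => x [].
  exists (rho (sp a)); first exact: lspan_sub sCE rm.
  apply/cell_relationsP; first exact: UB.
  by rewrite specialB special_lift (rho_id rm); exact: rho_diff.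
- move=> z /coefP hz; apply: iff_trans (cell_relationsP (lift_below z)) _.
  rewrite special_lift; split=> [h|/coefP h].
    apply/coefP => x n0; split; first exact: hz.
    suff /rho_eq0 : rho z = 0 by apply.
    have : rho (rho z) = 0 by apply/rho_eq0 => y; move/coefP: h => /[apply] -[].
    rewrite rho_id //; apply: lspan_sub (rho_mem (E := setT) _) => [y []//|].
    exact/coefP.
  have -> : rho z = 0 by apply/rho_eq0 => x /h [].
  exact: lspan0.
- by move=> w a /klC_spanP aU; rewrite actE; apply/klC_spanP/UM.
move=> w a b /klC_spanP aU /klC_spanP bU /(cell_relationsP (UB _ _ aU bU)) h.
rewrite !actE -MB; apply/cell_relationsP; first exact/UM/UB.
by rewrite (special_mul D phiE); apply: dl.
Qed.

End CellModules.

(** * Right translations and their eigenspaces *)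

HB.lock Definition rtr (W : groupType) (w : W) (x : {malg int[W]}) : {malg int[W]} :=
  lext (fun v => << (v * w)%g >>) x.

Section RightTranslation.
Variables (W : groupType).
Local Notation ZW := ({malg int[W]}).
Implicit Types (x y z : ZW).

Lemma rtrD (w : W) x y : rtr w (x + y) = rtr w x + rtr w y.
Proof. by rewrite unlock; exact: raddfD. Qed.

Lemma rtrB (w : W) x y : rtr w (x - y) = rtr w x - rtr w y.
Proof. by rewrite unlock; exact: raddfB. Qed.

Lemma rtr0 (w : W) : rtr w (0 : ZW) = 0.
Proof. by rewrite unlock; exact: raddf0. Qed.

Lemma rtrZ (w : W) r x : rtr w (r *: x) = r *: rtr w x.
Proof. by rewrite unlock sextZ. Qed.

Lemma rtr_linear (w : W) : linear (rtr w).
Proof. by move=> r x y; rewrite rtrD rtrZ. Qed.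

Lemma rtrU (w v : W) : rtr w (<< v >> : ZW) = << (v * w)%g >>.
Proof. by rewrite unlock sextU. Qed.

Lemma rtr_ltr (v w : W) x : rtr w (ltr v x) = ltr v (rtr w x).
Proof.
apply: (@lext_linear_unique W int ZW (fun x => rtr w (ltr v x)) (fun x => ltr v (rtr w x)))
  => [r a b|r a b|u].
- by rewrite ltr_linear rtr_linear.
- by rewrite rtr_linear ltr_linear.
- by rewrite ltrU !rtrU ltrU mulgA.
Qed.

Lemma rtrK (w : W) x : (w * w)%g = 1%g -> rtr w (rtr w x) = x.
Proof.
move=> ww; apply: (@lext_linear_unique W int ZW (fun x => rtr w (rtr w x)) id) => [r a b|//|u].
  by rewrite !rtr_linear.
by rewrite !rtrU -mulgA ww mulg1.
Qed.

Lemma rtr_coeff (w : W) x v : (w * w)%g = 1%g -> (rtr w x)@_v = x@_(v * w)%g.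
Proof.
move=> ww; apply: (@lext_linear_unique W int int^o (fun x => (rtr w x)@_v)
  (fun x => x@_(v * w)%g)) => [r a b|r a b|u].
- by rewrite rtr_linear mcoeffD mcoeffZ.
- by rewrite mcoeffD mcoeffZ.
- rewrite rtrU !mcoeffU; congr (_ *+ (nat_of_bool _)).
  by apply/eqP/eqP => [<-|->]; rewrite -mulgA ww mulg1.
Qed.

End RightTranslation.

Section SpanImage.
Variables (K : choiceType) (R : comNzRingType) (V : lmodType R) (c : K -> V).

Lemma lspan_image (g : V -> V) (a b : nat -> K) (u : nat -> R) (E F : set K) z : linear g ->
  (forall n, c (b n) = u n *: g (c (a n))) -> (forall n, u n * u n = 1) ->
  (forall n, E (a n)) -> (forall x, E x -> exists n, x = a n) ->
  (forall n, F (b n)) -> (forall x, F x -> exists n, x = b n) ->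
  lspan c F z <-> exists2 y, lspan c E y & z = g y.
Proof.
move=> gL cb uu Ea aE Fb bF.
have gD x y : g (x + y) = g x + g y by rewrite -[x in LHS]scale1r gL scale1r.
have g0 : g 0 = 0 by apply: (addrI (g 0)); rewrite -gD !addr0.
have gZ r x : g (r *: x) = r *: g x by rewrite -[_ *: _ in LHS]addr0 gL g0 addr0.
split=> [|[y hy ->]].
  apply: (@lspan_map K R V V c F (fun z => exists2 y, lspan c E y & z = g y) id).
  - by move=> r x y.
  - by exists 0; [exact: lspan0|rewrite g0].
  - by move=> x y [x' hx ->] [y' hy ->]; exists (x' + y'); [exact: lspanD|rewrite gD].
  - by move=> r x [x' hx ->]; exists (r *: x'); [exact: lspanZ|rewrite gZ].
  - move=> x /bF[n ->]; exists (u n *: c (a n)); first exact/lspanZ/lspan_gen.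
    by rewrite gZ cb.
move: hy; apply: (lspan_map gL) => [||r x|x /aE[n ->]].
- exact: lspan0.
- exact: lspanD.
- exact: lspanZ.
have -> : g (c (a n)) = u n *: c (b n) by rewrite cb scalerA uu scale1r.
exact/lspanZ/lspan_gen.
Qed.

Lemma lspan_union (E F : set K) z : lspan c (E `|` F) z <->
  exists x y, [/\ lspan c E x, lspan c F y & z = x + y].
Proof.
split=> [|[x [y [hx hy ->]]]]; last first.
  by apply: lspanD; [apply: lspan_sub hx|apply: lspan_sub hy] => v; [left|right].
apply: (@lspan_map K R V V c (E `|` F)
  (fun z => exists x y, [/\ lspan c E x, lspan c F y & z = x + y]) id).
- by move=> r x y.
- by exists 0, 0; split; [exact: lspan0|exact: lspan0|rewrite addr0].
- move=> x y [x1 [x2 [h1 h2 ->]]] [y1 [y2 [h3 h4 ->]]]; exists (x1 + y1), (x2 + y2).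
  by split; [exact: lspanD|exact: lspanD|rewrite addrACA].
- move=> r x [x1 [x2 [h1 h2 ->]]]; exists (r *: x1), (r *: x2).
  by split; [exact: lspanZ|exact: lspanZ|rewrite scalerDr].
- move=> x [Ex|Fx]; [exists (c x), 0|exists 0, (c x)]; split; rewrite ?addr0 ?add0r //;
    by [exact: lspan_gen|exact: lspan0].
Qed.

Lemma lspan_set0 z : lspan c set0 z <-> z = 0.
Proof.
split=> [[a Ea ->]|->]; last exact: lspan0.
have -> : a = 0; last exact: raddf0.
by apply/malgP => x; rewrite mcoeff0; apply/eqP; apply: contraT => /Ea.
Qed.

End SpanImage.

Section EigenSpan.
Variables (W : groupType) (S : set W) (s t : W) (c : W -> {malg int[W]}) (eps : int).
Hypothesis D : is_dihedral S s t.
Local Notation len := (cox_length S).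
Hypothesis tri : forall w v, (len w <= len v)%N -> (c w)@_v = if w == v then 1 else 0.
Hypothesis eig : forall k, rtr s (c (alt s t k.+1)) = eps *: c (alt s t k.+1).
Hypothesis eps2 : eps * eps = 1.
Let D' := dihedral_sym D.

(** At a longest element [v] of the support of an eigenvector, [v * s] cannot be longer, so [v] ends
    in [s] and is the only such word of its length. Subtracting a multiple of its basis element
    shortens the support. *)
Lemma eigen_span (E : set W) z : (forall n, E (alt s t n.+1)) ->
  (forall x, E x -> exists n, x = alt s t n.+1) ->
  lspan c E z <-> rtr s z = eps *: z.
Proof.
move=> Ep pE; split.
  apply: (@lspan_map W int _ _ c E (fun z => rtr s z = eps *: z) id).
  - by move=> r x y.
  - by rewrite rtr0 scaler0.
  - by move=> x y ex ey; rewrite rtrD ex ey scalerDr.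
  - by move=> r x ex; rewrite rtrZ ex !scalerA mulrC.
  - by move=> x /pE[n ->]; exact: eig.
have [n] := malg_low len z; elim: n z => [|n IH] z zn ez.
  have -> : z = 0 by apply/malgP => v; rewrite zn // mcoeff0.
  exact: lspan0.
have coefz v : z@_(v * s)%g = eps * z@_v.
  by have := congr1 (fun z : {malg int[W]} => z@_v) ez; rewrite mcoeffZ rtr_coeff // (dih_ss D).
have asc v : len v = n -> len (v * s)%g = n.+1 -> z@_v = 0.
  move=> _ lv; have : eps * z@_v = 0 by rewrite -coefz zn // lv.
  by move/(congr1 ( *%R eps)); rewrite mulrA eps2 mul1r mulr0.
case: n => [|n] in IH zn asc *.
  apply: IH => // v _; have [v1|v1] := eqVneq v 1%g.
    by apply: asc; rewrite v1 ?mul1g ?(len1 D) // (len_S D (dih_Ss D)).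
  by apply: zn; have [x [_ ->]] := len_gt0 D (elimN eqP v1).
pose a := z@_(alt s t n.+1).
have za : lspan c E (z - a *: c (alt s t n.+1)).
  apply: IH.
    move=> v; rewrite leq_eqVlt => /predU1P[lv|lv]; rewrite mcoeffB mcoeffZ; last first.
      rewrite zn // tri; last by rewrite (length_alt _ D) ltnW.
      by case: eqP lv => [<-|_ _]; rewrite ?(length_alt _ D) ?ltnn // mulr0 subrr.
    rewrite tri; last by rewrite (length_alt _ D) lv.
    case: eqP => [<-|nv]; first by rewrite mulr1 subrr.
    rewrite mulr0 subr0; apply: asc; first by rewrite -lv.
    have [ve|[k ve]|[k ve]] := dih_cases v D.
    - by move: lv; rewrite ve (len1 D).
    - by case: nv; move: lv; rewrite ve (length_alt _ D) => ->.
    - move: lv; rewrite ve (length_alt _ D') => <-.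
      by rewrite -altSr (length_alt _ D).
  by rewrite rtrB rtrZ eig ez scalerBr !scalerA mulrC.
rewrite -[z](subrK (a *: c (alt s t n.+1))); apply: lspanD za _.
exact/lspanZ/lspan_gen.
Qed.

End EigenSpan.

(** Every element is lengthened on the right by [s] or by [t], so a longest element of the support
    would produce a longer one. *)
Lemma no_common_eigen (W : groupType) (S : set W) (s t : W) (z : {malg int[W]}) (a b : int) :
  is_dihedral S s t -> rtr s z = a *: z -> rtr t z = b *: z -> a * a = 1 -> b * b = 1 -> z = 0.
Proof.
move=> D; have D' := dihedral_sym D; have [n] := malg_low (cox_length S) z.
have key x (e : int) v : (x * x)%g = 1%g -> rtr x z = e *: z -> e * e = 1 -> z@_(v * x)%g = 0 -> z@_v = 0.
  move=> xx ez ee; have := congr1 (fun z : {malg int[W]} => z@_v) ez.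
  rewrite mcoeffZ rtr_coeff // => -> /(congr1 ( *%R e)).
  by rewrite mulrA ee mul1r mulr0.
move=> zn es et aa bb; elim: n zn => [|n IH] zn; first by apply/malgP => v; rewrite zn // mcoeff0.
apply: IH => v; rewrite leq_eqVlt => /predU1P[lv|]; last exact: zn.
have [ve|[k ve]|[k ve]] := dih_cases v D.
- apply: (key s a) => //; first exact: (dih_ss D).
  by apply: zn; rewrite ve mul1g (len_S D (dih_Ss D)) lv ve (len1 D).
- apply: (key t b) => //; first exact: (dih_ss D').
  by apply: zn; rewrite ve -altSr (length_alt _ D') lv ve (length_alt _ D).
- apply: (key s a) => //; first exact: (dih_ss D).
  by apply: zn; rewrite ve -altSr (length_alt _ D) lv ve (length_alt _ D').
Qed.

Section FamilyMembership.
Variables (W : groupType) (S : set W) (s t : W).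
Hypothesis D : is_dihedral S s t.
Let D' := dihedral_sym D.

Lemma kappaU2P b x : kappaU S b s t x = 2%N -> exists n, x = alt s t n.+1.
Proof.
have [->|->|[k ->]|[k ->]] := dih_cases2 D x;
  rewrite ?kappaU1 ?(kappaU_t D) ?(kappaU_alt D) ?(kappaU_alt' D);
  first [by []|by case: b|by exists k].
Qed.

Lemma kappaU3P b x : kappaU S b s t x = 3%N -> exists n, x = alt t s n.+2.
Proof.
have [->|->|[k ->]|[k ->]] := dih_cases2 D x;
  rewrite ?kappaU1 ?(kappaU_t D) ?(kappaU_alt D) ?(kappaU_alt' D);
  first [by []|by case: b|by exists k].
Qed.

Lemma kappaU13P x : kappaU S true s t x = 1%N \/ kappaU S true s t x = 3%N ->
  exists n, x = alt t s n.+1.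
Proof.
have [->|->|[k ->]|[k ->]] := dih_cases2 D x;
  rewrite ?kappaU1 ?(kappaU_t D) ?(kappaU_alt D) ?(kappaU_alt' D); move=> h;
  first [by case: h|by exists 0%N|by exists k.+1].
Qed.

Lemma kappaU13_alt n : kappaU S true s t (alt t s n.+1) = 1%N \/
  kappaU S true s t (alt t s n.+1) = 3%N.
Proof. by case: n => [|n]; rewrite ?(kappaU_t D) ?(kappaU_alt' D); [left|right]. Qed.

Lemma kappaE2P x : kappaE S s x = 2%N -> exists n, x = alt s t n.+1.
Proof.
have [->|[k ->]|[k ->]] := dih_cases x D;
  by rewrite ?kappaE1 ?(kappaE_alt D) ?(kappaE_alt' D) //; exists k.
Qed.

Lemma kappaE3P x : kappaE S s x = 3%N -> exists n, x = alt t s n.+1.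
Proof.
have [->|[k ->]|[k ->]] := dih_cases x D;
  by rewrite ?kappaE1 ?(kappaE_alt D) ?(kappaE_alt' D) //; exists k.
Qed.

End FamilyMembership.

Lemma scale_comb2 (R : comNzRingType) (V : lmodType R) (u v x k : R) (g h : V) :
  u *: (x *: (v *: g) + k *: (v *: h)) = (u * v) *: (x *: g + k *: h).
Proof. by module_eq R; ring. Qed.

Section Spans.
Variables (W : groupType) (S : set W) (s t : W) (G : tozmodType).
Variables (phi : Sbar S -> G) (wt : W -> G).
Hypothesis D : is_dihedral S s t.
Hypothesis phiE : forall (o : Sbar S) x, val o x -> phi o = wt x.
Let D' := dihedral_sym D.
Local Notation T := (@heckeT W G).
Local Notation M := (hM phi).
Local Notation ZW := ({malg int[W]}).
Local Notation sp := (@special W G).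
Local Notation c := (spkl phi).
Local Notation kl := (klT s t phi wt).
Local Notation good := (forall w,
  kl_spec S (@neg_low W S G) (eT s t wt) (klT s t phi wt) (hbar phi) w).

Definition sgx (x : W) : int := (-1) ^+ neg_wt wt x.

Lemma sgx_sq x : sgx x * sgx x = 1.
Proof. by rewrite /sgx; case: neg_wt. Qed.

Lemma special_mul_r x h : sp (M h (T x)) = rtr x (sp h).
Proof.
apply: (@sext_eq W (group_ring G) int ZW (@augmentation G)
  (fun h => sp (M h (T x))) (fun h => rtr x (sp h))).
- by move=> a b; rewrite (hmDl D phiE) specialD.
- by move=> a b; rewrite specialD rtrD.
- by move=> r a; rewrite (hmZl D phiE) specialZ.
- by move=> r a; rewrite specialZ rtrZ.
- move=> k; rewrite -/(T k) (special_mul D phiE) !specialT rtrU ltrU; reflexivity.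
Qed.

Lemma special_ro x h : sp (ro phi wt x h) = sgx x *: rtr x (sp h).
Proof. by rewrite ro.unlock specialZ special_mul_r rmorphXn rmorphN rmorph1. Qed.

Definition sgi (w : W) : int := augmentation (sgw s t wt w).

Lemma sgi_sq w : sgi w * sgi w = 1.
Proof. by rewrite /sgi -rmorphM (sg_sq wt D) rmorph1. Qed.

Lemma special_klT w : sp (kl w) = sgi w *: c w.
Proof. by rewrite klT.unlock specialZ spkl.unlock klL.unlock. Qed.

Lemma spkl_klT w : c w = sgi w *: sp (kl w).
Proof. by rewrite special_klT scalerA sgi_sq scale1r. Qed.

Lemma spkl_right x w a : ro phi wt x (kl w) = gexp a *: kl w ->
  rtr x (c w) = sgx x *: c w.
Proof.
move/(congr1 sp); rewrite special_ro specialZ augmentation_exp scale1r => e.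
rewrite spkl_klT rtrZ -{2}e !scalerA mulrAC sgx_sq mul1r; reflexivity.
Qed.

Section Unequal.
Variable b : bool.
Hypothesis lt_ts : abs_wt wt t < abs_wt wt s.
Hypothesis bE : b = (abs_wt wt t != 0).

Let gd := unequal_good D phiE lt_ts bE.
Let tri := spkl_tri D gd.

Lemma unequal_span_p z :
  lspan c [set x | kappaU S b s t x = 2%N] z <-> rtr s z = sgx s *: z.
Proof.
apply: (eigen_span D tri) => [k||n|x].
- exact: (spkl_right (unequal_right D phiE lt_ts bE k)).
- exact: sgx_sq.
- exact: (kappaU_alt D).
- exact: (kappaU2P D).
Qed.

(** Specializes [uneq_kl_right]: right multiplication by T_t + [kap] becomes, up to sign, [sgx t]
    times the translation by [t], plus 1 or 0 according to [b]. *)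
Lemma unequal_span_q z : lspan c [set x | kappaU S b s t x = 3%N] z <->
  exists2 y, rtr s y = sgx s *: y & z = sgx t *: rtr t y + (nat_of_bool b)%:Z *: y.
Proof.
have e n : c (alt t s n.+2) = (sgi (alt t s n.+2) * sgi (alt s t n.+1)) *:
    (sgx t *: rtr t (c (alt s t n.+1)) + (nat_of_bool b)%:Z *: c (alt s t n.+1)).
  rewrite spkl_klT (unequal_right_q D phiE lt_ts bE n) specialD special_ro specialZ.
  have -> : augmentation (kap_wt t wt b) = (nat_of_bool b)%:Z.
    by rewrite /kap_wt; case: b; [exact: augmentation_exp|exact: raddf0].
  rewrite !special_klT rtrZ; exact: scale_comb2.
apply: iff_trans (lspan_image (c := c) (g := fun y => sgx t *: rtr t y + (nat_of_bool b)%:Z *: y)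
   (a := fun n => alt s t n.+1) (E := [set x | kappaU S b s t x = 2%N]) _ _ e _ _ _ _ _) _.
- move=> r x y; rewrite rtr_linear !scalerDr !scalerA [_ * r]mulrC [_ * r]mulrC addrACA; reflexivity.
- by move=> n; rewrite mulrACA !sgi_sq mulr1.
- by move=> n /=; exact: (kappaU_alt D).
- by move=> x; exact: (kappaU2P D).
- by move=> n /=; exact: (kappaU_alt' D).
- by move=> x; exact: (kappaU3P D).
by split=> -[y /unequal_span_p hy ->]; exists y.
Qed.

Lemma unequal_span_t z : b ->
  lspan c [set x | kappaU S b s t x = 1%N \/ kappaU S b s t x = 3%N] z <->
  rtr t z = sgx t *: z.
Proof.
move=> bT; have tr := tri; have ur n := spkl_right (unequal_right_t D phiE lt_ts bE n bT).
rewrite bT; apply: (eigen_span D' tr) => [k||n|x].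
- exact: ur.
- exact: sgx_sq.
- exact: (kappaU13_alt D).
- exact: (kappaU13P D).
Qed.

End Unequal.

Section Equal.
Hypothesis st_eq : abs_wt wt s = abs_wt wt t.
Hypothesis s_gt0 : 0 < abs_wt wt s.
Let gd := equal_good D phiE st_eq s_gt0.

Lemma equal_span_p z : lspan c [set x | kappaE S s x = 2%N] z <-> rtr s z = sgx s *: z.
Proof.
apply: (eigen_span D (spkl_tri D gd)) => [k||n|x].
- exact: (spkl_right (equal_right D phiE st_eq s_gt0 k)).
- exact: sgx_sq.
- exact: (kappaE_alt D).
- exact: (kappaE2P D).
Qed.

End Equal.

End Spans.

(** * Cell modules attached to a point of the space of positive subsets *)

Section PositionModules.
Variables (W : groupType) (S : set W) (s t : W) (cs ct : Sbar S).
Hypothesis H : two_classes s t cs ct.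
Implicit Types (X Y : pos (ZSbar S)) (E F C : set W).
Let D := tc_dih H.

Definition lclosed X E : Prop :=
  left_closed S (klL (phi_of X) : W -> {malg (group_ring (pos_quot X))[W]})
    (@heckeT W (pos_quot X)) (hM (phi_of X)) E.

Definition pspan X E : {malg int[W]} -> Prop := lspan (spkl (phi_of X)) E.

Lemma pos_good X : exists s' t' (wt : W -> pos_quot X), [/\ is_dihedral S s' t',
  forall (o : Sbar S) x, val o x -> phi_of X o = wt x
  & forall w, kl_spec S (@neg_low W S _) (eT s' t' wt) (klT s' t' (phi_of X) wt)
      (hbar (phi_of X)) w].
Proof.
have H' := two_classes_sym H; have D' := dihedral_sym D.
have [lt|lt|[e n0]|[e1 e2]] := nrm_cases X H.
- exists s, t, (wt_of s cs ct X); split=> //; first exact: (@wt_ofE _ _ _ _ _ _ H X).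
  rewrite -(abs_wt_of_s s cs ct) -(abs_wt_of_t H) in lt.
  exact: (unequal_good D (@wt_ofE _ _ _ _ _ _ H X) lt erefl).
- exists t, s, (wt_of t ct cs X); split=> //; first exact: (@wt_ofE _ _ _ _ _ _ H' X).
  rewrite -(abs_wt_of_s t ct cs) -(abs_wt_of_t H') in lt.
  exact: (unequal_good D' (@wt_ofE _ _ _ _ _ _ H' X) lt erefl).
- exists s, t, (wt_of s cs ct X); split=> //; first exact: (@wt_ofE _ _ _ _ _ _ H X).
  rewrite -(abs_wt_of_s s cs ct) -(abs_wt_of_t H) in e.
  apply: (equal_good D (@wt_ofE _ _ _ _ _ _ H X) e).
  by rewrite lt_neqAle eq_sym abs_wt_of_s n0 -(abs_wt_of_s s cs ct) abs_wt_ge0.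
- exists s, t, (wt_of s cs ct X); split=> //; first exact: (@wt_ofE _ _ _ _ _ _ H X).
  rewrite -(abs_wt_of_s s cs ct) in e1; rewrite -(abs_wt_of_t H) in e2.
  exact: (zero_good D (@wt_ofE _ _ _ _ _ _ H X) e1 e2).
Qed.

Lemma pos_presents X C w0 E : C = [set x | cell_eq (phi_of X) LeftSide x w0] -> C `<=` E ->
  lclosed X E -> lclosed X (E `\` C) -> presents (ZM (phi_of X) C) (pspan X E) (pspan X (E `\` C)).
Proof.
have [s' [t' [wt [D1 phiE gd]]]] := pos_good X.
move=> CE sE h1 h2.
exact: (ZM_presents D1 phiE gd CE sE h1 h2).
Qed.

Lemma pos_submod X E : lclosed X E -> submod (pspan X E).
Proof.
by have [s' [t' [wt [D1 phiE gd]]]] := pos_good X; exact: (lspan_submod D1 phiE gd).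
Qed.

Lemma pspan_setT X z : pspan X setT z.
Proof.
have [s' [t' [wt [D1 phiE gd]]]] := pos_good X.
by have [a ->] := tri_surj (spkl_tri D1 gd) z; exists a.
Qed.

Lemma pspan_set0 X z : pspan X set0 z <-> z = 0.
Proof. exact: lspan_set0. Qed.

Lemma lclosed_setT X : lclosed X setT.
Proof.
have [s' [t' [wt [D1 phiE gd]]]] := pos_good X; move=> z w _ _.
have [a e] := cm_surj (hecke_cell_model D1 phiE gd) (hM (phi_of X) (heckeT _ z) (klL (phi_of X) w)).
by exists a.
Qed.

Lemma lclosed_set0 X : lclosed X set0.
Proof. by []. Qed.

Lemma lclosedU X E F : lclosed X E -> lclosed X F -> lclosed X (E `|` F).
Proof.
move=> hE hF z w Sz [Ew|Fw].
  by apply: lspan_sub (hE z w Sz Ew) => x; left.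
by apply: lspan_sub (hF z w Sz Fw) => x; right.
Qed.

Lemma setD_diff E F : E `<=` F -> F `\` (F `\` E) = E.
Proof.
move=> EF; apply/seteqP; split=> x; first by move=> [Fx h]; apply: contrapT => nE; apply: h.
by move=> Ex; split; [exact: EF|move=> []].
Qed.

(** For a chain of closed sets at Y whose successive differences are cells, [pos_presents]
    identifies every quotient; only the presentation of the module at X remains to be supplied. *)
Lemma chain_filtration X Y C d (E : nat -> set W) :
  (forall i, (i <= d)%N -> lclosed Y (E i)) ->
  (forall i, (i < d)%N -> E i `<=` E i.+1) ->
  (forall i, (i < d)%N -> is_cell (phi_of Y) LeftSide (E i.+1 `\` E i)) ->
  C = E d `\` E 0%N ->
  presents (ZM (phi_of X) C) (pspan Y (E d)) (pspan Y (E 0%N)) ->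
  cell_filtration X Y C.
Proof.
move=> hc hs hcell CE hX.
have mono i j : (i <= j)%N -> (j <= d)%N -> E i `<=` E j.
  elim: j => [|j IH] ij jd; first by move: ij; rewrite leqn0 => /eqP ->.
  move: ij; rewrite leq_eqVlt => /predU1P[-> //|ij] x Ex.
  by apply: hs => //; apply: IH => //; exact: ltnW.
have disj i j x : (i < j)%N -> (j < d)%N -> (E i.+1 `\` E i) x -> (E j.+1 `\` E j) x -> False.
  by move=> ij jd [Ei _] [_]; apply; exact: (mono _ _ ij (ltnW jd)) Ei.
apply: (filtrationP (Ds := fun i => E i.+1 `\` E i) (N := fun i => pspan Y (E i))); [exact: hcell|idtac|idtac|idtac|idtac|exact: hX|idtac].
- move=> i j x id jd hi hj; have [ij|ij|//] := ltngtP i j.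
    by case: (disj _ _ _ ij jd hi hj).
  by case: (disj _ _ _ ij id hj hi).
- move=> x; rewrite CE; split=> [[Ed nE0]|[i id [Ex nE]]]; last first.
    split; first exact: (mono _ _ id (leqnn d)) Ex.
    by move=> E0; apply: nE; exact: (mono 0%N _ (leq0n _) (ltnW id)) E0.
  have : exists k, (k <= d)%N /\ E k x by exists d.
  move=> [k []]; elim: k => [//|k IH] kd Ek.
  have [Ek'|nEk] := EM (E k x); first by apply: IH Ek'; exact: ltnW.
  by exists k.
- by move=> i id; apply/pos_submod/hc.
- by move=> i x id; apply: lspan_sub; exact: hs.
- move=> i id; have [w0 e] := hcell i id.
  have sD := setD_diff (hs i id).
  have := pos_presents e _ (hc i.+1 id); rewrite sD; apply; last by apply: hc; exact: ltnW.
  by move=> x [].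
Qed.

End PositionModules.

(** For submodules that are isomorphic without being equal: a pointwise choice of preimages under
    [g] is additive and equivariant because [g] is injective on [P']. *)
Lemma presents_bij (W : groupType) (U : opmod W) (P P' : {malg int[W]} -> Prop)
    (g : {malg int[W]} -> {malg int[W]}) : submod P -> submod P' ->
  (forall x, P' x -> P (g x)) -> (forall x y, g (x - y) = g x - g y) ->
  (forall (w : W) x, g (ltr w x) = ltr w (g x)) ->
  (forall x, P x -> exists2 y, P' y & x = g y) -> (forall y, P' y -> g y = 0 -> y = 0) ->
  presents U P' (fun z => z = 0) -> presents U P (fun z => z = 0).
Proof.
move=> [_ PB Pl] sP' gP gB gl gs gi; have [_ PB' Pl'] := sP'.
have /choice[h hP] : forall x, exists y, P x -> P' y /\ x = g y.
  move=> x; have [/gs[y Py e]|nP] := EM (P x); first by exists y.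
  by exists 0.
have hg x y : P x -> P' y -> x = g y -> h x = y.
  move=> Px Py e; have [Ph eh] := hP x Px; apply/eqP; rewrite -subr_eq0; apply/eqP.
  by apply: gi; [exact: PB'|rewrite gB -eh e subrr].
apply: (presents_map (g := h)) => [//|x Px|x y Px Py|w x Px|x Px|x Px].
- by have [] := hP x Px.
- have [Phx ex] := hP x Px; have [Phy ey] := hP y Py.
  by apply: hg; [exact: PB|exact: PB'|rewrite gB -ex -ey].
- have [Phx ex] := hP x Px.
  by apply: hg; [exact: Pl|exact: Pl'|rewrite gl -ex].
- exists (g x); first exact: gP.
  by rewrite (hg (g x) x) ?subrr //; exact: gP.
- have [Phx ex] := hP x Px; split=> [x0|hx0]; last by rewrite ex hx0 -(subrr 0) gB !subrr.
  by apply: gi; rewrite -?ex.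
Qed.

Section EigenvectorsOfTranslations.
Variables (W : groupType) (s t : W) (e d : int) (x y : {malg int[W]}).
Hypotheses (ex : rtr s x = e *: x) (ey : rtr s y = e *: y).

Lemma eigenZ : rtr s (d *: x) = e *: (d *: x).
Proof. by rewrite rtrZ ex !scalerA (mulrC d). Qed.

Lemma eigenD : rtr s (x + y) = e *: (x + y).
Proof. by rewrite rtrD ex ey scalerDr. Qed.

Lemma eigenB : rtr s (x - y) = e *: (x - y).
Proof. by rewrite rtrB ex ey scalerBr. Qed.

End EigenvectorsOfTranslations.

Section PositionSpans.
Variables (W : groupType) (S : set W) (s t : W) (cs ct : Sbar S).
Hypothesis H : two_classes s t cs ct.
Variable X : pos (ZSbar S).
Let D := tc_dih H.

Definition sgn (Z : pos (ZSbar S)) (o : Sbar S) : int := (-1) ^+ (~~ (0 <= phi_of Z o)).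

Lemma sgn_sq Z o : sgn Z o * sgn Z o = 1.
Proof. by rewrite /sgn; case: (0 <= _). Qed.

Let wt := wt_of s cs ct X.
Let wtE := @wt_ofE _ _ _ _ _ _ H X.

Let sgx_s : sgx wt s = sgn X cs.
Proof. by rewrite /sgx /neg_wt /wt wt_of_s. Qed.

Let sgx_t : sgx wt t = sgn X ct.
Proof. exact: (congr1 (fun a : pos_quot X => (-1) ^+ (~~ (0 <= a)) : int) (wt_of_t H X)). Qed.

Section Dominant.
Variable b : bool.
Hypotheses (bE : b = (nrm X ct != 0)) (lt : nrm X ct < nrm X cs).

Let ltw : abs_wt wt t < abs_wt wt s.
Proof. by rewrite /wt abs_wt_of_s (abs_wt_of_t H). Qed.
Let bw : b = (abs_wt wt t != 0).
Proof. by rewrite /wt (abs_wt_of_t H). Qed.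

Lemma dom_closed_p : lclosed X [set x | kappaU S b s t x = 2%N].
Proof. exact: (unequal_closed_p D wtE ltw bw). Qed.

Lemma dom_closed_q : lclosed X [set x | kappaU S b s t x = 3%N].
Proof. exact: (unequal_closed_q D wtE ltw bw). Qed.

Lemma dom_closed_t : b -> lclosed X [set x | kappaU S b s t x = 1%N \/ kappaU S b s t x = 3%N].
Proof. exact: (unequal_closed_t D wtE ltw bw). Qed.

Lemma dom_span_p z : pspan X [set x | kappaU S b s t x = 2%N] z <-> rtr s z = sgn X cs *: z.
Proof. by rewrite -sgx_s; exact: (unequal_span_p D wtE ltw bw). Qed.

Lemma dom_span_q z : pspan X [set x | kappaU S b s t x = 3%N] z <->
  exists2 y, rtr s y = sgn X cs *: y & z = sgn X ct *: rtr t y + (nat_of_bool b)%:Z *: y.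
Proof. by rewrite -sgx_s -sgx_t; exact: (unequal_span_q D wtE ltw bw). Qed.

Lemma dom_span_t z : b ->
  pspan X [set x | kappaU S b s t x = 1%N \/ kappaU S b s t x = 3%N] z <->
  rtr t z = sgn X ct *: z.
Proof. by rewrite -sgx_t; exact: (unequal_span_t D wtE ltw bw). Qed.

End Dominant.

Section Equal.
Hypotheses (e : nrm X cs = nrm X ct) (n0 : nrm X cs != 0).

Let ew : abs_wt wt s = abs_wt wt t.
Proof. by rewrite /wt abs_wt_of_s (abs_wt_of_t H). Qed.
Let gw : 0 < abs_wt wt s.
Proof. by rewrite lt_neqAle eq_sym abs_wt_ge0 andbT /wt abs_wt_of_s. Qed.

Lemma eq_pos_closed_p : lclosed X [set x | kappaE S s x = 2%N].
Proof. exact: (equal_closed_p D wtE ew gw). Qed.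

Lemma eq_pos_closed_q : lclosed X [set x | kappaE S s x = 3%N].
Proof. exact: (equal_closed_q D wtE ew gw). Qed.

Lemma eq_pos_span_p z : pspan X [set x | kappaE S s x = 2%N] z <-> rtr s z = sgn X cs *: z.
Proof. by rewrite -sgx_s; exact: (equal_span_p D wtE ew gw). Qed.

End Equal.

End PositionSpans.

Lemma kappaE_swap (W : groupType) (S : set W) (s t : W) : is_dihedral S s t ->
  [set x | kappaE S t x = 2%N] = [set x | kappaE S s x = 3%N].
Proof.
move=> D; have D' := dihedral_sym D; apply/seteqP; split=> x /=.
  by move=> /(kappaE2P D')[n ->]; rewrite (kappaE_alt' D).
by move=> /(kappaE3P D)[n ->]; rewrite (kappaE_alt D').
Qed.

(** * Conjecture B *)

Section ConjectureB.
Variables (W : groupType) (S : set W) (s t : W) (cs ct : Sbar S).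
Hypothesis H : two_classes s t cs ct.
Variables (X Y : pos (ZSbar S)).
Hypotheses (sXY : spz cs ct X Y) (gY : generic cs ct Y) (dY : nrm Y ct < nrm Y cs).
Let D := tc_dih H.
Let H' := two_classes_sym H.
Local Notation ka := (kappaU S true s t).
Local Notation A2 := [set x | ka x = 2%N].
Local Notation A3 := [set x | ka x = 3%N].
Local Notation A13 := [set x | ka x = 1%N \/ ka x = 3%N].

Let bY : true = (nrm Y ct != 0).
Proof. by rewrite (generic_nrm (generic_sym gY)). Qed.

Let cellY x y : cell_eq (phi_of Y) LeftSide x y <-> ka x = ka y.
Proof. exact: (dom_cells H LeftSide x y bY dY). Qed.

Let ka_le x : (ka x <= 3)%N.
Proof. by rewrite /kappaU; do 3?case: ifP. Qed.

Let c2 : lclosed Y A2. Proof. exact: (dom_closed_p H bY dY). Qed.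
Let c3 : lclosed Y A3. Proof. exact: (dom_closed_q H bY dY). Qed.
Let c13 : lclosed Y A13. Proof. exact: (dom_closed_t H bY dY isT). Qed.
Let c23 : lclosed Y (A2 `|` A3). Proof. exact: lclosedU. Qed.
Let c213 : lclosed Y (A2 `|` A13). Proof. exact: lclosedU. Qed.
Let cT : lclosed Y setT. Proof. exact: (lclosed_setT H). Qed.

Let cell_set (E : set W) n : (forall x, E x <-> ka x = n) -> (exists w, ka w = n) ->
  is_cell (phi_of Y) LeftSide E.
Proof.
move=> hE [w kw]; exists w; apply/seteqP; split=> x; first by move=> /hE e; apply/cellY; rewrite kw.
by move=> /cellY; rewrite kw => /hE.
Qed.

Let ex0 : exists w, ka w = 0%N. Proof. by exists 1%g; exact: kappaU1. Qed.
Let ex1 : exists w, ka w = 1%N. Proof. by exists (alt t s 1); rewrite (kappaU_t D). Qed.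
Let ex2 : exists w, ka w = 2%N. Proof. by exists (alt s t 1); rewrite (kappaU_alt D). Qed.
Let ex3 : exists w, ka w = 3%N. Proof. by exists (alt t s 2); rewrite (kappaU_alt' D). Qed.

Let cell2 : is_cell (phi_of Y) LeftSide (A2 `\` set0).
Proof. by rewrite setD0; apply: (cell_set (n := 2)). Qed.
Let cell3 : is_cell (phi_of Y) LeftSide (A3 `\` set0).
Proof. by rewrite setD0; apply: (cell_set (n := 3)). Qed.
Let cell32 : is_cell (phi_of Y) LeftSide ((A2 `|` A3) `\` A2).
Proof. by apply: (cell_set (n := 3)) => // x; rewrite /setD /setU /=; lia. Qed.
Let cell1 : is_cell (phi_of Y) LeftSide (A13 `\` A3).
Proof. by apply: (cell_set (n := 1)) => // x; rewrite /setD /setU /=; lia. Qed.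
Let cell1' : is_cell (phi_of Y) LeftSide ((A2 `|` A13) `\` (A2 `|` A3)).
Proof. by apply: (cell_set (n := 1)) => // x; rewrite /setD /setU /=; lia. Qed.
Let cell0 : is_cell (phi_of Y) LeftSide (setT `\` (A2 `|` A13)).
Proof. by apply: (cell_set (n := 0)) => // x; have := ka_le x; rewrite /setD /setU /setT /=; lia. Qed.

Lemma chain1 (C E0 E1 : set W) : E0 `<=` E1 -> lclosed Y E0 -> lclosed Y E1 ->
  is_cell (phi_of Y) LeftSide (E1 `\` E0) -> C = E1 `\` E0 ->
  presents (ZM (phi_of X) C) (pspan Y E1) (pspan Y E0) -> cell_filtration X Y C.
Proof.
move=> sE h0 h1 hc CE pr; pose E (i : nat) := nth set0 [:: E0; E1] i.
apply: (chain_filtration H (d := 1) (E := E)) => // [[|[]]|[]|[]] //.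
Qed.

Lemma chain2 (C E0 E1 E2 : set W) : E0 `<=` E1 -> E1 `<=` E2 ->
  lclosed Y E0 -> lclosed Y E1 -> lclosed Y E2 ->
  is_cell (phi_of Y) LeftSide (E1 `\` E0) -> is_cell (phi_of Y) LeftSide (E2 `\` E1) ->
  C = E2 `\` E0 ->
  presents (ZM (phi_of X) C) (pspan Y E2) (pspan Y E0) -> cell_filtration X Y C.
Proof.
move=> s1 s2 h0 h1 h2 hc1 hc2 CE pr; pose E (i : nat) := nth set0 [:: E0; E1; E2] i.
apply: (chain_filtration H (d := 2) (E := E)) => // [[|[|[]]]|[|[]]|[|[]]] //.
Qed.

Definition same_span (E F : set W) : Prop := forall z, pspan X E z <-> pspan Y F z.

Lemma same_spanU E F E' F' : same_span E E' -> same_span F F' ->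
  same_span (E `|` F) (E' `|` F').
Proof.
move=> hE hF z; apply: iff_trans (lspan_union _ _ _ _) (iff_trans _ (iff_sym (lspan_union _ _ _ _))).
by split=> -[x [y [/hE hx /hF hy ->]]]; exists x, y.
Qed.

Lemma same_setT : same_span setT setT.
Proof. by move=> z; split=> _; exact: (pspan_setT H). Qed.

Lemma same_set0 : same_span set0 set0.
Proof. by move=> z; split=> /pspan_set0 ->; apply/pspan_set0. Qed.

Lemma same_presents (C E1 E0 F1 F0 : set W) (w0 : W) :
  C = [set x | cell_eq (phi_of X) LeftSide x w0] -> C `<=` E1 -> E1 `\` C = E0 ->
  lclosed X E1 -> lclosed X E0 -> same_span E1 F1 -> same_span E0 F0 ->
  presents (ZM (phi_of X) C) (pspan Y F1) (pspan Y F0).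
Proof.
move=> CE sC dE h1 h0 s1 s0; apply: (presents_ext s1 s0).
by rewrite -dE; apply: (pos_presents H CE) => //; rewrite dE.
Qed.

Let sgn_s : nrm X cs != 0 -> sgn X cs = sgn Y cs.
Proof. by rewrite nrm_eq0 /sgn => n0; rewrite (spz_neg_wt sXY n0). Qed.

Let sgn_t : nrm X ct != 0 -> sgn X ct = sgn Y ct.
Proof. by rewrite nrm_eq0 /sgn => n0; rewrite (spz_neg_wt (spz_sym sXY) n0). Qed.

Let span2 z : pspan Y A2 z <-> rtr s z = sgn Y cs *: z.
Proof. exact: (dom_span_p H bY dY). Qed.

Let span13 z : pspan Y A13 z <-> rtr t z = sgn Y ct *: z.
Proof. exact: (dom_span_t H bY dY _ isT). Qed.

Let span3 z : pspan Y A3 z <->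
  exists2 y, rtr s y = sgn Y cs *: y & z = sgn Y ct *: rtr t y + y.
Proof.
apply: iff_trans (dom_span_q H bY dY z) _.
by split=> -[y hy ->]; exists y => //; rewrite scale1r.
Qed.

Lemma filtration_dom (C : set W) : is_cell (phi_of X) LeftSide C -> nrm X ct < nrm X cs ->
  nrm X ct != 0 -> cell_filtration X Y C.
Proof.
move=> [w CE] dX n0; have bX : true = (nrm X ct != 0) by rewrite n0.
have s0 : nrm X cs != 0.
  apply/eqP => /esym; apply: to_lt_neq; apply: le_lt_trans dX; rewrite nrmE; exact: toabs_ge0.
have x2 := dom_closed_p H bX dX; have x3 := dom_closed_q H bX dX.
have x13 := dom_closed_t H bX dX isT; have x213 := lclosedU x2 x13.
have same2 : same_span A2 A2.
  by move=> z; rewrite (dom_span_p H bX dX) span2 sgn_s.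
have same3 : same_span A3 A3.
  move=> z; apply: iff_trans (dom_span_q H bX dX z) (iff_trans _ (iff_sym (span3 z))).
  by rewrite sgn_s // sgn_t //; split=> -[y hy ->]; exists y => //; rewrite scale1r.
have same13 : same_span A13 A13.
  by move=> z; rewrite (dom_span_t H bX dX _ isT) span13 sgn_t.
have Ck : C = [set x | ka x = ka w].
  by rewrite CE; apply/seteqP; split=> x /(dom_cells H LeftSide _ _ bX dX).
have := ka_le w; move: Ck; case: (ka w) => [|[|[|[|//]]]] Ck _.
- apply: (@chain1 C (A2 `|` A13) setT) => //.
    by rewrite Ck; apply/seteqP; split=> x; have := ka_le x; rewrite /setD /setU /setT /=; lia.
  apply: (same_presents CE _ _ (lclosed_setT H X) x213 same_setT (same_spanU same2 same13)) => //.
  by rewrite Ck; apply/seteqP; split=> x; have := ka_le x; rewrite /setD /setU /setT /=; lia.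
- apply: (@chain1 C A3 A13) => //; first by move=> x; right.
    by rewrite Ck; apply/seteqP; split=> x; rewrite /setD /=; lia.
  apply: (same_presents CE _ _ x13 x3 same13 same3); rewrite Ck; first by move=> x; left.
  by apply/seteqP; split=> x; rewrite /setD /=; lia.
- apply: (@chain1 C set0 A2) => //; first by rewrite setD0.
  by apply: (same_presents CE _ _ x2 (@lclosed_set0 _ _ X) same2 same_set0); rewrite Ck ?setDv.
- apply: (@chain1 C set0 A3) => //; first by rewrite setD0.
  by apply: (same_presents CE _ _ x3 (@lclosed_set0 _ _ X) same3 same_set0); rewrite Ck ?setDv.
Qed.

Let kaE_ka x : [/\ kappaE S s x = 0%N <-> ka x = 0%N, kappaE S s x = 2%N <-> ka x = 2%N,
  kappaE S s x = 3%N <-> ka x = 1%N \/ ka x = 3%N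
  & [\/ kappaE S s x = 0%N, kappaE S s x = 2%N | kappaE S s x = 3%N]].
Proof.
have [->|->|[k ->]|[k ->]] := dih_cases2 D x;
  rewrite ?kappaE1 ?(kappaE_alt D) ?(kappaE_alt' D) ?kappaU1 ?(kappaU_t D) ?(kappaU_alt D)
    ?(kappaU_alt' D); split; try lia; by [constructor 1|constructor 2|constructor 3].
Qed.

Let kaF_ka x : [/\ kappaU S false s t x = 0%N <-> ka x = 0%N \/ ka x = 1%N,
  kappaU S false s t x = 2%N <-> ka x = 2%N, kappaU S false s t x = 3%N <-> ka x = 3%N
  & [\/ kappaU S false s t x = 0%N, kappaU S false s t x = 2%N | kappaU S false s t x = 3%N]].
Proof.
have [->|->|[k ->]|[k ->]] := dih_cases2 D x;
  rewrite ?kappaU1 ?(kappaU_t D) ?(kappaU_alt D) ?(kappaU_alt' D); split; try lia;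
  by [constructor 1|constructor 2|constructor 3].
Qed.

(** The eigenspace for [t] is spanned at X by all words ending in [t], and at Y by [t] together with
    the longer ones. Only this cell splits, through the closed set [A3]. *)
Lemma filtration_eq (C : set W) : is_cell (phi_of X) LeftSide C -> nrm X cs = nrm X ct ->
  nrm X cs != 0 -> cell_filtration X Y C.
Proof.
move=> [w CE] eX s0; have t0 : nrm X ct != 0 by rewrite -eX.
have E2 : [set x | kappaE S s x = 2%N] = A2 by apply/seteqP; split=> x /=; have [_ h _ _] := kaE_ka x; move/h.
have E3 : [set x | kappaE S s x = 3%N] = A13.
  by apply/seteqP; split=> x /=; have [_ _ h _] := kaE_ka x; move/h.
have x2 : lclosed X A2 by rewrite -E2; exact: (eq_pos_closed_p H eX s0).
have x13 : lclosed X A13 by rewrite -E3; exact: (eq_pos_closed_q H eX s0).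
have x213 := lclosedU x2 x13.
have same2 : same_span A2 A2.
  by move=> z; rewrite -{1}E2 (eq_pos_span_p H eX s0) span2 sgn_s.
have same13 : same_span A13 A13.
  by move=> z; rewrite -{1}E3 -(kappaE_swap D) (eq_pos_span_p H' (esym eX) t0) span13 sgn_t.
have Ck : C = [set x | kappaE S s x = kappaE S s w].
  by rewrite CE; apply/seteqP; split=> x /(eq_cells H LeftSide _ _ eX s0).
have [_ _ _ []] := kaE_ka w => kw; rewrite kw in Ck.
- have Ck' : C = [set x | ka x = 0%N].
    by rewrite Ck; apply/seteqP; split=> x /=; have [h _ _ _] := kaE_ka x; move/h.
  have CD : C = setT `\` (A2 `|` A13).
    by rewrite Ck'; apply/seteqP; split=> x; have := ka_le x; rewrite /setD /setU /setT /=; lia.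
  apply: (@chain1 C (A2 `|` A13) setT) => //.
  apply: (same_presents CE _ _ (lclosed_setT H X) x213 same_setT (same_spanU same2 same13)) => //.
  by rewrite CD; apply: setD_diff.
- rewrite E2 in Ck; apply: (@chain1 C set0 A2) => //; first by rewrite setD0.
  by apply: (same_presents CE _ _ x2 (@lclosed_set0 _ _ X) same2 same_set0); rewrite Ck ?setDv.
- rewrite E3 in Ck; apply: (@chain2 C set0 A3 A13) => //.
  + by move=> x; right.
  + by rewrite setD0.
  by apply: (same_presents CE _ _ x13 (@lclosed_set0 _ _ X) same13 same_set0); rewrite Ck ?setDv.
Qed.

(** At X the only cell is W and its module is Z[W], which the elements c_w span at Y too; a chain of
    closed sets for Y from the empty set to W then gives the filtration. *)
Lemma filtration_nil (C : set W) : is_cell (phi_of X) LeftSide C -> nrm X cs = 0 ->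
  nrm X ct = 0 -> cell_filtration X Y C.
Proof.
move=> [w CE] s0 t0; have CT : C = setT.
  by rewrite CE; apply/seteqP; split=> // x _; exact: (nil_cells H).
pose E (i : nat) := nth set0 [:: set0; A2; A2 `|` A3; A2 `|` A13; setT] i.
apply: (chain_filtration H (d := 4) (E := E)).
- move=> [_|[_|[_|[_|[_|//]]]]];
    [exact: (@lclosed_set0 _ _ Y)|exact: c2|exact: c23|exact: c213|exact: cT].
- by move=> [|[|[|[|]]]] // _ x; rewrite /E /= /setU /=; lia.
- by move=> [_|[_|[_|[_|//]]]]; [exact: cell2|exact: cell32|exact: cell1'|exact: cell0].
- by rewrite /E /= setD0.
apply: (same_presents CE _ _ (lclosed_setT H X) (@lclosed_set0 _ _ X) same_setT same_set0) => //.
by rewrite CT setDv.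
Qed.

Section Degenerate.
Hypotheses (dX : nrm X ct < nrm X cs) (t0 : nrm X ct = 0).

Let bX : false = (nrm X ct != 0). Proof. by rewrite t0 eqxx. Qed.
Let s0 : nrm X cs != 0.
Proof. by apply/eqP => /esym; apply: to_lt_neq; rewrite -t0. Qed.

Let F2 : [set x | kappaU S false s t x = 2%N] = A2.
Proof. by apply/seteqP; split=> x /=; have [_ h _ _] := kaF_ka x; move/h. Qed.
Let F3 : [set x | kappaU S false s t x = 3%N] = A3.
Proof. by apply/seteqP; split=> x /=; have [_ _ h _] := kaF_ka x; move/h. Qed.

Let x2 : lclosed X A2. Proof. by rewrite -F2; exact: (dom_closed_p H bX dX). Qed.
Let x3 : lclosed X A3. Proof. by rewrite -F3; exact: (dom_closed_q H bX dX). Qed.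

Let xspan2 z : pspan X A2 z <-> rtr s z = sgn Y cs *: z.
Proof. by rewrite -F2 (dom_span_p H bX dX) sgn_s. Qed.

Let xspan3 z : pspan X A3 z <-> exists2 y, rtr s y = sgn Y cs *: y & z = rtr t y.
Proof.
have t1 : sgn X ct = 1.
  have /eqP : nrm X ct == 0 by rewrite t0.
  by move/eqP; rewrite nrm_eq0 /sgn => /eqP ->; rewrite lexx.
rewrite -F3; apply: iff_trans (dom_span_q H bX dX z) _; rewrite sgn_s // t1.
by split=> -[y hy ->]; exists y => //; rewrite scale1r scale0r addr0.
Qed.

Let same2 : same_span A2 A2.
Proof. by move=> z; apply: iff_trans (xspan2 z) (iff_sym (span2 z)). Qed.

(** Adding I absorbs the difference between I t and I (1 +- t), where I is the eigenspace for [s]: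
    the spans of [A3] differ at X and Y, but not after [A2] is added. *)
Let same23 : same_span (A2 `|` A3) (A2 `|` A3).
Proof.
move=> z; apply: iff_trans (lspan_union _ _ _ _) (iff_trans _ (iff_sym (lspan_union _ _ _ _))).
have tt := dih_ss (dihedral_sym D); have dd := sgn_sq Y ct.
split=> [[x [y [/xspan2 hx /xspan3[u hu ->] ->]]]|[x [y [/span2 hx /span3[u hu ->] ->]]]].
  exists (x - sgn Y ct *: u), (rtr t u + sgn Y ct *: u); split.
  - apply/span2; exact: (eigenB hx (eigenZ (sgn Y ct) hu)).
  - apply/span3; exists (sgn Y ct *: u); first exact: (eigenZ (sgn Y ct) hu).
    by rewrite rtrZ scalerA dd scale1r.
  - by rewrite [rtr t u + _]addrC addrA subrK.
exists (x + u), (rtr t (sgn Y ct *: u)); split.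
- apply/xspan2; exact: (eigenD hx hu).
- apply/xspan3; exists (sgn Y ct *: u) => //; exact: (eigenZ (sgn Y ct) hu).
- by rewrite rtrZ [_ + u]addrC addrA.
Qed.

(* The cell {s t, t s t, ...} is presented by [I t] at X and by [I (1 +- t)] at Y, where I is
   an eigenspace of the right translation by s; these left ideals differ, but the right
   multiplication by [t +- 1] is an isomorphism between them, because no element of finite
   support is an eigenvector for both s and t. *)
Let q_presents (C : set W) : presents (ZM (phi_of X) C) (pspan X A3) (pspan X set0) ->
  presents (ZM (phi_of X) C) (pspan Y A3) (pspan Y set0).
Proof.
have tt := dih_ss (dihedral_sym D); have dd := sgn_sq Y ct.
move=> /(presents_ext (fun z => iff_refl _) (@pspan_set0 _ _ X)) pr.
apply: (presents_ext (fun z => iff_refl _) (fun z => iff_sym (@pspan_set0 _ _ Y z))).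
apply: (presents_bij (g := fun z => sgn Y ct *: z + rtr t z) (pos_submod H c3) (pos_submod H x3)) pr.
- move=> _ /xspan3[u hu ->]; apply/span3; exists u => //.
  by rewrite (rtrK _ tt).
- by move=> x y; rewrite rtrB scalerBr opprD addrACA.
- by move=> v x; rewrite rtr_ltr ltrD ltrZ.
- move=> _ /span3[u hu ->]; exists (rtr t u); first by apply/xspan3; exists u.
  by rewrite (rtrK _ tt).
- move=> _ /xspan3[u hu ->]; rewrite (rtrK _ tt) => e.
  have e' : rtr t u = - sgn Y ct *: u.
    have e1 : sgn Y ct *: rtr t u = - u by apply/eqP; rewrite -addr_eq0; apply/eqP.
    by rewrite -[rtr t u]scale1r -dd -scalerA e1 scalerN scaleNr.
  have dd' : - sgn Y ct * - sgn Y ct = 1 by rewrite mulrNN dd.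
  by rewrite (no_common_eigen D hu e' (sgn_sq Y cs) dd') rtr0.
Qed.

Lemma filtration_degenerate (C : set W) : is_cell (phi_of X) LeftSide C ->
  cell_filtration X Y C.
Proof.
move=> [w CE].
have Ck : C = [set x | kappaU S false s t x = kappaU S false s t w].
  by rewrite CE; apply/seteqP; split=> x /(dom_cells H LeftSide _ _ bX dX).
have [_ _ _ []] := kaF_ka w => kw; rewrite kw in Ck.
- have Ck' : C = [set x | ka x = 0%N \/ ka x = 1%N].
    by rewrite Ck; apply/seteqP; split=> x /=; have [h _ _ _] := kaF_ka x; move/h.
  have CD : C = setT `\` (A2 `|` A3).
    by rewrite Ck'; apply/seteqP; split=> x; have := ka_le x; rewrite /setD /setU /setT /=; lia.
  apply: (@chain2 C (A2 `|` A3) (A2 `|` A13) setT) => //.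
    by move=> x [h|h]; [left|right; right].
  apply: (same_presents CE _ _ (lclosed_setT H X) (lclosedU x2 x3) same_setT same23) => //.
  by rewrite CD; apply: setD_diff.
- rewrite F2 in Ck; apply: (@chain1 C set0 A2) => //; first by rewrite setD0.
  by apply: (same_presents CE _ _ x2 (@lclosed_set0 _ _ X) same2 same_set0); rewrite Ck ?setDv.
- rewrite F3 in Ck; apply: (@chain1 C set0 A3) => //; first by rewrite setD0.
  apply: q_presents; have CC : A3 `\` C = set0 by rewrite Ck setDv.
  rewrite -[in X in presents _ _ X]CC; apply: (pos_presents H CE) => //; first by rewrite Ck.
  by rewrite CC.
Qed.

End Degenerate.

Theorem filtration_exists (C : set W) : is_cell (phi_of X) LeftSide C ->
  cell_filtration X Y C.
Proof.
move=> hC; have [lt|lt|[e n0]|[e1 e2]] := nrm_cases X H.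
- have [e|n0] := eqVneq (nrm X ct) 0; first exact: filtration_degenerate.
  exact: filtration_dom.
(* A strict inequality between the absolute values at X persists at Y, where the opposite one
   holds. *)
- have := spz_dom (spz_sym sXY) lt => /(lt_trans dY); by rewrite ltxx.
- exact: filtration_eq.
- exact: filtration_nil.
Qed.

End ConjectureB.

Theorem arr4_conjB (W : groupType) (S : set W) (s t : W) (cs ct : Sbar S) :
  two_classes s t cs ct -> conjectureB S.
Proof.
move=> H; exists (arr4 cs ct); first exact: (arr4_essential H).
move=> X C hC Ch hCh cX Y CY; have cn := tc_neq H; have H' := two_classes_sym H.
have sp := closure_spz cn hCh.1 cX CY.
have g : generic cs ct Y by move=> a na; exact: (chamber_ne0 hCh CY na).
have [lt|lt] := chamber_dom hCh CY; first exact: (filtration_exists H sp g lt hC).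
exact: (filtration_exists H' (spz_sym sp) (generic_sym g) lt hC).
Qed.

Lemma dihedral_two_classes (W : groupType) (S : set W) (s t : W) (Ss : S s) (St : S t) :
  is_dihedral S s t -> two_classes s t (Sbar_class Ss) (Sbar_class St).
Proof.
move=> D; have D' := dihedral_sym D; split=> // [x|x|o].
- split=> [[Sx [g e]]|->]; last exact: Sbar_class_val.
  by have [//|xt] := dih_SP D Sx; case: (@dih_not_conj _ _ _ _ g D); rewrite -xt.
- split=> [[Sx [g e]]|->]; last exact: Sbar_class_val.
  by have [xs|//] := dih_SP D Sx; case: (@dih_not_conj _ _ _ _ g D'); rewrite -xs.
have [r Sr e] := set_mem (valP o).
by have [rs|rt] := dih_SP D Sr; [left|right]; apply: val_inj; rewrite -[LHS]e ?rs ?rt.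
Qed.

Theorem proposition7p2 (W : groupType) (S : set W) (s t : W)
    (Ss : S s) (St : S t) :
  coxeter_system S -> S = [set s; t] -> s <> t ->
  (forall n : nat, (0 < n)%N -> ((s * t) ^+ n <> 1)%g) ->
  let cs := Sbar_class Ss in
  let ct := Sbar_class St in
  let es := ZSbar_elt cs in
  let et := ZSbar_elt ct in
  [/\ cs <> ct /\ (forall o : Sbar S, o = cs \/ o = ct),
      conjectureA S,
      essential_set [set posH es; posH et; posH (es - et); posH (es + et)]
    & conjectureB S].
Proof.
move=> cox SE st inf cs ct es et.
have D : is_dihedral S s t.
  split; [|exact: (cox_involution cox Ss).2|exact: (cox_involution cox St).2
    |exact: (cox_generated cox)|exact: inf].
  by move=> x; rewrite SE.
have H := dihedral_two_classes Ss St D; split.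
- by split; [exact: (tc_neq H)|exact: (tc_all H)].
- by exists (arr4 cs ct); exact: (arr4_conjA H).
- exact: (arr4_essential H).
- exact: (arr4_conjB H).
Qed.
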